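(* Let $p\ge2$, $\mathbf{a}=(a_1,\dots,a_{p+1})\in\mathbb{C}^{p+1}$, $\mathbf{b}=(b_1,\dots,b_p)\in\mathbb{C}^p$ with no $b_i\in\{0,-1,-2,\dots\}$, $b_i-b_j\notin\mathbb{Z}$ for $i\ne j$, and $\nu=\sum_{j=1}^{p}b_j-\sum_{i=1}^{p+1}a_i\notin\mathbb{Z}$. Suppose $\mathrm{Re}(a_j)>0$ for $j=3,\dots,p+1$. Then $$\frac{\prod_{j=3}^{p+1}\Gamma(a_j)}{\prod_{j=1}^{p}\Gamma(b_j)}\;{}_{p+1}F_p\!\left(\begin{matrix}\mathbf{a}\\\mathbf{b}\end{matrix}\right)=\frac{\pi}{\sin(\pi\nu)}\sum_{k=1}^{p}\frac{\prod_{j\ne k}\Gamma(b_k-b_j)}{\prod_{i=1}^{p+1}\Gamma(b_k-a_i)}\sum_{n=0}^{\infty}\frac{(1-b_k+a_1)_n(1-b_k+a_2)_n}{\Gamma(1-b_k+a_1+a_2+n)\,n!}\;{}_{p}F_{p-1}\!\left(\begin{matrix}-n,\,1-b_k+a_3,\dots,1-b_k+a_{p+1}\\(1-b_k+b_j)_{1\le j\le p,\;j\ne k}\end{matrix}\right),$$ where the infinite series on the right-hand side converge (under the condition $\mathrm{Re}(a_j)>0$, $j=3,\dots,p+1$). Here the left-hand side is the sum of the hypergeometric series if $\mathrm{Re}(\nu)>0$, and its analytic continuation in the parameters otherwise.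
   Context: ${}_{q+1}F_q$ denotes the generalized hypergeometric function ${}_{q+1}F_q(\mathbf{a};\mathbf{b};z)=\sum_{k\ge0}\frac{\prod_i(a_i)_k}{\prod_j(b_j)_k}\frac{z^k}{k!}$; an omitted argument means $z=1$. $(c)_n=\Gamma(c+n)/\Gamma(c)$ is the Pochhammer symbol. In the lower row of the ${}_pF_{p-1}$ the notation $(1-b_k+b_j)_{j\neq k}$ means the list of these $p-1$ parameters (not Pochhammer symbols). $1/\Gamma$ is taken to be $0$ at poles of $\Gamma$. The series for ${}_{p+1}F_p(\mathbf{a};\mathbf{b};1)$ converges when $\mathrm{Re}(\nu)>0$. *)

(* Defs.v *)
From HB Require Import structures.
From mathcomp Require Import all_boot all_order all_algebra.
From mathcomp Require Import complex.
From mathcomp Require Import all_classical all_reals all_analysis.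

Set Implicit Arguments.
Unset Strict Implicit.
Unset Printing Implicit Defensive.

Import Order.TTheory GRing.Theory Num.Theory.
Import numFieldNormedType.Exports.

Local Open Scope classical_set_scope.
Local Open Scope ring_scope.
Local Open Scope complex_scope.

(* The complex numbers are R[i]; limits are taken in R[i]^o, which carries the
   topology given by the modulus. *)

Definition csum_cvg (R : realType) (u : nat -> R[i]) : Prop :=
  cvgn (series (u : nat -> R[i]^o)).

Definition csum (R : realType) (u : nat -> R[i]) : R[i] :=
  limn (series (u : nat -> R[i]^o)).

Definition cexp (R : realType) (z : R[i]) : R[i] :=
  (expR (complex.Re z))%:C * (cos (complex.Im z) +i* sin (complex.Im z)).

Definition csin (R : realType) (z : R[i]) : R[i] :=
  (cexp ('i * z) - cexp (- ('i * z))) / (2%:R * 'i).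

(* 1 / Gamma by Gauss' formula
     1 / Gamma(z) = lim_n z (z + 1) ... (z + n) / (n! n^z),
   an entire function of z, equal to 0 exactly at the poles of Gamma. *)
Definition rGamma (R : realType) (z : R[i]) : R[i] :=
  limn (fun n : nat =>
    (\prod_(i < n.+1) (z + i%:R)) / (n`!%:R * cexp ((ln n%:R)%:C * z)) : R[i]^o).

Definition Gamma (R : realType) (z : R[i]) : R[i] := (rGamma z)^-1.

(* The product form of Gamma(c + n) / Gamma(c) also covers the poles of
   Gamma, as needed for the upper parameter c = - n. *)
Definition poch (R : realType) (c : R[i]) (n : nat) : R[i] :=
  \prod_(i < n) (c + i%:R).

Definition pFq (R : realType) (a b : seq R[i]) (z : R[i]) : R[i] :=
  csum (fun k => (\prod_(x <- a) poch x k) / (\prod_(y <- b) poch y k)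
                 * (z ^+ k / k`!%:R)).

Definition nu (R : realType) (p : nat)
    (a : 'rV[R[i]]_p.+1) (b : 'rV[R[i]]_p) : R[i] :=
  \sum_(j < p) b 0 j - \sum_(i < p.+1) a 0 i.

Definition hyp1 (R : realType) (p : nat)
    (a : 'rV[R[i]]_p.+1) (b : 'rV[R[i]]_p) : R[i] :=
  pFq [seq a 0 i | i <- enum 'I_p.+1] [seq b 0 j | j <- enum 'I_p] 1.

(* Partial sum, over the multi-indices with all entries < N, of the power
   series in m variables with coefficients c. *)
Definition mpsum (R : realType) (m : nat) (c : {ffun 'I_m -> nat} -> R[i])
    (h : 'rV[R[i]]_m) (N : nat) : R[i] :=
  \sum_(f : {ffun 'I_m -> 'I_N})
    c [ffun i => f i : nat] * \prod_(i < m) h 0 i ^+ f i.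

(* f is given on a polydisc around z by a power series, absolutely convergent
   on the closed polydisc. *)
Definition analytic_at (R : realType) (m : nat) (f : 'rV[R[i]]_m -> R[i])
    (z : 'rV[R[i]]_m) : Prop :=
  exists (c : {ffun 'I_m -> nat} -> R[i]) (r M : R[i]),
    [/\ 0 < r,
        forall N, mpsum (fun k => `|c k|) (const_mx r) N <= M
      & forall h : 'rV[R[i]]_m, (forall i, `|h 0 i| < r) ->
          (fun N => mpsum c h N : R[i]^o) @ \oo --> (f (z + h) : R[i]^o)].

Definition lower_ok (R : realType) (p : nat) (b : 'rV[R[i]]_p) : Prop :=
  forall (j : 'I_p) (m : nat), b 0 j != - m%:R.

(* F is the analytic continuation, in the 2 p + 1 parameters jointly, of the
   sum of the series at z = 1.  The domain is the complement of the polar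
   hyperplanes b_j = - m and nu = - m; it is connected. *)
Definition hyp1_continuation (R : realType) (p : nat)
    (F : 'rV[R[i]]_p.+1 -> 'rV[R[i]]_p -> R[i]) : Prop :=
  (forall a b, lower_ok b -> 0 < complex.Re (nu a b) -> F a b = hyp1 a b) /\
  (forall a b, lower_ok b -> (forall m : nat, nu a b != - m%:R) ->
     analytic_at (fun z : 'rV[R[i]]_(p.+1 + p) => F (lsubmx z) (rsubmx z))
                 (row_mx a b)).

(* a_1, a_2 and a_3, ..., a_{p+1} have indices 0, 1 and i > 1. *)
Definition inner_term (R : realType) (p : nat)
    (a : 'rV[R[i]]_p.+1) (b : 'rV[R[i]]_p) (k : 'I_p) (n : nat) : R[i] :=
  let a1 := a 0 ord0 in
  let a2 := a 0 (inord 1) in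
  poch (1 - b 0 k + a1) n * poch (1 - b 0 k + a2) n
  * rGamma (1 - b 0 k + a1 + a2 + n%:R) / n`!%:R
  * pFq (- n%:R :: [seq 1 - b 0 k + a 0 i | i : 'I_p.+1 <- enum 'I_p.+1 & (1 < i)%N])
        [seq 1 - b 0 k + b 0 j | j <- enum 'I_p & j != k] 1.

(* Main.v *)
Require Import Defs.
From HB Require Import structures.
From mathcomp Require Import all_boot all_order all_algebra.
From mathcomp Require Import complex.
From mathcomp Require Import all_classical all_reals all_analysis.
From mathcomp Require Import ring lra.

(* Write [Y_k] for the inner series of index [k], with the Gamma factors absorbed. Its n-th
   term is a weight of order [n ^ (- b_k)] times the n-th finite difference at [0] of
   [c_k z = prod_i Gamma (z + alpha_i) / Gamma (z + beta_i)] up to normalisation.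
   - When the [b_j] have large real parts and the parameters are generic, [c_k] expands in
     partial fractions [sum rho / (z + alpha_i + l)]. The n-th difference of [1 / (z + q)] at
     [0] is [n! / (q)_(n+1)], so each pole contributes a 3F2-like series, which Dougall's method
     (contiguity in [al], limit [al -> oo], then Newton steps in [b]) evaluates as
     [sin pi (b_k - a_1 - a_2) / pi] times the corresponding sum over the original summation
     index, plus an explicit Gamma product. Weighted by
     [tau_k = prod_(i >= 3) sin pi (b_k - a_i) / prod_(j <> k) sin pi (b_k - b_j)], the Gamma
     products cancel and the sines add up to [sin pi nu], by Lagrange interpolation in
     [exp (2 pi i b_k)].
   - In general the finite differences are [O(n ^ (- s))] for [s < min Re alpha_i]: one
     quotient [(alpha)_j / (beta)_j] at a time, the differences are transformed by a
     Vandermonde convolution. This gives convergence, locally uniformly in the parameters.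
   - Shifting all [b_j] by the same [om t] keeps the lower parameters [1 - b_k + b_j] fixed and
     leads at [t = 1] into the generic region, so both sides are continued along the segment
     from [t = 1] to [t = 0]. *)

(** Orders of magnitude explain the hypothesis [Re a_j > 0]: the [alpha_i] are [1 - b_k + a_j] with
    [j >= 3], so the differences against the weight [n ^ (- b_k)] leave terms of order
    [n ^ (-1 - min Re a_j)], up to an arbitrarily small loss in the exponent. The expansion over
    poles closes up because of one coincidence: at [z = s + b_k - 1] the quotient [c_k z] depends on
    [k] only through a missing Gamma factor of [b_k], and the weight in [s] supplies it. Hence every
    [Y_k] yields the same hypergeometric sum, and only the coefficients vary with [k]. Moving [b]
    alone cannot reach a generic point, since it leaves the differences [a_i - a_j] unchanged. So
    the [a_i] with [i >= 3] move too, in the imaginary direction with distinct slopes; on the real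
    segment this preserves their real parts, hence the convergence of the inner series. A slope [om]
    with nonzero imaginary part keeps the segment off the poles of the left side. Uniform limits of
    polynomials suffice for the identity principle: a continuation [F] is used only on one complex
    line. *)

Set Implicit Arguments.
Unset Strict Implicit.
Unset Printing Implicit Defensive.
Import Order.TTheory GRing.Theory Num.Theory.
Import numFieldNormedType.Exports.
Local Open Scope ring_scope.
Local Open Scope complex_scope.

(** * Modulus, null sequences and absolutely convergent series *)

Section Modulus.
Variable R : realType.
Local Notation C := R[i].
Implicit Types (z w : C) (x y : R).

(* The norm of [R[i]] takes its values in [R[i]]; [nm] is the real modulus. *)
Definition nm z : R := complex.Re `|z|.

Lemma nmE z : `|z| = (nm z)%:C.
Proof. by rewrite /nm normc_def. Qed.

Lemma nm_ge0 z : 0 <= nm z.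
Proof. by rewrite -ler0c -nmE normr_ge0. Qed.

Lemma nmD z w : nm (z + w) <= nm z + nm w.
Proof. by rewrite -lecR rmorphD /= -!nmE ler_normD. Qed.

Lemma nmM z w : nm (z * w) = nm z * nm w.
Proof. by apply: complexI; rewrite rmorphM /= -!nmE normrM. Qed.

Lemma nmN z : nm (- z) = nm z.
Proof. by apply: complexI; rewrite -!nmE normrN. Qed.

Lemma nmV z : nm z^-1 = (nm z)^-1.
Proof. by apply: complexI; rewrite fmorphV /= -!nmE normfV. Qed.

Lemma nm_eq0 z : (nm z == 0) = (z == 0).
Proof. by rewrite -(inj_eq (@complexI R)) -nmE normr_eq0. Qed.

Lemma nm0 : nm 0 = 0.
Proof. by apply/eqP; rewrite nm_eq0. Qed.

Lemma nm1 : nm 1 = 1.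
Proof. by apply: complexI; rewrite -nmE normr1. Qed.

Lemma nm_gt0 z : (0 < nm z) = (z != 0).
Proof. by rewrite lt_neqAle nm_ge0 andbT eq_sym nm_eq0. Qed.

Lemma nmX z n : nm (z ^+ n) = nm z ^+ n.
Proof. by apply: complexI; rewrite rmorphXn /= -!nmE normrX. Qed.

Lemma nm_real x : nm x%:C = `|x|.
Proof. by rewrite /nm normc_def /= expr0n /= addr0 sqrtr_sqr. Qed.

Lemma nm_nat n : nm n%:R = n%:R.
Proof. by rewrite -(rmorph_nat (real_complex R)) nm_real ger0_norm. Qed.

Lemma nmf_div z w : nm (z / w) = nm z / nm w.
Proof. by rewrite nmM nmV. Qed.

Lemma nmB z w : nm (z - w) = nm (w - z).
Proof. by rewrite -nmN opprB. Qed.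

Lemma nmD_le z w x y : nm z <= x -> nm w <= y -> nm (z + w) <= x + y.
Proof. by move=> zx wy; rewrite (le_trans (nmD z w)) // lerD. Qed.

Lemma nmB_le z w : nm (z - w) <= nm z + nm w.
Proof. by rewrite -(nmN w) nmD. Qed.

Lemma nm_subr_ge z w : nm z - nm w <= nm (z - w).
Proof. by rewrite lerBlDr -{1}(subrK w z) nmD. Qed.

Lemma nm_tri z w u : nm (z - u) <= nm (z - w) + nm (w - u).
Proof. by rewrite -[z - u](subrKA w) nmD. Qed.

Lemma nm_sum (I : Type) (r : seq I) (P : pred I) (F : I -> C) :
  nm (\sum_(i <- r | P i) F i) <= \sum_(i <- r | P i) nm (F i).
Proof.
elim/big_rec2: _ => [|i y1 y2 _ h]; first by rewrite nm0.
by rewrite (le_trans (nmD _ _)) // lerD2l.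
Qed.

Lemma nm_prod (I : Type) (r : seq I) (P : pred I) (F : I -> C) :
  nm (\prod_(i <- r | P i) F i) = \prod_(i <- r | P i) nm (F i).
Proof. by elim/big_rec2: _ => [|i y1 y2 _ <-]; rewrite ?nm1 ?nmM. Qed.

Lemma Re_le_nm z : `|complex.Re z| <= nm z.
Proof. by rewrite -lecR -nmE normc_ge_Re. Qed.

Lemma Im_le_nm z : `|complex.Im z| <= nm z.
Proof.
rewrite /nm normc_def /= -[`|_|]sqrtr_sqr; apply: ler_wsqrtr.
by case: z => u v /=; rewrite lerDr sqr_ge0.
Qed.

Lemma nm_le_ReIm z : nm z <= `|complex.Re z| + `|complex.Im z|.
Proof.
rewrite {1}[z]complexE (le_trans (nmD _ _)) // nmM !nm_real.
have -> : nm 'i%C = 1; last by rewrite mul1r.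
by rewrite /nm normc_def /= expr0n /= expr1n add0r sqrtr1.
Qed.

Lemma ReD z w : complex.Re (z + w : C) = complex.Re z + complex.Re w.
Proof. by case: z => ? ?; case: w. Qed.
Lemma ImD z w : complex.Im (z + w : C) = complex.Im z + complex.Im w.
Proof. by case: z => ? ?; case: w. Qed.
Lemma ReN z : complex.Re (- z : C) = - complex.Re z.
Proof. by case: z. Qed.
Lemma ImN z : complex.Im (- z : C) = - complex.Im z.
Proof. by case: z. Qed.
Lemma cReMr x z : complex.Re (x%:C * z : C) = x * complex.Re z.
Proof. by case: z => ? ? /=; rewrite mul0r subr0. Qed.
Lemma cImMr x z : complex.Im (x%:C * z : C) = x * complex.Im z.
Proof. by case: z => ? ? /=; rewrite mul0r addr0. Qed.
Lemma Re_nat n : complex.Re (n%:R : C) = n%:R.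
Proof. by rewrite -(rmorph_nat (real_complex R)). Qed.
Lemma Im_nat n : complex.Im (n%:R : C) = 0.
Proof. by rewrite -(rmorph_nat (real_complex R)). Qed.

Lemma Re_1 : complex.Re (1 : C) = 1. Proof. by []. Qed.
Lemma Re_sum (I : Type) (r : seq I) (P : pred I) (F : I -> C) :
  complex.Re (\sum_(i <- r | P i) F i) = \sum_(i <- r | P i) complex.Re (F i).
Proof. exact: (big_morph _ ReD). Qed.
Lemma Im_sum (I : Type) (r : seq I) (P : pred I) (F : I -> C) :
  complex.Im (\sum_(i <- r | P i) F i) = \sum_(i <- r | P i) complex.Im (F i).
Proof. exact: (big_morph _ ImD). Qed.

Lemma rcV x : (x^-1)%:C = (x%:C)^-1 :> C. Proof. by rewrite fmorphV. Qed.
Lemma rcD x y : (x + y)%:C = x%:C + y%:C :> C. Proof. by rewrite rmorphD. Qed.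
Lemma rcB x y : (x - y)%:C = x%:C - y%:C :> C. Proof. by rewrite rmorphB. Qed.
Lemma rcN x : (- x)%:C = - x%:C :> C. Proof. by rewrite rmorphN. Qed.
Lemma rcM x y : (x * y)%:C = x%:C * y%:C :> C. Proof. by rewrite rmorphM. Qed.
Lemma rcn n : (n%:R)%:C = n%:R :> C. Proof. by rewrite rmorph_nat. Qed.

End Modulus.

Section Sequences.
Variable R : realType.
Local Notation C := R[i].
Implicit Types (u v : nat -> C) (l : C) (x y g : nat -> R).

(* [null x] only bounds [x] from above; it is used for nonnegative sequences. *)
Definition null x := forall e : R, 0 < e -> exists N, forall n, (N <= n)%N -> x n < e.

(** Real epsilons replace the filter convergence in [R[i]^o], whose radii are elements of [R[i]];
    [tends_cvg] links the two. *)
Definition tends u l := null (fun n => nm (u n - l)).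

Lemma null_le y x : (exists N, forall n, (N <= n)%N -> x n <= y n) -> null y -> null x.
Proof.
move=> [N xy] ny e /ny [N' h]; exists (maxn N N') => n.
rewrite geq_max => /andP[/xy xyn /h]; exact: le_lt_trans.
Qed.

Lemma nullD x y : null x -> null y -> null (fun n => x n + y n).
Proof.
move=> nx ny e e0; have e2 : 0 < e / 2 by rewrite divr_gt0.
have [N h] := nx _ e2; have [N' h'] := ny _ e2.
exists (maxn N N') => n; rewrite geq_max => /andP[/h hn /h' hn'].
by rewrite [e]splitr ltrD.
Qed.

Lemma nullZ (c : R) x : 0 <= c -> null x -> null (fun n => c * x n).
Proof.
move=> c0 nx e e0; have c1 : 0 < c + 1 by lra.
(* Dividing by [c + 1] covers [c = 0]. *)
have [N h] := nx (e / (c + 1)) (divr_gt0 e0 c1); exists N => n /h.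
rewrite ltr_pdivlMr // => hn; have [x0|x0] := ltP (x n) 0; nra.
Qed.

Lemma null_shift k x : null x -> null (fun n => x (n + k)%N).
Proof. by move=> nx e /nx[N h]; exists N => n Nn; rewrite h // (leq_trans Nn) // leq_addr. Qed.

Lemma null_unshift k x : null (fun n => x (n + k)%N) -> null x.
Proof.
move=> nx e /nx[N h]; exists (N + k)%N => n Nn.
have kn : (k <= n)%N by rewrite (leq_trans _ Nn) // leq_addl.
by rewrite -(subnK kn) h // leq_subRL // addnC.
Qed.

Lemma archi_nat (z : R) : exists n : nat, z < n%:R.
Proof.
exists (Num.bound z); have [z0|z0] := leP 0 z; first exact: archi_boundP.
by rewrite (lt_le_trans z0).
Qed.

Lemma null_inv (c : R) : null (fun n => c / n.+1%:R).
Proof.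
move=> e e0; have [N h] := archi_nat (c / e); exists N => n Nn.
have n0 : (0 : R) < n.+1%:R by rewrite ltr0n.
rewrite ltr_pdivrMr // mulrC -ltr_pdivrMr // (lt_trans h) // ltr_nat ltnS //.
Qed.

Lemma tends_cvg u l : tends u l <-> ((u : nat -> R[i]^o) @ \oo --> (l : R[i]^o))%classic.
Proof.
split=> [ul|/cvgrPdist_lt ul e e0].
  apply/cvgrPdist_lt => e e0.
  have [N h] : exists N, forall n, (N <= n)%N -> nm (u n - l) < complex.Re e.
    by apply: ul; move: e0; rewrite ltcE => /andP[].
  exists N => // n /= /h; rewrite -normrN opprB nmE.
  have -> : e = (complex.Re e)%:C.
    by rewrite {1}[e]complexE; move: e0; rewrite ltcE /= => /andP[/eqP -> _]; rewrite mulr0 addr0.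
  by rewrite ltcR.
have ec : 0 < e%:C by rewrite ltcR.
have [N _ h] := ul _ ec; exists N => n Nn.
by have := h n Nn; rewrite /= -normrN opprB nmE ltcR.
Qed.

Lemma tends_lim u l : tends u l -> limn (u : nat -> R[i]^o) = l.
Proof. by move/tends_cvg => h; apply: cvg_lim. Qed.

Lemma tends_unique u l l' : tends u l -> tends u l' -> l = l'.
Proof. by move=> /tends_lim <- /tends_lim. Qed.

Lemma tendsD u v l l' : tends u l -> tends v l' -> tends (fun n => u n + v n) (l + l').
Proof.
move=> h h'; apply: null_le (nullD h h'); exists 0%N => n _.
by rewrite opprD addrACA nmD.
Qed.

Lemma tendsN u l : tends u l -> tends (fun n => - u n) (- l).
Proof. by apply: null_le; exists 0%N => n _; rewrite -opprD nmN. Qed.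

Lemma tendsB u v l l' : tends u l -> tends v l' -> tends (fun n => u n - v n) (l - l').
Proof. by move=> h /tendsN; apply: tendsD. Qed.

Lemma tends_cst l : tends (fun=> l) l.
Proof. by move=> e e0; exists 0%N => n _; rewrite subrr nm0. Qed.

Lemma tends_eq u v l : (exists N, forall n, (N <= n)%N -> u n = v n) ->
  tends u l -> tends v l.
Proof. by move=> [N uv]; apply: null_le; exists N => n /uv ->. Qed.

Lemma tends_ext u v l : u =1 v -> tends u l -> tends v l.
Proof. by move=> uv; apply: tends_eq; exists 0%N. Qed.

Lemma tends_shift k u l : tends u l -> tends (fun n => u (n + k)%N) l.
Proof. exact: (@null_shift k (fun n => nm (u n - l))). Qed.

Lemma tends_unshift k u l : tends (fun n => u (n + k)%N) l -> tends u l.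
Proof. exact: (@null_unshift k (fun n => nm (u n - l))). Qed.

Lemma tends_le u l (M : R) : (exists N, forall n, (N <= n)%N -> nm (u n) <= M) ->
  tends u l -> nm l <= M.
Proof.
move=> [N uM] ul; apply/ler_addgt0Pr => e /ul[N' h].
have := h (maxn N N') (leq_maxr _ _); have := uM (maxn N N') (leq_maxl _ _).
have := nm_tri l (u (maxn N N')) 0; rewrite !subr0 (nmB l); lra.
Qed.

Lemma tends0 u : null (fun n => nm (u n)) -> tends u 0.
Proof. by apply: null_le; exists 0%N => n _; rewrite subr0. Qed.

Lemma tends_bounded u l : tends u l -> exists M : R, 0 <= M /\ forall n, nm (u n) <= M.
Proof.
move=> /(_ 1 ltr01)[N h].
exists (\sum_(i < N) nm (u i) + (nm l + 1)).
have s0 : 0 <= \sum_(i < N) nm (u i) by apply: sumr_ge0 => i _; apply: nm_ge0.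
split=> [|n]; first by have := nm_ge0 l; lra.
have [/h hn|nN] := leqP N n.
  by have := nm_tri (u n) l 0; rewrite !subr0; lra.
rewrite (bigD1 (Ordinal nN)) //= -addrA lerDl.
by rewrite addr_ge0 ?sumr_ge0 // => [i _|]; [apply: nm_ge0 | have := nm_ge0 l; lra].
Qed.

Lemma tendsM u v l l' : tends u l -> tends v l' -> tends (fun n => u n * v n) (l * l').
Proof.
move=> h h'; have [M [M0 uM]] := tends_bounded h.
apply: null_le (nullD (nullZ M0 h') (nullZ (nm_ge0 l') h)); exists 0%N => n _ /=.
have -> : u n * v n - l * l' = u n * (v n - l') + l' * (u n - l) by ring.
by apply: nmD_le; rewrite nmM ler_wpM2r ?nm_ge0.
Qed.

Lemma tendsZ (c : C) u l : tends u l -> tends (fun n => c * u n) (c * l).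
Proof. exact: tendsM (tends_cst c). Qed.

Lemma tendsV u l : l != 0 -> tends u l -> tends (fun n => (u n)^-1) l^-1.
Proof.
rewrite -nm_gt0 => l0 h.
have [N hN] : exists N, forall n, (N <= n)%N -> nm (u n - l) < nm l / 2 by apply: h; rewrite divr_gt0.
have uN n : (N <= n)%N -> nm l / 2 < nm (u n).
  by move=> /hN; have := nm_tri l (u n) 0; rewrite !subr0 (nmB l); lra.
have c0 : 0 <= (nm l / 2)^-1 / nm l by rewrite divr_ge0 ?invr_ge0 ?divr_ge0 ?nm_ge0.
apply: null_le (nullZ c0 h); exists N => n Nn.
have un0 : 0 < nm (u n) by apply: lt_trans (uN n Nn); lra.
have -> : (u n)^-1 - l^-1 = (u n)^-1 / l * (l - u n).
  by field; rewrite -!nm_gt0 un0 l0.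
rewrite !nmM !nmV (nmB l) ler_wpM2r ?nm_ge0 // ler_wpM2r ?invr_ge0 ?nm_ge0 //.
by rewrite lef_pV2 ?posrE ?divr_gt0 // ltW // uN.
Qed.

Lemma tends_sum (I : Type) (r : seq I) (P : pred I) (u : I -> nat -> C) (l : I -> C) :
  (forall i, P i -> tends (u i) (l i)) ->
  tends (fun n => \sum_(i <- r | P i) u i n) (\sum_(i <- r | P i) l i).
Proof.
move=> h; elim: r => [|i r IH].
  by rewrite big_nil; apply: tends_ext (tends_cst 0) => n; rewrite big_nil.
rewrite big_cons; case: ifPn => Pi.
  by apply: tends_ext (tendsD (h _ Pi) IH) => n /=; rewrite big_cons Pi.
by apply: tends_ext IH => n; rewrite big_cons (negbTE Pi).
Qed.

Lemma tends_prod (I : Type) (r : seq I) (P : pred I) (u : I -> nat -> C) (l : I -> C) :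
  (forall i, P i -> tends (u i) (l i)) ->
  tends (fun n => \prod_(i <- r | P i) u i n) (\prod_(i <- r | P i) l i).
Proof.
move=> h; elim: r => [|i r IH].
  by rewrite big_nil; apply: tends_ext (tends_cst 1) => n; rewrite big_nil.
rewrite big_cons; case: ifPn => Pi.
  by apply: tends_ext (tendsM (h _ Pi) IH) => n /=; rewrite big_cons Pi.
by apply: tends_ext IH => n; rewrite big_cons (negbTE Pi).
Qed.

End Sequences.

Section Sums.
Variable R : realType.
Local Notation C := R[i].
Implicit Types (u v : nat -> C) (l : C) (x y g : nat -> R).

Definition has_sum u l := tends (fun n => \sum_(i < n) u i) l.

Definition bsum g (M : R) := forall n, \sum_(i < n) g i <= M.

(** Absolute convergence, as a bound on all finite sums: this form passes directly to dominated
    sequences. *)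
Definition summable u := exists M, bsum (fun n => nm (u n)) M.

Lemma bsum_tail g M : (forall i, 0 <= g i) -> bsum g M ->
  forall e, 0 < e -> exists N, forall n, \sum_(i < n | (N <= i)%N) g i < e.
Proof.
move=> g0 gM e e0.
pose S := [set s | exists n, s = \sum_(i < n) g i]%classic.
have hS : has_sup S.
  by split; [exists 0, 0%N; rewrite big_ord0 | exists M => _ [n ->]].
have [_ [N ->] hN] := sup_adherent e0 hS.
exists N => n.
have le_sup k : \sum_(i < k) g i <= sup S by apply: ub_le_sup; [case: hS | exists k].
have split_sum k : \sum_(i < N + k | (N <= i)%N) g i + \sum_(i < N) g i = \sum_(i < N + k) g i.
  rewrite !big_split_ord /= big_pred0 ?add0r; last by move=> i; rewrite leqNgt ltn_ord.
  rewrite addrC; congr (_ + _); apply: eq_bigl => i; exact: leq_addr.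
have mono : \sum_(i < n | (N <= i)%N) g i <= \sum_(i < N + n | (N <= i)%N) g i.
  rewrite (addnC N) [leRHS]big_split_ord /= lerDl sumr_ge0 // => i _; exact: g0.
by have := split_sum n; have := le_sup (N + n)%N; lra.
Qed.

Lemma seriesE u : series (u : nat -> R[i]^o) = (fun n => \sum_(i < n) u i) :> (nat -> R[i]^o).
Proof. by apply/funext => n; rewrite /series /= big_mkord. Qed.

Lemma has_sum_csum u l : has_sum u l -> csum u = l.
Proof. by move=> h; rewrite /csum seriesE; apply: tends_lim. Qed.

Lemma has_sum_cvg u l : has_sum u l -> csum_cvg u.
Proof. by move=> /tends_cvg h; rewrite /csum_cvg seriesE; apply/cvg_ex; exists l. Qed.

Lemma real_abs_sum x M : bsum (fun n => `|x n|) M ->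
  exists l : R, forall e, 0 < e -> exists N, forall n, (N <= n)%N -> `|\sum_(i < n) x i - l| < e.
Proof.
move=> xM; have : cvgn (series x).
  apply: (@normed_cvg R R^o); apply: nondecreasing_is_cvgn.
    by apply: nondecreasing_series => n _ _; apply: normr_ge0.
  by exists M => _ [n _ <-]; rewrite /= /series /= big_mkord; apply: xM.
move=> /cvg_ex[l /= h]; exists l => e e0.
have /cvgrPdist_lt /(_ e e0)[N _ hN] := h; exists N => n Nn.
by have := hN n Nn; rewrite /= /series /= big_mkord distrC.
Qed.

Lemma bsum_le g g' M : (forall n, g n <= g' n) -> bsum g' M -> bsum g M.
Proof. by move=> gg gM n; apply: le_trans (gM n); apply: ler_sum => i _. Qed.

Lemma summable_has_sum u : summable u -> has_sum u (csum u).
Proof.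
move=> [M uM].
have [r hr] : exists l : R, forall e, 0 < e -> exists N, forall n, (N <= n)%N ->
    `|\sum_(i < n) complex.Re (u i) - l| < e.
  by apply: (@real_abs_sum (fun n => complex.Re (u n)) M); apply: bsum_le uM => n; apply: Re_le_nm.
have [s hs] : exists l : R, forall e, 0 < e -> exists N, forall n, (N <= n)%N ->
    `|\sum_(i < n) complex.Im (u i) - l| < e.
  by apply: (@real_abs_sum (fun n => complex.Im (u n)) M); apply: bsum_le uM => n; apply: Im_le_nm.
suff h : has_sum u (r +i* s) by rewrite (has_sum_csum h).
move=> e e0; have e2 : 0 < e / 2 by lra.
have [N h] := hr _ e2; have [N' h'] := hs _ e2.
exists (maxn N N') => n; rewrite geq_max => /andP[/h hn /h' hn'].
apply: le_lt_trans (nm_le_ReIm _) _.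
rewrite ReD ImD ReN ImN /=.
rewrite Re_sum Im_sum.
lra.
Qed.

Lemma csum_le u M : bsum (fun n => nm (u n)) M -> nm (csum u) <= M.
Proof.
move=> uM; have /tends_le : has_sum u (csum u) by apply: summable_has_sum; exists M.
apply; exists 0%N => n _; exact: le_trans (nm_sum _ _ _) (uM n).
Qed.

Lemma summable_le u g M : (forall n, nm (u n) <= g n) -> bsum g M -> summable u.
Proof. by move=> ug gM; exists M; apply: bsum_le gM. Qed.

Lemma eq_csum u v : u =1 v -> csum u = csum v.
Proof. by move=> /funext ->. Qed.

Lemma eq_summable u v : u =1 v -> summable u -> summable v.
Proof. by move=> /funext ->. Qed.

Lemma has_sumD u v l l' : has_sum u l -> has_sum v l' -> has_sum (fun n => u n + v n) (l + l').
Proof. by move=> h h'; apply: tends_ext (tendsD h h') => n; rewrite big_split. Qed.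

Lemma has_sumZ (c : C) u l : has_sum u l -> has_sum (fun n => c * u n) (c * l).
Proof. by move=> h; apply: tends_ext (tendsZ c h) => n; rewrite mulr_sumr. Qed.

Lemma summableD u v : summable u -> summable v -> summable (fun n => u n + v n).
Proof.
move=> [M uM] [M' vM]; exists (M + M') => n.
apply: le_trans (lerD (uM n) (vM n)); rewrite -big_split ler_sum // => i _; exact: nmD.
Qed.

Lemma summableZ (c : C) u : summable u -> summable (fun n => c * u n).
Proof.
move=> [M uM]; exists (nm c * M) => n; under eq_bigr do rewrite /= nmM.
by rewrite -mulr_sumr ler_wpM2l ?nm_ge0.
Qed.

Lemma csumD u v : summable u -> summable v -> csum (fun n => u n + v n) = csum u + csum v.
Proof. by move=> *; apply: has_sum_csum; apply: has_sumD; apply: summable_has_sum. Qed.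

Lemma csumZ (c : C) u : summable u -> csum (fun n => c * u n) = c * csum u.
Proof. by move=> *; apply: has_sum_csum; apply: has_sumZ; apply: summable_has_sum. Qed.

Lemma summable_sum (I : Type) (r : seq I) (P : pred I) (u : I -> nat -> C) :
  (forall i, P i -> summable (u i)) -> summable (fun n => \sum_(i <- r | P i) u i n).
Proof.
move=> h; elim: r => [|i r IH].
  by exists 0 => n; rewrite big1 // => i _; rewrite /= big_nil nm0.
have [Pi|Pi] := boolP (P i).
  by apply: eq_summable (summableD (h _ Pi) IH) => n; rewrite big_cons Pi.
by apply: eq_summable IH => n; rewrite big_cons (negbTE Pi).
Qed.

Lemma csum_sum (I : Type) (r : seq I) (P : pred I) (u : I -> nat -> C) :
  (forall i, P i -> summable (u i)) ->
  csum (fun n => \sum_(i <- r | P i) u i n) = \sum_(i <- r | P i) csum (u i).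
Proof.
move=> h; apply: has_sum_csum.
apply: tends_ext (tends_sum r (fun i Pi => summable_has_sum (h i Pi))) => n.
by rewrite exchange_big.
Qed.

Lemma has_sum_finite u N : (forall n, (N <= n)%N -> u n = 0) -> has_sum u (\sum_(i < N) u i).
Proof.
move=> u0; apply: tends_eq (tends_cst _); exists N => n Nn.
rewrite -(subnKC Nn) big_split_ord /= [X in _ = _ + X]big1 ?addr0 // => i _.
by rewrite u0 // leq_addr.
Qed.

Lemma summable_shift u k : summable u -> summable (fun n => u (n + k)%N).
Proof.
move=> [M uM]; exists M => n; apply: le_trans (uM (k + n)%N).
rewrite big_split_ord /= (eq_bigr (fun i : 'I_n => nm (u (k + i)%N))); last by move=> i _; rewrite addnC.
by rewrite lerDr sumr_ge0 // => i _; apply: nm_ge0.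
Qed.

Lemma csum_recl u : summable u -> csum u = u 0%N + csum (fun n => u n.+1).
Proof.
move=> su; have s1 : summable (fun n => u n.+1).
  by apply: eq_summable (summable_shift 1 su) => n; rewrite addn1.
apply: has_sum_csum; apply: (@tends_unshift _ 1).
apply: tends_ext (tendsD (tends_cst (u 0%N)) (summable_has_sum s1)) => n.
by rewrite addn1 big_ord_recl.
Qed.

(** Dominated convergence for series: [g] controls all tails at once, and the finitely many
    remaining terms converge. Domination is asked for large [k] only, because some majorants below
    hold only beyond some index. *)
Lemma tannery (u : nat -> nat -> C) v g M :
  (exists N, forall k n, (N <= k)%N -> nm (u k n) <= g n) -> bsum g M ->
  (forall n, tends (u ^~ n) (v n)) ->
  tends (fun k => csum (u k)) (csum v).
Proof.
move=> [K ug] gM uv.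
have g0 n : 0 <= g n by apply: le_trans (ug K n (leqnn _)); apply: nm_ge0.
have vg n : nm (v n) <= g n by apply: tends_le (uv n); exists K => k /ug.
have sv : summable v by apply: summable_le gM.
move=> e e0; have e3 : 0 < e / 4 by lra.
have [N hN] := bsum_tail g0 gM e3.
have [K' hK'] : exists K', forall k, (K' <= k)%N ->
    nm (\sum_(i < N) u k i - \sum_(i < N) v i) < e / 4.
  by have := @tends_sum R 'I_N (index_enum _) xpredT (fun i k => u k i) (fun i => v i) (fun i _ => uv i) _ e3.
have tail w : (forall n, nm (w n) <= g n) -> nm (csum w - \sum_(i < N) w i) <= e / 4.
  move=> wg; have sw : has_sum w (csum w) by apply: summable_has_sum; apply: summable_le gM.
  apply: tends_le (tendsB sw (tends_cst (\sum_(i < N) w i))).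
  exists N => n Nn; rewrite -(subnKC Nn) big_split_ord /= [X in nm X]addrC addKr.
  apply: le_trans (nm_sum _ _ _) _; apply: le_trans (ltW (hN (N + (n - N))%N)).
  rewrite [leRHS]big_split_ord /= [X in _ <= X + _]big_pred0; last first.
    by move=> i; rewrite leqNgt ltn_ord.
  rewrite add0r [leRHS](eq_bigl xpredT); last by move=> i; exact: leq_addr.
  by apply: ler_sum => i _.
exists (maxn K K') => k; rewrite geq_max => /andP[Kk /hK' h].
have t1 := tail _ (fun n => ug k n Kk); have := tail _ vg; rewrite (nmB (csum v)).
have := nm_tri (csum (u k)) (\sum_(i < N) u k i) (csum v).
have := nm_tri (\sum_(i < N) u k i) (\sum_(i < N) v i) (csum v).
move: h t1; lra.
Qed.

Lemma double_summable (u : nat -> nat -> C) (M : R) :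
  (forall m n, \sum_(i < m) \sum_(j < n) nm (u i j) <= M) ->
  [/\ forall i, summable (u i), forall j, summable (u ^~ j) & summable (fun i => csum (u i))].
Proof.
move=> uM.
have s1 i : summable (u i).
  exists M => n; apply: le_trans (uM i.+1 n).
  rewrite [leRHS](bigD1 ord_max) //= lerDl sumr_ge0 // => k _.
  by apply: sumr_ge0 => j _; apply: nm_ge0.
split=> [//|j|].
  exists M => n; apply: le_trans (uM n j.+1); apply: ler_sum => i _ /=.
  by rewrite (bigD1 ord_max) //= lerDl sumr_ge0 // => k _; apply: nm_ge0.
exists M => m.
(* The moduli are cast back into the complex numbers, so that their row sums are again values of
   [csum]; widening the rectangles bounds the first [m] row sums together. *)
have h : tends (fun n => \sum_(i < m) (\sum_(j < n) nm (u i j))%:C) (\sum_(i < m) csum (fun j => (nm (u i j))%:C)).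
  apply: (@tends_sum R 'I_m _ _ (fun i n => (\sum_(j < n) nm (u i j))%:C) (fun i => csum (fun j => (nm (u i j))%:C))) => i _.
  apply: tends_ext (summable_has_sum _) => [n|]; first by rewrite rmorph_sum.
  by have [B hB] := s1 i; exists B => n; under eq_bigr do rewrite /= nm_real ger0_norm ?nm_ge0 //.
have nmc i : nm (csum (u i)) <= complex.Re (csum (fun j => (nm (u i j))%:C)).
  have s2 : summable (fun j => (nm (u i j))%:C).
    by have [B hB] := s1 i; exists B => n; under eq_bigr do rewrite /= nm_real ger0_norm ?nm_ge0 //.
  apply/ler_addgt0Pr => e e0.
  have [N hN] := summable_has_sum s2 e0; have [N' hN'] := summable_has_sum (s1 i) e0.
  apply/ler_addgt0Pr => e' e'0.
  have [N2 hN2] := summable_has_sum (s1 i) e'0.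
  have := hN (maxn N N2) (leq_maxl _ _); have := hN2 (maxn N N2) (leq_maxr _ _).
  set k := maxn N N2 => h1 h2.
  have := nm_sum (index_enum 'I_k) xpredT (fun j => u i j).
  have := nm_tri (csum (u i)) (\sum_(j < k) u i j) 0; rewrite !subr0 (nmB (csum _)).
  have := Re_le_nm (\sum_(j < k) (nm (u i j))%:C - csum (fun j => (nm (u i j))%:C)).
  rewrite ReD ReN Re_sum /= ler_norml => /andP[_]; lra.
apply: (@le_trans _ _ (\sum_(i < m) complex.Re (csum (fun j => (nm (u i j))%:C)))).
  by apply: ler_sum => i _; apply: nmc.
rewrite -Re_sum.
apply: le_trans (ler_norm _) (le_trans (Re_le_nm _) _).
apply: tends_le h; exists 0%N => n _.
rewrite -rmorph_sum nm_real ger0_norm ?uM //.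
by apply: sumr_ge0 => i _; apply: sumr_ge0 => j _; apply: nm_ge0.
Qed.

(** Tannery's theorem for the sums over the first [m] rows, which the column sums of the moduli
    dominate. *)
Lemma fubini_csum (u : nat -> nat -> C) (M : R) :
  (forall m n, \sum_(i < m) \sum_(j < n) nm (u i j) <= M) ->
  csum (fun i => csum (u i)) = csum (fun j => csum (u ^~ j)).
Proof.
move=> uM; have [s1 s2 s3] := double_summable uM.
have := summable_has_sum s3.
have bM : bsum (fun j => complex.Re (csum (fun i => (nm (u i j))%:C))) M.
  move=> n; have uM' : forall m k, \sum_(j < m) \sum_(i < k) nm ((nm (u i j))%:C : C) <= M.
    move=> m k; rewrite exchange_big /=; apply: le_trans (uM k m); apply: ler_sum => i _.
    by apply: ler_sum => j _; rewrite nm_real ger0_norm ?nm_ge0.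
  have [t1 t2 t3] := @double_summable (fun j i => (nm (u i j))%:C) M uM'.
  have h : tends (fun k => \sum_(j < n) \sum_(i < k) (nm (u i j))%:C)
                 (\sum_(j < n) csum (fun i => (nm (u i j))%:C)).
    by apply: (@tends_sum R 'I_n _ _ (fun j k => \sum_(i < k) (nm (u i j))%:C) (fun j => csum (fun i => (nm (u i j))%:C))) => j _; apply: summable_has_sum; apply: t1.
  rewrite -Re_sum.
  apply: le_trans (ler_norm _) (le_trans (Re_le_nm _) _).
  apply: tends_le h; exists 0%N => k _; apply: le_trans (nm_sum _ _ _) _.
  apply: le_trans (uM' n k); apply: ler_sum => j _; exact: nm_sum.
have step : tends (fun m => csum (fun j => \sum_(i < m) u i j)) (csum (fun j => csum (u ^~ j))).
  apply: (@tannery _ _ _ M _ bM) => [|j]; last exact: summable_has_sum.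
  exists 0%N => m j _; apply: le_trans (nm_sum _ _ _) _.
  have sj : summable (fun i => (nm (u i j))%:C).
    by have [B hB] := s2 j; exists B => n; under eq_bigr do rewrite /= nm_real ger0_norm ?nm_ge0 //.
  have hj := summable_has_sum sj.
  apply/ler_addgt0Pr => e /hj[N hN].
  have := hN (maxn N m) (leq_maxl _ _).
  set k := maxn N m => h2.
  have := Re_le_nm (\sum_(i < k) (nm (u i j))%:C - csum (fun i => (nm (u i j))%:C)).
  rewrite ReD ReN Re_sum /= ler_norml => /andP[_ h3].
  have : \sum_(i < m) nm (u i j) <= \sum_(i < k) nm (u i j).
    rewrite -[k](subnKC (leq_maxr N m)) big_split_ord /= lerDl sumr_ge0 // => i _; exact: nm_ge0.
  by move: h2 h3; lra.
move=> h; apply: tends_unique h _; apply: tends_ext step => m.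
by rewrite csum_sum.
Qed.

End Sums.

(** * Exponential and Pochhammer asymptotics *)

Section ElementaryEstimates.
Variable R : realType.
Local Notation C := R[i].
Implicit Types (z w : C) (x y : R).

Lemma expR_taylor1 x : `|x| <= 1/2 -> 0 <= expR x - 1 - x <= 2 * x ^+ 2.
Proof.
move=> xh; have [h1 h2] : x <= 1/2 /\ - (1/2) <= x by move: xh; rewrite ler_norml => /andP[]; lra.
have l1 := expR_ge1Dx x; have l2 := expR_ge1Dx (- x); have e0 := expR_gt0 x.
have := expRxMexpNx_1 x => e1; apply/andP; split; first lra.
have : expR x * (1 - x) <= expR x * expR (- x) by rewrite ler_wpM2l // ltW.
nra.
Qed.

Lemma sin_le_norm x : `|sin x| <= `|x|.
Proof.
have pos (y : R) : 0 < y -> `|sin y| <= y.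
  move=> y0; have [|c _] := @MVT R sin cos 0 y y0 (fun x _ => is_derive_sin x).
    by apply: continuous_subspaceT => z; apply: continuous_sin.
  rewrite sin0 !subr0 => ->; rewrite normrM (gtr0_norm y0).
  by rewrite -[leRHS]mul1r ler_wpM2r ?cos_max // ltW.
have [x0|x0|->] := ltgtP x 0; last by rewrite sin0 normr0.
  by rewrite -normrN -sinN (le_trans (pos _ _)) ?oppr_gt0 // ltr0_norm.
by rewrite (le_trans (pos _ _)) // gtr0_norm.
Qed.

Lemma cos_taylor1 x : 0 <= 1 - cos x <= x ^+ 2 / 2.
Proof.
rewrite subr_ge0 cos_le1 /=.
have -> : 1 - cos x = 2 * sin (x / 2) ^+ 2.
  by rewrite {1}[x](_ : _ = (x / 2) *+ 2) ?cos_mulr2n ?sin2cos2; [lra | rewrite mulr2n; lra].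
have := sin_le_norm (x / 2); rewrite -ler_sqr ?nnegrE // !real_normK ?num_real //; lra.
Qed.

Lemma sin_taylor1 x : `|sin x - x| <= `|x| ^+ 3 / 2.
Proof.
have pos (y : R) : 0 < y -> `|sin y - y| <= y ^+ 3 / 2.
  move=> y0; have [|c] := @MVT R (fun t => sin t - t) (fun t => cos t - 1) 0 y y0 (fun t _ => _).
    apply: continuous_subspaceT => z; apply: cvgB; [exact: continuous_sin|exact: cvg_id].
  rewrite in_itv /= => /andP[c0 cy]; rewrite sin0 !subr0 => ->.
  rewrite normrM (gtr0_norm y0) distrC.
  have /andP[h1 h2] := cos_taylor1 c; rewrite ger0_norm //.
  have : c ^+ 2 <= y ^+ 2 by rewrite ler_sqr ?nnegrE; lra.
  rewrite exprS; nra.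
have [x0|x0|->] := ltgtP x 0; last by rewrite sin0 subr0 normr0 expr0n /= mul0r.
  have -> : sin x - x = - (sin (- x) - (- x)) by rewrite sinN; ring.
  rewrite normrN (ltr0_norm x0). by apply: pos; rewrite oppr_gt0.
by rewrite (gtr0_norm x0) pos.
Qed.

Lemma ln1D_taylor x : 0 <= x -> x / (1 + x) <= ln (1 + x) <= x.
Proof.
move=> x0; have x1 : 0 < 1 + x by lra.
apply/andP; split; last by apply: le_ln1Dx; lra.
(* The lower bound is the upper bound for the logarithm at [1 / (1 + x) = 1 - x / (1 + x)]. *)
have h : -1 < - (x / (1 + x)).
  by rewrite ltrN2 ltr_pdivrMr // mul1r; lra.
have := le_ln1Dx h; have -> : 1 + - (x / (1 + x)) = (1 + x)^-1 by field; lra.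
by rewrite lnV ?posrE //; lra.
Qed.

Lemma cexpE z : cexp z = (expR (complex.Re z) * cos (complex.Im z)) +i* (expR (complex.Re z) * sin (complex.Im z)).
Proof. by rewrite /cexp; apply/eqP; rewrite eq_complex /= !mul0r subr0 addr0 !eqxx. Qed.

Lemma cexpD z w : cexp (z + w) = cexp z * cexp w.
Proof.
rewrite !cexpE ReD ImD expRD cosD sinD; apply/eqP; rewrite eq_complex /=.
by apply/andP; split; apply/eqP; ring.
Qed.

Lemma cexp0 : cexp 0 = 1 :> C.
Proof. by rewrite cexpE /= expR0 cos0 sin0 mulr1 mulr0. Qed.

Lemma nm_cexp z : nm (cexp z) = expR (complex.Re z).
Proof.
rewrite /nm normc_def cexpE /= !exprMn -mulrDr cos2Dsin2 mulr1 sqrtr_sqr.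
by rewrite ger0_norm ?expR_ge0.
Qed.

Lemma cexp_neq0 z : cexp z != 0.
Proof. by rewrite -nm_gt0 nm_cexp expR_gt0. Qed.

Lemma cexpN z : cexp (- z) = (cexp z)^-1.
Proof.
by apply: (mulfI (cexp_neq0 z)); rewrite -cexpD subrr cexp0 divff // cexp_neq0.
Qed.

Lemma cexpB z w : cexp (z - w) = cexp z / cexp w.
Proof. by rewrite cexpD cexpN. Qed.

Lemma cexp_real x : cexp x%:C = (expR x)%:C.
Proof. by rewrite cexpE /= cos0 sin0 mulr1 mulr0. Qed.

Lemma cexp_natl n z : cexp (n%:R * z) = cexp z ^+ n.
Proof.
elim: n => [|n IH]; first by rewrite mul0r cexp0.
by rewrite -addn1 natrD mulrDl mul1r cexpD IH exprD.
Qed.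

Lemma cexp_taylor1 w : nm w <= 1/2 -> nm (cexp w - 1 - w) <= 8 * nm w ^+ 2.
Proof.
move=> wh; rewrite cexpE; case: w wh => x y wh.
have hx := Re_le_nm (x +i* y); have hy := Im_le_nm (x +i* y); move: hx hy wh => /=.
move: (nm (x +i* y)) (nm_ge0 (x +i* y)) => n n0 hx hy wh.
apply: le_trans (nm_le_ReIm _) _ => /=; rewrite oppr0 addr0.
have /expR_taylor1/andP[e1 e2] : `|x| <= 1/2 by lra.
have /andP[c1 c2] := cos_taylor1 y; have s1 := sin_taylor1 y.
have x2 : x ^+ 2 <= n ^+ 2 by rewrite -(real_normK (num_real x)) ler_sqr ?nnegrE.
have y2 : y ^+ 2 <= n ^+ 2 by rewrite -(real_normK (num_real y)) ler_sqr ?nnegrE.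
have y3 : `|y| ^+ 3 <= n ^+ 2.
  by rewrite exprS real_normK ?num_real //; have := normr_ge0 y; nra.
have E2 : expR x <= 2.
  by move: hx; rewrite ler_norml => /andP[]; nra.
have E0 := expR_gt0 x.
have A : `|expR x * cos y - 1 - x| <= 4 * n ^+ 2.
  have -> : expR x * cos y - 1 - x = (expR x - 1 - x) - expR x * (1 - cos y) by ring.
  by apply: le_trans (ler_normB _ _) _; rewrite normrM !ger0_norm ?(ltW E0) //; nra.
have B : `|expR x * sin y - y| <= 4 * n ^+ 2.
  have -> : expR x * sin y - y = expR x * (sin y - y) + (expR x - 1) * y by ring.
  apply: le_trans (ler_normD _ _) _; rewrite !normrM (gtr0_norm E0).
  have : `|expR x - 1| <= 2 * n.
    by move: hx; rewrite !ler_norml => /andP[hx1 hx2]; nra.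
  have := normr_ge0 (sin y - y); have := normr_ge0 (expR x - 1); have := normr_ge0 y; nra.
lra.
Qed.

Lemma cexp_near1 w : nm w <= 1/2 -> nm (cexp w - 1) <= 5 * nm w.
Proof.
move=> wh; have := cexp_taylor1 wh; have := nm_ge0 w => w0.
have := nm_tri (cexp w) (1 + w) 1; rewrite opprD addrA [1 + w]addrC addrK; nra.
Qed.

End ElementaryEstimates.

Section PowerWeights.
Variable R : realType.
Implicit Types (x y : R).

(** The power [(n + 1) ^ x]; the base [n + 1] keeps the weight positive at [n = 0], so that bounds
    can hold for every [n]. *)
Definition pw (n : nat) x : R := expR (x * ln n.+1%:R).

Lemma pw_gt0 n x : 0 < pw n x. Proof. exact: expR_gt0. Qed.
Lemma pw_ge0 n x : 0 <= pw n x. Proof. exact: expR_ge0. Qed.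
Hint Resolve pw_gt0 pw_ge0 : core.

Lemma pwD n x y : pw n (x + y) = pw n x * pw n y.
Proof. by rewrite /pw mulrDl expRD. Qed.

Lemma pwN n x : pw n (- x) = (pw n x)^-1.
Proof. by rewrite /pw mulNr expRN. Qed.

Lemma pwB n x y : pw n (x - y) = pw n x / pw n y.
Proof. by rewrite pwD pwN. Qed.

Lemma pw0 n : pw n 0 = 1.
Proof. by rewrite /pw mul0r expR0. Qed.

Lemma pw1 n : pw n 1 = n.+1%:R.
Proof. by rewrite /pw mul1r lnK // posrE ltr0n. Qed.

Lemma pw_le n x y : x <= y -> pw n x <= pw n y.
Proof. by move=> xy; rewrite ler_expR ler_wpM2r // ln_ge0 // ler1n. Qed.

Lemma pw_le1 n x : x <= 0 -> pw n x <= 1.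
Proof. by move=> x0; rewrite -(pw0 n) pw_le. Qed.

Lemma pw_null x : x < 0 -> null (fun n => pw n x).
Proof.
move=> x0 e e0; have [N hN] := archi_nat (expR (ln e / x)).
exists N => n Nn; rewrite -[ltRHS](lnK e0) ltr_expR mulrC -ltr_ndivrMr //.
rewrite -ltr_expR lnK ?posrE ?ltr0n // (lt_trans hN) // ltr_nat //.
Qed.

Lemma ln_step n : 1 / n.+2%:R <= ln (n.+2%:R : R) - ln (n.+1%:R : R) <= 1 / n.+1%:R.
Proof.
have n1 : (0 : R) < n.+1%:R by rewrite ltr0n.
have n2 : (0 : R) < n.+2%:R by rewrite ltr0n.
rewrite -ln_div ?posrE //.
have -> : n.+2%:R / n.+1%:R = 1 + 1 / n.+1%:R :> R.
  by rewrite -[n.+2]addn1 natrD; field; lra.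
have /ln1D_taylor : (0 : R) <= 1 / n.+1%:R by rewrite divr_ge0 // ltW.
suff -> : 1 / n.+1%:R / (1 + 1 / n.+1%:R) = 1 / n.+2%:R :> R by [].
by rewrite -[n.+2]addn1 natrD; field; lra.
Qed.

(* The sum telescopes against n^(- s). *)
Lemma bsum_pw (s : R) : 0 < s -> exists M, bsum (fun n => pw n (- 1 - s)) M.
Proof.
(* With this constant the inequality [e3] reduces to [v * (1 + s) >= 1 + s], that is [v >= 1]. *)
move=> s0; exists ((2 + s) / s).
have step n : pw n (- 1 - s) <= (2 + s) / s * (pw n (- s) - pw n.+1 (- s)).
  have n1 : (0 : R) < n.+1%:R by rewrite ltr0n.
  have n11 : (1 : R) <= n.+1%:R by rewrite ler1n.
  have /andP[l1 _] := ln_step n.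
  have E : pw n.+1 (- s) = pw n (- s) * expR (- (s * (ln n.+2%:R - ln n.+1%:R))).
    by rewrite /pw -expRD; congr expR; ring.
  rewrite E pwD (pwN n 1) pw1.
  set t := s * _ in E *; set v := n.+1%:R in n1 n11 l1 *.
  have tv : s / (v + 1) <= t.
    by rewrite /t; move: l1; rewrite -[n.+2]addn1 natrD -/v => l1; rewrite ler_pM2l // -[_^-1]mul1r.
  have e1 : expR (- t) <= (1 + t)^-1.
    have t0 : 0 < t by apply: lt_le_trans tv; rewrite divr_gt0 //; lra.
    by rewrite expRN lef_pV2 ?posrE ?expR_gt0 ?expR_ge1Dx //; lra.
  have e2 : (1 + t)^-1 <= (1 + s / (v + 1))^-1.
    have sv : 0 < s / (v + 1) by rewrite divr_gt0 //; lra.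
    by rewrite lef_pV2 ?posrE; lra.
  have e3 : (2 + s) / s * (1 - (1 + s / (v + 1))^-1) >= v^-1.
    have -> : (2 + s) / s * (1 - (1 + s / (v + 1))^-1) = (2 + s) / (v + 1 + s).
      by field; rewrite ?gt_eqF //; try lra; rewrite -addrA [1 + s]addrC addrA; lra.
    rewrite -[v^-1]mul1r ler_pdivrMr // mulrAC ler_pdivlMr; nra.
  have p0 := pw_gt0 n (- s).
  have -> : pw n (- s) - pw n (- s) * expR (- t) = pw n (- s) * (1 - expR (- t)) by ring.
  rewrite mulrC mulrCA ler_pM2l //.
  apply: le_trans e3 _; rewrite ler_pM2l ?divr_gt0 //; lra.
move=> n; apply: (@le_trans _ _ (\sum_(i < n) (2 + s) / s * (pw i (- s) - pw i.+1 (- s)))).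
  by apply: ler_sum => i _; apply: step.
rewrite -mulr_sumr.
have -> : \sum_(i < n) (pw i (- s) - pw i.+1 (- s)) = 1 - pw n (- s).
  elim: n => [|n IH]; first by rewrite big_ord0 /pw ln1 mulr0 expR0 subrr.
  by rewrite big_ord_recr IH /=; ring.
by rewrite -[leRHS]mulr1 ler_pM2l ?divr_gt0 //; [have := pw_ge0 n (- s); lra | lra].
Qed.

End PowerWeights.
#[global] Hint Extern 0 (is_true (_ <= pw _ _)) => solve [exact: pw_ge0] : core.
#[global] Hint Extern 0 (is_true (_ < pw _ _)) => solve [exact: pw_gt0] : core.

Section Pochhammer.
Variable R : realType.
Local Notation C := R[i].
Implicit Types (z w : C).

Lemma poch0 z : poch z 0 = 1.
Proof. by rewrite /poch big_ord0. Qed.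

Lemma pochS z n : poch z n.+1 = poch z n * (z + n%:R).
Proof. by rewrite /poch big_ord_recr. Qed.

Lemma pochSl z n : poch z n.+1 = z * poch (z + 1) n.
Proof.
rewrite /poch big_ord_recl addr0; congr (_ * _); apply: eq_bigr => i _.
by rewrite -addrA -[in RHS](natrD _ 1).
Qed.

Lemma poch1 z : poch z 1 = z.
Proof. by rewrite pochS poch0 mul1r addr0. Qed.

Lemma pochD z m n : poch z (m + n) = poch z m * poch (z + m%:R) n.
Proof.
elim: n => [|n IH]; first by rewrite addn0 poch0 mulr1.
by rewrite addnS !pochS IH natrD mulrA !addrA.
Qed.

Lemma poch_eq0P z n : (forall m : nat, (m < n)%N -> z != - m%:R) -> poch z n != 0.
Proof.
move=> h; rewrite /poch prodf_seq_neq0; apply/allP => i _ /=.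
by rewrite addr_eq0 h.
Qed.

Lemma poch_neq0 z n : (forall m : nat, z != - m%:R) -> poch z n != 0.
Proof. by move=> h; apply: poch_eq0P. Qed.

Lemma poch_1 n : poch 1 n = n`!%:R :> C.
Proof.
elim: n => [|n IH]; first by rewrite poch0.
by rewrite pochS IH factS natrM mulrC -(natrD _ 1).
Qed.

Lemma nm_poch_le z (K : R) n : nm z <= K -> nm (poch z n) <= \prod_(i < n) (K + i%:R).
Proof.
move=> zK; rewrite /poch nm_prod ler_prod // => i _.
by rewrite nm_ge0 /= (le_trans (nmD _ _)) // nm_nat lerD2r.
Qed.

Lemma nm_poch_ge_Re z (x : R) n : 0 <= x -> x <= complex.Re z ->
  \prod_(i < n) (x + i%:R) <= nm (poch z n).
Proof.
move=> x0 xz; rewrite /poch nm_prod ler_prod // => i _.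
rewrite addr_ge0 //= (le_trans _ (Re_le_nm _)) // ReD Re_nat.
by rewrite (le_trans _ (ler_norm _)) // lerD2r.
Qed.

End Pochhammer.

(** * The reciprocal Gamma function *)

Section GammaAsymptotics.
Variable R : realType.
Local Notation C := R[i].
Implicit Types (z w : C).

Definition npow (n : nat) z : C := cexp ((ln n.+1%:R)%:C * z).

Lemma nm_npow n z : nm (npow n z) = pw n (complex.Re z).
Proof. by rewrite nm_cexp cReMr mulrC. Qed.

Lemma npow_neq0 n z : npow n z != 0. Proof. exact: cexp_neq0. Qed.

Lemma npowD n z w : npow n (z + w) = npow n z * npow n w.
Proof. by rewrite /npow mulrDr cexpD. Qed.

Lemma npowN n z : npow n (- z) = (npow n z)^-1.
Proof. by rewrite /npow mulrN cexpN. Qed.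

Lemma npow1 n : npow n 1 = n.+1%:R.
Proof. by rewrite /npow mulr1 cexp_real lnK ?posrE ?ltr0n // rmorph_nat. Qed.

(** The factor that leads from Gauss' quotient [ggam n z] to [ggam n.+1 z]. *)
Definition cfac (n : nat) z : C :=
  (1 + z / n.+1%:R) * cexp (- (ln n.+2%:R - ln n.+1%:R)%:C * z).

Lemma natC_neq0 n : (n.+1%:R : C) != 0.
Proof. by rewrite pnatr_eq0. Qed.

(** To first order the two factors contribute [z / (n + 1)] and [- z / (n + 1)], so only terms of
    order [1 / n ^ 2] survive, uniformly for bounded [z]. Their summability makes Gauss' product
    converge. *)
Lemma cfac_near1 (K : R) : 0 <= K -> exists C0 N, 0 <= C0 /\ forall n z, (N <= n)%N -> nm z <= K ->
  nm (cfac n z - 1) <= C0 / n.+1%:R ^+ 2.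
Proof.
move=> K0; have [N hN] := archi_nat (2 * K); exists (K + 17 * K ^+ 2 + 0), N.
split=> [|n z Nn zK]; first nra.
have n1 : (0 : R) < n.+1%:R by rewrite ltr0n.
have nK : 2 * K < n.+1%:R by apply: lt_trans hN _; rewrite ltr_nat ltnS.
have /andP[l1 l2] := ln_step R n; set la : R := ln _ - ln _ in l1 l2 *.
have n2 : (n.+2%:R : R) = n.+1%:R + 1 by rewrite -[n.+2]addn1 natrD.
rewrite n2 in l1; set x : R := n.+1%:R in n1 nK l1 l2 *.
have ex : (n.+1%:R : C) = x%:C by rewrite rmorph_nat.
rewrite /cfac -/la ex {n2}; clearbody la x.
set v : C := - la%:C * z; set r : C := cexp v - 1 - v.
have la0 : 0 <= la by apply: le_trans l1; rewrite divr_ge0 //; lra.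
have nv : nm v = la * nm z by rewrite nmM nmN nm_real ger0_norm.
have z0 := nm_ge0 z.
have v1 : nm v <= K / x.
  by rewrite nv mulrC; apply: ler_pM => //; rewrite -[x^-1]mul1r.
have v2 : nm v <= 1/2.
  by apply: le_trans v1 _; rewrite ler_pdivrMr //; lra.
have hr : nm r <= 8 * (K / x) ^+ 2.
  apply: le_trans (cexp_taylor1 v2) _; rewrite ler_pM2l //.
  by rewrite ler_sqr ?nnegrE ?nm_ge0 // divr_ge0 // ltW.
have zx : nm (z / x%:C) <= K / x.
  by rewrite nmf_div nm_real (gtr0_norm n1) ler_pM2r ?invr_gt0.
have -> : (1 + z / x%:C) * cexp v - 1
    = (z / x%:C + v) + (z / x%:C) * v + (1 + z / x%:C) * r by rewrite /r; ring.
have h1 : nm (z / x%:C + v) <= K / x ^+ 2.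
  have -> : z / x%:C + v = (x^-1 - la)%:C * z by rewrite /v [(x^-1 - la)%:C]rcB rcV; ring.
  rewrite nmM nm_real mulrC; apply: ler_pM => //.
  rewrite ler_norml; apply/andP; split; last first.
    have : 1 / (x + 1) <= la by [].
    have -> : 1 / (x + 1) = x^-1 - 1 / (x * (x + 1)) by field; lra.
    have : 1 / (x * (x + 1)) <= (x ^+ 2)^-1.
      by rewrite mul1r lef_pV2 ?posrE; nra.
    move: (x ^- 2) (1 / (x * (x + 1))) (x^-1) => p q t; lra.
  have : 0 <= (x ^+ 2)^-1 by rewrite invr_ge0 sqr_ge0.
  by move: l2; rewrite mul1r; move: (x ^- 2) (x^-1) => p t; lra.
have h2 : nm (z / x%:C * v) <= K ^+ 2 / x ^+ 2.
  by rewrite nmM -expr_div_n expr2; apply: ler_pM; rewrite ?nm_ge0.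
have h3 : nm ((1 + z / x%:C) * r) <= 16 * K ^+ 2 / x ^+ 2.
  have -> : 16 * K ^+ 2 / x ^+ 2 = 2 * (8 * (K / x) ^+ 2) by rewrite expr_div_n; ring.
  rewrite nmM; apply: ler_pM; rewrite ?nm_ge0 //.
  apply: le_trans (nmD _ _) _; rewrite nm1.
  have : K / x <= 1/2 by rewrite ler_pdivrMr //; lra.
  by move: zx; lra.
have -> : (K + 17 * K ^+ 2 + 0) / x ^+ 2 = K / x ^+ 2 + K ^+ 2 / x ^+ 2 + 16 * K ^+ 2 / x ^+ 2 by ring.
by apply: nmD_le => //; apply: nmD_le.
Qed.

Lemma prod_near1 (f : nat -> C) (d : nat -> R) N m (s : R) :
  (forall n, (N <= n)%N -> nm (f n - 1) <= d n) ->
  \sum_(N <= i < N + m) d i <= s -> s <= 1/2 ->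
  nm (\prod_(N <= i < N + m) f i - 1) <= 2 * s.
Proof.
move=> fd hs s12.
have d0 n : (N <= n)%N -> 0 <= d n by move=> /fd; apply: le_trans; apply: nm_ge0.
(* A bound by an exponential is multiplicative and therefore suits the induction;
   [expR s - 1 <= 2 * s] enters only at the end. *)
suff h k : (k <= m)%N -> nm (\prod_(N <= i < N + k) f i - 1) <= expR (\sum_(N <= i < N + k) d i) - 1.
  apply: le_trans (h m (leqnn _)) _.
  have he : expR (\sum_(N <= i < N + m) d i) <= expR s by rewrite ler_expR.
  have s0 : 0 <= s.
    by apply: le_trans hs; rewrite big_seq sumr_ge0 // => i; rewrite mem_index_iota => /andP[/d0].
  have /expR_taylor1 : `|s| <= 1/2 by rewrite ger0_norm.
  by move=> /andP[_]; nra.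
elim: k => [|k IH] km; first by rewrite addn0 !big_geq // subrr nm0 expR0 subrr.
rewrite addnS !big_nat_recr ?leq_addr //= expRD.
have {}IH := IH (ltnW km).
set P := \prod_(_ <= i < _) _ in IH *; set S := \sum_(_ <= i < _) _ in IH *.
have hf := fd (N + k)%N (leq_addr _ _); have dk := d0 (N + k)%N (leq_addr _ _).
have -> : P * f (N + k)%N - 1 = (P - 1) * (f (N + k)%N - 1) + (P - 1) + (f (N + k)%N - 1) by ring.
have e1 := expR_ge1Dx (d (N + k)%N).
have nP := nm_ge0 (P - 1); have nf := nm_ge0 (f (N + k)%N - 1).
apply: (@le_trans _ _ ((expR S - 1) * (expR (d (N + k)%N) - 1) + (expR S - 1) + (expR (d (N + k)%N) - 1))); last lra.
have hf' : nm (f (N + k)%N - 1) <= expR (d (N + k)%N) - 1 by lra.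
by apply: nmD_le => //; apply: nmD_le => //; rewrite nmM ler_pM.
Qed.

Definition Eprod N m z : C := \prod_(N <= i < N + m) cfac i z.

Lemma inv_sq_sum (N m : nat) : \sum_(N <= i < N + m) (i.+1%:R ^+ 2)^-1 <= 2 / N.+1%:R :> R.
Proof.
have h n : (n.+1%:R ^+ 2)^-1 <= 2 / n.+1%:R - 2 / n.+2%:R :> R.
  have n1 : (1 : R) <= n.+1%:R by rewrite ler1n.
  rewrite -[n.+2]addn1 natrD; set x : R := n.+1%:R in n1 *; clearbody x.
  have -> : 2 / x - 2 / (x + 1) = 2 / (x * (x + 1)) by field; rewrite !gt_eqF //; lra.
  rewrite ler_pdivlMr ?mulr_gt0 //; try lra.
  rewrite mulrC ler_pdivrMr ?exprn_gt0 //; nra.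
apply: (@le_trans _ _ (2 / N.+1%:R - 2 / (N + m).+1%:R)); last first.
  by rewrite gerBl divr_ge0.
elim: m => [|m IH]; first by rewrite addn0 big_geq // subrr.
rewrite addnS big_nat_recr ?leq_addr //=; apply: le_trans (lerD IH (h _)) _.
by rewrite addrA subrK.
Qed.

Lemma Eprod_near1 (K : R) : 0 <= K -> exists C0 N0, 0 <= C0 /\ forall N m z, (N0 <= N)%N -> nm z <= K ->
  nm (Eprod N m z - 1) <= C0 / N.+1%:R.
Proof.
move=> K0; have [C0 [N1 [C00 h]]] := cfac_near1 K0.
have [N2 hN2] := archi_nat (4 * C0); exists (4 * C0), (maxn N1 N2).
split=> [|N m z]; first lra.
rewrite geq_max => /andP[N1N N2N] zK.
have n1 : (0 : R) < N.+1%:R by rewrite ltr0n.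
have -> : 4 * C0 / N.+1%:R = 2 * (C0 * (2 / N.+1%:R)) by ring.
apply: (prod_near1 (d := fun n => C0 / n.+1%:R ^+ 2)) => [n Nn||].
- by apply: h => //; apply: leq_trans Nn.
- by rewrite -mulr_sumr ler_wpM2l // inv_sq_sum.
- rewrite mulrA ler_pdivrMr //.
  have : (N2%:R : R) <= N.+1%:R by rewrite ler_nat (leq_trans N2N).
  lra.
Qed.

Lemma EprodE N m z : Eprod N m z =
  poch (z + N.+1%:R) m * N`!%:R / (N + m)`!%:R * (npow N z / npow (N + m) z).
Proof.
have f0 n : (n`!%:R : C) != 0 by rewrite pnatr_eq0 -lt0n fact_gt0.
elim: m => [|m IH].
  by rewrite /Eprod addn0 big_geq // poch0 mul1r !divff ?mulr1 ?npow_neq0 ?f0.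
rewrite /Eprod addnS big_nat_recr ?leq_addr //= -/(Eprod N m z) IH /cfac pochS.
have -> : npow (N + m).+1 z = npow (N + m) z * cexp ((ln (N + m).+2%:R - ln (N + m).+1%:R)%:C * z).
  by rewrite /npow -cexpD -mulrDl -rmorphD /= addrCA subrr addr0.
rewrite mulNr cexpN factS natrM.
have -> : (z + N.+1%:R + m%:R) = (z + (N + m).+1%:R).
  by rewrite -addrA -natrD.
have := cexp_neq0 ((ln (N + m).+2%:R - ln (N + m).+1%:R)%:C * z).
move: (f0 N) (f0 (N + m)%N) (npow_neq0 N z) (npow_neq0 (N + m) z) (natC_neq0 (N + m)).
move: (poch _ m) (N`!%:R : C) ((N + m)`!%:R : C) (npow N z) (npow (N + m) z) (cexp _).
move: ((N + m).+1%:R : C) => g a b c d e f hb hc hd he hg hf.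
by field; rewrite ?hb ?hc ?hd ?he ?hf ?hg.
Qed.

Definition ggam n z : C := poch z n.+1 / (n`!%:R * npow n z).

Lemma ggam_Eprod N m z : ggam (N + m) z = ggam N z * Eprod N m z.
Proof.
rewrite EprodE /ggam -addSn pochD.
have f0 n : (n`!%:R : C) != 0 by rewrite pnatr_eq0 -lt0n fact_gt0.
move: (f0 N) (f0 (N + m)%N) (npow_neq0 N z) (npow_neq0 (N + m) z).
move: (N`!%:R : C) ((N + m)`!%:R : C) (npow N z) (npow (N + m) z) (poch z _) (poch _ m).
by move=> a b c d e f ha hb hc hd; field; rewrite ha hb hc hd.
Qed.

Lemma npow_ratio (k : nat) z :
  tends (fun n => npow (n + k).+1 z / npow (n + k) z) 1.
Proof.
have E n : npow (n + k).+1 z / npow (n + k) z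
    = cexp ((ln (n + k).+2%:R - ln (n + k).+1%:R)%:C * z).
  by rewrite /npow -cexpB -mulrBl -rmorphB.
apply: tends_ext (fun n => esym (E n)) _.
have [N hN] := archi_nat (2 * nm z).
have b n : nm ((ln (n + k).+2%:R - ln (n + k).+1%:R)%:C * z) <= nm z / n.+1%:R.
  have /andP[l1 l2] := ln_step R (n + k).
  rewrite nmM nm_real mulrC ler_wpM2l ?nm_ge0 // ger0_norm; last first.
    by apply: le_trans l1; rewrite divr_ge0.
  apply: le_trans l2 _; rewrite mul1r lef_pV2 ?posrE ?ltr0n // ler_nat ltnS leq_addr //.
have c5 : 0 <= 5 :> R by [].
apply: null_le (nullZ c5 (null_inv (nm z))); exists N => n Nn.
apply: le_trans (cexp_near1 _) _; last by rewrite ler_pM2l // b.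
apply: le_trans (b n) _; rewrite ler_pdivrMr ?ltr0n //.
have : (N%:R : R) <= n.+1%:R by rewrite ler_nat (leq_trans Nn).
lra.
Qed.

Lemma ggam_cvg z : exists l, tends (ggam ^~ z) l.
Proof.
have [C0 [N [C00 h]]] := Eprod_near1 (nm_ge0 z).
have [C1 [N1 [C10 h1]]] := cfac_near1 (nm_ge0 z).
pose k := maxn N N1.
pose M := nm (ggam k z) * (1 + C0).
have gb m : nm (ggam (k + m) z) <= M.
  rewrite ggam_Eprod nmM ler_wpM2l ?nm_ge0 //.
  have := h k m z (leq_maxl _ _) (lexx _); have := nm_tri (Eprod k m z) 1 0; rewrite !subr0 nm1.
  have : C0 / k.+1%:R <= C0 by rewrite ler_pdivrMr ?ltr0n // ler_peMr // ler1n.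
  move: (C0 / k.+1%:R) => q; lra.
have s : summable (fun m => ggam (k + m.+1)%N z - ggam (k + m)%N z).
  exists (M * (C1 * (2 / k.+1%:R))) => n.
  apply: (@le_trans _ _ (\sum_(i < n) M * (C1 * ((k + i).+1%:R ^+ 2)^-1))); last first.
    rewrite -!mulr_sumr ler_wpM2l ?mulr_ge0 ?nm_ge0 ?addr_ge0 // ler_wpM2l //.
    by have := inv_sq_sum k n; rewrite -{1}[k]add0n big_addn addKn big_mkord; under eq_bigr do rewrite addnC.
  apply: ler_sum => i _; rewrite addnS -addn1 ggam_Eprod /Eprod addn1 big_nat1 -{2}[ggam _ z]mulr1 -mulrBr nmM.
  by apply: ler_pM; rewrite ?nm_ge0 ?gb // h1 // (leq_trans (leq_maxr N _)) // leq_addr.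
have hs := summable_has_sum s.
exists (csum (fun m => ggam (k + m.+1)%N z - ggam (k + m)%N z) + ggam k z).
apply: (@tends_unshift _ k).
apply: tends_ext (tendsD hs (tends_cst (ggam k z))) => n.
elim: n => [|n IH]; first by rewrite big_ord0 add0r add0n.
by rewrite big_ord_recr /= addrAC IH [(n + k)%N]addnC subrKC addnS addSn addnC.
Qed.

(** [rGamma] is defined with [n ^ z] and [ggam] with [(n + 1) ^ z]: after a shift by one they differ
    by a ratio of consecutive powers, which tends to [1]. *)
Lemma ggam_rGamma z : tends (ggam ^~ z) (rGamma z).
Proof.
have [l hl] := ggam_cvg z.
suff h : tends (fun n => (\prod_(i < n.+1) (z + i%:R)) / (n`!%:R * cexp ((ln n%:R)%:C * z))) l.
  by rewrite /rGamma (tends_lim h).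
apply: (@tends_unshift _ 1).
have := tendsM (tends_shift 1 hl) (npow_ratio 0 z); rewrite mulr1; apply: tends_ext => n.
rewrite addn0 addn1 /ggam /poch -/(npow n z).
have f0 : (n.+1`!%:R : C) != 0 by rewrite pnatr_eq0 -lt0n fact_gt0.
move: f0 (npow_neq0 n z) (npow_neq0 n.+1 z).
move: (n.+1`!%:R : C) (npow n z) (npow n.+1 z) (\prod_(i < _) _).
by move=> a b c d ha hb hc; field; rewrite ha hb hc.
Qed.

Lemma tends_ratio_nat (z w : C) : tends (fun n => (z + n%:R) / (w + n%:R)) 1.
Proof.
have [N hN] := archi_nat (nm w + nm w).
have c0 : 0 <= 2 * nm (z - w) by rewrite mulr_ge0 ?nm_ge0.
apply: (@tends_unshift _ 1); apply: null_le (null_inv (2 * nm (z - w))).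
exists N => n Nn.
have nn : nm w + nm w < n.+1%:R by apply: lt_le_trans hN _; rewrite ler_nat (leq_trans Nn).
have wn : n.+1%:R / 2 <= nm (w + n.+1%:R).
  have := nm_subr_ge n.+1%:R (- w); rewrite opprK nmN nm_nat [_ + w]addrC.
  by move: nn; move: (n.+1%:R : R) (nm (w + _)) => p q; lra.
have p0 : (0 : R) < n.+1%:R by rewrite ltr0n.
have w0 : w + n.+1%:R != 0 by rewrite -nm_gt0; lra.
rewrite addn1.
have E (q : C) : w + q != 0 -> (z + q) / (w + q) - 1 = (z - w) / (w + q) by move=> ?; field.
rewrite E //.
have q0 : 0 < nm (w + n.+1%:R) by rewrite nm_gt0.
rewrite nmf_div ler_pdivrMr // mulrAC ler_pdivlMr //.
move: wn p0 q0 (nm_ge0 (z - w)); move: (n.+1%:R : R) (nm (w + _)) (nm (z - w)) => p q d; nra.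
Qed.

Lemma rGamma_rec z : rGamma z = z * rGamma (z + 1).
Proof.
apply: tends_unique (ggam_rGamma z) _.
have := tendsM (tendsZ z (ggam_rGamma (z + 1))) (tends_ratio_nat 1 (z + 1)).
rewrite mulr1; apply: tends_eq.
have [N hN] := archi_nat (nm (z + 1)); exists N => n Nn.
have w0 : z + 1 + n%:R != 0.
  apply/eqP => h; have e : n%:R = - (z + 1) by apply/eqP; rewrite -addr_eq0 addrC h.
  have := nm_nat R n; rewrite e nmN => e'.
  by move: hN; rewrite e' ltr_nat ltnNge Nn.
rewrite /ggam (pochSl z) (pochS (z + 1)) npowD npow1.
have f0 : (n`!%:R : C) != 0 by rewrite pnatr_eq0 -lt0n fact_gt0.
have -> : 1 + n%:R = n.+1%:R :> C by rewrite -(natrD _ 1).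
move: f0 (npow_neq0 n z) (natC_neq0 n) w0.
move: (n`!%:R : C) (npow n z) (n.+1%:R : C) (z + 1 + n%:R) (poch _ n).
by move=> a b c d e ha hb hc hd; field; rewrite ha hb hc hd.
Qed.

Lemma rGamma_poch z n : rGamma z = poch z n * rGamma (z + n%:R).
Proof.
elim: n => [|n IH]; first by rewrite poch0 mul1r addr0.
by rewrite IH pochS -mulrA [rGamma (z + _)]rGamma_rec -addrA -natr1.
Qed.

(** Gauss' limit with factorial and power taken at [N + m], as in [EprodE]. It identifies the limit
    of the tail product without a division by [ggam N z], which may vanish. *)
Lemma poch_scaled_lim (w : C) N :
  tends (fun m => poch w m / ((N + m)`!%:R * npow (N + m) (w - N.+1%:R))) (rGamma w).
Proof.
have f0 n : (n`!%:R : C) != 0 by rewrite pnatr_eq0 -lt0n fact_gt0.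
elim: N => [|N IH].
  have := tendsM (ggam_rGamma w) (tends_ratio_nat 1 w); rewrite mulr1; apply: tends_eq.
  have [N hN] := archi_nat (nm w); exists N => n Nn.
  have w0 : w + n%:R != 0.
    apply/eqP => h; have e : n%:R = - w by apply/eqP; rewrite -addr_eq0 addrC h.
    have := nm_nat R n; rewrite e nmN => e'.
    by move: hN; rewrite e' ltr_nat ltnNge Nn.
  rewrite /ggam pochS add0n npowD npowN npow1.
  have -> : 1 + n%:R = n.+1%:R :> C by rewrite -(natrD _ 1).
  move: (f0 n) (npow_neq0 n w) (natC_neq0 n) w0.
  move: (n`!%:R : C) (npow n w) (n.+1%:R : C) (w + n%:R) (poch w n).
  by move=> a b c d e ha hb hc hd; field; rewrite ha hb hc hd.
have /tendsV : (1 : C) != 0 by apply: oner_neq0.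
move=> /(_ _ (npow_ratio N (w - N.+2%:R))); rewrite invr1 => h.
have := tendsM IH h; rewrite mulr1; apply: tends_ext => m.
rewrite addSn factS natrM [(m + N)%N]addnC.
have -> : w - N.+1%:R = (w - N.+2%:R) + 1 by rewrite -[N.+2]addn1 natrD; ring.
rewrite npowD npow1.
move: (f0 (N + m)%N) (npow_neq0 (N + m) (w - N.+2%:R)) (npow_neq0 (N + m).+1 (w - N.+2%:R)) (natC_neq0 (N + m)).
move: ((N + m)`!%:R : C) (npow (N + m) (w - _)) (npow (N + m).+1 (w - _)) ((N + m).+1%:R : C) (poch w m).
by move=> a b c d e ha hb hc hd; field; rewrite ha hb hc hd.
Qed.

(* Unlike Gauss' quotient, [qgam N z] tends to [1] for every [z], poles of Gamma included. *)
Definition qgam N z : C := N`!%:R * npow N z * rGamma (z + N.+1%:R).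

Lemma Eprod_qgam N z : tends (fun m => Eprod N m z) (qgam N z).
Proof.
have := tendsZ (N`!%:R * npow N z) (poch_scaled_lim (z + N.+1%:R) N).
apply: tends_ext => m; rewrite EprodE addrK.
have f0 : ((N + m)`!%:R : C) != 0 by rewrite pnatr_eq0 -lt0n fact_gt0.
move: f0 (npow_neq0 (N + m) z).
move: (N`!%:R : C) ((N + m)`!%:R : C) (npow N z) (npow (N + m) z) (poch _ m).
by move=> a b c d e hb hd; field; rewrite hb hd.
Qed.

(** The substitute for Stirling's formula: [rGamma (z + N + 1)] is [(N + 1) ^ (- z) / N!] with
    relative error [O(1 / N)], uniformly for bounded [z]. The growth estimates for Gamma factors and
    Pochhammer symbols derive from it. *)
Lemma qgam_near1 (K : R) : 0 <= K -> exists C0 N0, 0 <= C0 /\ forall N z, (N0 <= N)%N -> nm z <= K ->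
  nm (qgam N z - 1) <= C0 / N.+1%:R.
Proof.
move=> K0; have [C0 [N0 [C00 h]]] := Eprod_near1 K0; exists C0, N0; split=> // N z NN zK.
apply: tends_le (tendsB (Eprod_qgam N z) (tends_cst 1)).
by exists 0%N => m _; apply: h.
Qed.

End GammaAsymptotics.

(** * Orders of magnitude, uniform in a parameter *)

Section Order.
Variable R : realType.
Local Notation C := R[i].
Variables (T : Type) (D : T -> Prop).
Implicit Types (u v : T -> nat -> C) (x y : R).

(** One constant serves all [t] in the parameter set [D]: continuation needs domination on whole
    discs. With [unit] as parameter type this is the order of a single sequence. *)
Definition bigO u x := exists B : R, 0 <= B /\ forall t n, D t -> nm (u t n) <= B * pw n x.

Lemma bigO_le u x y : x <= y -> bigO u x -> bigO u y.
Proof.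
move=> xy [B [B0 h]]; exists B; split=> // t n Dt; apply: le_trans (h t n Dt) _.
by rewrite ler_wpM2l // pw_le.
Qed.

Lemma bigOM u v x y : bigO u x -> bigO v y -> bigO (fun t n => u t n * v t n) (x + y).
Proof.
move=> [B [B0 h]] [B' [B'0 h']]; exists (B * B'); split=> [|t n Dt]; first exact: mulr_ge0.
by rewrite nmM pwD mulrACA ler_pM ?nm_ge0 ?h ?h'.
Qed.

Lemma bigOD u v x : bigO u x -> bigO v x -> bigO (fun t n => u t n + v t n) x.
Proof.
move=> [B [B0 h]] [B' [B'0 h']]; exists (B + B'); split=> [|t n Dt]; first exact: addr_ge0.
by rewrite mulrDl nmD_le ?h ?h'.
Qed.

Lemma bigO_cst (c : T -> C) (K : R) : (forall t, D t -> nm (c t) <= K) -> bigO (fun t _ => c t) 0.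
Proof.
move=> h; exists (`|K|); split=> [|t n Dt]; first exact: normr_ge0.
by rewrite pw0 mulr1 (le_trans (h _ Dt)) ?ler_norm.
Qed.

Lemma bigO_eq u v x : (forall t n, D t -> u t n = v t n) -> bigO u x -> bigO v x.
Proof. by move=> uv [B [B0 h]]; exists B; split=> // t n Dt; rewrite -uv // h. Qed.

Lemma bigO_bsum u x : x < -1 -> bigO u x ->
  exists (g : nat -> R) (M : R), bsum g M /\ forall t n, D t -> nm (u t n) <= g n.
Proof.
move=> x1 [B [B0 h]]; have [M hM] : exists M, bsum (fun n => pw n x) M.
  have [|M hM] := @bsum_pw R (- 1 - x); first lra.
  by exists M; rewrite opprB addrC subrK in hM.
exists (fun n => B * pw n x), (B * M); split=> // n.
by rewrite -mulr_sumr ler_wpM2l.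
Qed.

Lemma bigO_summable u x t : x < -1 -> bigO u x -> D t -> summable (u t).
Proof.
move=> x1 /(bigO_bsum x1)[g [M [gM h]]] Dt; apply: summable_le gM => n; exact: h.
Qed.

Lemma bigO_tends0 u x t : x < 0 -> bigO u x -> D t -> tends (u t) 0.
Proof.
move=> x0 [B [B0 h]] Dt; apply: tends0; apply: null_le (nullZ B0 (pw_null x0)).
by exists 0%N => n _; apply: h.
Qed.

Lemma bigO_prod (I : Type) (r : seq I) (u : I -> T -> nat -> C) (x : I -> R) :
  (forall i, bigO (u i) (x i)) ->
  bigO (fun t n => \prod_(i <- r) u i t n) (\sum_(i <- r) x i).
Proof.
move=> h; elim: r => [|i r IH].
  rewrite big_nil; apply: bigO_eq (@bigO_cst (fun=> 1) 1 _) => [t n _|t _]; first by rewrite big_nil.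
  by rewrite nm1.
by rewrite big_cons; apply: bigO_eq (bigOM (h i) IH) => t n _; rewrite big_cons.
Qed.

End Order.

Section PowerShift.
Variable R : realType.

Lemma pw_succ n (x : R) : pw n.+1 x <= expR `|x| * pw n x /\ pw n x <= expR `|x| * pw n.+1 x.
Proof.
have /andP[l1 l2] := ln_step R n.
have l0 : 0 <= ln (n.+2%:R : R) - ln (n.+1%:R : R) by apply: le_trans l1; rewrite divr_ge0.
have l3 : ln (n.+2%:R : R) - ln (n.+1%:R : R) <= 1.
  by apply: le_trans l2 _; rewrite ler_pdivrMr ?ltr0n // mul1r ler1n.
have := ler_norm x; have := ler_norm (- x); rewrite normrN; have := normr_ge0 x.
rewrite /pw -!expRD !ler_expR.
by move: l0 l3; move: `|x| (ln (n.+2%:R : R)) (ln (n.+1%:R : R)) => k a b; split; nra.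
Qed.

Lemma pw_ge_exp n N (x K : R) : (n <= N)%N -> `|x| <= K -> pw N (- K) <= pw n x.
Proof.
move=> nN xK; apply: le_trans (_ : pw n (- K) <= _).
  rewrite /pw ler_expR !mulNr lerN2 ler_wpM2l ?(le_trans (normr_ge0 x)) //.
  by rewrite ler_ln ?posrE ?ltr0n // ler_nat ltnS.
by apply: pw_le; move: xK; rewrite ler_norml => /andP[].
Qed.

End PowerShift.

(** * Uniform bounds for the reciprocal Gamma function and Pochhammer symbols *)

Section GammaBounds.
Variable R : realType.
Local Notation C := R[i].
Implicit Types (z w : C).

Lemma factC_neq0 n : (n`!%:R : C) != 0.
Proof. by rewrite pnatr_eq0 -lt0n fact_gt0. Qed.

Lemma factR_gt0 n : (0 : R) < n`!%:R.
Proof. by rewrite ltr0n fact_gt0. Qed.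

Lemma Re_bound z (K : R) : nm z <= K -> `|complex.Re z| <= K.
Proof. by apply: le_trans; apply: Re_le_nm. Qed.

Lemma rGamma_qgam N z : rGamma (z + N.+1%:R) = qgam N z / (N`!%:R * npow N z).
Proof. by rewrite /qgam mulrAC mulfV ?mul1r // mulf_neq0 ?npow_neq0 ?factC_neq0. Qed.

Lemma rGamma_bound (K : R) : 0 <= K -> exists B : R, 0 <= B /\ forall z, nm z <= K -> nm (rGamma z) <= B.
Proof.
move=> K0; have [C0 [N [C00 h]]] := qgam_near1 K0.
exists (\prod_(i < N.+1) (K + i%:R) * ((1 + C0) * pw N K)); split.
  apply: mulr_ge0; first by apply: prodr_ge0 => i _; apply: addr_ge0.
  by apply: mulr_ge0 => //; apply: addr_ge0.
move=> z zK; rewrite (rGamma_poch z N.+1) nmM.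
apply: ler_pM; rewrite ?nm_ge0 ?nm_poch_le // rGamma_qgam nmf_div.
apply: ler_pM; rewrite ?nm_ge0 ?invr_ge0 ?nm_ge0 //.
  have := h N z (leqnn _) zK; have := nm_tri (qgam N z) 1 0; rewrite !subr0 nm1.
  have : C0 / N.+1%:R <= C0 by rewrite ler_pdivrMr ?ltr0n // ler_peMr // ler1n.
  move: (C0 / N.+1%:R) => q; lra.
rewrite nmM nm_nat nm_npow invfM -pwN -[leRHS]mul1r; apply: ler_pM; rewrite ?invr_ge0 ?ler0n //.
  by rewrite invf_le1 ?factR_gt0 // ler1n fact_gt0.
by apply: pw_le; move: (Re_bound zK); rewrite ler_norml => /andP[]; lra.
Qed.

Lemma rGamma_shift_bound (K : R) : 0 <= K -> exists B : R, 0 <= B /\ forall z n, nm z <= K ->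
  nm (n`!%:R * rGamma (z + n%:R)) <= B * pw n (1 - complex.Re z).
Proof.
move=> K0; have [C0 [N [C00 h]]] := qgam_near1 K0.
have KN : 0 <= K + N%:R by rewrite addr_ge0.
have [C1 [C10 h1]] := rGamma_bound KN.
(* [B1] serves the finitely many [n <= N], where the weight is at least [pw N (- (K + 1))]. [B2]
   serves the others, for which the product equals [qgam n z * npow n (1 - z)] with [n] the
   predecessor of the index. *)
pose B1 := N`!%:R * C1 / pw N (- (K + 1)).
have B10 : 0 <= B1 by rewrite divr_ge0 ?mulr_ge0.
pose B2 := (1 + C0) * expR (K + 1).
have B20 : 0 <= B2 by rewrite mulr_ge0 ?addr_ge0 // expR_ge0.
exists (B1 + B2); split=> [|z n zK]; first exact: addr_ge0.
have rz : `|1 - complex.Re z| <= K + 1.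
  by rewrite (le_trans (ler_normB _ _)) // normr1 addrC lerD2r Re_bound.
have [nN|Nn] := leqP n N.
  apply: (@le_trans _ _ (B1 * pw n (1 - complex.Re z))); last first.
    by rewrite ler_wpM2r // lerDl.
  apply: (@le_trans _ _ (N`!%:R * C1)).
    rewrite nmM nm_nat; apply: ler_pM; rewrite ?nm_ge0 //; last first.
      by apply: h1; rewrite (le_trans (nmD _ _)) // lerD // nm_nat ler_nat.
    by rewrite ler_nat leq_fact.
  rewrite /B1 mulrAC ler_pdivlMr ?pw_gt0 // ler_wpM2l ?mulr_ge0 //.
  exact: pw_ge_exp.
case: n Nn => // n Nn; rewrite ltnS in Nn.
apply: (@le_trans _ _ (B2 * pw n.+1 (1 - complex.Re z))); last first.
  by rewrite ler_wpM2r // lerDr.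
rewrite rGamma_qgam factS natrM.
have -> : n.+1%:R * n`!%:R * (qgam n z / (n`!%:R * npow n z)) = qgam n z * npow n (1 - z).
  rewrite npowD npow1 npowN.
  move: (factC_neq0 n) (npow_neq0 n z).
  move: (n`!%:R : C) (npow n z) (n.+1%:R : C) (qgam n z) => a b c d ha hb.
  by field; rewrite ha hb.
rewrite nmM nm_npow ReD ReN -mulrA; apply: ler_pM; rewrite ?nm_ge0 //.
  have := h n z Nn zK; have := nm_tri (qgam n z) 1 0; rewrite !subr0 nm1.
  have : C0 / n.+1%:R <= C0 by rewrite ler_pdivrMr ?ltr0n // ler_peMr // ler1n.
  move: (C0 / n.+1%:R) => q; lra.
rewrite -[complex.Re 1]/(1 : R); have [_ p2] := pw_succ n (1 - complex.Re z).
by apply: le_trans p2 _; rewrite ler_wpM2r // ler_expR.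
Qed.

Lemma rGamma_neq0 z : (forall m : nat, z != - m%:R) -> rGamma z != 0.
Proof.
move=> hz; have [C0 [N [C00 h]]] := qgam_near1 (nm_ge0 z).
have [N' hN'] := archi_nat C0; pose n := maxn N N'.
rewrite (rGamma_poch z n.+1) rGamma_qgam; apply: mulf_neq0; first exact: poch_neq0.
apply: mulf_neq0; last by rewrite invr_eq0 mulf_neq0 ?npow_neq0 ?factC_neq0.
apply/eqP => q0; have := h n z (leq_maxl _ _) (lexx _).
rewrite q0 sub0r nmN nm1 ler_pdivlMr ?ltr0n // mul1r.
have : (N'%:R : R) <= n.+1%:R by rewrite ler_nat leqW // leq_maxr.
by move: (n.+1%:R : R) => k; lra.
Qed.

Lemma rGamma1 : rGamma 1 = 1 :> C.
Proof.
apply: tends_unique (ggam_rGamma 1) _; apply: tends_ext (tends_cst 1) => n.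
by rewrite /ggam poch_1 npow1 factS natrM [n.+1%:R * _]mulrC divff // mulf_neq0 ?natC_neq0 ?factC_neq0.
Qed.

Section UniformPochhammer.
Variables (T : Type) (D : T -> Prop) (z : T -> C) (K : R).
Hypothesis zK : forall t, D t -> nm (z t) <= K.

Lemma bigO_rGamma (x : R) : (forall t, D t -> 1 - complex.Re (z t) <= x) ->
  bigO D (fun t n => n`!%:R * rGamma (z t + n%:R)) x.
Proof.
move=> hx; have [K0|K0] := leP 0 K.
  have [B [B0 h]] := rGamma_shift_bound K0; exists B; split=> // t n Dt.
  by apply: le_trans (h _ _ (zK Dt)) _; rewrite ler_wpM2l // pw_le // hx.
exists 0; split=> // t n Dt.
by have := le_lt_trans (zK Dt) K0; rewrite ltNge nm_ge0.
Qed.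

Lemma bigO_poch (x : R) : (forall t, D t -> complex.Re (z t) - 1 <= x) ->
  bigO D (fun t n => poch (z t) n / n`!%:R) x.
Proof.
move=> hx; have [K0|K0] := leP 0 K; last first.
  exists 0; split=> // t n Dt.
  by have := le_lt_trans (zK Dt) K0; rewrite ltNge nm_ge0.
have [C0 [N [C00 h]]] := qgam_near1 K0.
have [Br [Br0 hr]] := rGamma_bound K0.
have [N' hN'] := archi_nat (2 * C0); pose M := maxn N N'.
pose B1 := (\sum_(j < M.+1) \prod_(i < j) (K + i%:R)) / pw M (- (K + 1)).
have s0 j : 0 <= \prod_(i < j) (K + i%:R) by apply: prodr_ge0 => i _; apply: addr_ge0.
have B10 : 0 <= B1 by rewrite divr_ge0 ?sumr_ge0.
pose B2 := 2 * Br * expR (K + 1).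
have B20 : 0 <= B2 by rewrite !mulr_ge0 // expR_ge0.
exists (B1 + B2); split=> [|t n Dt]; first exact: addr_ge0.
apply: (@le_trans _ _ ((B1 + B2) * pw n (complex.Re (z t) - 1))); last first.
  by rewrite ler_wpM2l ?addr_ge0 // pw_le // hx.
have rz : `|complex.Re (z t) - 1| <= K + 1.
  by rewrite (le_trans (ler_normB _ _)) // normr1 lerD2r Re_bound ?zK.
rewrite nmf_div nm_nat.
have [nM|Mn] := leqP n M.
  apply: (@le_trans _ _ (B1 * pw n (complex.Re (z t) - 1))); last first.
    by rewrite ler_wpM2r // lerDl.
  apply: (@le_trans _ _ (\sum_(j < M.+1) \prod_(i < j) (K + i%:R))).
    apply: le_trans (_ : nm (poch (z t) n) <= _).
      by rewrite ler_pdivrMr ?factR_gt0 // ler_peMr ?nm_ge0 // ler1n fact_gt0.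
    apply: le_trans (nm_poch_le _ (zK Dt)) _.
    by rewrite [leRHS](bigD1 (Ordinal (nM : (n < M.+1)%N))) //= lerDl; apply: sumr_ge0 => j _; apply: s0.
  rewrite /B1 mulrAC ler_pdivlMr ?pw_gt0 // ler_wpM2l ?sumr_ge0 //.
  exact: pw_ge_exp.
case: n Mn => // n; rewrite ltnS => Mn.
apply: (@le_trans _ _ (B2 * pw n.+1 (complex.Re (z t) - 1))); last first.
  by rewrite ler_wpM2r // lerDr.
have q12 : 1/2 <= nm (qgam n (z t)).
  have := h n (z t) (leq_trans (leq_maxl _ _) Mn) (zK Dt).
  have := nm_tri 1 (qgam n (z t)) 0; rewrite !subr0 nm1 (nmB 1).
  have : C0 / n.+1%:R <= 1/2.
    rewrite ler_pdivrMr ?ltr0n //.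
    have : (N'%:R : R) <= n.+1%:R by rewrite ler_nat leqW // (leq_trans (leq_maxr N _)).
    by move: (n.+1%:R : R) => k; lra.
  move: (C0 / n.+1%:R) => q; lra.
(* The relation avoids dividing by [rGamma (z t)], which may vanish; a lower bound for [qgam] is
   enough. *)
have e : nm (poch (z t) n.+1) * nm (qgam n (z t)) = nm (rGamma (z t)) * (n`!%:R * pw n (complex.Re (z t))).
  have := rGamma_poch (z t) n.+1; rewrite rGamma_qgam => ->.
  move: (qgam n (z t)) => q; rewrite !nmM nmV nmM nm_nat nm_npow.
  move: (factR_gt0 n) (pw_gt0 n (complex.Re (z t))).
  move: (n`!%:R : R) (pw n _) (nm (poch _ _)) (nm q) => a b c d a0 b0.
  by field; rewrite !gt_eqF.
have p1 : nm (poch (z t) n.+1) <= 2 * Br * (n`!%:R * pw n (complex.Re (z t))).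
  have : nm (rGamma (z t)) * (n`!%:R * pw n (complex.Re (z t))) <= Br * (n`!%:R * pw n (complex.Re (z t))).
    by rewrite ler_wpM2r ?mulr_ge0 // hr // zK.
  have := nm_ge0 (poch (z t) n.+1); move: e q12.
  move: (nm (poch _ _)) (nm (qgam _ _)) (nm (rGamma _) * _) => p q r e q12 p0.
  rewrite -mulrA; move: (Br * _) => s; nra.
apply: le_trans (_ : 2 * Br * pw n (complex.Re (z t) - 1) <= _).
  rewrite ler_pdivrMr ?factR_gt0 //; apply: le_trans p1 _.
  rewrite -!mulrA ler_wpM2l // ler_wpM2l // factS natrM pwB pw1.
  move: (ltr0Sn R n) (pw_gt0 n (complex.Re (z t))) (factR_gt0 n).
  move: (n.+1%:R : R) (pw n _) (n`!%:R : R) => a b c a0 b0 c0.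
  by rewrite mulrA divfK ?gt_eqF // mulrC.
rewrite /B2 -!mulrA ler_wpM2l // ler_wpM2l //.
have [_ p2] := pw_succ n (complex.Re (z t) - 1).
by apply: le_trans p2 _; rewrite ler_wpM2r // ler_expR.
Qed.

End UniformPochhammer.

(** The constant contains [1 / nm (rGamma z)], so it depends on [z] and degenerates near the poles
    of Gamma. Keeping the lower parameters fixed during the continuation makes this pointwise bound
    sufficient. *)
Lemma poch_lower_bound z : (forall m : nat, z != - m%:R) ->
  exists B : R, 0 <= B /\ forall n, nm (n`!%:R / poch z n) <= B * pw n (1 - complex.Re z).
Proof.
move=> hz; have [B [B0 h]] := rGamma_shift_bound (nm_ge0 z).
have g0 : 0 < nm (rGamma z) by rewrite nm_gt0 rGamma_neq0.
exists (B / nm (rGamma z)); split=> [|n]; first by rewrite divr_ge0 ?nm_ge0.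
have p0 : poch z n != 0 by apply: poch_neq0.
have := h z n (lexx _); rewrite mulrAC ler_pdivlMr // -nmM; apply: le_trans.
rewrite [X in _ * X](rGamma_poch z n) mulrA divfK //.
Qed.

End GammaBounds.

Section PointwiseOrder.
Variable R : realType.
Local Notation C := R[i].
Implicit Types (u v : nat -> C) (x y : R).

Definition bigo u x := bigO (fun _ : unit => True) (fun _ => u) x.

Lemma bigo_summable u x : x < -1 -> bigo u x -> summable u.
Proof. by move=> x1 h; apply: (bigO_summable (t := tt) x1 h). Qed.

Lemma bigo_tends0 u x : x < 0 -> bigo u x -> tends u 0.
Proof. by move=> x1 h; apply: (bigO_tends0 (t := tt) x1 h). Qed.

Lemma bigo_eq u v x : u =1 v -> bigo u x -> bigo v x.
Proof. by move=> uv; apply: bigO_eq => t n _; apply: uv. Qed.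

Lemma bigoM u v x y : bigo u x -> bigo v y -> bigo (fun n => u n * v n) (x + y).
Proof. exact: bigOM. Qed.

Lemma bigoZ (c : C) u x : bigo u x -> bigo (fun n => c * u n) x.
Proof.
move=> h; have := bigOM (bigO_cst (c := fun _ : unit => c) (K := nm c) (D := fun _ => True) _) h.
by rewrite add0r; apply.
Qed.

Lemma bigo_le u x y : x <= y -> bigo u x -> bigo u y.
Proof. exact: bigO_le. Qed.

Lemma bigo_poch (z : C) : bigo (fun n => poch z n / n`!%:R) (complex.Re z - 1).
Proof. by apply: (@bigO_poch _ _ _ (fun=> z) (nm z)). Qed.

Lemma bigo_rGamma (z : C) : bigo (fun n => n`!%:R * rGamma (z + n%:R)) (1 - complex.Re z).
Proof. by apply: (@bigO_rGamma _ _ _ (fun=> z) (nm z)). Qed.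

Lemma bigo_pochV (z : C) : (forall m : nat, z != - m%:R) ->
  bigo (fun n => n`!%:R / poch z n) (1 - complex.Re z).
Proof. by move=> /poch_lower_bound[B [B0 h]]; exists B; split=> // t n _. Qed.

Lemma bigo_nat : bigo (fun n => n%:R) 1.
Proof. by exists 1; split=> // t n _; rewrite nm_nat pw1 mul1r ler_nat. Qed.

Lemma bigo_near u v x : bigo u x -> (exists (B : R) N, 0 <= B /\ forall n, (N <= n)%N -> nm (v n) <= B * nm (u n)) ->
  bigo v x.
Proof.
move=> [B [B0 h]] [B' [N [B'0 h']]].
have s0 n : 0 <= nm (v n) / pw n x by rewrite divr_ge0 ?nm_ge0.
exists (B' * B + \sum_(i < N) nm (v i) / pw i x); split=> [|t n _].
  by rewrite addr_ge0 ?mulr_ge0 // sumr_ge0.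
have [Nn|nN] := leqP N n.
  apply: le_trans (h' _ Nn) _; apply: le_trans (ler_wpM2l B'0 (h tt n I)) _.
  by rewrite mulrA ler_wpM2r // lerDl sumr_ge0.
rewrite -ler_pdivrMr // (bigD1 (Ordinal nN)) //= addrCA lerDl addr_ge0 ?mulr_ge0 //.
by apply: sumr_ge0 => i _.
Qed.

Lemma tends_qgam (z : C) : tends (fun N => qgam N z) 1.
Proof.
have [C0 [N [C00 h]]] := qgam_near1 (nm_ge0 z).
by apply: null_le (null_inv C0); exists N => n Nn; apply: h.
Qed.

End PointwiseOrder.

(** * Gauss' summation theorem *)

Section GaussSum.
Variable R : realType.
Local Notation C := R[i].
Implicit Types (a b c : C).

(** A term of [2F1(a, b; c; 1) / Gamma(c)], defined for every [c]. *)
Definition gterm a b c (s : nat) : C := poch a s * poch b s / s`!%:R * rGamma (c + s%:R).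

Lemma bigo_gterm a b c : bigo (gterm a b c) (complex.Re (a + b - c) - 1).
Proof.
have h := bigoM (bigoM (bigo_poch a) (bigo_poch b)) (bigo_rGamma c).
have -> : complex.Re (a + b - c) - 1 = complex.Re a - 1 + (complex.Re b - 1) + (1 - complex.Re c).
  by rewrite !ReD ReN; ring.
apply: bigo_eq h => s; rewrite /gterm.
move: (factC_neq0 R s); move: (s`!%:R : C) (poch a s) (poch b s) (rGamma _) => f p q r f0.
by field.
Qed.

Lemma summable_gterm a b c : 0 < complex.Re (c - a - b) -> summable (gterm a b c).
Proof.
move=> h; apply: (bigo_summable _ (bigo_gterm a b c)).
by move: h; rewrite !ReD !ReN; lra.
Qed.

Lemma gterm_shift a b c s : gterm a b c s = (c + s%:R) * gterm a b (c + 1) s.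
Proof. by rewrite /gterm rGamma_rec -!addrA [s%:R + 1]addrC; ring. Qed.

Lemma gterm_succ a b c s :
  s.+1%:R * gterm a b c s.+1 = (a + s%:R) * (b + s%:R) * gterm a b (c + 1) s.
Proof.
rewrite /gterm !pochS factS natrM -natr1 [s%:R + 1]addrC [c + (1 + _)]addrA.
have : (1 + s%:R : C) != 0 by rewrite -(natrD _ 1) natC_neq0.
move: (factC_neq0 R s); move: (s`!%:R : C) (poch a s) (poch b s) (rGamma _) => f p q r f0 s0.
by field; rewrite ?f0 ?s0.
Qed.

(** The finite form of the contiguous relation in [c]; its boundary term tends to [0] when
    [Re (c - a - b) > 0]. *)
Lemma gterm_telescope a b c (S : nat) :
  (a + b - c) * \sum_(s < S) gterm a b c s
  = S%:R * gterm a b c S - (c - a) * (c - b) * \sum_(s < S) gterm a b (c + 1) s.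
Proof.
elim: S => [|S IH]; first by rewrite !big_ord0 !mulr0 mul0r subr0.
rewrite !big_ord_recr /= !mulrDr IH gterm_succ gterm_shift.
move: (gterm a b (c + 1) S) (\sum_(s < S) _) => x y; ring.
Qed.

Lemma gauss_contiguous a b c : 0 < complex.Re (c - a - b) ->
  (c - a - b) * csum (gterm a b c) = (c - a) * (c - b) * csum (gterm a b (c + 1)).
Proof.
move=> h; have h' : 0 < complex.Re (c + 1 - a - b) by move: h; rewrite !ReD !ReN Re_1; lra.
have t1 := summable_has_sum (summable_gterm h).
have t2 := summable_has_sum (summable_gterm h').
have t3 : tends (fun S => S%:R * gterm a b c S) 0.
  apply: bigo_tends0 (bigoM (bigo_nat R) (bigo_gterm a b c)).
  by move: h; rewrite !ReD !ReN; lra.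
have e1 := tendsZ (a + b - c) t1.
have e2 := tendsB t3 (tendsZ ((c - a) * (c - b)) t2).
have e := tends_unique e1 (tends_ext (fun S => esym (gterm_telescope a b c S)) e2).
have -> : c - a - b = - (a + b - c) by ring.
by rewrite mulNr e sub0r opprK.
Qed.

Lemma gauss_iter a b c N : 0 < complex.Re (c - a - b) ->
  poch (c - a - b) N * csum (gterm a b c)
  = poch (c - a) N * poch (c - b) N * csum (gterm a b (c + N%:R)).
Proof.
move=> h; elim: N => [|N IH]; first by rewrite !poch0 !mul1r addr0.
have hN : 0 < complex.Re (c + N%:R - a - b).
  by move: h (ler0n R N); rewrite !ReD !ReN Re_nat; lra.
rewrite !pochS mulrAC IH.
have := gauss_contiguous hN.
have -> : c - a - b + N%:R = c + N%:R - a - b by ring.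
have -> : c - a + N%:R = c + N%:R - a by ring.
have -> : c - b + N%:R = c + N%:R - b by ring.
rewrite -[N.+1%:R]natr1 [c + (_ + 1)]addrA => e.
move: e; move: (csum (gterm a b (c + N%:R))) (csum (gterm a b _)) (poch _ _) (poch _ _) => x y p q e.
by transitivity (p * q * ((c + N%:R - a - b) * y)); [ring | rewrite e; ring].
Qed.

Lemma gauss_limit a b c :
  tends (fun N => csum (fun s => poch a s * poch b s / s`!%:R / poch (c + N.+1%:R) s)) 1.
Proof.
have [N0 hN0] := archi_nat (`|complex.Re a| + `|complex.Re b| + `|complex.Re c| + 1).
(* A real lower parameter for the majorant: [x0 > Re a + Re b] makes it summable, and [x0 >= 1]
   makes its Pochhammer symbols positive. *)
pose x0 := complex.Re c + N0%:R.
have ineqs : complex.Re a + complex.Re b < x0 /\ 1 <= x0.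
  have := ler_norm (complex.Re a); have := ler_norm (complex.Re b).
  have := ler_norm (- complex.Re c); rewrite normrN /x0.
  by have := normr_ge0 (complex.Re a); have := normr_ge0 (complex.Re b); lra.
have [x0ab x01] := ineqs.
have nx0 (m : nat) : x0%:C != - m%:R.
  apply/eqP => /(congr1 (@complex.Re R)); rewrite ReN Re_nat /= => e.
  by have := ler0n R m; lra.
pose v := fun s : nat => ((s == 0%N)%:R : C).
have e1 : csum v = 1.
  apply/has_sum_csum; have := @has_sum_finite R v 1 _; rewrite big_ord1; apply.
  by case.
rewrite -[X in tends _ X]e1.
have hO : bigo (fun s => poch a s * poch b s / s`!%:R / poch x0%:C s) (complex.Re a - 1 + (complex.Re b - 1) + (1 - x0)).
  apply: bigo_eq (bigoM (bigoM (bigo_poch a) (bigo_poch b)) (bigo_pochV nx0)) => s.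
  move: (factC_neq0 R s) (poch_neq0 s nx0).
  move: (s`!%:R : C) (poch a s) (poch b s) (poch _ s) => f p q r f0 r0.
  by field; rewrite f0 r0.
have [|M hM] := bigo_summable _ hO; first lra.
apply: (tannery _ hM) => [|s].
  exists N0 => N s NN; rewrite /= nmf_div [leRHS]nmf_div ler_wpM2l ?nm_ge0 //.
  rewrite lef_pV2 ?posrE ?nm_gt0 ?poch_neq0 //; last first.
    move=> m; apply/eqP => /(congr1 (@complex.Re R)); rewrite ReD ReN !Re_nat => e.
    have : (N0%:R : R) <= N.+1%:R by rewrite ler_nat ltnW.
    by have := ler0n R m; rewrite /x0 in x01; lra.
  have -> : nm (poch x0%:C s) = \prod_(i < s) (x0 + i%:R).
    rewrite /poch nm_prod; apply: eq_bigr => i _.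
    by rewrite -rcn -rcD nm_real ger0_norm // addr_ge0 //; lra.
  apply: nm_poch_ge_Re; first lra.
  rewrite ReD Re_nat lerD2l ler_nat; exact: ltnW.
case: s => [|s].
  by apply: tends_ext (tends_cst 1) => N; rewrite /v /= !poch0 fact0 !divr1 mulr1.
pose K := nm (poch a s.+1 * poch b s.+1 / s.+1`!%:R).
apply: tends0; apply: (@null_unshift _ N0); apply: null_le (null_inv K).
exists 0%N => N _; rewrite nmf_div -/K ler_wpM2l ?nm_ge0 //.
have hre : N.+1%:R <= complex.Re (c + (N + N0).+1%:R).
  rewrite ReD Re_nat -addSn natrD; rewrite /x0 in x01; lra.
rewrite lef_pV2 ?posrE ?ltr0n //; last first.
  rewrite nm_gt0 poch_neq0 // => m; apply/eqP => e; move: hre; rewrite e ReN Re_nat.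
  by have := ler0n R m; have := ltr0Sn R N; move: (N.+1%:R : R) => k; lra.
apply: le_trans (nm_poch_ge_Re s.+1 (ler0n _ _) hre).
rewrite big_ord_recl addr0 ler_peMr //.
elim/big_rec: _ => // i x _ x1; rewrite mulr_ege1 //.
by rewrite -natrD ler1n.
Qed.

(* The quotient of the two sides of Gauss' formula is unchanged under [c -> c + N],
   and both sides become equivalent as [N] grows. *)
Lemma gauss_sum a b c : 0 < complex.Re (c - a - b) ->
  rGamma (c - a - b) * csum (gterm a b c) = rGamma (c - a) * rGamma (c - b).
Proof.
move=> h; set X := LHS; set Y := RHS.
have lim : tends (fun N => (qgam N c * qgam N (c - a - b)) / (qgam N (c - a) * qgam N (c - b)) *
    csum (fun s => poch a s * poch b s / s`!%:R / poch (c + N.+1%:R) s)) 1.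
  rewrite -[X in tends _ X]mulr1; apply: tendsM (gauss_limit a b c).
  have t1 := tendsM (tends_qgam c) (tends_qgam (c - a - b)).
  have t2 := tendsM (tends_qgam (c - a)) (tends_qgam (c - b)).
  rewrite mulr1 in t1 t2; rewrite -[X in tends _ X]mulr1 -[X in tends _ (_ * X)]invr1.
  by apply: tendsM t1 (tendsV (oner_neq0 _) t2).
apply: tends_unique (tends_cst X) _; rewrite -[Y]mulr1.
apply: tends_eq (tendsZ Y lim).
have ev z : exists N, forall n, (N <= n)%N -> qgam n z != 0 :> C.
  have [N hN] := tends_qgam z ltr01; exists N => n /hN; apply: contraTneq => ->.
  by rewrite sub0r nmN nm1 ltxx.
have [N1 h1] := ev (c - a); have [N2 h2] := ev (c - b); have [N3 h3] := archi_nat (nm c).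
exists (maxn N1 (maxn N2 N3)) => N; rewrite !geq_max => /and3P[/h1 q1 /h2 q2 NN].
have cN m : c + N.+1%:R != - (m%:R : C).
  rewrite -addr_eq0 -addrA -natrD; apply/eqP => /eqP; rewrite addr_eq0 => /eqP e.
  have := h3; rewrite e nmN nm_nat ltr_nat ltnNge.
  by rewrite (leq_trans NN) // addSn leqW // leq_addr.
have E : csum (gterm a b (c + N.+1%:R)) = rGamma (c + N.+1%:R) *
    csum (fun s => poch a s * poch b s / s`!%:R / poch (c + N.+1%:R) s).
  have hN : 0 < complex.Re (c + N.+1%:R - a - b).
    by move: h (ltr0Sn R N); rewrite !ReD !ReN Re_nat; lra.
  have e s : gterm a b (c + N.+1%:R) s = rGamma (c + N.+1%:R) * (poch a s * poch b s / s`!%:R / poch (c + N.+1%:R) s).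
    rewrite /gterm (rGamma_poch (c + N.+1%:R) s).
    move: (poch_neq0 s cN); move: (poch (c + _) s) (poch a s * poch b s / _) (rGamma _) => x y z x0.
    by field.
  rewrite (eq_csum e) csumZ //.
  have r0 : rGamma (c + N.+1%:R) != 0 by apply: rGamma_neq0.
  have := summableZ (rGamma (c + N.+1%:R))^-1 (summable_gterm hN).
  by apply: eq_summable => s; rewrite e mulKf.
rewrite /X (rGamma_poch (c - a - b) N.+1) [RHS]mulrAC gauss_iter // E.
rewrite /Y (rGamma_poch (c - a) N.+1) (rGamma_poch (c - b) N.+1) !rGamma_qgam.
have -> : npow N (c - a - b) = npow N (c - a) * npow N (c - b) / npow N c.
  by rewrite -npowN -!npowD; congr npow; ring.
move: q1 q2 (factC_neq0 R N) (npow_neq0 N (c - a)) (npow_neq0 N (c - b)) (npow_neq0 N c).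
move: (npow N (c - a)) (npow N (c - b)) (npow N c) (N`!%:R : C) (csum _).
move: (qgam N (c - a - b)) (qgam N (c - a)) (qgam N (c - b)) (qgam N c) (poch _ _) (poch _ _).
move=> d1 d2 d3 d4 d5 d6 d7 d8 d9 d10 d11 e1 e2 e3 e4 e5 e6.
by field; rewrite ?e1 ?e2 ?e3 ?e4 ?e5 ?e6.
Qed.

End GaussSum.

(** * The reflection formula *)

Section RootsOfUnity.
Variable R : realType.
Local Notation C := R[i].
Implicit Types (z w : C).

Definition omega (n : nat) : C := cexp ('i * (2 * pi / n%:R)%:C).

Lemma ReiM (x : R) : complex.Re ('i * x%:C) = 0.
Proof. by rewrite /= mul0r mul1r subr0. Qed.
Lemma ImiM (x : R) : complex.Im ('i * x%:C) = x.
Proof. by rewrite /= mul0r mul1r add0r. Qed.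

Lemma cexp_i (x : R) : cexp ('i * x%:C) = cos x +i* sin x.
Proof. by rewrite cexpE ReiM ImiM expR0 !mul1r. Qed.

Lemma omegaX n k : omega n ^+ k = cos (2 * (pi * k%:R / n%:R)) +i* sin (2 * (pi * k%:R / n%:R)).
Proof.
rewrite /omega -cexp_natl -cexp_i; congr cexp.
by rewrite mulrCA -rcn -rcM; congr ('i * _%:C); ring.
Qed.

Lemma cos_dbl (x : R) : cos (2 * x) = 1 - 2 * sin x ^+ 2.
Proof. by rewrite mulr_natl cos_mulr2n cos2sin2; ring. Qed.

Lemma cos_dbl' (x : R) : cos (2 * x) = 2 * cos x ^+ 2 - 1.
Proof. by rewrite mulr_natl cos_mulr2n mulr_natl. Qed.

Lemma omega_prim n : (0 < n)%N -> n.-primitive_root (omega n).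
Proof.
move=> n0; have nR : (0 : R) < n%:R by rewrite ltr0n.
apply/andP; split=> //; apply/forallP => i; rewrite unity_rootE omegaX.
have [/eqP ->|ne] := boolP (i.+1 == n).
  by rewrite (mulfK (lt0r_neq0 nR)) mulr_natl cos2pi sin2pi eqxx.
have lt : (i.+1 < n)%N by rewrite ltn_neqAle ne ltn_ord.
rewrite cos_dbl; apply/eqP/negbTE; apply/eqP => /(congr1 (@complex.Re R)) /=.
have : 0 < sin (pi * i.+1%:R / n%:R) :> R.
  apply: sin_gt0_pi; rewrite divr_gt0 ?mulr_gt0 ?pi_gt0 ?ltr0n //=.
  by rewrite ltr_pdivrMr // ltr_pM2l ?pi_gt0 // ltr_nat.
by move: (sin _) => s s0; nra.
Qed.

Lemma omega_sum n k : (0 < n)%N -> ~~ (n %| k)%N -> \sum_(j < n) omega n ^+ (j * k) = 0.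
Proof.
move=> n0 nk; have pr := omega_prim n0.
have w1 : omega n ^+ k - 1 != 0 by rewrite subr_eq0 -(prim_order_dvd pr).
apply: (mulfI w1); rewrite mulr0.
transitivity ((omega n ^+ k - 1) * \sum_(j < n) (omega n ^+ k) ^+ j).
  by congr (_ * _); apply: eq_bigr => j _; rewrite -exprM mulnC.
by rewrite -subrX1 -exprM mulnC exprM (prim_expr_order pr) expr1n subrr.
Qed.

Lemma nm_omegaX n k : nm (omega n ^+ k) = 1.
Proof. by rewrite omegaX -cexp_i nm_cexp ReiM expR0. Qed.

Lemma omega_prod n t : (0 < n)%N -> \prod_(1 <= k < n) (t - omega n ^+ k) = \sum_(j < n) t ^+ j.
Proof.
move=> n0; have pr := omega_prim n0.
have e : \prod_(1 <= k < n) ('X - (omega n ^+ k)%:P) = \sum_(j < n) 'X^j :> {poly C}.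
  apply: (mulfI (negbT (polyXsubC_eq0 (1 : C)))).
  rewrite -[1%:P in RHS]/(1 : {poly C}) -subrX1 -(factor_Xn_sub_1 pr).
  by rewrite [RHS]big_ltn // expr0.
have := congr1 (fun p : {poly C} => p.[t]) e; rewrite horner_prod horner_sum.
under eq_bigr do rewrite hornerXsubC.
by move=> ->; apply: eq_bigr => j _; rewrite hornerXn.
Qed.

Lemma omega_prod2 n x y : (0 < n)%N -> y != 0 ->
  \prod_(1 <= k < n) (x - omega n ^+ k * y) = \sum_(j < n) x ^+ (n.-1 - j) * y ^+ j.
Proof.
move=> n0 y0; transitivity (y ^+ n.-1 * \prod_(1 <= k < n) (x / y - omega n ^+ k)).
  have -> : y ^+ n.-1 = \prod_(1 <= k < n) y by rewrite prodr_const_nat subn1.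
  rewrite -big_split /=; apply: eq_bigr => k _.
  by rewrite mulrBr mulrCA divff // mulr1 [y * _]mulrC.
rewrite omega_prod // mulr_sumr (reindex_inj rev_ord_inj) /=.
apply: eq_bigr => j _.
have jn : (j <= n.-1)%N by rewrite -ltnS prednK.
have -> : (n - j.+1 = n.-1 - j)%N by rewrite subnS -subn1 -subnDA addnC subnDA subn1.
rewrite exprMn exprVn -{1}(subnK jn) exprD.
by move: (expf_neq0 (n.-1 - j) y0); move: (y ^+ (n.-1 - j)) => q q0; field.
Qed.

Lemma pair_prod (F : nat -> C) m :
  \prod_(1 <= k < m.*2.+1) F k = \prod_(i < m) (F i.+1 * F (m.*2 - i)%N).
Proof.
rewrite big_add1 /= big_mkord -addnn big_split_ord /= big_split /=; congr (_ * _).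
rewrite (reindex_inj rev_ord_inj) /=; apply: eq_bigr => i _; congr F.
by rewrite -addnS subnSK // addnBA // ltnW.
Qed.

Definition cot2 (m k : nat) : R :=
  (cos (pi * k.+1%:R / m.*2.+1%:R) / sin (pi * k.+1%:R / m.*2.+1%:R)) ^+ 2.

Lemma angle_bounds m k : (k < m)%N ->
  0 < (pi : R) * k.+1%:R / m.*2.+1%:R < pi / 2.
Proof.
move=> km; rewrite divr_gt0 ?mulr_gt0 ?pi_gt0 ?ltr0n //=.
rewrite ltr_pdivrMr ?ltr0n // mulrAC -mulrA ltr_pM2l ?pi_gt0 //.
rewrite ltr_pdivlMr // -natrM ltr_nat muln2 ltnS leq_double //.
Qed.

Lemma sin_angle_gt0 m k : (k < m)%N -> 0 < sin (pi * k.+1%:R / m.*2.+1%:R) :> R.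
Proof. by move=> /angle_bounds; apply: sin_gt0_pihalf. Qed.

(** The two roots of unity are conjugate: their product is [1] and their sum is twice a cosine. The
    double angle formulas then give the factors [4 sin ^ 2] and [4 cos ^ 2]. *)
Lemma omega_pair m k w : (k < m)%N ->
  ((1 + w) - omega m.*2.+1 ^+ k.+1 * (1 - w)) * ((1 + w) - omega m.*2.+1 ^+ (m.*2 - k) * (1 - w))
  = (4 * sin (pi * k.+1%:R / m.*2.+1%:R) ^+ 2)%:C * (1 + w ^+ 2 * (cot2 m k)%:C).
Proof.
move=> km; have pr := omega_prim (ltn0Sn m.*2); have s0 := sin_angle_gt0 km.
have e1 : omega m.*2.+1 ^+ k.+1 * omega m.*2.+1 ^+ (m.*2 - k) = 1.
  rewrite -exprD addSn subnKC ?prim_expr_order //.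
  by rewrite (leq_trans (ltnW km)) // -addnn leq_addr.
have e2 : omega m.*2.+1 ^+ k.+1 + omega m.*2.+1 ^+ (m.*2 - k)
    = (2 * cos (2 * (pi * k.+1%:R / m.*2.+1%:R)))%:C.
  have -> : omega m.*2.+1 ^+ (m.*2 - k) = (omega m.*2.+1 ^+ k.+1)^-1.
    have w0 : omega m.*2.+1 ^+ k.+1 != 0 by rewrite -nm_gt0 nm_omegaX ltr01.
    by apply: (mulfI w0); rewrite e1 divff.
  rewrite omegaX -cexp_i -cexpN -mulrN -rcN !cexp_i cosN sinN.
  by apply/eqP; rewrite eq_complex /= subrr eqxx andbT; apply/eqP; ring.
have -> : (4 * sin (pi * k.+1%:R / m.*2.+1%:R) ^+ 2)%:C * (1 + w ^+ 2 * (cot2 m k)%:C)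
   = (4 * sin (pi * k.+1%:R / m.*2.+1%:R) ^+ 2)%:C + w ^+ 2 * (4 * cos (pi * k.+1%:R / m.*2.+1%:R) ^+ 2)%:C.
  have -> : 4 * cos (pi * k.+1%:R / m.*2.+1%:R) ^+ 2
      = 4 * sin (pi * k.+1%:R / m.*2.+1%:R) ^+ 2 * cot2 m k.
    by rewrite /cot2; move: s0; move: (sin _) (cos _) => s c s0; field; apply: lt0r_neq0.
  by rewrite rcM; ring.
have -> : 4 * sin (pi * k.+1%:R / m.*2.+1%:R) ^+ 2 = 2 - 2 * cos (2 * (pi * k.+1%:R / m.*2.+1%:R)) :> R.
  by rewrite cos_dbl; ring.
have -> : 4 * cos (pi * k.+1%:R / m.*2.+1%:R) ^+ 2 = 2 + 2 * cos (2 * (pi * k.+1%:R / m.*2.+1%:R)) :> R.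
  by rewrite cos_dbl'; ring.
rewrite (rcB 2) (rcD 2 (2 * _)) -e2 rcn.
move: e1; move: (omega m.*2.+1 ^+ k.+1) (omega m.*2.+1 ^+ (m.*2 - k)) => p q e.
transitivity ((1 + w) ^+ 2 - (1 + w) * (1 - w) * (p + q) + (p * q) * (1 - w) ^+ 2); first ring.
by rewrite e; ring.
Qed.

(** A finite form of Euler's product: for [w = i x / n] with [n = 2 m + 1] the left side tends to
    [2 i sin x]. The exponent is odd so that the nontrivial roots of unity pair off. *)
Lemma sine_polynomial m w : w != 1 ->
  (1 + w) ^+ m.*2.+1 - (1 - w) ^+ m.*2.+1
  = 2 * w * m.*2.+1%:R * \prod_(k < m) (1 + w ^+ 2 * (cot2 m k)%:C).
Proof.
move=> w1.
have key v : v != 1 -> \sum_(j < m.*2.+1) (1 + v) ^+ (m.*2 - j) * (1 - v) ^+ j =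
    (\prod_(k < m) (4 * sin (pi * k.+1%:R / m.*2.+1%:R) ^+ 2)%:C) * \prod_(k < m) (1 + v ^+ 2 * (cot2 m k)%:C).
  move=> v1; rewrite -(@omega_prod2 m.*2.+1) ?subr_eq0 1?eq_sym // pair_prod -big_split /=.
  by apply: eq_bigr => k _; rewrite omega_pair.
(* At [v = 0] the factorization evaluates the product of the [4 sin ^ 2] as [2 m + 1]. *)
have e0 := key 0; rewrite eq_sym oner_neq0 in e0; have {}e0 := e0 isT.
rewrite addr0 subr0 in e0.
have -> : (1 + w) ^+ m.*2.+1 - (1 - w) ^+ m.*2.+1 = 2 * w * \sum_(j < m.*2.+1) (1 + w) ^+ (m.*2 - j) * (1 - w) ^+ j.
  by rewrite subrXX /=; congr (_ * _); ring.
rewrite key // mulrA; congr (_ * _); congr (_ * _).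
move: e0; rewrite [X in _ = _ * X]big1 ?mulr1 => [<-|i _]; last by rewrite expr0n /= mul0r addr0.
under eq_bigr do rewrite !expr1n mulr1.
by rewrite sumr_const card_ord.
Qed.

End RootsOfUnity.

Section SineProduct.
Variable R : realType.
Local Notation C := R[i].
Implicit Types (z w : C).

Lemma subXX_le (a b : C) (M : R) n : nm a <= M -> nm b <= M -> 
  nm (a ^+ n - b ^+ n) <= n%:R * M ^+ n.-1 * nm (a - b).
Proof.
move=> aM bM; rewrite subrXX nmM mulrC ler_wpM2r ?nm_ge0 //.
apply: le_trans (nm_sum _ _ _) _.
have -> : n%:R * M ^+ n.-1 = \sum_(i < n) M ^+ n.-1 by rewrite sumr_const card_ord mulr_natl.
apply: ler_sum => i _.
have hi : (i <= n.-1)%N by rewrite -ltnS prednK // (leq_trans _ (ltn_ord i)).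
rewrite nmM !nmX -[in leRHS](subnK hi) exprD.
by apply: ler_pM; rewrite ?exprn_ge0 ?nm_ge0 // lerXn2r ?nnegrE ?nm_ge0 // (le_trans (nm_ge0 a)).
Qed.

Lemma cexp_power_approx (u : C) n : 2 * nm u <= n.+1%:R ->
  nm (cexp u - (1 + u / n.+1%:R) ^+ n.+1) <= 8 * nm u ^+ 2 * expR (nm u) / n.+1%:R.
Proof.
move=> un; have n0 : (0 : R) < n.+1%:R by rewrite ltr0n.
have e1 : cexp u = cexp (u / n.+1%:R) ^+ n.+1.
  by rewrite -cexp_natl mulrC divfK ?natC_neq0.
have u1 : nm (u / n.+1%:R) = nm u / n.+1%:R by rewrite nmf_div nm_nat.
rewrite e1; set v := u / n.+1%:R in u1 *.
have b1 : nm (cexp v) <= expR (nm v).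
  by rewrite nm_cexp ler_expR (le_trans (ler_norm _)) // Re_le_nm.
have b2 : nm (1 + v) <= expR (nm v).
  by apply: le_trans (nmD _ _) _; rewrite nm1 expR_ge1Dx.
apply: le_trans (subXX_le n.+1 b1 b2) _ => /=.
have v2 : nm v <= 1/2.
  by rewrite u1 ler_pdivrMr //; move: un; move: (n.+1%:R : R) => q; lra.
have := cexp_taylor1 v2; rewrite -addrA -opprD => t.
have E : expR (nm v) ^+ n <= expR (nm u).
  rewrite -expRM_natl ler_expR u1 mulrCA ler_piMr ?nm_ge0 //.
  by rewrite ler_pdivrMr // mul1r ler_nat.
apply: (@le_trans _ _ (n.+1%:R * expR (nm u) * (8 * nm v ^+ 2))).
  by apply: ler_pM; rewrite ?nm_ge0 ?mulr_ge0 ?exprn_ge0 ?expR_ge0 // ler_wpM2l // ltW.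
rewrite u1; move: n0; move: (n.+1%:R : R) (nm u) (expR _) => q x e q0.
rewrite le_eqVlt; apply/orP; left; apply/eqP; field; by rewrite gt_eqF.
Qed.

Lemma cexp_power_cvg (u : C) : tends (fun n => (1 + u / n.+1%:R) ^+ n.+1) (cexp u).
Proof.
have [N hN] := archi_nat (2 * nm u).
apply: null_le (null_inv (8 * nm u ^+ 2 * expR (nm u))); exists N => n Nn.
rewrite nmB; apply: cexp_power_approx; apply: ltW; apply: lt_trans hN _.
by rewrite ltr_nat.
Qed.

(** Both bounds come from [x cos x <= sin x <= x]. The upper one dominates the factors of the finite
    products, and the lower one gives their limits. *)
Lemma cot_bound (x : R) : 0 < x < pi / 2 -> cos x ^+ 2 <= x ^+ 2 * (cos x / sin x) ^+ 2 <= 1.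
Proof.
move=> /andP[x0 xp]; have s0 : 0 < sin x by apply: sin_gt0_pihalf; rewrite x0.
have c0 : 0 < cos x by apply: cos_gt0_pihalf; rewrite xp andbT; apply: lt_trans x0; rewrite oppr_lt0 divr_gt0 ?pi_gt0.
have sx : sin x <= x by have := sin_le_norm x; rewrite !gtr0_norm.
have cs : x * cos x <= sin x.
  have [t _||c] := @MVT R (fun t => sin t - t * cos t) (fun t => t * sin t) 0 x x0.
    by apply: is_derive_eq; rewrite /GRing.scale /=; ring.
    apply: continuous_subspaceT => t; apply: cvgB; first exact: continuous_sin.
    by apply: cvgM; [exact: cvg_id | exact: continuous_cos].
  rewrite in_itv /= => /andP[cc0 cx]; rewrite sin0 mul0r !subr0 => e.
  have : 0 <= sin c * c * x.
    by rewrite !mulr_ge0 ?(ltW cc0) ?(ltW x0) // ltW // sin_gt0_pihalf // cc0 (lt_trans cx).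
  by rewrite mulrC [sin c * c]mulrC; move: e; lra.
have e : x ^+ 2 * (cos x / sin x) ^+ 2 = (x * cos x / sin x) ^+ 2.
  by field; rewrite gt_eqF.
rewrite e; apply/andP; split.
  rewrite ler_sqr ?nnegrE ?divr_ge0 ?mulr_ge0 ?(ltW x0) ?(ltW c0) ?(ltW s0) //.
  by rewrite ler_pdivlMr // mulrC ler_wpM2r // ltW.
rewrite -[leRHS](expr1n _ 2) ler_sqr ?nnegrE ?divr_ge0 ?mulr_ge0 ?(ltW x0) ?(ltW c0) ?(ltW s0) //.
by rewrite ler_pdivrMr // mul1r.
Qed.

End SineProduct.

Section ProductTannery.
Variable R : realType.
Local Notation C := R[i].

Lemma tends_sub (u : nat -> C) (l : C) (f : nat -> nat) :
  (forall n, (n <= f n)%N) -> tends u l -> tends (fun n => u (f n)) l.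
Proof. by move=> fn h e /h[N hN]; exists N => n Nn; apply: hN; apply: leq_trans (fn n). Qed.

Lemma prod1D_telescope (a : nat -> C) m :
  \prod_(k < m) (1 + a k) = 1 + \sum_(k < m) a k * \prod_(j < k) (1 + a j).
Proof.
elim: m => [|m IH]; first by rewrite !big_ord0 addr0.
by rewrite big_ord_recr /= [X in _ = 1 + X]big_ord_recr /= addrA -IH; ring.
Qed.

Lemma prod1D_bound (a : nat -> C) (d : nat -> R) M m :
  (forall k, (k < m)%N -> nm (a k) <= d k) -> \sum_(k < m) d k <= M ->
  nm (\prod_(k < m) (1 + a k)) <= expR M.
Proof.
move=> ad dM; apply: (@le_trans _ _ (expR (\sum_(k < m) d k))); last by rewrite ler_expR.
rewrite nm_prod expR_sum ler_prod // => k _; rewrite nm_ge0 /=.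
apply: le_trans (nmD _ _) _; rewrite nm1; apply: le_trans (expR_ge1Dx _).
by rewrite lerD2l ad.
Qed.

(** Telescoping turns a product into a sum whose terms carry partial products; these stay below
    [expR M], so Tannery's theorem for series applies to both sides. *)
Lemma tannery_prod (a : nat -> nat -> C) (b : nat -> C) (d : nat -> R) M :
  (forall m k, (k < m)%N -> nm (a m k) <= d k) -> bsum d M ->
  (forall k, tends (a ^~ k) (b k)) ->
  exists l, tends (fun m => \prod_(k < m) (1 + a m k)) l /\
            tends (fun m => \prod_(k < m) (1 + b k)) l.
Proof.
move=> ad dM ab.
have d0 k : 0 <= d k by apply: le_trans (ad k.+1 k (ltnSn k)); apply: nm_ge0.
have bd k : nm (b k) <= d k by apply: tends_le (ab k); exists k.+1 => m; apply: ad.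
have dM' m k : (k <= m)%N -> \sum_(j < k) d j <= M by [].
pose u m k := if (k < m)%N then a m k * \prod_(j < k) (1 + a m j) else 0.
pose v k := b k * \prod_(j < k) (1 + b j).
have gM : bsum (fun k => expR M * d k) (expR M * M).
  by move=> n; rewrite -mulr_sumr ler_wpM2l ?expR_ge0.
have t : tends (fun m => csum (u m)) (csum v).
  apply: (tannery _ gM) => [|k].
    exists 0%N => m k _; rewrite /u; case: ifPn => km; last by rewrite nm0 mulr_ge0 ?expR_ge0.
    rewrite nmM mulrC ler_pM ?nm_ge0 ?ad //.
    by apply: prod1D_bound (dM k) => j jk; apply: ad; apply: ltn_trans km.
  apply: (@tends_eq _ (fun m => a m k * \prod_(j < k) (1 + a m j))).
    by exists k.+1 => m km; rewrite /u km.
  apply: tendsM (ab k) _; apply: (@tends_prod R 'I_k _ _ (fun j m => 1 + a m j) (fun j => 1 + b j)) => j _.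
  exact: tendsD (tends_cst 1) (ab j).
exists (1 + csum v); split.
  apply: tends_ext (tendsD (tends_cst 1) t) => m; rewrite prod1D_telescope; congr (_ + _).
  have -> : csum (u m) = \sum_(k < m) u m k.
    by apply: has_sum_csum; apply: has_sum_finite => n mn; rewrite /u ltnNge mn.
  by apply: eq_bigr => k _; rewrite /u ltn_ord.
have sv : summable v.
  apply: summable_le gM => k; rewrite nmM mulrC ler_pM ?nm_ge0 //.
  by apply: prod1D_bound (dM k) => j _; apply: bd.
apply: tends_ext (tendsD (tends_cst 1) (summable_has_sum sv)) => m.
by rewrite prod1D_telescope.
Qed.

End ProductTannery.

Section Reflection.
Variable R : realType.
Local Notation C := R[i].
Implicit Types (z : C).

Lemma bsum_inv_sq (B : R) : 0 <= B -> bsum (fun k => B / k.+1%:R ^+ 2) (B * 2).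
Proof.
move=> B0 n; have := inv_sq_sum R 0 n; rewrite add0n big_mkord divr1 => h.
by rewrite -mulr_sumr ler_wpM2l.
Qed.

(** Euler's product, from [sine_polynomial] at [w = i pi z / (2 m + 1)]: the rescaled squared
    cotangents [c m k] are dominated by [1 / (k + 1) ^ 2] and tend to it. *)
Lemma sine_product z : exists l,
  tends (fun m => \prod_(k < m) (1 - z ^+ 2 / k.+1%:R ^+ 2)) l /\ csin (pi%:C * z) = pi%:C * z * l.
Proof.
pose c m k : R := (pi / m.*2.+1%:R) ^+ 2 * cot2 R m k.
have cE m k : (k < m)%N ->
    cos (pi * k.+1%:R / m.*2.+1%:R) ^+ 2 / k.+1%:R ^+ 2 <= c m k <= 1 / k.+1%:R ^+ 2.
  move=> km; set x : R := pi * k.+1%:R / m.*2.+1%:R; have /cot_bound := @angle_bounds R m k km; rewrite -/x.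
  have k0 : (0 : R) < k.+1%:R ^+ 2 by rewrite exprn_gt0 // ltr0n.
  have -> : c m k = x ^+ 2 * (cos x / sin x) ^+ 2 / k.+1%:R ^+ 2.
    rewrite /c /cot2 -/x; move: ((cos x / sin x) ^+ 2) => y; rewrite /x.
    have : (k.+1%:R : R) != 0 by rewrite pnatr_eq0.
    by move: (k.+1%:R : R) (m.*2.+1%:R^-1 : R) => p q p0; field.
  by move=> /andP[h1 h2]; rewrite !ler_pM2r ?invr_gt0 // h1 h2.
pose B := nm z ^+ 2.
have B0 : 0 <= B by rewrite exprn_ge0 // nm_ge0.
have [l [l1 l2]] : exists l, tends (fun m => \prod_(k < m) (1 + - (z ^+ 2 * (c m k)%:C))) l /\
    tends (fun m => \prod_(k < m) (1 + - (z ^+ 2 / k.+1%:R ^+ 2))) l.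
  apply: (@tannery_prod R (fun m k => - (z ^+ 2 * (c m k)%:C)) (fun k => - (z ^+ 2 / k.+1%:R ^+ 2)) _ _ _ (bsum_inv_sq B0)) => [m k km|k].
    have /andP[h1 h2] := cE _ _ km; rewrite nmN nmM nmX nm_real ger0_norm; last first.
      by apply: le_trans h1; rewrite divr_ge0 ?sqr_ge0.
    by rewrite ler_wpM2l // -[(_ ^+ 2)^-1]mul1r.
  apply: tendsN; apply: tendsZ.
  apply: null_le (null_inv (pi ^+ 2 : R)); exists k.+1 => m km.
  have /andP[h1 h2] := cE _ _ km.
  rewrite -rcn -rmorphXn /= -rcV -rcB nm_real distrC.
  set x : R := pi * k.+1%:R / m.*2.+1%:R in h1.
  have xk : x ^+ 2 / k.+1%:R ^+ 2 <= pi ^+ 2 / m.+1%:R.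
    have -> : x ^+ 2 / k.+1%:R ^+ 2 = pi ^+ 2 / m.*2.+1%:R ^+ 2.
      rewrite /x; have : (k.+1%:R : R) != 0 by rewrite pnatr_eq0.
      have : (m.*2.+1%:R : R) != 0 by rewrite pnatr_eq0.
      by move: (k.+1%:R : R) (m.*2.+1%:R : R) => p q q0 p0; field; rewrite p0 q0.
    rewrite ler_wpM2l ?sqr_ge0 // lef_pV2 ?posrE ?exprn_gt0 ?ltr0n //.
    rewrite -natrX ler_nat expnS expn1 -[X in (X <= _)%N]muln1 leq_mul // ltnS -addnn leq_addr //.
  have cx : 1 - x ^+ 2 <= cos x ^+ 2.
    have := sin_le_norm x; rewrite -ler_sqr ?nnegrE // !real_normK ?num_real //.
    by rewrite cos2sin2; lra.
  have k0 : (0 : R) < (k.+1%:R ^+ 2)^-1 by rewrite invr_gt0 exprn_gt0 // ltr0n.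
  move: h1 h2 xk k0; rewrite mul1r; move: ((k.+1%:R ^+ 2)^-1 : R) (c m k) (pi ^+ 2 / m.+1%:R) => p q r h1 h2 xk k0.
  by rewrite ger0_norm; nra.
exists l; split=> //.
have w2 m : ('i * (pi%:C * z) / m.*2.+1%:R) ^+ 2 = - (z ^+ 2 * ((pi / m.*2.+1%:R) ^+ 2)%:C) :> C.
  rewrite rmorphXn /= rcM rcV rcn; move: (sqr_i R) => i2.
  have -> : ('i * (pi%:C * z) / m.*2.+1%:R) ^+ 2 = 'i ^+ 2 * (z ^+ 2 * (pi%:C / m.*2.+1%:R) ^+ 2) :> C.
    by rewrite !exprMn; ring.
  by rewrite i2 mulN1r.
have tm (u : C) : tends (fun m => (1 + u / m.*2.+1%:R) ^+ m.*2.+1) (cexp u).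
  by apply: (@tends_sub _ _ _ double _ (cexp_power_cvg u)) => n; rewrite -addnn leq_addr.
have T := tendsB (tm ('i * (pi%:C * z))) (tm (- ('i * (pi%:C * z)))).
have T2 := tendsZ (2 * 'i * (pi%:C * z)) l1.
have i2 : (2%:R * 'i : C) != 0.
  by rewrite mulf_neq0 ?pnatr_eq0 // -nm_gt0 /nm normc_def /= expr0n /= expr1n add0r sqrtr1 ltr01.
suff e : cexp ('i * (pi%:C * z)) - cexp (- ('i * (pi%:C * z))) = 2 * 'i * (pi%:C * z) * l.
  by rewrite /csin e -(mulrA (2%:R * 'i)) mulrAC divff // mul1r.
apply: tends_unique T _; apply: tends_eq T2.
have [N hN] := archi_nat (nm ('i * (pi%:C * z))); exists N => m Nm.
have n0 : (m.*2.+1%:R : C) != 0 by rewrite pnatr_eq0.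
rewrite mulNr sine_polynomial; last first.
  have nR : (m.*2.+1%:R : R) != 0 by rewrite pnatr_eq0.
  apply/eqP => /(congr1 (@nm R)); rewrite nmf_div nm1 nm_nat => /(canRL (divfK nR)).
  rewrite mul1r => e; move: hN; rewrite e ltr_nat ltnNge.
  by rewrite (leq_trans Nm) // leqW // -addnn leq_addr.
have -> : 2 * ('i * (pi%:C * z) / m.*2.+1%:R) * m.*2.+1%:R = 2 * 'i * (pi%:C * z).
  by rewrite !mulrA divfK.
congr (_ * _); apply: eq_bigr => k _.
by rewrite w2 /c (rcM (_ ^+ 2)); ring.
Qed.

Lemma poch_pair z n : poch (1 + z) n * poch (1 - z) n
  = n`!%:R ^+ 2 * \prod_(k < n) (1 - z ^+ 2 / k.+1%:R ^+ 2).
Proof.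
elim: n => [|n IH]; first by rewrite !poch0 big_ord0 !mulr1 expr1n.
rewrite !pochS big_ord_recr /= factS natrM.
have -> : poch (1 + z) n * (1 + z + n%:R) * (poch (1 - z) n * (1 - z + n%:R))
   = (poch (1 + z) n * poch (1 - z) n) * ((1 + n%:R) ^+ 2 - z ^+ 2) by ring.
rewrite IH -(natrD _ 1) add1n.
have := natC_neq0 R n; move: (n.+1%:R : C) (n`!%:R : C) (\prod_(k < n) _) => p q r p0.
by field.
Qed.

Lemma reflection z : pi%:C * (rGamma z * rGamma (1 - z)) = csin (pi%:C * z).
Proof.
have [l [hl ->]] := sine_product z; rewrite -mulrA; congr (_ * _).
apply: tends_unique (tendsM (ggam_rGamma z) (ggam_rGamma (1 - z))) _.
have := tendsM (tendsZ z hl) (tends_ratio_nat (1 - z) 1); rewrite mulr1; apply: tends_ext => n.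
rewrite /ggam (pochSl z) (pochS (1 - z)) npowD npowN npow1 -(natrD _ 1) add1n [z + 1]addrC.
have := poch_pair z n; move: (factC_neq0 R n) (natC_neq0 R n) (npow_neq0 n z).
move: (poch _ n) (poch _ n) (n`!%:R : C) (n.+1%:R : C) (npow n z) (\prod_(k < n) _).
move=> p q f g w P f0 g0 w0 e.
transitivity (z * (f ^+ 2 * P) / f ^+ 2 * ((1 - z + n%:R) / g)); first by field; rewrite f0 g0.
by rewrite -e; field; rewrite f0 g0 w0.
Qed.

End Reflection.

Section OrderMore.
Variable R : realType.
Local Notation C := R[i].
Implicit Types (u v : nat -> C) (x : R).

Lemma bigo_eventually u x : (exists (B : R) N, 0 <= B /\ forall n, (N <= n)%N -> nm (u n) <= B * pw n x) -> bigo u x.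
Proof.
move=> [B [N [B0 h]]]; apply: (@bigo_near _ (fun n => (pw n x)%:C)).
  by exists 1; split=> // t n _; rewrite mul1r nm_real ger0_norm.
by exists B, N; split=> // n /h; rewrite nm_real ger0_norm.
Qed.

Lemma bigo_unshift u x : bigo (fun n => u n.+1) x -> bigo u x.
Proof.
move=> [B [B0 h]]; apply: bigo_eventually; exists (B * expR `|x|), 1%N.
split=> [|[//|n] _]; first by rewrite mulr_ge0 ?expR_ge0.
apply: le_trans (h tt n I) _; rewrite -mulrA ler_wpM2l //.
by have [_] := pw_succ n x.
Qed.

Lemma bigo_addV (w : C) : bigo (fun s => (s%:R + w)^-1) (- 1).
Proof.
have [N hN] := archi_nat (2 * nm w + 1).
apply: bigo_eventually; exists 4, N; split=> // n Nn.
rewrite nmV pwN pw1.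
have nN : 2 * nm w + 1 < n%:R by apply: lt_le_trans hN _; rewrite ler_nat.
have := nm_subr_ge n%:R (- w); rewrite opprK nmN nm_nat => h.
have e : (n.+1%:R : R) = n%:R + 1 by rewrite -natr1.
have w0 := nm_ge0 w.
have p0 : 0 < nm (n%:R + w) by lra.
rewrite -[leLHS]mul1r ler_pdivrMr // mulrAC ler_pdivlMr ?ltr0n // e.
by move: h nN p0; move: (nm (n%:R + w)) (n%:R : R) => p q; lra.
Qed.

Lemma npole_addn (z : C) k : (forall m : nat, z != - m%:R) -> forall m : nat, z + k%:R != - m%:R.
Proof.
move=> h m; apply: contraNneq (h (k + m)%N) => e.
by rewrite -(addrK k%:R z) e natrD opprD addrC.
Qed.

Lemma npole_add1 (z : C) : (forall m : nat, z != - m%:R) -> forall m : nat, z + 1 != - m%:R.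
Proof. exact: (@npole_addn z 1). Qed.

Lemma rGamma_sub (z : C) n : rGamma (z - n%:R) = (-1) ^+ n * poch (1 - z) n * rGamma z.
Proof.
rewrite (rGamma_poch (z - n%:R) n) subrK; congr (_ * _).
elim: n => [|n IH]; first by rewrite !poch0 mul1r.
rewrite pochSl.
have -> : z - n.+1%:R + 1 = z - n%:R by rewrite -natr1; ring.
by rewrite IH exprS pochS -natr1; ring.
Qed.

End OrderMore.

(** * Dougall's method for a single pole *)

Section Dougall.
Variable R : realType.
Local Notation C := R[i].
Variables (a1 a2 : C).
Implicit Types (b al X : C).

(** At [X = b - n] this is [n!] times the weight of the inner series, up to a factor free of [n];
    see [EfunE]. Since only [b - n] enters, a unit shift of [b] is a shift of [n]. *)
Definition Efun X : C := rGamma (X - a1) * rGamma (X - a2) * rGamma (1 + a1 + a2 - X).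

(** Equal to [sin (pi (b - a1 - a2)) / pi] by the reflection formula. *)
Definition kap b : C := rGamma (b - a1 - a2) * rGamma (1 - (b - a1 - a2)).

(** The n-th term of the weighted series of differences for the single pole [1 / (z + q)] with
    [q = al + 1 - b]; the two factorials have cancelled. *)
Definition Yterm b al (n : nat) : C := Efun (b - n%:R) / poch (al + 1 - b) n.+1.

(** The same pole [1 / (z + al + 1 - b)], taken at [z = s + b - 1], is [1 / (s + al)]. *)
Definition Lterm b al (s : nat) : C := gterm a1 a2 b s / (s%:R + al).

Definition Dgap b al : C := csum (Yterm b al) - kap b * csum (Lterm b al).

Lemma EfunE b n : Efun (b - n%:R) =
  rGamma (b - a1) * rGamma (b - a2) *
  (poch (1 - b + a1) n * poch (1 - b + a2) n * rGamma (1 - b + a1 + a2 + n%:R)).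
Proof.
rewrite /Efun.
have -> : b - n%:R - a1 = b - a1 - n%:R by ring.
have -> : b - n%:R - a2 = b - a2 - n%:R by ring.
rewrite !rGamma_sub.
have -> : 1 - (b - a1) = 1 - b + a1 by ring.
have -> : 1 - (b - a2) = 1 - b + a2 by ring.
have -> : 1 + a1 + a2 - (b - n%:R) = 1 - b + a1 + a2 + n%:R by ring.
have : (-1) ^+ n * (-1) ^+ n = 1 :> C by rewrite -exprMn mulrNN mulr1 expr1n.
move: ((-1) ^+ n : C) (poch _ n) (poch _ n) (rGamma _) (rGamma _) (rGamma _) => e p q u v w ee.
by rewrite -[RHS]mul1r -ee; ring.
Qed.

Lemma bigo_Efun b : bigo (fun n => Efun (b - n%:R) / n`!%:R) (- complex.Re b).
Proof.
have h := bigoM (bigoM (bigo_poch (1 - b + a1)) (bigo_poch (1 - b + a2))) (bigo_rGamma (1 - b + a1 + a2)).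
have -> : - complex.Re b = complex.Re (1 - b + a1) - 1 + (complex.Re (1 - b + a2) - 1) + (1 - complex.Re (1 - b + a1 + a2)).
  by rewrite !ReD ReN Re_1; ring.
apply: bigo_eq (bigoZ (rGamma (b - a1) * rGamma (b - a2)) h) => n; rewrite EfunE.
move: (factC_neq0 R n); move: (n`!%:R : C) (poch _ n) (poch _ n) (rGamma _) (rGamma _) (rGamma _).
by move=> f p q r u v f0; field.
Qed.

Lemma bigo_Yterm b al : (forall m : nat, al + 1 - b != - m%:R) ->
  bigo (Yterm b al) (- complex.Re al - 1).
Proof.
move=> hb; have hb1 := npole_add1 hb.
have := bigoM (bigo_Efun b) (bigoZ (al + 1 - b)^-1 (bigo_pochV hb1)).
have -> : - complex.Re b + (1 - complex.Re (al + 1 - b + 1)) = - complex.Re al - 1.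
  by rewrite !ReD ReN Re_1; ring.
apply: bigo_eq => n; rewrite /Yterm pochSl.
have := hb 0%N; rewrite oppr0; move: (factC_neq0 R n) (poch_neq0 n hb1).
move: (al + 1 - b) (n`!%:R : C) (poch _ n) (Efun _) => u f p e f0 p0 u0.
by field; rewrite f0 p0 u0.
Qed.

Lemma summable_Yterm b al : (forall m : nat, al + 1 - b != - m%:R) -> 0 < complex.Re al ->
  summable (Yterm b al).
Proof. by move=> h al0; apply: bigo_summable (bigo_Yterm h); lra. Qed.

Lemma bigo_Lterm b al : bigo (Lterm b al) (complex.Re (a1 + a2 - b) - 1 - 1).
Proof. exact: bigoM (bigo_gterm a1 a2 b) (bigo_addV al). Qed.

Lemma summable_Lterm b al : 0 < complex.Re (1 + b - a1 - a2) -> summable (Lterm b al).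
Proof.
move=> h; apply: bigo_summable (bigo_Lterm b al).
by move: h; rewrite !ReD !ReN Re_1; lra.
Qed.

Lemma Re_gt0_shift al (m : nat) : 0 < complex.Re al -> m%:R + al != 0.
Proof.
move=> h; apply/eqP => /(congr1 (@complex.Re R)); rewrite ReD Re_nat => e.
by have := ler0n R m; move: e => /=; lra.
Qed.

(** A certificate in the style of Gosper: the combination of the terms for [al] and [al + 1] is the
    difference of an explicit sequence, so the sums satisfy a first order relation with a closed
    inhomogeneous term. *)
Lemma Yterm_telescope b al N : (forall m : nat, al + 1 - b != - m%:R) ->
  al * (al + 1 - b) * \sum_(n < N) Yterm b al n
  - (al + 1 - a1) * (al + 1 - a2) * \sum_(n < N) Yterm b (al + 1) n
  = (a1 + a2 - b) * Efun b - Efun (b - N%:R) * (a1 + a2 - b + N%:R) / poch (al + 1 - b + 1) N.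
Proof.
move=> hb; have hb1 := npole_add1 hb.
elim: N => [|N IH].
  by rewrite !big_ord0 !mulr0 subr0 poch0 divr1 subr0 addr0 mulrC subrr.
rewrite !big_ord_recr /=.
move: IH; move: (\sum_(n < N) Yterm b al n) (\sum_(n < N) Yterm b (al + 1) n) => S1 S2 IH.
transitivity ((al * (al + 1 - b) * S1 - (al + 1 - a1) * (al + 1 - a2) * S2)
  + (al * (al + 1 - b) * Yterm b al N - (al + 1 - a1) * (al + 1 - a2) * Yterm b (al + 1) N)); first ring.
rewrite IH.
have EE : Efun (b - N.+1%:R) * (a1 + a2 - b + N.+1%:R)
    = Efun (b - N%:R) * (b - N.+1%:R - a1) * (b - N.+1%:R - a2).
  rewrite /Efun.
  have -> : 1 + a1 + a2 - (b - N.+1%:R) = 1 + a1 + a2 - (b - N%:R) + 1 by rewrite -natr1; ring.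
  rewrite (rGamma_rec (b - N.+1%:R - a1)) (rGamma_rec (b - N.+1%:R - a2)) (rGamma_rec (1 + a1 + a2 - (b - N%:R))).
  have -> : b - N.+1%:R - a1 + 1 = b - N%:R - a1 by rewrite -natr1; ring.
  have -> : b - N.+1%:R - a2 + 1 = b - N%:R - a2 by rewrite -natr1; ring.
  by rewrite -natr1; ring.
rewrite EE /Yterm (pochSl (al + 1 - b)) (pochS (al + 1 - b + 1)).
have -> : al + 1 + 1 - b = al + 1 - b + 1 by ring.
rewrite (pochS (al + 1 - b + 1)).
have n0 : al + 1 - b + 1 + N%:R != 0 by rewrite addr_eq0 hb1.
have := hb 0%N; rewrite oppr0 => u0; move: (poch_neq0 N hb1) n0 u0.
rewrite -natr1; move: (N%:R : C) (poch _ N) (Efun (b - _)) (Efun b) => n p e e' p0 n0 u0.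
by field; rewrite p0 u0 n0.
Qed.

Lemma Y_contiguous b al : (forall m : nat, al + 1 - b != - m%:R) -> 0 < complex.Re al ->
  al * (al + 1 - b) * csum (Yterm b al) - (al + 1 - a1) * (al + 1 - a2) * csum (Yterm b (al + 1))
  = (a1 + a2 - b) * Efun b.
Proof.
move=> hb al0; have hb1 := npole_add1 hb.
have hb' (m : nat) : al + 1 + 1 - b != - m%:R by rewrite addrAC hb1.
have al1 : 0 < complex.Re (al + 1) by rewrite ReD Re_1; lra.
have t1 := summable_has_sum (summable_Yterm hb al0).
have t2 := summable_has_sum (summable_Yterm hb' al1).
apply: tends_unique (tendsB (tendsZ _ t1) (tendsZ _ t2)) _.
apply: tends_ext (fun N => esym (Yterm_telescope N hb)) _.
rewrite -[X in tends _ X]subr0; apply: tendsB (tends_cst _) _.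
have h : bigo (fun n => Efun (b - n%:R) / n`!%:R * (n%:R + (a1 + a2 - b)) * (n`!%:R / poch (al + 1 - b + 1) n)) (- complex.Re b + 1 + (1 - complex.Re (al + 1 - b + 1))).
  apply: bigoM (bigo_pochV hb1); apply: bigoM (bigo_Efun b) _.
  apply: bigOD (bigo_nat R) _.
  by apply: bigo_le (@bigO_cst _ unit (fun=> True) (fun=> a1 + a2 - b) (nm (a1 + a2 - b)) _).
apply: (bigo_tends0 _ (bigo_eq _ h)); last first.
  move=> n; move: (factC_neq0 R n) (poch_neq0 n hb1); move: (n`!%:R : C) (poch _ n) (Efun _) => f p e f0 p0.
  by field; rewrite f0 p0.
by rewrite !ReD ReN Re_1; lra.
Qed.

Lemma Lterm_telescope b al S : 0 < complex.Re al ->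
  al * (al + 1 - b) * \sum_(s < S) Lterm b al s
  - (al + 1 - a1) * (al + 1 - a2) * \sum_(s < S) Lterm b (al + 1) s
  = S%:R * gterm a1 a2 b S * (al + 1 - b) / (S%:R + al)
    - (b - a1) * (b - a2) * \sum_(s < S) gterm a1 a2 (b + 1) s.
Proof.
move=> al0; elim: S => [|S IH]; first by rewrite !big_ord0 !mulr0 !mul0r.
rewrite !big_ord_recr /=.
move: IH; move: (\sum_(s < S) Lterm b al s) (\sum_(s < S) Lterm b (al + 1) s) => S1 S2 IH.
transitivity ((al * (al + 1 - b) * S1 - (al + 1 - a1) * (al + 1 - a2) * S2)
  + (al * (al + 1 - b) * Lterm b al S - (al + 1 - a1) * (al + 1 - a2) * Lterm b (al + 1) S)); first ring.
rewrite IH gterm_succ /Lterm gterm_shift.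
have h0 := Re_gt0_shift S al0; have h1 := Re_gt0_shift S.+1 al0.
rewrite -natr1 in h1 *.
have {}h1 : S%:R + (al + 1) != 0 by rewrite addrA addrAC.
have -> : S%:R + 1 + al = S%:R + (al + 1) by ring.
move: h0 h1; move: (S%:R : C) (gterm a1 a2 (b + 1) S) (\sum_(s < S) _) => s g x h0 h1.
have {}h1 : s + al + 1 != 0 by rewrite -addrA.
by field; rewrite h0 ?h1 //= addrA h1.
Qed.

Lemma L_contiguous b al : 0 < complex.Re al -> 0 < complex.Re (1 + b - a1 - a2) ->
  al * (al + 1 - b) * csum (Lterm b al) - (al + 1 - a1) * (al + 1 - a2) * csum (Lterm b (al + 1))
  = - ((b - a1) * (b - a2) * csum (gterm a1 a2 (b + 1))).
Proof.
move=> al0 d0.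
have g0 : 0 < complex.Re (b + 1 - a1 - a2) by move: d0; rewrite !ReD; lra.
have t1 := summable_has_sum (summable_Lterm al d0).
have t2 := summable_has_sum (summable_Lterm (al + 1) d0).
have t3 := summable_has_sum (summable_gterm g0).
apply: tends_unique (tendsB (tendsZ _ t1) (tendsZ _ t2)) _.
apply: tends_ext (fun N => esym (Lterm_telescope b N al0)) _.
rewrite -[X in tends _ X]sub0r; apply: tendsB (tendsZ _ t3).
have h := bigoZ (al + 1 - b) (bigoM (bigoM (bigo_nat R) (bigo_gterm a1 a2 b)) (bigo_addV al)).
apply: (bigo_tends0 _ (bigo_eq _ h)) => [|n]; last by ring.
by move: d0; rewrite !ReD !ReN Re_1; lra.
Qed.

(** Gauss' theorem makes the inhomogeneous terms of the recurrences of the two series proportional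
    with ratio [kap b]; hence they cancel in [Dgap]. *)
Lemma kap_gauss b : 0 < complex.Re (1 + b - a1 - a2) ->
  kap b * ((b - a1) * (b - a2) * csum (gterm a1 a2 (b + 1))) = (b - a1 - a2) * Efun b.
Proof.
move=> d0; have g0 : 0 < complex.Re (b + 1 - a1 - a2) by move: d0; rewrite !ReD; lra.
have := gauss_sum g0.
rewrite /kap /Efun (rGamma_rec (b - a1 - a2)) (rGamma_rec (b - a1)) (rGamma_rec (b - a2)).
have -> : b - a1 - a2 + 1 = b + 1 - a1 - a2 by ring.
have -> : b - a1 + 1 = b + 1 - a1 by ring.
have -> : b - a2 + 1 = b + 1 - a2 by ring.
have -> : 1 - (b - a1 - a2) = 1 + a1 + a2 - b by ring.
move: (rGamma _) (csum _) (rGamma _) (rGamma _) (rGamma _) => g1 S g2 g3 g4 e.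
transitivity ((b - a1 - a2) * (b - a1) * (b - a2) * g1 * (g4 * S)); first ring.
by rewrite e; ring.
Qed.

Lemma Dgap_rec b al : (forall m : nat, al + 1 - b != - m%:R) -> 0 < complex.Re al ->
  0 < complex.Re (1 + b - a1 - a2) ->
  al * (al + 1 - b) * Dgap b al = (al + 1 - a1) * (al + 1 - a2) * Dgap b (al + 1).
Proof.
move=> hb al0 d0; apply/eqP; rewrite -subr_eq0; apply/eqP.
have e1 := Y_contiguous hb al0; have e2 := L_contiguous al0 d0; have e3 := kap_gauss d0.
rewrite /Dgap; transitivity ((a1 + a2 - b) * Efun b + (b - a1 - a2) * Efun b); last ring.
rewrite -e1 -e3 -[(b - a1) * _ * _]opprK -e2; ring.
Qed.

Lemma Dgap_iter b al N : (forall m : nat, al + 1 - b != - m%:R) -> 0 < complex.Re al ->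
  0 < complex.Re (1 + b - a1 - a2) ->
  poch al N * poch (al + 1 - b) N * Dgap b al
  = poch (al + 1 - a1) N * poch (al + 1 - a2) N * Dgap b (al + N%:R).
Proof.
move=> hb al0 d0; elim: N => [|N IH]; first by rewrite !poch0 !mul1r addr0.
have hbN (m : nat) : al + N%:R + 1 - b != - m%:R.
  have -> : al + N%:R + 1 - b = al + 1 - b + N%:R by ring.
  exact: npole_addn.
have alN : 0 < complex.Re (al + N%:R) by rewrite ReD Re_nat; have := ler0n R N; lra.
have := Dgap_rec hbN alN d0; rewrite !pochS -natr1 [al + (_ + 1)]addrA.
move: IH; move: (Dgap b al) (Dgap b (al + N%:R)) (Dgap b (al + N%:R + 1)).
move: (poch al N) (poch (al + 1 - b) N) (poch (al + 1 - a1) N) (poch (al + 1 - a2) N).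
move=> p q r s x y z IH e.
transitivity ((al + N%:R) * (al + 1 - b + N%:R) * (p * q * x)); first ring.
rewrite IH; transitivity (r * s * ((al + N%:R) * (al + N%:R + 1 - b) * y)); first ring.
by rewrite e; ring.
Qed.

End Dougall.

(** * The limit of large [al] and the evaluation for a single pole *)

Section DougallLimit.
Variable R : realType.
Local Notation C := R[i].
Variables (a1 a2 : C).
Implicit Types (b al x z d : C).

Lemma Re_gt0_npole z : 0 < complex.Re z -> forall m : nat, z != - m%:R.
Proof. by move=> z0 m; have := Re_gt0_shift m z0; rewrite addrC addr_eq0. Qed.

(** Gauss' theorem with second upper parameter [al] and lower parameter [al + 1], where
    [(al)_s / Gamma(al + 1 + s)] collapses to [1 / (Gamma(al) (al + s))]. It is the partial fraction
    expansion of the Beta function. *)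
Lemma beta_sum x al : 0 < complex.Re (1 - x) -> (forall m : nat, al != - m%:R) ->
  csum (fun s => poch x s / s`!%:R / (s%:R + al)) = rGamma (al + 1 - x) / (rGamma (1 - x) * rGamma al).
Proof.
move=> x0 al0; have g0 : 0 < complex.Re (al + 1 - x - al) by rewrite addrAC [al + 1]addrC addrK.
have := gauss_sum g0.
have -> : al + 1 - x - al = 1 - x by ring.
have -> : al + 1 - al = 1 by ring.
rewrite rGamma1 mulr1 => e.
have ra : rGamma al != 0 by apply: rGamma_neq0.
have rx : rGamma (1 - x) != 0 by apply: rGamma_neq0; apply: Re_gt0_npole.
have E s : poch x s / s`!%:R / (s%:R + al) = (rGamma al)^-1 * gterm x al (al + 1) s.
  have s0 : s%:R + al != 0 by rewrite addrC addr_eq0.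
  have := rGamma_poch al s.+1; rewrite pochS -natr1 [al + (_ + 1)]addrA addrAC /gterm => h.
  move: ra; rewrite h; rewrite [al + s%:R]addrC in h *; move=> ra.
  have [[p0 _] r0] : (poch al s != 0 /\ True) /\ rGamma (al + 1 + s%:R) != 0.
    by move: ra; rewrite !mulf_eq0 !negb_or => /andP[/andP[-> _] ->].
  by move: s0 p0 r0 (factC_neq0 R s); move: (s%:R + al) (poch al s) (rGamma _) (s`!%:R : C) (poch x s) => *; field; apply/and4P.
rewrite (eq_csum E) csumZ; last exact: summable_gterm.
by rewrite -e; move: rx ra; move: (rGamma _) (rGamma _) (csum _) => *; field; apply/andP.
Qed.

Lemma qgam_eventually z : exists (B : R) N, 0 <= B /\ forall n, (N <= n)%N ->
  nm (qgam n z - 1) <= B / n.+1%:R /\ 1/2 <= nm (qgam n z) <= 2.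
Proof.
have [C0 [N [C00 h]]] := qgam_near1 (nm_ge0 z); have [N' hN'] := archi_nat (2 * C0).
exists C0, (maxn N N'); split=> // n; rewrite geq_max => /andP[Nn N'n].
have hn := h n z Nn (lexx _); split=> //.
have c12 : C0 / n.+1%:R <= 1/2.
  rewrite ler_pdivrMr ?ltr0n //.
  have : (N'%:R : R) <= n.+1%:R by rewrite ler_nat leqW.
  by move: (n.+1%:R : R) => k; lra.
have := nm_tri 1 (qgam n z) 0; have := nm_tri (qgam n z) 1 0; rewrite !subr0 nm1 (nmB 1).
by move: hn c12; move: (C0 / n.+1%:R) => q; lra.
Qed.

Lemma poch_qgam z n : qgam n z != 0 -> poch z n.+1 = rGamma z * (n`!%:R * npow n z) / qgam n z.
Proof.
move=> q0; have := rGamma_poch z n.+1; rewrite rGamma_qgam => ->.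
move: q0 (factC_neq0 R n) (npow_neq0 n z).
by move: (qgam n z) (n`!%:R : C) (npow n z) (poch _ _) => *; field; apply/and3P.
Qed.

Lemma beta_ratio d al :
  tends (fun N => npow N d * (rGamma (al + d + N.+1%:R) / rGamma (al + N.+1%:R))) 1.
Proof.
have := tendsM (tends_qgam (al + d)) (tendsV (oner_neq0 _) (tends_qgam al)).
rewrite invr1 mulr1; apply: tends_eq.
have [B [N [_ h]]] := qgam_eventually al; exists N => n /h[_ /andP[h1 h2]].
have q0 : qgam n al != 0 by rewrite -nm_gt0; lra.
rewrite !rGamma_qgam npowD; move: q0 (factC_neq0 R n) (npow_neq0 n al) (npow_neq0 n d).
move: (npow n al) (npow n d) (n`!%:R : C) (qgam n (al + d)) (qgam n al) => p q f u w.
by move=> w0 f0 p0 q0; field; rewrite ?w0 ?f0 ?p0 ?q0.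
Qed.

(* Both sequences are equivalent to a multiple of [n ^ (- d)], with relative errors [O(1 / n)]. *)
Lemma gterm_comparison b : let d := 1 + b - a1 - a2 in 0 < complex.Re (1 - d) ->
  bigo (fun s => gterm a1 a2 b s - rGamma a1 * rGamma a2 / rGamma (1 - d) * (poch (1 - d) s / s`!%:R))
       (- complex.Re d - 1).
Proof.
move=> d d0; apply: bigo_unshift; apply: bigo_eventually.
have rd : rGamma (1 - d) != 0 by apply: rGamma_neq0; apply: Re_gt0_npole.
have [B1 [N1 [B10 h1]]] := qgam_eventually a1.
have [B2 [N2 [B20 h2]]] := qgam_eventually a2.
have [B3 [N3 [B30 h3]]] := qgam_eventually b.
have [B4 [N4 [B40 h4]]] := qgam_eventually (1 - d).
pose B := B1 + B2 + B3 + B4.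
exists (nm (rGamma a1 * rGamma a2) * (16 * B)), (maxn (maxn N1 N2) (maxn N3 N4)).
split=> [|n]; first by rewrite mulr_ge0 ?nm_ge0 // mulr_ge0 // !addr_ge0.
rewrite !geq_max => /andP[/andP[/h1[q1 /andP[l1 u1]] /h2[q2 /andP[l2 u2]]] /andP[/h3[q3 /andP[l3 u3]] /h4[q4 /andP[l4 u4]]]].
have half_neq0 (w : C) : 1/2 <= nm w -> w != 0.
  by move=> hw; rewrite -nm_gt0; apply: lt_le_trans hw; rewrite divr_gt0.
have n1 := half_neq0 _ l1; have n2 := half_neq0 _ l2; have n4 := half_neq0 _ l4.
rewrite /gterm !poch_qgam // rGamma_qgam factS natrM.
have pe : npow n a1 * npow n a2 / npow n b = npow n (1 - d).
  by rewrite -npowN -!npowD; congr npow; rewrite /d; ring.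
set q := (X in nm X <= _).
have -> : q = rGamma a1 * rGamma a2 * (npow n (1 - d) / n.+1%:R) *
    ((qgam n b * qgam n (1 - d) - qgam n a1 * qgam n a2) / (qgam n a1 * qgam n a2 * qgam n (1 - d))).
  rewrite /q -pe; move: n1 n2 n4 rd (factC_neq0 R n) (natC_neq0 R n) (npow_neq0 n a1) (npow_neq0 n a2) (npow_neq0 n b).
  move: (qgam n a1) (qgam n a2) (qgam n (1 - d)) (qgam n b) (rGamma (1 - d)) (rGamma a1) (rGamma a2).
  move: (npow n a1) (npow n a2) (npow n b) (n`!%:R : C) (n.+1%:R : C).
  move=> p1 p2 p3 f g q1' q2' q3' q4' r1 r2 r3 e1 e2 e3 e4 e5 e6 e7 e8 e9.
  by field; rewrite e1 e2 e3 e4 e5 e6 e9.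
rewrite -mulrA nmM -[leRHS]mulrA ler_wpM2l ?nm_ge0 // nmM.
have -> : nm (npow n (1 - d) / n.+1%:R) = pw n (- complex.Re d).
  by rewrite nmf_div nm_nat nm_npow ReD ReN Re_1 pwD pw1 mulrC mulKf ?pnatr_eq0.
have -> : 16 * B * pw n (- complex.Re d - 1) = pw n (- complex.Re d) * (16 * B / n.+1%:R).
  by rewrite pwD (pwN n 1) pw1 mulrCA -mulrA.
rewrite ler_wpM2l // {q} nmf_div (nmM (qgam n a1 * qgam n a2)) (nmM (qgam n a1) (qgam n a2)).
have i0 : 0 < n.+1%:R^-1 :> R by rewrite invr_gt0 ltr0n.
set e : R := n.+1%:R^-1 in q1 q2 q3 q4 i0 *.
have num : nm (qgam n b * qgam n (1 - d) - qgam n a1 * qgam n a2) <= 2 * B * e.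
  have -> : qgam n b * qgam n (1 - d) - qgam n a1 * qgam n a2
     = (qgam n b - 1) * qgam n (1 - d) + (qgam n (1 - d) - 1) + - ((qgam n a1 - 1) * qgam n a2) + - (qgam n a2 - 1) by ring.
  have -> : 2 * B * e = 2 * B3 * e + 2 * B4 * e + 2 * B1 * e + 2 * B2 * e by rewrite /B; ring.
  have m2 : forall (u v : C) (K : R), 0 <= K -> nm u <= K * e -> nm v <= 2 -> nm (u * v) <= 2 * K * e.
    by move=> u v K K0 hu hv; rewrite nmM -mulrA mulrC; apply: ler_pM; rewrite ?nm_ge0.
  have m1 : forall (u : C) (K : R), 0 <= K -> nm u <= K * e -> nm u <= 2 * K * e.
    by move=> u K K0 hu; apply: le_trans hu _; rewrite ler_pM2r // ler_peMl // ler1n.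
  apply: nmD_le; last by rewrite nmN; apply: m1.
  apply: nmD_le; last by rewrite nmN; apply: m2.
  by apply: nmD_le; [apply: m2 | apply: m1].
have den : 1/8 <= nm (qgam n a1) * nm (qgam n a2) * nm (qgam n (1 - d)).
  have -> : 1/8 = 1/2 * (1/2) * (1/2) :> R by field.
  by apply: ler_pM => //; apply: ler_pM.
rewrite ler_pdivrMr; last by apply: lt_le_trans den; rewrite divr_gt0.
apply: le_trans num _; rewrite -/e.
have BE : 0 <= B * e by rewrite mulr_ge0 ?(ltW i0) // !addr_ge0.
have fin (D x : R) : 1/8 <= D -> 0 <= x -> 2 * x <= 16 * x * D.
  move=> hD hx; have -> : 16 * x * D = 2 * x * (8 * D) by ring.
  by rewrite ler_peMr ?mulr_ge0 // -ler_pdivrMl // mulrC.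
by have := fin _ _ den BE; rewrite !mulrA.
Qed.

Lemma csum_dominated_shift (u : nat -> C) al (x : R) : x < -1 -> bigo u x -> 0 < complex.Re al ->
  exists B : R, 0 <= B /\ forall N, summable (fun s => u s / (s%:R + (al + N.+1%:R))) /\
    nm (csum (fun s => u s / (s%:R + (al + N.+1%:R)))) <= B / N.+1%:R.
Proof.
move=> x1 hu al0; have [M hM] := bigo_summable x1 hu.
have M0 : 0 <= M by have := hM 0%N; rewrite big_ord0.
exists M; split=> // N.
have n0 : (0 : R) < N.+1%:R by rewrite ltr0n.
have b : bsum (fun s => nm (u s / (s%:R + (al + N.+1%:R)))) (M / N.+1%:R).
  move=> n; rewrite ler_pdivlMr // mulr_suml; apply: le_trans (hM n); apply: ler_sum => s _.
  have : N.+1%:R <= nm (s%:R + (al + N.+1%:R)).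
    apply: le_trans (le_trans (ler_norm _) (Re_le_nm _)).
    by rewrite !ReD !Re_nat; have := ler0n R s; lra.
  move=> h; rewrite nmf_div mulrAC ler_pdivrMr; last by apply: lt_le_trans h.
  by rewrite ler_wpM2l ?nm_ge0.
by split; [exists (M / N.+1%:R) | apply: csum_le].
Qed.

Lemma Y_shift_bound b al : 0 < complex.Re al ->
  exists (B : R) N0, 0 <= B /\ forall N, (N0 <= N)%N ->
    nm (csum (Yterm a1 a2 b (al + N.+1%:R))) <= B / N.+1%:R.
Proof.
move=> al0; pose be := al + 1 - b.
(* Large enough for two purposes: the exponent [1 - Re b - x0] of the majorant is below [-1], and
   [Re be + N + 1] is at least [(N + 1) / 2]. *)
have [N0 hN0] := archi_nat (2 * `|complex.Re be| + 2 + `|complex.Re b|).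
pose x0 := complex.Re be + N0%:R.
have := ler_norm (complex.Re b); have := ler_norm (- complex.Re b).
have := ler_norm (complex.Re be); have := ler_norm (- complex.Re be); rewrite !normrN => i1 i2 i3 i4.
have x01 : 2 - complex.Re b < x0 /\ 0 < x0 by rewrite /x0; lra.
have px0 : forall m : nat, x0%:C != - m%:R by apply: Re_gt0_npole => /=; case: x01.
have h := bigoM (bigo_Efun a1 a2 b) (bigo_pochV px0).
have [|M hM] := bigo_summable _ h; first by rewrite /=; lra.
have M0 : 0 <= M by have := hM 0%N; rewrite big_ord0.
exists (2 * M), N0; split=> [|N NN]; first lra.
apply: csum_le => n.
have n0 : (0 : R) < N.+1%:R by rewrite ltr0n.
have NR : (N0%:R : R) <= N%:R by rewrite ler_nat.
rewrite mulrAC; apply: (@le_trans _ _ (\sum_(i < n) 2 / N.+1%:R * nm (Efun a1 a2 (b - i%:R) / i`!%:R * (i`!%:R / poch x0%:C i)))); last first.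
  by rewrite -mulr_sumr ler_wpM2l ?divr_ge0 // hM.
apply: ler_sum => i _; rewrite /Yterm.
have -> : al + N.+1%:R + 1 - b = be + N.+1%:R by rewrite /be; ring.
rewrite pochSl nmf_div nmM invfM.
have -> : Efun a1 a2 (b - i%:R) / i`!%:R * (i`!%:R / poch x0%:C i) = Efun a1 a2 (b - i%:R) / poch x0%:C i.
  have := factC_neq0 R i; have := poch_neq0 i px0.
  by move: (i`!%:R : C) (poch _ _) (Efun _ _ _) => *; field; apply/andP.
rewrite nmf_div [leRHS]mulrCA ler_wpM2l ?nm_ge0 //.
have N1 : (N.+1%:R : R) = N%:R + 1 by rewrite -natr1.
have reb : complex.Re (be + N.+1%:R) = complex.Re be + N%:R + 1 by rewrite ReD Re_nat N1 addrA.
apply: ler_pM; rewrite ?invr_ge0 ?nm_ge0 //.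
  have : N.+1%:R / 2 <= nm (be + N.+1%:R).
    apply: le_trans (le_trans (ler_norm _) (Re_le_nm _)).
    by rewrite reb N1; lra.
  move=> hh; rewrite -[2]invrK -invfM mulrC lef_pV2 ?posrE ?divr_gt0 //.
  by apply: lt_le_trans hh; rewrite divr_gt0.
have -> : nm (poch x0%:C i) = \prod_(j < i) (x0 + j%:R).
  rewrite /poch nm_prod; apply: eq_bigr => j _.
  by rewrite -rcn -rcD nm_real ger0_norm // addr_ge0 //; lra.
have ge : \prod_(j < i) (x0 + j%:R) <= nm (poch (be + N.+1%:R + 1) i).
  apply: nm_poch_ge_Re; first lra.
  by rewrite ReD reb Re_1 /x0; lra.
have p0 : 0 < \prod_(j < i) (x0 + j%:R).
  by apply: prodr_gt0 => j _; rewrite ltr_wpDr //; lra.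
by rewrite lef_pV2 ?posrE // (lt_le_trans p0).
Qed.

(** With [d = 1 + b - a1 - a2], the sum of [Yterm] and the remainder left by [gterm_comparison] are
    [O(1 / N)], negligible against [N ^ (- d)] because [Re d < 1]. The comparison sequence itself
    sums to a Beta quotient, equivalent to a multiple of [N ^ (- d)]. *)
Lemma Dgap_limit b al : 0 < complex.Re al -> 0 < complex.Re (1 + b - a1 - a2) < 1 ->
  tends (fun N => npow N (1 + b - a1 - a2) * Dgap a1 a2 b (al + N.+1%:R)) (rGamma a1 * rGamma a2).
Proof.
move=> al0 /andP[d0 d1]; set d := 1 + b - a1 - a2 in d0 d1 *.
have d1' : 0 < complex.Re (1 - d) by rewrite ReD ReN Re_1; lra.
have rd : rGamma d != 0 by apply: rGamma_neq0; apply: Re_gt0_npole.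
have rd1 : rGamma (1 - d) != 0 by apply: rGamma_neq0; apply: Re_gt0_npole.
pose r := rGamma a1 * rGamma a2 / rGamma (1 - d).
pose df s := gterm a1 a2 b s - r * (poch (1 - d) s / s`!%:R).
have [B1 [B10 hB1]] : exists B : R, 0 <= B /\ forall N, summable (fun s => df s / (s%:R + (al + N.+1%:R))) /\
    nm (csum (fun s => df s / (s%:R + (al + N.+1%:R)))) <= B / N.+1%:R.
  apply: (csum_dominated_shift _ (gterm_comparison d1')) => //.
  by rewrite -/d; lra.
have [B2 [N2 [B20 hB2]]] := Y_shift_bound b al0.
have pwn : null (fun N => pw N (complex.Re d - 1)) by apply: pw_null; lra.
have small u (B : R) : 0 <= B -> (exists N0, forall N, (N0 <= N)%N -> nm (u N) <= B / N.+1%:R) ->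
    tends (fun N => npow N d * u N) 0.
  move=> B0 [N0 h]; apply: tends0; apply: null_le (nullZ B0 pwn); exists N0 => N /h hN.
  by rewrite nmM nm_npow pwD pwN pw1 mulrCA ler_wpM2l.
have t1 := small _ _ B20 (ex_intro _ N2 hB2).
have t2 := small (fun N => csum (fun s => df s / (s%:R + (al + N.+1%:R)))) _ B10 (ex_intro _ 0%N (fun N _ => (hB1 N).2)).
have t3 := beta_ratio d al.
have t := tendsB (tendsB t1 (tendsZ (kap a1 a2 b) t2)) (tendsZ (kap a1 a2 b * r / rGamma d) t3).
have e : kap a1 a2 b * r / rGamma d = - (rGamma a1 * rGamma a2).
  rewrite /kap /r.
  have -> : b - a1 - a2 = d - 1 by rewrite /d; ring.
  rewrite (rGamma_rec (d - 1)) subrK.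
  have e1 : rGamma (1 - d) = (1 - d) * rGamma (1 - (d - 1)).
    by rewrite rGamma_rec; congr (_ * rGamma _); ring.
  move: rd1; rewrite e1 mulf_eq0 negb_or => /andP[x0 y0].
  move: rd x0 y0; move: (rGamma (1 - (d - 1))) (rGamma d) (rGamma a1) (rGamma a2) => u v w z v0 x0 y0.
  clear -v0 x0 y0; clearbody d.
  by field; rewrite v0 y0 x0.
move: t; rewrite e !sub0r mulr0 oppr0 mulr1 opprK add0r; apply: tends_ext => N.
have aN0 : 0 < complex.Re (al + N.+1%:R) by rewrite ReD Re_nat; have := ltr0Sn R N; lra.
have sl : summable (fun s => poch (1 - d) s / s`!%:R / (s%:R + (al + N.+1%:R))).
  have hh := bigoM (bigo_poch (1 - d)) (bigo_addV (al + N.+1%:R)).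
  by apply: bigo_summable hh; rewrite ReD ReN Re_1; lra.
have L : csum (Lterm a1 a2 b (al + N.+1%:R)) = csum (fun s => df s / (s%:R + (al + N.+1%:R)))
    + r * (rGamma (al + d + N.+1%:R) / (rGamma d * rGamma (al + N.+1%:R))).
  have -> : rGamma (al + d + N.+1%:R) / (rGamma d * rGamma (al + N.+1%:R))
      = csum (fun s => poch (1 - d) s / s`!%:R / (s%:R + (al + N.+1%:R))).
    rewrite beta_sum //; [|by have -> : 1 - (1 - d) = d by ring|exact: Re_gt0_npole].
    have -> : 1 - (1 - d) = d by ring.
    by congr (rGamma _ / _); ring.
  rewrite -csumZ // -csumD; [|exact: (hB1 N).1|exact: summableZ].
  apply: eq_csum => s; rewrite /Lterm /df.
  by move: ((s%:R + _)^-1) => q; ring.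
rewrite /Dgap L.
have ra : rGamma (al + N.+1%:R) != 0 by apply: rGamma_neq0; apply: Re_gt0_npole.
have e' : kap a1 a2 b * r = - (rGamma a1 * rGamma a2) * rGamma d by rewrite -e divfK.
move: e' ra rd; move: (csum _) (csum _) (npow N d) (rGamma (al + d + _)) (rGamma (al + _)) (rGamma d) (kap a1 a2 b).
move=> c1 c2 p u v w k e' v0 w0.
rewrite mulrBr mulrDr [X in _ = p * c2 - X](_ : _ = k * (p * c1) + (k * r) * (p * (u / (w * v)))); last by ring.
by rewrite e'; field; rewrite v0 w0.
Qed.

(* Both sides satisfy the same first order recurrence [al -> al + 1] and have the same
   asymptotics as [al] grows. *)
Lemma dougall_strip b al : (forall m : nat, al + 1 - b != - m%:R) -> 0 < complex.Re al ->
  0 < complex.Re (1 + b - a1 - a2) < 1 ->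
  Dgap a1 a2 b al * (rGamma al * rGamma (al + 1 - b))
  = rGamma a1 * rGamma a2 * rGamma (al + 1 - a1) * rGamma (al + 1 - a2).
Proof.
move=> hb al0 dd; have d0 : 0 < complex.Re (1 + b - a1 - a2) by case/andP: dd.
have t := Dgap_limit al0 dd.
have tn := tendsM (tends_qgam al) (tends_qgam (al + 1 - b)).
have td := tendsM (tends_qgam (al + 1 - a1)) (tends_qgam (al + 1 - a2)).
rewrite mulr1 in tn td.
have tq := tendsM tn (tendsV (oner_neq0 _) td); rewrite invr1 mulr1 in tq.
have tk := tendsZ (rGamma (al + 1 - a1) * rGamma (al + 1 - a2)) (tendsM t tq).
apply: tends_unique (tends_cst _) _.
have -> : rGamma a1 * rGamma a2 * rGamma (al + 1 - a1) * rGamma (al + 1 - a2)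
   = rGamma (al + 1 - a1) * rGamma (al + 1 - a2) * (rGamma a1 * rGamma a2 * 1) by ring.
apply: tends_eq tk.
have [B1 [N1 [_ h1]]] := qgam_eventually (al + 1 - a1).
have [B2 [N2 [_ h2]]] := qgam_eventually (al + 1 - a2).
exists (maxn N1 N2) => N; rewrite geq_max => /andP[/h1[_ /andP[q1 _]] /h2[_ /andP[q2 _]]].
have half_neq0 (w : C) : 1/2 <= nm w -> w != 0.
  by move=> hw; rewrite -nm_gt0; apply: lt_le_trans hw; rewrite divr_gt0.
have n1 := half_neq0 _ q1; have n2 := half_neq0 _ q2.
rewrite (rGamma_poch al N.+1) (rGamma_poch (al + 1 - b) N.+1).
have -> : Dgap a1 a2 b al * (poch al N.+1 * rGamma (al + N.+1%:R) * (poch (al + 1 - b) N.+1 * rGamma (al + 1 - b + N.+1%:R)))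
  = poch al N.+1 * poch (al + 1 - b) N.+1 * Dgap a1 a2 b al * (rGamma (al + N.+1%:R) * rGamma (al + 1 - b + N.+1%:R)) by ring.
rewrite Dgap_iter // (rGamma_poch (al + 1 - a1) N.+1) (rGamma_poch (al + 1 - a2) N.+1) !rGamma_qgam.
have -> : npow N (1 + b - a1 - a2) = npow N (al + 1 - a1) * npow N (al + 1 - a2) / (npow N al * npow N (al + 1 - b)).
  by rewrite -npowD -npowD -npowN -npowD; congr npow; ring.
move: n1 n2 (factC_neq0 R N) (npow_neq0 N (al + 1 - a1)) (npow_neq0 N (al + 1 - a2)) (npow_neq0 N al) (npow_neq0 N (al + 1 - b)).
move: (qgam N (al + 1 - a1)) (qgam N (al + 1 - a2)) (qgam N al) (qgam N (al + 1 - b)) (N`!%:R : C).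
move: (npow N (al + 1 - a1)) (npow N (al + 1 - a2)) (npow N al) (npow N (al + 1 - b)) (Dgap _ _ _ _) (poch _ _) (poch _ _).
move=> p1 p2 p3 p4 D r s w1 w2 w3 w4 f e1 e2 e3 e4 e5 e6 e7.
by field; rewrite e1 e2 e3 e4 e5 e6 e7.
Qed.

Lemma kap_gauss0 b : 0 < complex.Re (b - a1 - a2) ->
  kap a1 a2 b * csum (gterm a1 a2 b) = Efun a1 a2 b.
Proof.
move=> g0; rewrite /kap mulrAC gauss_sum // /Efun.
by have -> : 1 - (b - a1 - a2) = 1 + a1 + a2 - b by ring.
Qed.

Lemma kap_pred b : b - 1 - a1 - a2 != 0 -> kap a1 a2 (b - 1) = - kap a1 a2 b.
Proof.
move=> x0; rewrite /kap (rGamma_rec (b - 1 - a1 - a2)) (rGamma_rec (1 - (b - a1 - a2))).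
have -> : b - 1 - a1 - a2 + 1 = b - a1 - a2 by ring.
have -> : 1 - (b - a1 - a2) + 1 = 1 - (b - 1 - a1 - a2) by ring.
by ring.
Qed.

(* One term of the Newton expansion of [1 / (s + al)] is exchanged for a unit shift of [b]. *)
Lemma Dgap_newton b al : (forall m : nat, al + 1 - b != - m%:R) -> 0 < complex.Re al ->
  0 < complex.Re (b - a1 - a2) -> b - 1 - a1 - a2 != 0 ->
  (al + 1 - b) * Dgap a1 a2 b al = Dgap a1 a2 (b - 1) al.
Proof.
move=> hb al0 g0 x0.
have u0 : al + 1 - b != 0 by have := hb 0%N; rewrite oppr0.
have d0 : 0 < complex.Re (1 + b - a1 - a2) by move: g0; rewrite !ReD Re_1; lra.
have Y : csum (Yterm a1 a2 b al) = (Efun a1 a2 b + csum (Yterm a1 a2 (b - 1) al)) / (al + 1 - b).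
  have sY := summable_Yterm a1 a2 hb al0.
  have E n : Yterm a1 a2 b al n.+1 = (al + 1 - b)^-1 * Yterm a1 a2 (b - 1) al n.
    rewrite /Yterm pochSl.
    have -> : al + 1 - (b - 1) = al + 1 - b + 1 by ring.
    have -> : b - 1 - n%:R = b - n.+1%:R by rewrite -natr1; ring.
    by rewrite invfM mulrCA.
  have sY' : summable (Yterm a1 a2 (b - 1) al).
    apply: summable_Yterm => //.
    have -> : al + 1 - (b - 1) = al + 1 - b + 1 by ring.
    exact: npole_add1.
  rewrite csum_recl // (eq_csum E) csumZ // /Yterm subr0 poch1.
  by rewrite mulrDl [_^-1 * _]mulrC.
have L : csum (Lterm a1 a2 (b - 1) al) = csum (gterm a1 a2 b) - (al + 1 - b) * csum (Lterm a1 a2 b al).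
  have sL := summable_Lterm al d0.
  rewrite -mulNr -csumZ // -csumD; [|exact: summable_gterm|exact: summableZ].
  apply: eq_csum => s; rewrite /Lterm (gterm_shift _ _ (b - 1)) subrK.
  move: (Re_gt0_shift s al0); move: (s%:R : C) (gterm _ _ _ _) => t g t0.
  by field.
rewrite /Dgap Y L kap_pred // -(kap_gauss0 g0).
by move: (csum _) (csum _) (csum _) (kap _ _ _) => *; field.
Qed.

(** [M] Newton steps lead back to the strip. The real part of [1 + b - a1 - a2] is never an integer
    on the way, so [b - 1 - a1 - a2] does not vanish. *)
Lemma dougall_sum b al (M : nat) : (forall m : nat, al + 1 - b != - m%:R) -> 0 < complex.Re al ->
  M%:R < complex.Re (1 + b - a1 - a2) < M.+1%:R ->
  Dgap a1 a2 b al * (rGamma al * rGamma (al + 1 - b))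
  = rGamma a1 * rGamma a2 * rGamma (al + 1 - a1) * rGamma (al + 1 - a2).
Proof.
elim: M b => [|M IH] b hb al0 hM; first exact: dougall_strip.
have e : complex.Re (1 + (b - 1) - a1 - a2) = complex.Re (1 + b - a1 - a2) - 1.
  by rewrite !ReD !ReN Re_1; ring.
have e2 : complex.Re (b - a1 - a2) = complex.Re (1 + b - a1 - a2) - 1.
  by rewrite !ReD !ReN Re_1; ring.
have e3 : complex.Re (b - 1 - a1 - a2) = complex.Re (1 + b - a1 - a2) - 2.
  by rewrite !ReD !ReN Re_1; ring.
have M0 := ler0n R M.
move: hM; rewrite -(natr1 M.+1) -(natr1 M) => /andP[h1 h2].
have g0 : 0 < complex.Re (b - a1 - a2) by rewrite e2; lra.
have hb' : forall m : nat, al + 1 - (b - 1) != - m%:R.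
  have -> : al + 1 - (b - 1) = al + 1 - b + 1 by ring.
  exact: npole_add1.
have x0 : b - 1 - a1 - a2 != 0.
  apply/eqP => x0; move: e3; rewrite x0 /= => e3.
  case: M {IH} M0 h1 h2 => [|M] M0 h1 h2; first by lra.
  by have := ler0n R M; rewrite -natr1 in h1; lra.
rewrite -(IH (b - 1)) //; last by rewrite e -(natr1 M); apply/andP; split; lra.
rewrite -Dgap_newton // (rGamma_rec (al + 1 - b)).
have -> : al + 1 - (b - 1) = al + 1 - b + 1 by ring.
by ring.
Qed.

End DougallLimit.

(** * Partial fractions of Gamma quotients *)

Section Separation.
Variable R : realType.
Local Notation C := R[i].
Implicit Types (z w : C).

Lemma npole_separation w : (forall n : nat, w != - n%:R) ->
  exists d : R, 0 < d /\ forall n : nat, d <= nm (w + n%:R).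
Proof.
move=> hw; have [B [B0 h]] := bigo_addV w.
have B1 : 0 < B + 1 by lra.
exists (B + 1)^-1; split=> [|n]; first by rewrite invr_gt0.
have n0 : 0 < nm (w + n%:R) by rewrite nm_gt0 addr_eq0.
rewrite -[leRHS]invrK lef_pV2 ?posrE ?invr_gt0 // -nmV [w + _]addrC.
apply: le_trans (h tt n I) _; apply: (@le_trans _ _ B); last by rewrite lerDl.
by rewrite ler_piMr // pw_le1 // oppr_le0.
Qed.

Lemma nonint_separation w : (forall n : int, w != n%:~R) ->
  exists d : R, 0 < d /\ forall n n' : nat, d <= nm (w + n%:R - n'%:R).
Proof.
move=> hw.
have [d1 [d10 h1]] : exists d : R, 0 < d /\ forall n : nat, d <= nm (w + n%:R).
  by apply: npole_separation => n; have := hw (- n%:Z); rewrite mulrNz.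
have [d2 [d20 h2]] : exists d : R, 0 < d /\ forall n : nat, d <= nm (- w + n%:R).
  by apply: npole_separation => n; rewrite eqr_opp; have := hw n%:Z.
exists (Num.min d1 d2); split=> [|n n']; first by rewrite lt_min d10.
rewrite ge_min; have [nn|nn] := leqP n' n.
  by rewrite -addrA -natrB // h1.
by rewrite -nmN opprB addrC opprD addrAC -addrA -natrB ?h2 ?orbT // ltnW.
Qed.

Lemma summableM_bounded (u v : nat -> C) (B : R) : summable u -> (forall n, nm (v n) <= B) ->
  summable (fun n => u n * v n).
Proof.
move=> [M hM] hB; exists (M * B) => n.
have B0 : 0 <= B by apply: le_trans (hB 0%N); apply: nm_ge0.
apply: (@le_trans _ _ ((\sum_(i < n) nm (u i)) * B)); last by rewrite ler_wpM2r.
by rewrite mulr_suml; apply: ler_sum => i _; rewrite nmM ler_wpM2l ?nm_ge0.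
Qed.

(** The second bound serves all denominators that keep the distance [d] from [0], hence is uniform
    in the point of evaluation. *)
Lemma summable_div (u v : nat -> C) (d : R) : 0 < d -> summable u -> (forall n, d <= nm (v n)) ->
  summable (fun n => u n / v n) /\ exists M : R, forall w : nat -> C, (forall n, d <= nm (w n)) -> nm (csum (fun n => u n / w n)) <= M.
Proof.
move=> d0 su hv.
have inv (w : nat -> C) n : d <= nm (w n) -> nm (w n)^-1 <= d^-1.
  by move=> hw; rewrite nmV lef_pV2 ?posrE // (lt_le_trans d0).
split; first by apply: (summableM_bounded su) => n; apply: inv.
have [M hM] := su; exists (M * d^-1) => w hw; apply: csum_le => n.
apply: (@le_trans _ _ ((\sum_(i < n) nm (u i)) * d^-1)); last first.
  by rewrite ler_wpM2r ?invr_ge0 ?(ltW d0).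
by rewrite mulr_suml; apply: ler_sum => i _; rewrite nmM ler_wpM2l ?nm_ge0 ?inv.
Qed.

Lemma fubini_product (u v : nat -> C) (K : nat -> nat -> C) (B : R) :
  summable u -> summable v -> (forall i j, nm (K i j) <= B) ->
  exists M : R, forall m n, \sum_(i < m) \sum_(j < n) nm (u i * v j * K i j) <= M.
Proof.
move=> [Mu hu] [Mv hv] hB.
have B0 : 0 <= B by apply: le_trans (hB 0%N 0%N); apply: nm_ge0.
have Mv0 : 0 <= Mv by have := hv 0%N; rewrite big_ord0.
exists (Mu * (Mv * B)) => m n.
apply: (@le_trans _ _ ((\sum_(i < m) nm (u i)) * ((\sum_(j < n) nm (v j)) * B))); last first.
  apply: ler_pM => //; rewrite ?mulr_ge0 ?sumr_ge0 //; try by move=> *; apply: nm_ge0.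
  by rewrite ler_wpM2r.
rewrite mulr_suml; apply: ler_sum => i _; rewrite mulr_suml mulr_sumr; apply: ler_sum => j _.
by rewrite !nmM -mulrA ler_wpM2l ?nm_ge0 // ler_wpM2l ?nm_ge0.
Qed.

End Separation.

Section PartialFractions.
Variable R : realType.
Local Notation C := R[i].
Variables (al be : nat -> C).
Implicit Types (z : C) (i j m : nat).

Definition hq i z : C := rGamma (z + be i) / rGamma (z + al i).

(** The residue of [hq i] at [- (al i + l)], with [rGamma (be i - al i - l)] expanded by
    [rGamma_sub]; the two signs [(-1) ^ l] cancel. *)
Definition rres i l : C := poch (1 - be i + al i) l / l`!%:R * rGamma (be i - al i).

(** The residue of the product of the first [m] quotients at [- (al i + l)], where the quotients
    other than the i-th are regular. *)
Definition pfcoef m i l : C := rres i l * \prod_(j < m | (j : nat) != i) hq j (- (al i + l%:R)).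

Lemma summable_rres i : 1 < complex.Re (be i - al i) -> summable (rres i).
Proof.
move=> h; have hh := bigoZ (rGamma (be i - al i)) (bigo_poch (1 - be i + al i)).
have hh2 : bigo (rres i) (complex.Re (1 - be i + al i) - 1).
  by apply: bigo_eq hh => l; rewrite mulrC.
by apply: bigo_summable hh2; move: h; rewrite !ReD !ReN Re_1; lra.
Qed.

(** This is [beta_sum] at [z + al i] with [x = 1 - be i + al i]. *)
Lemma hq_expansion i z : 1 < complex.Re (be i - al i) -> (forall n : nat, z + al i != - n%:R) ->
  hq i z = csum (fun l => rres i l / (z + al i + l%:R)).
Proof.
move=> h hz.
have x0 : 0 < complex.Re (1 - (1 - be i + al i)).
  by move: h; rewrite !ReD !ReN !ReD ReN Re_1; lra.
have := beta_sum x0 hz.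
have -> : z + al i + 1 - (1 - be i + al i) = z + be i by ring.
have e1 : 1 - (1 - be i + al i) = be i - al i by ring.
rewrite e1 in x0 *.
have r0 : rGamma (be i - al i) != 0 by apply: rGamma_neq0; apply: Re_gt0_npole.
move=> e; rewrite /hq.
have -> : rGamma (z + be i) / rGamma (z + al i) = rGamma (be i - al i) *
   csum (fun s => poch (1 - be i + al i) s / s`!%:R / (s%:R + (z + al i))).
  rewrite e; have := rGamma_neq0 hz; move: r0; move: (rGamma _) (rGamma _) (rGamma _) => *.
  by field; apply/andP.
rewrite -csumZ; last first.
  have hh := bigoM (bigo_poch (1 - be i + al i)) (bigo_addV (z + al i)).
  by apply: bigo_summable hh; move: h; rewrite !ReD !ReN Re_1; lra.
apply: eq_csum => l; rewrite /rres [z + al i + _]addrC.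
by move: (_^-1) => q; ring.
Qed.

Variable m0 : nat.
Hypothesis al_sep : forall i j, (i < m0)%N -> (j < m0)%N -> i != j -> forall n : int, al i - al j != n%:~R.
Hypothesis be_al : forall i, (i < m0)%N -> 1 < complex.Re (be i - al i).

Lemma residue_point i j : (i < m0)%N -> (j < m0)%N -> i != j ->
  forall l n : nat, - (al i + l%:R) + al j != - n%:R.
Proof.
move=> im jm ij l n; have := al_sep im jm ij (n%:Z - l%:Z).
apply: contra_neq => e; rewrite mulrzBr -!pmulrn.
have -> : al i = al j + n%:R - l%:R; last by ring.
by rewrite -[n%:R]opprK -e; ring.
Qed.

Lemma hq_residue_bounded i j : (i < m0)%N -> (j < m0)%N -> i != j ->
  exists B : R, forall l : nat, nm (hq j (- (al i + l%:R))) <= B.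
Proof.
move=> im jm ij; have ji : j != i by rewrite eq_sym.
have [d [d0 hd]] := nonint_separation (al_sep jm im ji).
have [_ [M hM]] := @summable_div _ (rres j) (fun=> d%:C) d d0 (summable_rres (be_al jm)) (fun n => ltac:(by rewrite nm_real gtr0_norm)).
exists M => l; rewrite (hq_expansion (be_al jm) (residue_point im jm ij l)).
apply: hM => n; have := hd n l; congr (_ <= nm _); ring.
Qed.

Lemma pfcoef_recr i l m : (i < m)%N -> pfcoef m.+1 i l = pfcoef m i l * hq m (- (al i + l%:R)).
Proof.
move=> im; rewrite /pfcoef big_mkcond big_ord_recr -big_mkcond /= gtn_eqF // mulrA.
congr (_ * _ * _); apply: eq_bigl => j; rewrite eq_sym; congr (~~ _); exact: eq_sym.
Qed.

Lemma pfcoef_last l m : pfcoef m.+1 m l = rres m l * \prod_(j < m) hq j (- (al m + l%:R)).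
Proof.
rewrite /pfcoef big_mkcond big_ord_recr /= eqxx /= mulr1; congr (_ * _).
by apply: eq_bigr => j _; rewrite ltn_eqF.
Qed.

(* Each product [1 / ((z + x) (z + y))] is split by the resolvent identity; resummed over the old
   poles, the coefficients at the new poles are given by the induction hypothesis. *)
Lemma partial_fractions m : (0 < m <= m0)%N ->
  (forall i, (i < m)%N -> summable (pfcoef m i)) /\
  forall z, (forall i, (i < m)%N -> forall n : nat, z + al i != - n%:R) ->
    \prod_(i < m) hq i z = \sum_(i < m) csum (fun l => pfcoef m i l / (z + al i + l%:R)).
Proof.
elim: m => // -[|m] IH /= mm.
  have e l : pfcoef 1 0 l = rres 0 l by rewrite pfcoef_last big_ord0 mulr1.
  split=> [i|z hz].
    by rewrite ltnS leqn0 => /eqP ->; apply: eq_summable (fun l => esym (e l)) _; apply: summable_rres; apply: be_al.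
  rewrite !big_ord1 (hq_expansion _ (hz 0%N _)) //; last exact: be_al.
  by apply: eq_csum => l; rewrite e.
have [sIH eIH] := IH (ltnW mm); set k := m.+1 in sIH eIH mm *.
have km : (k < m0)%N by [].
have lt i : (i < k)%N -> (i < m0)%N by move=> ik; apply: ltn_trans km.
have ne i : (i < k)%N -> i != k by move=> ik; rewrite ltn_eqF.
have sk : summable (pfcoef k.+1 k).
  have hi (i : 'I_k) : exists M : R, forall l : nat, nm (csum (fun l' => pfcoef k i l' / (- (al k + l%:R) + al i + l'%:R))) <= M.
    have ik := ltn_ord i.
    have [d [d0 hd]] := nonint_separation (al_sep (lt _ ik) km (ne _ ik)).
    have [_ [M hM]] := @summable_div _ (pfcoef k i) (fun=> d%:C) d d0 (sIH _ ik) (fun n => ltac:(by rewrite nm_real gtr0_norm)).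
    exists M => l; apply: hM => n; have := hd n l; congr (_ <= nm _); ring.
  pose B := fun i : 'I_k => sval (cid (hi i)).
  have hB (i : 'I_k) : forall l : nat, nm (csum (fun l' => pfcoef k i l' / (- (al k + l%:R) + al i + l'%:R))) <= B i by exact: (svalP (cid (hi i))).
  apply: (eq_summable (fun l => esym (pfcoef_last l k))).
  apply: (@summableM_bounded _ _ _ (\sum_(i < k) B i)); first exact: summable_rres (be_al km).
  move=> l; rewrite eIH; last by move=> i ik n; apply: residue_point => //; [exact: lt | rewrite eq_sym ne].
  by apply: le_trans (nm_sum _ _ _) _; apply: ler_sum => i _; apply: hB.
have si i : (i < k)%N -> summable (pfcoef k.+1 i).
  move=> ik; have [B hB] := hq_residue_bounded (lt _ ik) km (ne _ ik).
  apply: (eq_summable (fun l => esym (pfcoef_recr l ik))).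
  exact: summableM_bounded (sIH _ ik) hB.
split=> [i|z hz].
  by rewrite ltnS leq_eqVlt => /orP[/eqP ->|/si].
have zk n : z + al k + n%:R != 0 by rewrite addr_eq0 hz.
have hzk := hz k (ltnSn k).
rewrite big_ord_recr /= eIH; last by move=> i ik; apply: hz; apply: ltnW.
rewrite [RHS]big_ord_recr /= mulr_suml.
have [dz [dz0 hdz]] := npole_separation hzk.
have step (i : 'I_k) :
  [/\ csum (fun l => pfcoef k i l / (z + al i + l%:R)) * hq k z
    = csum (fun l => pfcoef k.+1 i l / (z + al i + l%:R))
    + csum (fun l' => rres k l' / (z + al k + l'%:R) * csum (fun l => pfcoef k i l / (- (al k + l'%:R) + al i + l%:R)))
    & summable (fun l' => rres k l' / (z + al k + l'%:R) * csum (fun l => pfcoef k i l / (- (al k + l'%:R) + al i + l%:R)))].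
  have ik := ltn_ord i.
  have zi := hz i (ltnW ik).
  have [di [di0 hdi]] := npole_separation zi.
  have [d [d0 hd]] := nonint_separation (al_sep (lt _ ik) km (ne _ ik)).
  have pk : forall l : nat, - (al i + l%:R) + al k + 0 = - (al i + l%:R) + al k by move=> l; rewrite addr0.
  have sepn l l' : - (al k + l'%:R) + al i + l%:R != 0.
    rewrite -nm_gt0; apply: lt_le_trans d0 _; have := hd l l'; congr (_ <= nm _); ring.
  have expand l : hq k z / (z + al i + l%:R) = hq k (- (al i + l%:R)) / (z + al i + l%:R)
      + csum (fun l' => rres k l' * ((z + al k + l'%:R) * (- (al k + l'%:R) + al i + l%:R))^-1).
    have rp := residue_point (lt _ ik) km (ne _ ik) l.
    have zl : z + al i + l%:R != 0 by rewrite addr_eq0 zi.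
    rewrite (hq_expansion (be_al km) hzk) (hq_expansion (be_al km) rp).
    have s1 : summable (fun l' => rres k l' / (- (al i + l%:R) + al k + l'%:R)).
      have [d' [d'0 hd']] := npole_separation rp.
      by have [] := summable_div d'0 (summable_rres (be_al km)) hd'.
    have s2 : summable (fun l' => rres k l' / (z + al k + l'%:R)).
      by have [] := summable_div dz0 (summable_rres (be_al km)) hdz.
    apply/eqP; rewrite [X in _ == X]addrC -subr_eq -mulrBl; apply/eqP.
    rewrite -[- csum _]mulN1r -csumZ // -csumD //; last exact: summableZ.
    rewrite mulrC -csumZ; last by apply: summableD => //; exact: summableZ.
    apply: eq_csum => l'; have := sepn l l'; have := zk l'.
    have -> : - (al i + l%:R) + al k + l'%:R = - (- (al k + l'%:R) + al i + l%:R) by ring.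
    have -> : z + al i + l%:R = (z + al k + l'%:R) + (- (al k + l'%:R) + al i + l%:R) by ring.
    have : (z + al k + l'%:R) + (- (al k + l'%:R) + al i + l%:R) != 0.
      by have -> : (z + al k + l'%:R) + (- (al k + l'%:R) + al i + l%:R) = z + al i + l%:R by ring.
    move: (z + al k + l'%:R) (- (al k + l'%:R) + al i + l%:R) (rres k l') => x y r xy0 x0 y0.
    by field; rewrite x0 y0 xy0.
  have Kb l l' : nm ((z + al k + l'%:R) * (- (al k + l'%:R) + al i + l%:R))^-1 <= (dz * d)^-1.
    rewrite nmV nmM lef_pV2 ?posrE ?mulr_gt0 ?nm_gt0 //; apply: ler_pM; rewrite ?(ltW dz0) ?(ltW d0) //.
    by have := hd l l'; congr (_ <= nm _); ring.
  have [M hM] := fubini_product (sIH _ ik) (summable_rres (be_al km)) Kb.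
  have inner l' : csum (fun l => pfcoef k i l * rres k l' * ((z + al k + l'%:R) * (- (al k + l'%:R) + al i + l%:R))^-1)
     = rres k l' / (z + al k + l'%:R) * csum (fun l => pfcoef k i l / (- (al k + l'%:R) + al i + l%:R)).
    rewrite -csumZ.
      by apply: eq_csum => l; rewrite invfM; move: (_^-1) (_^-1) => x y; ring.
    have hs : forall l : nat, d <= nm (- (al k + l'%:R) + al i + l%:R).
      by move=> l; have := hd l l'; congr (_ <= nm _); ring.
    by have [] := summable_div d0 (sIH _ ik) hs.
  split; last first.
    apply: (eq_summable inner).
    have hM' : forall n n', \sum_(j < n) \sum_(l < n') nm (pfcoef k i l * rres k j * ((z + al k + j%:R) * (- (al k + j%:R) + al i + l%:R))^-1) <= M.
      by move=> n n'; rewrite exchange_big /=; apply: hM.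
    by have [_ _] := @double_summable _ (fun j l => pfcoef k i l * rres k j * ((z + al k + j%:R) * (- (al k + j%:R) + al i + l%:R))^-1) _ hM'.
  rewrite mulrC -csumZ; last by have [] := summable_div di0 (sIH _ ik) hdi.
  rewrite -(eq_csum inner) -(@fubini_csum _ (fun l l' => pfcoef k i l * rres k l' * ((z + al k + l'%:R) * (- (al k + l'%:R) + al i + l%:R))^-1) M hM) -csumD; first last.
  - by have [_ _] := @double_summable _ (fun l l' => pfcoef k i l * rres k l' * ((z + al k + l'%:R) * (- (al k + l'%:R) + al i + l%:R))^-1) M hM.
  - by have [] := summable_div di0 (si _ ik) hdi.
  apply: eq_csum => l; rewrite pfcoef_recr //.
  have -> : hq k z * (pfcoef k i l / (z + al i + l%:R)) = pfcoef k i l * (hq k z / (z + al i + l%:R)) by rewrite mulrCA.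
  rewrite expand mulrDr mulrA; congr (_ + _).
  rewrite -csumZ; first by apply: eq_csum => l'; rewrite mulrA.
  by apply: (summableM_bounded (summable_rres (be_al km))) => l'; apply: Kb.
rewrite (eq_bigr (fun i : 'I_k => csum (fun l => pfcoef k.+1 i l / (z + al i + l%:R))
    + csum (fun l' => rres k l' / (z + al k + l'%:R) * csum (fun l => pfcoef k i l / (- (al k + l'%:R) + al i + l%:R))))); last first.
  by move=> i _; case: (step i).
rewrite big_split /=; congr (_ + _).
rewrite -csum_sum; last by move=> i _; have [] := step i.
rewrite /=; apply: eq_csum => l'; rewrite -mulr_sumr -eIH; last first.
  by move=> i ik n; apply: residue_point => //; [exact: lt | rewrite eq_sym ne].
by rewrite pfcoef_last mulrAC.
Qed.

End PartialFractions.

(** * The identity in the generic region *)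

Section FiniteDifferences.
Variable R : realType.
Local Notation C := R[i].
Implicit Types (c : nat -> C) (q z : C).

Lemma nm_addn z (n : nat) : 0 <= complex.Re z -> nm z <= nm (z + n%:R).
Proof.
move=> z0; rewrite /nm !normc_def /= ReD Re_nat ImD Im_nat addr0.
have n0 : (0 : R) <= n%:R by [].
rewrite ler_wsqrtr // lerD2r lerXn2r ?nnegrE ?addr_ge0 // lerDl; exact: n0.
Qed.

(** A shift to the right increases every factor once the real part is nonnegative. The induction on
    [K] peels off the finitely many factors further left, each compared through its distance to [0].
    Uniformity in [l] and [n] bounds the kernel in the exchange of sums over [n] and over poles. *)
Lemma poch_shift_lower z : (forall m : nat, z != - m%:R) ->
  exists B : R, 0 <= B /\ forall l n, nm (poch z n) <= B * nm (poch (z + l%:R) n).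
Proof.
have [K hK] := archi_nat (- complex.Re z).
elim: K z hK => [|K IH] z hK hz.
  exists 1; split=> // l n; rewrite mul1r /poch !nm_prod; apply: ler_prod => i _.
  rewrite nm_ge0 /= addrAC nm_addn // ReD Re_nat addr_ge0 //.
  by move: hK; rewrite oppr_lt0 => /ltW.
have [|B [B0 hB]] := IH (z + 1) _ (npole_add1 hz).
  by rewrite ReD Re_1; move: hK; rewrite -natr1 opprD ltrBlDr.
have [d [d0 hd]] := npole_separation hz.
exists (1 + nm z * B / d); split; first by rewrite addr_ge0 // mulr_ge0 ?mulr_ge0 ?nm_ge0 ?invr_ge0 // ltW.
have q0 : 0 <= nm z * B / d by rewrite mulr_ge0 ?mulr_ge0 ?nm_ge0 ?invr_ge0 // ltW.
move=> l [|n]; first by rewrite !poch0 nm1 mulr1 lerDl.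
rewrite !pochSl !nmM mulrDl mul1r ler_wpDl ?mulr_ge0 ?nm_ge0 //.
have -> : z + l%:R + 1 = z + 1 + l%:R by ring.
apply: (@le_trans _ _ (nm z * (B * nm (poch (z + 1 + l%:R) n)))).
  by rewrite ler_wpM2l ?nm_ge0.
rewrite !mulrA ler_wpM2r ?nm_ge0 // -mulrA ler_peMr ?mulr_ge0 ?nm_ge0 //.
by rewrite mulrC ler_pdivlMr // mul1r.
Qed.

Definition Dn c n : C := \sum_(j < n.+1) (-1) ^+ j * 'C(n, j)%:R * c j.

Lemma Dn0 c : Dn c 0 = c 0%N.
Proof. by rewrite /Dn big_ord1 bin0 expr0 !mul1r. Qed.

Lemma DnS c n : Dn c n.+1 = Dn c n - Dn (fun j => c j.+1) n.
Proof.
rewrite /Dn big_ord_recl /=.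
have -> : \sum_(i < n.+1) (-1) ^+ bump 0 i * 'C(n.+1, bump 0 i)%:R * c (bump 0 i)
  = \sum_(i < n.+1) (-1) ^+ i.+1 * 'C(n, i.+1)%:R * c i.+1 - \sum_(i < n.+1) (-1) ^+ i * 'C(n, i)%:R * c i.+1.
  rewrite -sumrB; apply: eq_bigr => i _; rewrite /bump /= add1n binS natrD exprS.
  by move: ((-1) ^+ i) => x; ring.
rewrite addrA; congr (_ - _).
transitivity (\sum_(i < n.+2) (-1) ^+ i * 'C(n, i)%:R * c i).
  by rewrite [RHS]big_ord_recl /= !bin0.
by rewrite big_ord_recr /= bin_small // mulr0 mul0r addr0.
Qed.

Lemma eq_Dn c c' n : (forall j, c j = c' j) -> Dn c n = Dn c' n.
Proof. by move=> h; apply: eq_bigr => j _; rewrite h. Qed.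

Lemma Dn_inv q n : (forall m : nat, q != - m%:R) ->
  Dn (fun j => (j%:R + q)^-1) n = n`!%:R / poch q n.+1.
Proof.
elim: n q => [|n IH] q hq; first by rewrite Dn0 add0r poch1 mul1r.
have q0 : q != 0 by have := hq 0%N; rewrite oppr0.
have qn : q + n.+1%:R != 0 by rewrite addr_eq0 hq.
rewrite DnS IH // (@eq_Dn _ (fun j => (j%:R + (q + 1))^-1)); last first.
  by move=> j; rewrite -natr1 -addrA [1 + q]addrC.
rewrite IH; last exact: npole_add1.
have p0 : poch (q + 1) n != 0 by apply: poch_neq0; apply: npole_add1.
rewrite [poch q n.+2]pochSl pochSl [poch (q + 1) n.+1]pochS factS natrM.
have -> : q + 1 + n%:R = q + n.+1%:R by rewrite -natr1; ring.
have -> : (n.+1%:R : C) = (q + n.+1%:R) - q by ring.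
rewrite addrCA subrr addr0.
move: (q + n.+1%:R) (poch _ _) (n`!%:R : C) qn p0 => x y w x0 y0.
by field; rewrite x0 y0 q0.
Qed.

Lemma Dn_sum (I : Type) (r : seq I) (P : pred I) (u : I -> nat -> C) n :
  Dn (fun j => \sum_(i <- r | P i) u i j) n = \sum_(i <- r | P i) Dn (u i) n.
Proof.
rewrite /Dn exchange_big /=; apply: eq_bigr => j _; by rewrite mulr_sumr.
Qed.

Lemma Dn_csum (u : nat -> nat -> C) n : (forall j, summable (u j)) ->
  Dn (fun j => csum (u j)) n = csum (fun l => Dn (fun j => u j l) n).
Proof.
move=> h; rewrite /Dn csum_sum; last by move=> j _; apply: summableZ.
by apply: eq_bigr => j _; rewrite csumZ.
Qed.

Lemma fubini_weighted (u v : nat -> C) (K : nat -> nat -> C) (B : R) :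
  summable u -> summable v -> (forall i j, nm (K i j) <= B) ->
  [/\ summable (fun i => u i * csum (fun j => v j * K i j)),
      summable (fun j => v j * csum (fun i => u i * K i j))
    & csum (fun i => u i * csum (fun j => v j * K i j)) = csum (fun j => v j * csum (fun i => u i * K i j))].
Proof.
move=> su sv hK; have [M hM] := fubini_product su sv hK.
have [N hN] := fubini_product sv su (fun i j => hK j i).
have e1 i : csum (fun j => u i * v j * K i j) = u i * csum (fun j => v j * K i j).
  rewrite -csumZ; first by apply: eq_csum => j; rewrite mulrA.
  by apply: (@summableM_bounded _ _ _ B) => // j.
have e2 j : csum (fun i => u i * v j * K i j) = v j * csum (fun i => u i * K i j).
  rewrite -csumZ; first by apply: eq_csum => i; rewrite mulrA [v j * _]mulrC.
  by apply: (@summableM_bounded _ _ _ B).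
have e3 j : csum (fun i => v j * u i * K i j) = v j * csum (fun i => u i * K i j).
  by rewrite -e2; apply: eq_csum => i; rewrite [u i * _]mulrC.
split.
- apply: (eq_summable e1).
  by have [_ _] := @double_summable _ (fun i j => u i * v j * K i j) M hM.
- apply: (eq_summable e3).
  by have [_ _] := @double_summable _ (fun j i => v j * u i * K i j) N hN.
- by rewrite -(eq_csum e1) -(eq_csum e2) (@fubini_csum _ (fun i j => u i * v j * K i j) M hM).
Qed.

End FiniteDifferences.

(** * The inner series expanded over the poles *)

Section ExpandedSum.
Variable R : realType.
Local Notation C := R[i].
Variables (a1 a2 b : C) (al be : nat -> C) (m M : nat).
Hypothesis m_gt0 : (0 < m)%N.
Hypothesis al_sep : forall i j, (i < m)%N -> (j < m)%N -> i != j -> forall n : int, al i - al j != n%:~R.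
Hypothesis be_al : forall i, (i < m)%N -> 1 < complex.Re (be i - al i).
Hypothesis al_npole : forall i, (i < m)%N -> forall n : nat, al i != - n%:R.
Hypothesis Re_al : forall i, (i < m)%N -> 0 < complex.Re (al i + b - 1).
Hypothesis Re_b : M%:R < complex.Re (1 + b - a1 - a2) < M.+1%:R.

(** The value that [dougall_sum] gives to [Dgap a1 a2 b x]. *)
Definition Om (x : C) : C := rGamma a1 * rGamma a2 * rGamma (x + 1 - a1) * rGamma (x + 1 - a2)
  / (rGamma x * rGamma (x + 1 - b)).

(** The pole at [- (al i + l)] corresponds to the parameter [A i l = al i + b - 1 + l] of
    [dougall_sum], since [A i l + 1 - b = al i + l]. Summed over all poles, the parts with [Lterm]
    restore the product, now at [z = s + b - 1]. *)
Lemma expanded_sum :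
  [/\ summable (fun n => Efun a1 a2 (b - n%:R) / n`!%:R * Dn (fun j => \prod_(i < m) hq al be i j%:R) n),
      forall i, (i < m)%N -> summable (fun l => pfcoef al be m i l * Om (al i + b - 1 + l%:R))
   & csum (fun n => Efun a1 a2 (b - n%:R) / n`!%:R * Dn (fun j => \prod_(i < m) hq al be i j%:R) n)
  = kap a1 a2 b * csum (fun s => gterm a1 a2 b s * \prod_(i < m) hq al be i (s%:R + b - 1))
  + \sum_(i < m) csum (fun l => pfcoef al be m i l * Om (al i + b - 1 + l%:R))].
Proof.
have [spf epf] := partial_fractions al_sep be_al (introT andP (conj m_gt0 (leqnn m))).
have dpos : 0 < complex.Re (1 + b - a1 - a2).
  by case/andP: Re_b => h _; apply: le_lt_trans h.
(* [gterm] itself need not be summable here; a factor [1 / (s + 1)], compensated in the kernel,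
   makes it so. *)
have sg : summable (fun s => gterm a1 a2 b s / s.+1%:R).
  have := summable_Lterm 1 dpos; apply: eq_summable => s; rewrite /Lterm; congr (_ / _); exact: natr1.
pose A i (l : nat) : C := al i + b - 1 + l%:R.
have Re_A i l : (i < m)%N -> 0 < complex.Re (A i l).
  by move=> im; rewrite ReD Re_nat ltr_pwDl // Re_al.
have A_np i l : (i < m)%N -> forall n : nat, A i l + 1 - b != - n%:R.
  move=> im n; have -> : A i l + 1 - b = al i + l%:R by rewrite /A; ring.
  exact: npole_addn _ (al_npole im) n.
have Dexp n : Dn (fun j => \prod_(i < m) hq al be i j%:R) n
  = \sum_(i < m) csum (fun l => pfcoef al be m i l * (n`!%:R / poch (al i + l%:R) n.+1)).
  have e j : \prod_(i < m) hq al be i j%:R = \sum_(i < m) csum (fun l => pfcoef al be m i l / (j%:R + (al i + l%:R))).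
    rewrite epf; last by move=> i im k; rewrite [j%:R + _]addrC; apply: npole_addn _ (al_npole im) _.
    by apply: eq_bigr => i _; apply: eq_csum => l; rewrite addrA.
  rewrite (eq_Dn _ e) Dn_sum; apply: eq_bigr => i _; have im := ltn_ord i.
  rewrite Dn_csum; last first.
    move=> j; have [d [d0 hd]] := npole_separation (npole_addn j (al_npole im)).
    have hd' l : d <= nm (j%:R + (al i + l%:R)) by rewrite addrA [j%:R + _]addrC.
    by have [] := summable_div d0 (spf _ im) hd'.
  apply: eq_csum => l; rewrite -Dn_inv; last exact: npole_addn _ (al_npole im).
  by rewrite /Dn mulr_sumr; apply: eq_bigr => j _; rewrite mulrCA.
(* The terms are normalized by those of the pole with [l = 0]; the kernel
   [(al i)_(n+1) / (al i + l)_(n+1)] that remains is bounded by [poch_shift_lower]. *)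
have Yfub i : (i < m)%N ->
  [/\ summable (fun l => pfcoef al be m i l * csum (Yterm a1 a2 b (A i l))),
      summable (fun n => Efun a1 a2 (b - n%:R) / n`!%:R * csum (fun l => pfcoef al be m i l * (n`!%:R / poch (al i + l%:R) n.+1)))
    & csum (fun n => Efun a1 a2 (b - n%:R) / n`!%:R * csum (fun l => pfcoef al be m i l * (n`!%:R / poch (al i + l%:R) n.+1)))
    = csum (fun l => pfcoef al be m i l * csum (Yterm a1 a2 b (A i l)))].
  move=> im; have [B [B0 hB]] := poch_shift_lower (al_npole im).
  have pn0 n l : poch (al i + l%:R) n != 0 by apply: poch_neq0; exact: npole_addn _ (al_npole im).
  have hK l n : nm (poch (al i) n.+1 / poch (al i + l%:R) n.+1) <= B.
    by rewrite nmf_div ler_pdivrMr ?nm_gt0.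
  have sY : summable (Yterm a1 a2 b (A i 0)) by apply: summable_Yterm; [exact: A_np|exact: Re_A].
  have [f1 f2 f3] := fubini_weighted (spf _ im) sY hK.
  have e1 l : csum (fun n => Yterm a1 a2 b (A i 0%N) n * (poch (al i) n.+1 / poch (al i + l%:R) n.+1)) = csum (Yterm a1 a2 b (A i l)).
    apply: eq_csum => n; rewrite /Yterm.
    have -> : A i l + 1 - b = al i + l%:R by rewrite /A; ring.
    have -> : A i 0%N + 1 - b = al i by rewrite /A; ring.
    by have := pn0 n.+1 0%N; rewrite addr0 => h; rewrite mulrA divfK.
  have e2 n : Yterm a1 a2 b (A i 0%N) n * csum (fun l => pfcoef al be m i l * (poch (al i) n.+1 / poch (al i + l%:R) n.+1))
    = Efun a1 a2 (b - n%:R) / n`!%:R * csum (fun l => pfcoef al be m i l * (n`!%:R / poch (al i + l%:R) n.+1)).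
    have sb : summable (fun l => pfcoef al be m i l * (poch (al i) n.+1 / poch (al i + l%:R) n.+1)).
      by apply: (summableM_bounded (spf _ im)) => l; apply: hK.
    have sb2 : summable (fun l => pfcoef al be m i l * (n`!%:R / poch (al i + l%:R) n.+1)).
      have := summableZ (n`!%:R / poch (al i) n.+1) sb; apply: eq_summable => l.
      have := pn0 n.+1 0%N; rewrite addr0; move: (poch (al i) n.+1) (poch (al i + _) n.+1)^-1 (n`!%:R : C) => x y z x0.
      by field.
    rewrite -!csumZ //; apply: eq_csum => l; rewrite /Yterm.
    have -> : A i 0%N + 1 - b = al i by rewrite /A; ring.
    have := pn0 n.+1 0%N; rewrite addr0; have := factC_neq0 R n.
    move: (poch (al i) n.+1) (poch (al i + _) n.+1)^-1 (n`!%:R : C) (Efun _ _ _) => x y z w z0 x0.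
    by field; apply/andP.
  split.
  - by apply: eq_summable f1 => l; rewrite e1.
  - exact: eq_summable e2 f2.
  - by rewrite -(eq_csum e2) -f3; apply: eq_csum => l; rewrite e1.
have AV i l s : (i < m)%N -> s%:R + A i l != 0 by move=> im; apply: Re_gt0_shift; apply: Re_A.
have Lfub i : (i < m)%N ->
  [/\ summable (fun l => pfcoef al be m i l * csum (Lterm a1 a2 b (A i l))),
      summable (fun s => gterm a1 a2 b s * csum (fun l => pfcoef al be m i l / (s%:R + A i l)))
    & csum (fun l => pfcoef al be m i l * csum (Lterm a1 a2 b (A i l)))
      = csum (fun s => gterm a1 a2 b s * csum (fun l => pfcoef al be m i l / (s%:R + A i l)))].
  move=> im; have [d [d0 hd]] := npole_separation (Re_gt0_npole (Re_A i 0%N im)).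
  have hK l s : nm (s.+1%:R / (s%:R + A i l)) <= 1 + d^-1.
    have -> : s.+1%:R / (s%:R + A i l) = s%:R / (s%:R + A i l) + 1 / (s%:R + A i l).
      by rewrite -mulrDl natr1.
    have Rs : s%:R <= complex.Re (s%:R + A i l) by rewrite ReD Re_nat lerDl ltW // Re_A.
    apply: nmD_le.
      rewrite nmf_div nm_nat ler_pdivrMr ?nm_gt0 ?AV // mul1r.
      by apply: le_trans Rs _; apply: le_trans (ler_norm _) (Re_le_nm _).
    rewrite mul1r nmV lef_pV2 ?posrE ?nm_gt0 ?AV //.
    have := hd (s + l)%N; congr (_ <= nm _); rewrite natrD /A; ring.
  have [f1 f2 f3] := fubini_weighted (spf _ im) sg hK.
  have sn s : (s.+1%:R : C) != 0 by exact: natC_neq0.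
  have e1 l : csum (fun s => gterm a1 a2 b s / s.+1%:R * (s.+1%:R / (s%:R + A i l))) = csum (Lterm a1 a2 b (A i l)).
    by apply: eq_csum => s; rewrite /Lterm mulrA divfK.
  have e2 s : gterm a1 a2 b s / s.+1%:R * csum (fun l => pfcoef al be m i l * (s.+1%:R / (s%:R + A i l)))
    = gterm a1 a2 b s * csum (fun l => pfcoef al be m i l / (s%:R + A i l)).
    have sb : summable (fun l => pfcoef al be m i l * (s.+1%:R / (s%:R + A i l))).
      by apply: (summableM_bounded (spf _ im)) => l; apply: hK.
    have sb2 : summable (fun l => pfcoef al be m i l / (s%:R + A i l)).
      have := summableZ (s.+1%:R^-1) sb; apply: eq_summable => l.
      by move: (_ + A i l)^-1 (s.+1%:R : C) (sn s) => x y y0; field.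
    rewrite -!csumZ //; apply: eq_csum => l.
    by move: (_ + A i l)^-1 (s.+1%:R : C) (sn s) => x y y0; field.
  split.
  - by apply: eq_summable f1 => l; rewrite e1.
  - exact: eq_summable e2 f2.
  - by rewrite -(eq_csum e2) -f3; apply: eq_csum => l; rewrite e1.
have Dgap_Om i l : (i < m)%N -> csum (Yterm a1 a2 b (A i l)) = Om (A i l) + kap a1 a2 b * csum (Lterm a1 a2 b (A i l)).
  move=> im; have := dougall_sum (A_np i l im) (Re_A i l im) Re_b.
  have r1 := rGamma_neq0 (A_np i l im); have r2 := rGamma_neq0 (Re_gt0_npole (Re_A i l im)).
  by rewrite /Om => <-; rewrite mulfK ?mulf_neq0 // /Dgap subrK.
have sOm i : (i < m)%N -> summable (fun l => pfcoef al be m i l * Om (A i l)).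
  move=> im; have [f1 _ _] := Yfub i im; have [g1 _ _] := Lfub i im.
  have := summableD f1 (summableZ (- kap a1 a2 b) g1); apply: eq_summable => l.
  by rewrite Dgap_Om //; ring.
split=> //.
  have : summable (fun n => \sum_(i < m) Efun a1 a2 (b - n%:R) / n`!%:R * csum (fun l => pfcoef al be m i l * (n`!%:R / poch (al i + l%:R) n.+1))).
    by apply: summable_sum => i _; have [] := Yfub i (ltn_ord i).
  by apply: eq_summable => n; rewrite Dexp mulr_sumr.
have -> : csum (fun n => Efun a1 a2 (b - n%:R) / n`!%:R * Dn (fun j => \prod_(i < m) hq al be i j%:R) n)
  = \sum_(i < m) csum (fun l => pfcoef al be m i l * csum (Yterm a1 a2 b (A i l))).
  transitivity (csum (fun n => \sum_(i < m) Efun a1 a2 (b - n%:R) / n`!%:R * csum (fun l => pfcoef al be m i l * (n`!%:R / poch (al i + l%:R) n.+1)))).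
    by apply: eq_csum => n; rewrite Dexp mulr_sumr.
  rewrite csum_sum; last by move=> i _; have [] := Yfub i (ltn_ord i).
  by apply: eq_bigr => i _; have [] := Yfub i (ltn_ord i).
have -> : csum (fun s => gterm a1 a2 b s * \prod_(i < m) hq al be i (s%:R + b - 1))
  = \sum_(i < m) csum (fun l => pfcoef al be m i l * csum (Lterm a1 a2 b (A i l))).
  transitivity (csum (fun s => \sum_(i < m) gterm a1 a2 b s * csum (fun l => pfcoef al be m i l / (s%:R + A i l)))).
    apply: eq_csum => s; rewrite -mulr_sumr epf; last first.
      move=> i im k; have -> : s%:R + b - 1 + al i = A i s by rewrite /A; ring.
      exact: Re_gt0_npole (Re_A _ _ im) _.
    congr (_ * _); apply: eq_bigr => i _; apply: eq_csum => l; congr (_ / _).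
    by rewrite /A; ring.
  rewrite csum_sum; last by move=> i _; have [] := Lfub i (ltn_ord i).
  by apply: eq_bigr => i _; have [] := Lfub i (ltn_ord i).
rewrite mulr_sumr -big_split /=; apply: eq_bigr => i _; have im := ltn_ord i.
have [g1 _ _] := Lfub i im; rewrite -csumZ // -csumD //; [|exact: summableZ|exact: sOm].
by apply: eq_csum => l; rewrite Dgap_Om // mulrDr addrC mulrCA.
Qed.

End ExpandedSum.

(** * Lagrange interpolation and sums of sine quotients *)

Section Lagrange.
Variable F : fieldType.

Lemma prod_bump (T : comPzSemiRingType) n (k : 'I_n.+1) (f : nat -> T) :
  \prod_(j < n.+1 | j != k) f j = \prod_(i < n) f (bump k i).
Proof.
rewrite big_mkcond (bigD1_ord k) //= eqxx mul1r; apply: eq_bigr => i _.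
by rewrite eq_sym neq_lift.
Qed.

(** The difference between [f] and its interpolating polynomial has degree at most [n] and [n + 1]
    roots, so it is zero; then the coefficients of degree [n] are compared. *)
Lemma lagrange_top n (x : nat -> F) (f : {poly F}) :
  (forall i j : 'I_n.+1, i != j -> x i != x j) -> (size f <= n.+1)%N ->
  \sum_(k < n.+1) f.[x k] / (\prod_(j < n.+1 | j != k) (x k - x j)) = f`_n.
Proof.
move=> hx sf.
pose q (k : 'I_n.+1) : {poly F} := \prod_(j < n.+1 | j != k) ('X - (x j)%:P).
pose c (k : 'I_n.+1) := f.[x k] / (\prod_(j < n.+1 | j != k) (x k - x j)).
have sq k : size (q k) = n.+1.
  rewrite /q -big_filter size_prod_XsubC -sum1_size big_filter sum1_card.
  by rewrite (_ : #|_| = #|predC1 k|) ?cardC1 ?card_ord //; apply: eq_card => j.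
have mq k : (q k)`_n = 1.
  by have := monic_prod_XsubC (index_enum 'I_n.+1) (fun j => j != k) x; rewrite monicE lead_coefE sq => /eqP.
pose g := f - \sum_k c k *: q k.
have g0 : g = 0.
  apply/eqP; apply: contraTT (leqnn n.+1) => gn; rewrite -ltnNge.
  have : (size [seq x (nat_of_ord j) | j <- enum 'I_n.+1] < size g)%N.
    apply: max_poly_roots => //; last first.
      by rewrite map_inj_uniq ?enum_uniq // => i j; apply: contra_eq; apply: hx.
    apply/allP => _ /mapP[i _ ->]; rewrite rootE /g hornerD hornerN horner_sum (bigD1 i) //=.
    rewrite [X in _ - (_ + X)]big1; last first.
      move=> j ji; rewrite hornerZ /q (bigD1 i) 1?eq_sym //= hornerM hornerXsubC subrr mul0r mulr0 //.
    rewrite addr0 hornerZ /q horner_prod /c.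
    under [X in _ - _ * X]eq_bigr => j _ do rewrite hornerXsubC.
    rewrite divfK ?subrr //; apply/prodf_neq0 => j ji; rewrite subr_eq0 hx //.
    by rewrite eq_sym.
  rewrite size_map size_enum_ord => /leq_trans; apply.
  rewrite (leq_trans (size_polyD _ _)) // geq_max sf size_polyN (leq_trans (size_sum _ _ _)) //.
  by apply/bigmax_leqP => k _; rewrite (leq_trans (size_scale_leq _ _)) // sq.
have fE : f = \sum_k c k *: q k by apply/eqP; rewrite -subr_eq0 -/g g0.
by rewrite [in RHS]fE coef_sum; apply: eq_bigr => k _; rewrite coefZ mq mulr1.
Qed.

End Lagrange.

Section SineSums.
Variable R : realType.
Local Notation C := R[i].
Implicit Types (u v w z : C) (r : seq C).

Definition sg z : C := rGamma z * rGamma (1 - z).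

Definition eph z : C := cexp ('i * (pi%:C * z)).

Lemma ephD u v : eph (u + v) = eph u * eph v.
Proof. by rewrite /eph !mulrDr cexpD. Qed.

Lemma ephN u : eph (- u) = (eph u)^-1.
Proof. by rewrite /eph !mulrN cexpN. Qed.

Lemma eph_neq0 u : eph u != 0. Proof. exact: cexp_neq0. Qed.

Lemma eph_prod_neq0 r : \prod_(y <- r) eph y != 0.
Proof. by rewrite prodf_seq_neq0; apply/allP => y _; rewrite eph_neq0. Qed.

Definition two_ipi : C := 2%:R * 'i * pi%:C.

Lemma piC_neq0 : (pi%:C : C) != 0.
Proof. by rewrite fmorph_eq0 gt_eqF // pi_gt0. Qed.

Lemma two_ipi_neq0 : two_ipi != 0.
Proof. by rewrite !mulf_neq0 ?piC_neq0 ?neq0Ci // pnatr_eq0. Qed.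

Lemma sgE z : sg z = csin (pi%:C * z) / pi%:C.
Proof. by rewrite -reflection mulrAC divff ?piC_neq0 // mul1r. Qed.

Lemma sg_eph z : sg z = (eph z - (eph z)^-1) / two_ipi.
Proof.
rewrite sgE /csin /eph cexpN -mulrA; congr (_ * _); by rewrite -invfM.
Qed.

(** Up to invertible factors [sin (pi (u - v))] is a difference of squares of [eph]: quotients of
    sines become Lagrange quotients with nodes [exp (2 pi i b_k)]. *)
Lemma sgB u v : sg (u - v) * (two_ipi * eph u) * eph v = eph u ^+ 2 - eph v ^+ 2.
Proof.
rewrite sg_eph ephD ephN; move: two_ipi_neq0 (eph_neq0 u) (eph_neq0 v).
by move: two_ipi (eph u) (eph v) => k x y k0 x0 y0; field; rewrite k0 x0 y0.
Qed.

Lemma sg_neq0 z : (forall n : int, z != n%:~R) -> sg z != 0.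
Proof.
move=> h; rewrite mulf_neq0 // rGamma_neq0 // => m; first by have := h (- m%:Z); rewrite mulrNz.
have := h (m.+1%:Z); apply: contra_neq => e.
by rewrite -pmulrn -natr1 -[z](subKr 1) e opprK addrC.
Qed.

Lemma sg_subn z n : sg (z - n%:R) = (-1) ^+ n * sg z.
Proof.
rewrite /sg rGamma_sub opprB addrA [1 + n%:R - z]addrAC (rGamma_poch (1 - z) n).
by move: (rGamma _) (rGamma _) (poch _ _) ((-1) ^+ n) => *; ring.
Qed.

Lemma sg_prod r u : (\prod_(y <- r) sg (u - y)) * (two_ipi * eph u) ^+ size r * \prod_(y <- r) eph y
  = \prod_(y <- r) (eph u ^+ 2 - eph y ^+ 2).
Proof.
elim: r => [|y r IH]; first by rewrite !big_nil !mulr1.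
rewrite !big_cons -IH -(sgB u y) /= exprS.
by move: (sg _) (\prod_(_ <- _) _) (\prod_(_ <- _) _) (eph y) => *; ring.
Qed.

Variables (n : nat) (b : nat -> C).
Hypothesis b_sep : forall i j : 'I_n.+1, i != j -> sg (b i - b j) != 0.

Lemma eph_sep (i j : 'I_n.+1) : i != j -> eph (b i) ^+ 2 != eph (b j) ^+ 2.
Proof.
by move=> ij; rewrite -subr_eq0 -sgB (mulf_neq0 (mulf_neq0 (b_sep ij) (mulf_neq0 two_ipi_neq0 (eph_neq0 _))) (eph_neq0 _)).
Qed.

(** The last factor carries [eph (b k)] to the power [n - 1 - size r]: it is free of [k] when
    [size r = n - 1], and contributes [eph (b k) ^ (-2)] when [size r = n + 1]. *)
Lemma sg_ratio r (k : 'I_n.+1) :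
  (\prod_(y <- r) sg (b k - y)) / (\prod_(i < n) sg (b k - b (bump k i)))
  = (\prod_(y <- r) (eph (b k) ^+ 2 - eph y ^+ 2)) / (\prod_(j < n.+1 | j != k) (eph (b k) ^+ 2 - eph (b j) ^+ 2))
    * ((two_ipi * eph (b k)) ^+ n * (\prod_(j < n.+1) eph (b j)) / eph (b k)
       / ((two_ipi * eph (b k)) ^+ size r * \prod_(y <- r) eph y)).
Proof.
rewrite -sg_prod.
have := sg_prod [seq b (bump k (nat_of_ord i)) | i <- enum 'I_n] (b k).
rewrite !big_map size_map size_enum_ord.
rewrite -(prod_bump k (fun j => eph (b k) ^+ 2 - eph (b j) ^+ 2)) => <-.
rewrite (bigD1 k) //= (prod_bump k (fun j => eph (b j))).
have h1 := eph_prod_neq0 r.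
have h2 : \prod_(i < n) eph (b (bump k i)) != 0 by apply/prodf_neq0 => y _; apply: eph_neq0.
have h3 : \prod_(i < n) sg (b k - b (bump k i)) != 0.
  by apply/prodf_neq0 => i _; have := @b_sep k (lift k i) (neq_lift _ _).
have h4 : two_ipi * eph (b k) != 0 by rewrite mulf_neq0 ?two_ipi_neq0 ?eph_neq0.
have := expf_neq0 n h4; have := expf_neq0 (size r) h4; move: (eph_neq0 (b k)).
move: h1 h2 h3; move: (\prod_(y <- r) eph y) (\prod_(i < n) eph (b (bump k i))) (\prod_(i < n) sg _) (\prod_(y <- r) sg _).
move: (eph (b k)) ((two_ipi * eph (b k)) ^+ n) ((two_ipi * eph (b k)) ^+ size r) => z3 z1 z2 z4 z5 z6 z7 z40 z50 z60 z30 z20 z10.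
by field; rewrite z40 z50 z60 z30 z20 z10.
Qed.

(** The interpolated polynomial has degree [n - 1], so its coefficient of degree [n] is zero. *)
Lemma sg_sum_low r : (size r).+1 = n ->
  \sum_(k < n.+1) (\prod_(y <- r) sg (b k - y)) / (\prod_(i < n) sg (b k - b (bump k i))) = 0.
Proof.
move=> hr; pose f := \prod_(y <- r) ('X - (eph y ^+ 2)%:P).
have sf : size f = n by rewrite size_prod_XsubC.
pose K := two_ipi * (\prod_(j < n.+1) eph (b j)) / \prod_(y <- r) eph y.
have := @lagrange_top _ n (fun k => eph (b k) ^+ 2) f eph_sep.
rewrite sf => /(_ (leqnSn n)); rewrite nth_default ?sf // => /(congr1 ( *%R^~ K)); rewrite mul0r => e.
rewrite -[RHS]e mulr_suml; apply: eq_bigr => k _; rewrite sg_ratio; congr (_ / _ * _).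
  rewrite /f horner_prod. by apply: eq_bigr => y _; rewrite hornerXsubC.
have h1 := eph_prod_neq0 r.
have h4 : two_ipi * eph (b k) != 0 by rewrite mulf_neq0 ?two_ipi_neq0 ?eph_neq0.
have := expf_neq0 (size r) h4; move: (eph_neq0 (b k)) two_ipi_neq0.
have -> : (two_ipi * eph (b k)) ^+ n = (two_ipi * eph (b k)) * (two_ipi * eph (b k)) ^+ size r by rewrite -exprS hr.
rewrite /K.
move: h1; move: two_ipi (eph (b k)) (\prod_(y <- r) eph y) (\prod_(i < n.+1) _) ((two_ipi * eph (b k)) ^+ size r).
move=> z4 z5 z1 z2 z3 z10 z50 z40 z30.
by field; rewrite z10 z50 z30.
Qed.

Lemma sg_sum_high r : size r = n.+1 ->
  \sum_(k < n.+1) (\prod_(y <- r) sg (b k - y)) / (\prod_(i < n) sg (b k - b (bump k i)))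
  = sg (\sum_(k < n.+1) b k - \sum_(y <- r) y).
Proof.
move=> hr; pose f := \prod_(y <- r) ('X - (eph y ^+ 2)%:P).
have sf : size f = n.+2 by rewrite size_prod_XsubC hr.
(* An additional node at [0] produces the factor [eph (b k) ^ 2] in the denominators, and its own
   summand supplies the second exponential of the sine on the right. *)
pose x k := if k is k'.+1 then eph (b k') ^+ 2 else 0.
have hx (i j : 'I_n.+2) : i != j -> x i != x j.
  case: i => -[|i] hi; case: j => -[|j] hj //= ij.
  - by rewrite eq_sym expf_neq0 ?eph_neq0.
  - by rewrite expf_neq0 ?eph_neq0.
  - exact: (@eph_sep (Ordinal (hi : (i < n.+1)%N)) (Ordinal (hj : (j < n.+1)%N))).
have := @lagrange_top _ n.+1 x f hx; rewrite sf => /(_ (leqnn _)).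
have -> : f`_n.+1 = 1.
  by have := monic_prod_XsubC r predT (fun y => eph y ^+ 2); rewrite monicE lead_coefE sf => /eqP.
have hE z : eph z != 0 by apply: eph_neq0.
have eB : eph (\sum_(k < n.+1) b k) = \prod_(k < n.+1) eph (b k).
  elim: (index_enum _) => [|k s IH]; first by rewrite !big_nil /eph !mulr0 cexp0.
  by rewrite !big_cons ephD IH.
have eY : eph (\sum_(y <- r) y) = \prod_(y <- r) eph y.
  elim: (r) => [|k s IH]; first by rewrite !big_nil /eph !mulr0 cexp0.
  by rewrite !big_cons ephD IH.
have fx u : f.[u] = \prod_(y <- r) (u - eph y ^+ 2).
  by rewrite /f horner_prod; apply: eq_bigr => y _; rewrite hornerXsubC.
rewrite big_ord_recl /=.
have -> : \prod_(j < n.+2 | j != ord0) (0 - x j) = (-1) ^+ n.+1 * (\prod_(k < n.+1) eph (b k)) ^+ 2.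
  rewrite (prod_bump ord0 (fun j => 0 - x j)) -prodrXl -[X in (-1) ^+ X](card_ord n.+1) -prodr_const -big_split.
  by apply: eq_bigr => i _; rewrite /x /bump /= add0r mulN1r.
have -> : f.[0] = (-1) ^+ n.+1 * (\prod_(y <- r) eph y) ^+ 2.
  rewrite fx -hr; elim: (r) => [|y s IH]; first by rewrite !big_nil expr0 mul1r expr1n.
  rewrite !big_cons IH /= [(-1) ^+ _.+1]exprS; move: (eph y) (\prod_(_ <- _) _) ((-1) ^+ size s : C) => z1 z2 z3; ring.
set Y := \prod_(y <- r) eph y; set B := \prod_(k < n.+1) eph (b k).
have Y0 : Y != 0 by apply: eph_prod_neq0.
have B0 : B != 0 by apply/prodf_neq0 => y _; apply: eph_neq0.
have s0 : (-1) ^+ n.+1 != 0 :> C by rewrite signr_eq0.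
have -> : (-1) ^+ n.+1 * Y ^+ 2 / ((-1) ^+ n.+1 * B ^+ 2) = Y ^+ 2 / B ^+ 2.
  by move: ((-1) ^+ n.+1) s0 => s s0; field; rewrite s0 B0.
move=> e; have {e} : \sum_(i < n.+1) f.[x (bump 0 i)] / (\prod_(j < n.+2 | j != lift ord0 i) (x (bump 0 i) - x j)) = 1 - Y ^+ 2 / B ^+ 2.
  by apply/eqP; rewrite eq_sym subr_eq [X in _ == X]addrC eq_sym; apply/eqP.
move/(congr1 ( *%R^~ (B / (two_ipi * Y)))).
have -> : (1 - Y ^+ 2 / B ^+ 2) * (B / (two_ipi * Y)) = sg (\sum_(k < n.+1) b k - \sum_(y <- r) y).
  rewrite sg_eph ephD ephN eB eY -/B -/Y; move: two_ipi_neq0; move: two_ipi Y B Y0 B0 => z Y B *.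
  by field; apply/and3P.
move=> e; rewrite -[RHS]e mulr_suml; apply: eq_bigr => k _; rewrite sg_ratio fx.
rewrite /bump /=.
have -> : \prod_(j < n.+2 | j != lift ord0 k) (eph (b k) ^+ 2 - x j) = eph (b k) ^+ 2 * \prod_(j < n.+1 | j != k) (eph (b k) ^+ 2 - eph (b j) ^+ 2).
  rewrite big_mkcond big_ord_recl /= subr0 -big_mkcond /=; congr (_ * _).
have p0 : \prod_(j < n.+1 | j != k) (eph (b k) ^+ 2 - eph (b j) ^+ 2) != 0.
  by apply/prodf_neq0 => j jk; rewrite subr_eq0 eph_sep // eq_sym.
have h4 : two_ipi * eph (b k) != 0 by rewrite mulf_neq0 ?two_ipi_neq0 ?eph_neq0.
have := expf_neq0 n h4; move: (eph_neq0 (b k)) two_ipi_neq0; rewrite hr [(two_ipi * _) ^+ n.+1]exprS -/Y -/B.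
clear e; clearbody Y B; move: p0 Y0; move: two_ipi (eph (b k)) Y ((two_ipi * eph (b k)) ^+ n) (\prod_(y <- r) (_ - _)) (\prod_(_ < _ | _) _).
move=> z6 z7 z3 z5 z1 z2 z20 z30 z70 z60 z50.
by field; rewrite z20 z30 z50 z60 z70.
Qed.

End SineSums.

(** * The linear combination of the expanded inner series *)

Section GoodRegion.
Variable R : realType.
Local Notation C := R[i].

Lemma rGamma_quotient (z : C) s : (forall n : nat, z + s%:R != - n%:R) -> poch z s = rGamma z / rGamma (z + s%:R).
Proof. by move=> h; rewrite (rGamma_poch z s) mulfK // rGamma_neq0. Qed.

Variables (m : nat) (a1 a2 : C) (aa bb : nat -> C).

(** Here [p = m + 1], the list [aa] holds [a_3, ..., a_(p+1)], and [bump k] enumerates the indices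
    other than [k]. *)
Definition lower_shift k i : C := 1 - bb k + bb (bump k i).
Definition upper_shift k i : C := 1 - bb k + aa i.

Definition icoef k j : C := \prod_(i < m) (poch (upper_shift k i) j / poch (lower_shift k i) j).

Definition iweight k n : C := poch (1 - bb k + a1) n * poch (1 - bb k + a2) n
   * rGamma (1 - bb k + a1 + a2 + n%:R) / n`!%:R.

Definition iterm k n : C := iweight k n * Dn (icoef k) n.

Definition rfac k : C := (\prod_(i < m) rGamma (bb k - bb (bump k i)))^-1 *
  (rGamma (bb k - a1) * rGamma (bb k - a2) * \prod_(i < m) rGamma (bb k - aa i)).

(** The hypergeometric term divided by all [Gamma(b_j)], which makes it entire in the parameters. *)
Definition Lam s : C := poch a1 s * poch a2 s * (\prod_(i < m) poch (aa i) s) / s`!%:R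
   * \prod_(j < m.+1) rGamma (bb j + s%:R).

Definition nu_of : C := \sum_(j < m.+1) bb j - (a1 + a2) - \sum_(i < m) aa i.

Definition bsep := forall i j : 'I_m.+1, i != j -> forall n : int, bb i - bb j != n%:~R.

Lemma bump_sep (k : 'I_m.+1) (i : 'I_m) : bsep -> forall n : int, bb k - bb (bump k i) != n%:~R.
Proof. by move=> h n; have := h k (lift k i) (neq_lift _ _) n. Qed.

Lemma lower_shift_npole (k : 'I_m.+1) (i : 'I_m) : bsep -> forall n : nat, lower_shift k i != - n%:R.
Proof.
move=> h n; have := @bump_sep k i h n.+1%:Z; apply: contra_neq; rewrite /lower_shift => e.
have -> : bb k - bb (bump k i) = 1 - (1 - bb k + bb (bump k i)) by ring.
by rewrite e opprK -pmulrn -natr1 addrC.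
Qed.

Lemma prod_all (k : 'I_m.+1) (f : nat -> C) : \prod_(j < m.+1) f j = f k * \prod_(i < m) f (bump k i).
Proof. by rewrite (bigD1 k) //= (prod_bump k f). Qed.

(** The generic region: [a_sep] makes the poles simple, [ba_gt1] makes the residues summable,
    [ba_sep] keeps the sines in the denominators away from zero, and [Re_b] places each [b_k] in a
    strip of [dougall_sum]. *)
Hypothesis m_gt0 : (0 < m)%N.
Hypothesis b_sep : bsep.
Hypothesis ba_gt1 : forall (i : 'I_m) (j : 'I_m.+1), 1 < complex.Re (bb j - aa i).
Hypothesis a_sep : forall i j : 'I_m, i != j -> forall n : int, aa i - aa j != n%:~R.
Hypothesis ba_sep : forall (i : 'I_m) (k : 'I_m.+1) (n : int), bb k - aa i != n%:~R.
Hypothesis Re_a : forall i : 'I_m, 0 < complex.Re (aa i).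
Hypothesis Re_b : forall k : 'I_m.+1, exists M : nat, M%:R < complex.Re (1 + bb k - a1 - a2) < M.+1%:R.
Hypothesis iterm_summable : forall k : 'I_m.+1, summable (iterm k).
Hypothesis Lam_summable : summable Lam.

Let aas := [seq aa i | i <- iota 0 m].

Let tau k : C := (\prod_(y <- aas) sg (bb k - y)) / (\prod_(i < m) sg (bb k - bb (bump k i))).

Let sgb (i j : 'I_m.+1) : i != j -> sg (bb i - bb j) != 0.
Proof. by move=> ij; apply/sg_neq0/b_sep. Qed.

Let aasE (f : C -> C) : \prod_(y <- aas) f y = \prod_(i < m) f (aa i).
Proof. by rewrite big_map -[iota 0 m](_ : index_iota 0 m = _) ?big_mkord // /index_iota subn0. Qed.

Let upper_npole (k : 'I_m.+1) (i : 'I_m) (n : nat) : upper_shift k i != - n%:R.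
Proof.
have := ba_sep i k n.+1%:Z; apply: contra_neq; rewrite /upper_shift => e.
have -> : bb k - aa i = 1 - (1 - bb k + aa i) by ring.
by rewrite e opprK -pmulrn -natr1 addrC.
Qed.

Let X k : C := csum (fun n => Efun a1 a2 (bb k - n%:R) / n`!%:R *
   Dn (fun j => \prod_(i < m) hq (upper_shift k) (lower_shift k) i j%:R) n).

Let Qk k : C := \prod_(i < m) (rGamma (lower_shift k i) / rGamma (upper_shift k i)).

Let X_iterm (k : 'I_m.+1) : X k = rGamma (bb k - a1) * rGamma (bb k - a2) * Qk k * csum (iterm k).
Proof.
rewrite -csumZ //; apply: eq_csum => n; rewrite EfunE /iterm /iweight.
have e j : \prod_(i < m) hq (upper_shift k) (lower_shift k) i j%:R = Qk k * icoef k j.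
  rewrite -big_split; apply: eq_bigr => i _ /=; rewrite /hq.
  rewrite [j%:R + _]addrC [j%:R + upper_shift _ _]addrC.
  have h1 := npole_addn j (lower_shift_npole k i b_sep).
  have h2 := npole_addn j (upper_npole k i).
  rewrite (rGamma_quotient h1) (rGamma_quotient h2).
  have := rGamma_neq0 h1; have := rGamma_neq0 h2.
  have := rGamma_neq0 (lower_shift_npole k i b_sep); have := rGamma_neq0 (upper_npole k i).
  move: (rGamma (_ + _)) (rGamma (lower_shift k i + _)) (rGamma (upper_shift k i)) (rGamma (lower_shift k i)).
  by move=> x y z w z0 w0 x0 y0; field; rewrite x0 y0 z0 w0.
have -> : Dn (fun j => \prod_(i < m) hq (upper_shift k) (lower_shift k) i j%:R) n = Qk k * Dn (icoef k) n.
  rewrite (eq_Dn _ e) /Dn mulr_sumr; apply: eq_bigr => j _; rewrite mulrCA //.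
move: (Qk k) (Dn _ _) (rGamma _) (rGamma (bb k - a2)) (rGamma (_ + _)) (poch _ _) (poch _ _) (_^-1).
by move=> *; ring.
Qed.

(** Reflection pairs each Gamma factor of the prefactor with one from [Qk], which turns the
    prefactor into the sine quotient [tau]. *)
Let rfac_tau (k : 'I_m.+1) : rfac k * csum (iterm k) = tau k * X k.
Proof.
rewrite X_iterm /rfac /tau aasE [RHS]mulrA; congr (_ * _).
have -> : Qk k = (\prod_(i < m) rGamma (lower_shift k i)) / \prod_(i < m) rGamma (upper_shift k i).
  by rewrite -prodfV -big_split.
have e1 : \prod_(i < m) sg (bb k - aa i) = (\prod_(i < m) rGamma (bb k - aa i)) * \prod_(i < m) rGamma (upper_shift k i).
  by rewrite -big_split; apply: eq_bigr => i _; rewrite /sg /upper_shift opprB addrA addrAC.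
have e2 : \prod_(i < m) sg (bb k - bb (bump k i)) = (\prod_(i < m) rGamma (bb k - bb (bump k i))) * \prod_(i < m) rGamma (lower_shift k i).
  by rewrite -big_split; apply: eq_bigr => i _; rewrite /sg /lower_shift opprB addrA addrAC.
have : \prod_(i < m) sg (bb k - bb (bump k i)) != 0.
  by apply/prodf_neq0 => i _; apply: sg_neq0; apply: bump_sep.
have : \prod_(i < m) rGamma (upper_shift k i) != 0.
  by apply/prodf_neq0 => i _; apply: rGamma_neq0; apply: upper_npole.
rewrite e1 e2 mulf_eq0 negb_or => u0 /andP[]; move: u0.
move: (rGamma _) (rGamma (bb k - a2)) (\prod_(i < m) rGamma (bb k - aa i)) (\prod_(i < m) rGamma (bb k - bb _))
   (\prod_(i < m) rGamma (upper_shift k i)) (\prod_(i < m) rGamma (lower_shift k i)) => x1 x2 x3 x4 x5 x6 h5 h4 h6.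
by field; rewrite h4 h5 h6.
Qed.

Let PA : C := \prod_(i < m) rGamma (aa i).

Let PA_neq0 : PA != 0.
Proof. by apply/prodf_neq0 => i _; apply/rGamma_neq0/Re_gt0_npole. Qed.

(** At [z = s + b_k - 1] the shifted parameters become [aa i + s] and [b_j + s] with [j != k], and
    [gterm] supplies the missing factor of [b_k]. So the right side is free of [k]. *)
Let Lam_term (k : 'I_m.+1) s :
  gterm a1 a2 (bb k) s * \prod_(i < m) hq (upper_shift k) (lower_shift k) i (s%:R + bb k - 1) = PA^-1 * Lam s.
Proof.
rewrite /gterm /Lam (prod_all k (fun j => rGamma (bb j + s%:R))).
have -> : \prod_(i < m) hq (upper_shift k) (lower_shift k) i (s%:R + bb k - 1)
  = (\prod_(i < m) rGamma (bb (bump k i) + s%:R)) / \prod_(i < m) rGamma (aa i + s%:R).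
  rewrite -prodfV -big_split; apply: eq_bigr => i _; rewrite /hq /=.
  by congr (rGamma _ / rGamma _); rewrite /lower_shift /upper_shift; ring.
have -> : \prod_(i < m) poch (aa i) s = PA / \prod_(i < m) rGamma (aa i + s%:R).
  rewrite /PA -prodfV -big_split; apply: eq_bigr => i _; apply: rGamma_quotient.
  exact: npole_addn _ (Re_gt0_npole (Re_a i)).
have : \prod_(i < m) rGamma (aa i + s%:R) != 0.
  by apply/prodf_neq0 => i _; apply: rGamma_neq0; apply: npole_addn _ (Re_gt0_npole (Re_a i)).
move: PA_neq0 (factC_neq0 R s); move: PA (s`!%:R : C) (\prod_(i < m) _) (\prod_(i < m) rGamma (bb _ + _)) (rGamma _) (poch _ _) (poch a2 s).
by move=> x1 x2 x3 x4 x5 x6 x7 h1 h2 h3; field; rewrite h1 h2 h3.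
Qed.

Let OmK k (x : C) : C := Om a1 a2 (bb k) x.

(* Up to a factor independent of [k] this is a sine sum with one sine too few in the numerator. *)
Let residue_cancel (i : 'I_m) l :
  \sum_(k < m.+1) tau k * (pfcoef (upper_shift k) (lower_shift k) m i l * OmK k (aa i + l%:R)) = 0.
Proof.
pose W : C := (l`!%:R)^-1 * (\prod_(j < m.+1) rGamma (bb j - (aa i + l%:R)))
   / (\prod_(j < m | (j : nat) != i) rGamma (aa j - (aa i + l%:R)))
   * (rGamma a1 * rGamma a2 * rGamma (aa i + l%:R + 1 - a1) * rGamma (aa i + l%:R + 1 - a2) / rGamma (aa i + l%:R)).
pose r := [seq aa j | j <- [seq j <- iota 0 m | j != i :> nat]].
have hr : (size r).+1 = m.
  rewrite size_map size_filter; have := count_predC (pred1 (i : nat)) (iota 0 m).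
  rewrite size_iota count_uniq_mem ?iota_uniq // mem_iota /= ltn_ord add1n; exact.
have := sg_sum_low sgb hr; move/(congr1 (fun x => x * W)); rewrite mul0r => e; rewrite -[RHS]e mulr_suml.
apply: eq_bigr => k _.
have -> : tau k = (\prod_(y <- r) sg (bb k - y)) / (\prod_(i0 < m) sg (bb k - bb (bump k i0))) * sg (bb k - aa i).
  rewrite /tau mulrAC; congr (_ / _); rewrite aasE (bigD1 i) //= mulrC; congr (_ * _).
  rewrite big_map big_filter -[iota 0 m](_ : index_iota 0 m = _) ?big_mkord //; last by rewrite /index_iota subn0.
rewrite -[LHS]mulrA; congr (_ * _).
have s0 : sg (bb k - aa i) != 0 by apply: sg_neq0; apply: ba_sep.
(* Reflection moves the factor that depends on [b_k] into the numerator; there it completes the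
   product over [j != k] in [pfcoef] to one over all [j], which is free of [k]. *)
have -> : OmK k (aa i + l%:R) = rGamma a1 * rGamma a2 * rGamma (aa i + l%:R + 1 - a1) * rGamma (aa i + l%:R + 1 - a2) / rGamma (aa i + l%:R)
   * (rGamma (bb k - (aa i + l%:R)) / ((-1) ^+ l * sg (bb k - aa i))).
  have -> : (-1) ^+ l * sg (bb k - aa i) = sg (bb k - (aa i + l%:R)) by rewrite -sg_subn opprD addrA.
  rewrite /sg /OmK /Om.
  have -> : 1 - (bb k - (aa i + l%:R)) = aa i + l%:R + 1 - bb k by ring.
  have h : rGamma (bb k - (aa i + l%:R)) * rGamma (aa i + l%:R + 1 - bb k) != 0.
    have : sg (bb k - (aa i + l%:R)) != 0 by rewrite opprD addrA sg_subn mulf_neq0 // signr_eq0.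
    by rewrite /sg (_ : 1 - (bb k - (aa i + l%:R)) = aa i + l%:R + 1 - bb k) //; ring.
  move: h; rewrite mulf_eq0 negb_or => /andP[]; rewrite invfM.
  move: (rGamma (aa i + l%:R + 1 - bb k)) (rGamma (bb k - _)) (rGamma (aa i + l%:R))^-1 => x y z y0 x0.
  by field; rewrite x0 y0.
have -> : pfcoef (upper_shift k) (lower_shift k) m i l =
   (-1) ^+ l / l`!%:R * (\prod_(j < m) rGamma (bb (bump k j) - (aa i + l%:R))) / (\prod_(j < m | (j : nat) != i) rGamma (aa j - (aa i + l%:R))).
  rewrite /pfcoef [\prod_(j < m) _](bigD1 i) //=.
  have -> : \prod_(j < m | (j : nat) != i) hq (upper_shift k) (lower_shift k) j (- (upper_shift k i + l%:R))
    = (\prod_(j < m | j != i) rGamma (bb (bump k j) - (aa i + l%:R))) / (\prod_(j < m | (j : nat) != i) rGamma (aa j - (aa i + l%:R))).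
    rewrite -prodfV -big_split; apply: eq_bigr => j _; rewrite /hq /=.
    by congr (rGamma _ / rGamma _); rewrite /lower_shift /upper_shift; ring.
  have -> : rres (upper_shift k) (lower_shift k) i l = (-1) ^+ l / l`!%:R * rGamma (bb (bump k i) - (aa i + l%:R)).
    have -> : bb (bump k i) - (aa i + l%:R) = lower_shift k i - upper_shift k i - l%:R.
      by rewrite /lower_shift /upper_shift; ring.
    rewrite rGamma_sub /rres.
    have -> : 1 - (lower_shift k i - upper_shift k i) = 1 - lower_shift k i + upper_shift k i by ring.
    have := sqrr_sign C l; move: ((-1) ^+ l) (_^-1) (poch _ _) (rGamma _) => x y z w h.
    by transitivity (x ^+ 2 * (z * y * w)); [rewrite h mul1r | ring].
  by rewrite !mulrA.
rewrite /W (prod_all k (fun j => rGamma (bb j - (aa i + l%:R)))).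
have : (-1) ^+ l != 0 :> C by rewrite signr_eq0.
move: s0; move: ((-1) ^+ l) (sg _) ((\prod_(j < m | _) _)^-1) (\prod_(j < m) _) (rGamma (bb k - _)) (l`!%:R^-1) (_ / rGamma (aa i + _)).
by move=> x1 x2 x3 x4 x5 x6 x7 h2 h1; field; rewrite h1 h2.
Qed.

Lemma good_region : \prod_(i < m) rGamma (aa i) * \sum_(k < m.+1) rfac k * csum (iterm k) = sg nu_of * csum Lam.
Proof.
have ex (k : 'I_m.+1) : [/\ forall i : 'I_m, summable (fun l => pfcoef (upper_shift k) (lower_shift k) m i l * OmK k (aa i + l%:R))
   & X k = sg (bb k - (a1 + a2)) * (PA^-1 * csum Lam) + \sum_(i < m) csum (fun l => pfcoef (upper_shift k) (lower_shift k) m i l * OmK k (aa i + l%:R))].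
  have [M hM] := Re_b k.
  have h1 i j : (i < m)%N -> (j < m)%N -> i != j -> forall n : int, upper_shift k i - upper_shift k j != n%:~R.
    move=> im jm ij n; have -> : upper_shift k i - upper_shift k j = aa i - aa j by rewrite /upper_shift; ring.
    exact: (@a_sep (Ordinal im) (Ordinal jm)).
  have h2 i : (i < m)%N -> 1 < complex.Re (lower_shift k i - upper_shift k i).
    move=> im; have -> : lower_shift k i - upper_shift k i = bb (bump k i) - aa i by rewrite /lower_shift /upper_shift; ring.
    exact: (@ba_gt1 (Ordinal im) (lift k (Ordinal im))).
  have h3 i : (i < m)%N -> forall n : nat, upper_shift k i != - n%:R.
    by move=> im; apply: (upper_npole k (Ordinal im)).
  have e3 i : upper_shift k i + bb k - 1 = aa i by rewrite /upper_shift; ring.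
  have h4 i : (i < m)%N -> 0 < complex.Re (upper_shift k i + bb k - 1).
    by move=> im; rewrite e3; apply: (Re_a (Ordinal im)).
  have [_ f2 f3] := expanded_sum m_gt0 h1 h2 h3 h4 hM.
  split=> [i|].
    by have := f2 i (ltn_ord i); apply: eq_summable => l; rewrite e3.
  have K1 : kap a1 a2 (bb k) = sg (bb k - (a1 + a2)) by rewrite /kap (_ : bb k - a1 - a2 = bb k - (a1 + a2)) //; ring.
  have K2 : csum (fun s => gterm a1 a2 (bb k) s * \prod_(i < m) hq (upper_shift k) (lower_shift k) i (s%:R + bb k - 1)) = PA^-1 * csum Lam.
    by rewrite -csumZ //; apply: eq_csum => s; rewrite Lam_term.
  have K3 : \sum_(i < m) csum (fun l => pfcoef (upper_shift k) (lower_shift k) m i l * Om a1 a2 (bb k) (upper_shift k i + bb k - 1 + l%:R))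
     = \sum_(i < m) csum (fun l => pfcoef (upper_shift k) (lower_shift k) m i l * OmK k (aa i + l%:R)).
    by apply: eq_bigr => i _; apply: eq_csum => l; rewrite e3.
  by rewrite -K1 -K2 -K3; apply: f3.
have -> : \sum_(k < m.+1) rfac k * csum (iterm k) = \sum_(k < m.+1) (tau k * sg (bb k - (a1 + a2))) * (PA^-1 * csum Lam)
  + \sum_(i < m) csum (fun l => \sum_(k < m.+1) tau k * (pfcoef (upper_shift k) (lower_shift k) m i l * OmK k (aa i + l%:R))).
  have -> : \sum_(i < m) csum (fun l => \sum_(k < m.+1) tau k * (pfcoef (upper_shift k) (lower_shift k) m i l * OmK k (aa i + l%:R)))
    = \sum_(k < m.+1) tau k * \sum_(i < m) csum (fun l => pfcoef (upper_shift k) (lower_shift k) m i l * OmK k (aa i + l%:R)).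
    under [RHS]eq_bigr => k _ do rewrite mulr_sumr.
    rewrite [RHS]exchange_big /=; apply: eq_bigr => i _; rewrite csum_sum; last first.
      by move=> k _; apply: summableZ; have [] := ex k.
    by apply: eq_bigr => k _; rewrite csumZ //; have [] := ex k.
  rewrite -big_split; apply: eq_bigr => k _ /=; rewrite rfac_tau.
  by have [_ ->] := ex k; rewrite mulrDr mulrA.
rewrite [X in _ + X]big1; last first.
  move=> i _; apply: has_sum_csum; have := @has_sum_finite R (fun=> 0) 0 (fun=> fun=> erefl).
  by rewrite big_ord0; apply: tends_ext => n; apply: eq_bigr => l _; rewrite residue_cancel.
rewrite addr0 -mulr_suml.
have -> : \sum_(k < m.+1) tau k * sg (bb k - (a1 + a2)) = sg nu_of.
  have hr : size (a1 + a2 :: aas) = m.+1 by rewrite /= size_map size_iota.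
  have := sg_sum_high sgb hr; rewrite big_cons big_map -[iota 0 m](_ : index_iota 0 m = _) ?big_mkord; last first.
    by rewrite /index_iota subn0.
  rewrite opprD addrA -/nu_of => <-; apply: eq_bigr => k _.
  by rewrite big_cons /tau mulrC mulrA.
by rewrite mulrCA -/PA; congr (_ * _); rewrite mulrA divff // mul1r.
Qed.

End GoodRegion.

(** * Growth of the finite differences *)

Section VandermondeTransform.
Variable R : realType.
Local Notation C := R[i].
Implicit Types (al ga be : C) (c : nat -> C).

(** The Taylor coefficients of [(1 - x) ^ (- al)], whence the convolution identities. *)
Definition rfact al l : C := poch al l / l`!%:R.

Lemma rfactS al l : l.+1%:R * rfact al l.+1 = (al + l%:R) * rfact al l.
Proof.
rewrite /rfact pochS factS natrM; have := natC_neq0 R l; have := factC_neq0 R l.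
by move: (poch _ _) (l.+1%:R : C) (l`!%:R : C) (l%:R : C) => x y z w z0 y0; field; apply/andP.
Qed.

Lemma rfact_shift al l : al * rfact (al + 1) l = l.+1%:R * rfact al l.+1.
Proof.
rewrite /rfact pochSl factS natrM; have := natC_neq0 R l; have := factC_neq0 R l.
by move: (poch _ _) (l.+1%:R : C) (l`!%:R : C) => x y z z0 y0; field; apply/andP.
Qed.

Definition convol al ga (d : nat -> C) n : C := \sum_(l < n.+1) rfact al l * rfact ga (n - l) * d l.

(** The recurrence is built to match [DnS]; its core is the splitting of [n + 1] into [n + 1 - l]
    and [l] in front of each term. *)
Lemma convol_rec al ga d n :
  (al + ga + n%:R) * convol al ga d n
  - al * (convol (al + 1) ga d n - convol (al + 1) ga (fun l => d l.+1) n)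
  = n.+1%:R * convol al ga d n.+1.
Proof.
transitivity (\sum_(l < n.+1) (n.+1 - l)%:R * (rfact al l * rfact ga (n.+1 - l) * d l)
   + \sum_(l < n.+1) l.+1%:R * (rfact al l.+1 * rfact ga (n - l) * d l.+1)).
  rewrite mulrBr opprB addrCA addrC; congr (_ + _); rewrite /convol !mulr_sumr -?sumrB.
    apply: eq_bigr => l _; have ln : (l <= n)%N by rewrite -ltnS.
    have -> : (n.+1 - l)%:R * (rfact al l * rfact ga (n.+1 - l) * d l) = rfact al l * ((ga + (n - l)%:R) * rfact ga (n - l)) * d l.
      by rewrite subSn // -rfactS; move: (rfact al l) (rfact ga _) => *; ring.
    have -> : al * (rfact (al + 1) l * rfact ga (n - l) * d l) = (al + l%:R) * rfact al l * rfact ga (n - l) * d l.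
      have := rfact_shift al l; rewrite rfactS; move: (rfact ga _) (rfact (al + 1) l) (rfact al l) => u v w h.
      by transitivity (al * v * u * d l); [ring | rewrite h; ring].
    by rewrite natrB //; move: (rfact al l) (rfact ga _) (n%:R : C) (l%:R : C) => *; ring.
  apply: eq_bigr => l _; have := rfact_shift al l.
  move: (rfact ga _) (rfact (al + 1) l) (rfact al l.+1) => u v w h.
  by transitivity (al * v * u * d l.+1); [ring | rewrite h; ring].
rewrite /convol mulr_sumr.
have -> : \sum_(l < n.+1) (n.+1 - l)%:R * (rfact al l * rfact ga (n.+1 - l) * d l)
   = \sum_(l < n.+2) (n.+1 - l)%:R * (rfact al l * rfact ga (n.+1 - l) * d l).
  by rewrite [RHS]big_ord_recr /= subnn mul0r addr0.
have -> : \sum_(l < n.+1) l.+1%:R * (rfact al l.+1 * rfact ga (n - l) * d l.+1)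
   = \sum_(l < n.+2) l%:R * (rfact al l * rfact ga (n.+1 - l) * d l).
  by rewrite [RHS]big_ord_recl /= mul0r add0r; apply: eq_bigr => l _; rewrite /bump /= add1n subSS.
rewrite -big_split; apply: eq_bigr => l _ /=; have ln : (l <= n.+1)%N by rewrite -ltnS.
by rewrite -mulrDl -natrD subnK.
Qed.

(** Multiplying a sequence by [(al)_j / (al + ga)_j] acts on its differences as a weighted
    convolution. The alternating sum gives way to one that can be bounded term by term. *)
Lemma Dn_hyper al ga c n : (forall k : nat, al + ga != - k%:R) ->
  Dn (fun j => poch al j / poch (al + ga) j * c j) n = n`!%:R / poch (al + ga) n * convol al ga (Dn c) n.
Proof.
elim: n al c => [|n IH] al c hb.
  by rewrite Dn0 /convol big_ord1 /rfact subnn !poch0 Dn0 fact0 !(invr1, mulr1, mul1r).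
rewrite DnS IH //; set be := al + ga in hb *.
have b0 : be != 0 by have := hb 0%N; rewrite oppr0.
have hb1 : forall k : nat, al + 1 + ga != - k%:R by rewrite addrAC; apply: npole_add1.
have -> : Dn (fun j => poch al j.+1 / poch be j.+1 * c j.+1) n =
   al / be * (n`!%:R / poch (be + 1) n * convol (al + 1) ga (Dn (fun j => c j.+1)) n).
  have := IH (al + 1) (fun j => c j.+1) hb1; rewrite addrAC -/be => <-.
  rewrite /Dn mulr_sumr; apply: eq_bigr => j _; rewrite !pochSl invfM.
  by move: (poch _ _) (poch _ _)^-1 ((-1) ^+ j * _) => *; ring.
have -> : convol (al + 1) ga (Dn (fun j => c j.+1)) n = convol (al + 1) ga (Dn c) n - convol (al + 1) ga (fun l => Dn c l.+1) n.
  rewrite /convol -sumrB; apply: eq_bigr => l _; rewrite -mulrBr; congr (_ * _).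
  by rewrite DnS subKr.
have p0 : poch be n != 0 by apply: poch_neq0.
have y0 : be + n%:R != 0 by rewrite addr_eq0 hb.
have -> : poch (be + 1) n = poch be n * (be + n%:R) / be by rewrite -pochS pochSl mulrAC mulfV // mul1r.
rewrite factS natrM pochS; have := convol_rec al ga (Dn c) n; rewrite -/be.
move: (convol al ga (Dn c) n) (convol al ga (Dn c) n.+1) (convol (al + 1) ga _ n - convol (al + 1) ga _ n) => U W V h.
transitivity (n`!%:R / (poch be n * (be + n%:R)) * (n.+1%:R * W)); last first.
  by move: (n.+1%:R : C) (n`!%:R : C) (_^-1) => *; ring.
rewrite -h; clear h; move: (poch be n) p0 (be + n%:R) (n`!%:R : C) y0 => x x0 y z y0.
by field; rewrite x0 y0 b0.
Qed.

(** The Chu-Vandermonde identity, read off [Dn_hyper] for the sequence [1, 0, 0, ...], all of whose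
    differences are [1]. *)
Lemma convol_1 al ga n : (forall k : nat, al + ga != - k%:R) -> \sum_(l < n.+1) rfact al l * rfact ga (n - l) = rfact (al + ga) n.
Proof.
move=> hb; pose c j : C := (j == 0%N)%:R.
have Dc k f : Dn (fun j => f j * c j) k = f 0%N :> C.
  rewrite /Dn big_ord_recl big1 ?addr0; last by move=> i _; rewrite /c /= !mulr0.
  by rewrite /= bin0 expr0 /c eqxx !mulr1 mul1r.
have := Dn_hyper c n hb; rewrite Dc !poch0 divr1 => e.
have D1 k : Dn c k = 1.
  by rewrite (@eq_Dn _ c (fun j => 1 * c j)) ?Dc // => j; rewrite mul1r.
have -> : \sum_(l < n.+1) rfact al l * rfact ga (n - l) = convol al ga (Dn c) n.
  by apply: eq_bigr => l _; rewrite D1 mulr1.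
rewrite /rfact; have := poch_neq0 n hb; have := factC_neq0 R n; move: e; move: (poch _ _) (n`!%:R : C) (convol _ _ _ _) => x y z e y0 x0.
have -> : z = y / x * z * (x / y) by field; rewrite x0 y0.
by rewrite -e mul1r.
Qed.

(** The powers are comparable with the positive numbers [(x)_l / l!], whose convolution is given
    exactly by [convol_1]. *)
Lemma pw_convolution (x y : R) : 0 < x -> 0 < y ->
  exists B : R, 0 <= B /\ forall n, \sum_(l < n.+1) pw l (x - 1) * pw (n - l) (y - 1) <= B * pw n (x + y - 1).
Proof.
move=> x0 y0.
have hp (z : R) : 0 < z -> forall m : nat, z%:C != - m%:R :> C by move=> z0; apply: Re_gt0_npole.
have pr (z : R) n : poch (z%:C : C) n = (\prod_(i < n) (z + i%:R))%:C.
  by rewrite rmorph_prod; apply: eq_bigr => i _ /=; rewrite rmorphD /= rmorph_nat.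
have pr0 (z : R) n : 0 < z -> 0 < \prod_(i < n) (z + i%:R) by move=> z0; apply: prodr_gt0 => i _; rewrite ltr_pwDl.
pose r (z : R) n : R := (\prod_(i < n) (z + i%:R)) / n`!%:R.
have rE z n : rfact z%:C n = (r z n)%:C :> C by rewrite /rfact pr /r rcM rcV rcn.
have r0 z n : 0 < z -> 0 < r z n by move=> z0; rewrite divr_gt0 ?pr0 ?factR_gt0.
have low (z : R) : 0 < z -> exists B : R, 0 <= B /\ forall n, pw n (z - 1) <= B * r z n.
  move=> z0; have [B [B0 hB]] := poch_lower_bound (hp _ z0); exists B; split=> // n.
  have := hB n; have -> : (n`!%:R / poch z%:C n : C) = ((r z n)^-1)%:C by rewrite pr /r invf_div rcM rcn rcV.
  rewrite nm_real gtr0_norm ?invr_gt0 ?r0 // -(ler_pM2r (r0 z n z0)) mulVf ?gt_eqF ?r0 //.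
  have -> : 1 - complex.Re z%:C = - (z - 1) by rewrite /=; ring.
  by rewrite pwN => h; rewrite -[leLHS]mul1r -ler_pdivlMr ?pw_gt0 // mulrAC.
have [B1 [B10 h1]] := low x x0; have [B2 [B20 h2]] := low y y0.
have [B3 [B30 h3]] := bigo_poch ((x + y)%:C : C).
exists (B1 * B2 * B3); split=> [|n]; first by rewrite !mulr_ge0.
apply: (@le_trans _ _ (B1 * B2 * \sum_(l < n.+1) r x l * r y (n - l)%N)).
  rewrite mulr_sumr; apply: ler_sum => l _; rewrite mulrACA; apply: ler_pM; rewrite ?pw_ge0 //.
have e : \sum_(l < n.+1) r x l * r y (n - l)%N = r (x + y) n.
  have hxy : forall k : nat, x%:C + y%:C != - k%:R :> C by rewrite -rcD; apply: hp; rewrite addr_gt0.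
  have es : \sum_(l < n.+1) rfact x%:C l * rfact y%:C (n - l) = (\sum_(l < n.+1) r x l * r y (n - l)%N)%:C :> C.
    rewrite rmorph_sum; apply: eq_bigr => i _; rewrite !rE. by rewrite [RHS]rmorphM.
  by have := convol_1 n hxy; rewrite es -rcD rE => /(congr1 (@complex.Re R)).
rewrite e -[leRHS]mulrA; apply: ler_wpM2l; first by rewrite mulr_ge0.
have := h3 tt n I; rewrite -/(rfact _ _) rE nm_real => /(le_trans (ler_norm _)).
by rewrite /= .
Qed.

End VandermondeTransform.

(** * Sequences with decaying finite differences *)

Section DifferenceClass.
Variable R : realType.
Local Notation C := R[i].
Variables (T : Type) (D : T -> Prop).
Implicit Types (c : T -> nat -> C) (s : R).

(** Requiring the bound for every polynomial multiple makes the class stable under multiplication by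
    polynomials. *)
Definition dclass c s := forall q : {poly C}, bigO D (fun t n => Dn (fun j => q.[j%:R] * c t j) n) (- s).

Lemma Dn_natmul (c : nat -> C) n : Dn (fun j => j%:R * c j) n.+1 = n.+1%:R * (Dn c n.+1 - Dn c n).
Proof.
have e : Dn c n = \sum_(j < n.+2) (-1) ^+ j * 'C(n, j)%:R * c j.
  by rewrite [RHS]big_ord_recr /= bin_small // mulr0 mul0r addr0.
rewrite e /Dn -sumrB mulr_sumr; apply: eq_bigr => j _.
have -> : (-1) ^+ j * 'C(n.+1, j)%:R * (j%:R * c j) = (-1) ^+ j * (j * 'C(n.+1, j))%:R * c j.
  by rewrite natrM; move: ((-1) ^+ _) => ?; ring.
have -> : (j * 'C(n.+1, j) = n.+1 * ('C(n.+1, j) - 'C(n, j)))%N.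
  case: j => -[|j] _ /=; first by rewrite mul0n !bin0 subnn muln0.
  by rewrite binS addKn -(mul_bin_diag n.+1 j).
rewrite natrM natrB; last by case: j => -[|j] _ //=; rewrite ?bin0 // binS leq_addr.
by move: ((-1) ^+ _) => ?; ring.
Qed.

Lemma Dn_poly (q : {poly C}) : exists N, forall n, (N <= n)%N -> Dn (fun j => q.[j%:R]) n = 0.
Proof.
elim/poly_ind: q => [|q c [N hN]].
  by exists 0%N => n _; rewrite /Dn big1 // => j _; rewrite horner0 mulr0.
exists N.+2 => -[//|n] Nn.
rewrite (@eq_Dn _ _ (fun j => j%:R * q.[j%:R] + c)); last first.
  by move=> j; rewrite !hornerE mulrC.
have -> : Dn (fun j => j%:R * q.[j%:R] + c) n.+1 = Dn (fun j => j%:R * q.[j%:R]) n.+1 + Dn (fun=> c) n.+1.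
  by rewrite /Dn -big_split; apply: eq_bigr => j _; rewrite mulrDr.
by rewrite Dn_natmul !hN ?subrr ?mulr0 ?add0r ?DnS ?subrr // ltnW // ltnW.
Qed.

Lemma dclass_1 s : dclass (fun _ _ => 1) s.
Proof.
move=> q; have [N hN] := Dn_poly q.
have [B [B0 hB]] : bigo (fun n => Dn (fun j => q.[j%:R]) n) (- s).
  by apply: bigo_eventually; exists 0, N; split=> // n Nn; rewrite hN // nm0 mul0r.
exists B; split=> // t n _; rewrite (@eq_Dn _ _ (fun j => q.[j%:R])) ?(hB tt) // => j.
by rewrite mulr1.
Qed.

Lemma dclass_eq c c' s : (forall t j, D t -> c t j = c' t j) -> dclass c s -> dclass c' s.
Proof.
move=> h hc q; apply: bigO_eq (hc q) => t n Dt; apply: eq_Dn => j; by rewrite h.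
Qed.

Lemma dclassM c s (p : {poly C}) : dclass c s -> dclass (fun t j => p.[j%:R] * c t j) s.
Proof.
move=> hc q; apply: bigO_eq (hc (q * p)) => t n _; apply: eq_Dn => j.
by rewrite hornerM mulrA.
Qed.

Section Step.
Variables (al : T -> C) (be : C) (K x eta s : R).
Hypothesis al_bound : forall t, D t -> nm (al t) <= K.
Hypothesis be_npole : forall m : nat, be != - m%:R.
Hypothesis Re_al : forall t, D t -> x - eta <= complex.Re (al t) <= x + eta.
Hypothesis s_lt : s < x + eta.

(** The exponents are taken at the worst [al]: real part [x + eta] in [(al)_l] and [x - eta] in
    [(be - al)_(n-l)]. They no longer cancel exactly, hence the loss of [2 * eta]. *)
Lemma dclass_hyper_pos c : 0 < complex.Re be - x + eta -> dclass c s ->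
  dclass (fun t j => poch (al t) j / poch be j * c t j) (s - 2 * eta).
Proof.
move=> be_x hc q.
have [B1 [B10 h1]] := bigO_poch al_bound (x := x + eta - 1) (fun t Dt => ltac:(by have := Re_al Dt; lra)).
have [B2 [B20 h2]] := hc q.
have ga_bound t : D t -> nm (be - al t) <= nm be + K.
  by move=> Dt; apply: le_trans (nmB_le _ _) _; rewrite lerD2l al_bound.
have [B3 [B30 h3]] := bigO_poch ga_bound (x := complex.Re be - x + eta - 1)
  (fun t Dt => ltac:(by have := Re_al Dt; rewrite ReD ReN; lra)).
have [B4 [B40 h4]] := poch_lower_bound be_npole.
have xs0 : 0 < x + eta - s by rewrite subr_gt0.
have [B5 [B50 h5]] := pw_convolution xs0 be_x.
exists (B4 * (B1 * B2 * B3 * B5)); split=> [|t n Dt]; first by rewrite !mulr_ge0.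
have bE : al t + (be - al t) = be by ring.
rewrite (@eq_Dn _ _ (fun j => poch (al t) j / poch (al t + (be - al t)) j * (q.[j%:R] * c t j))); last first.
  by move=> j; rewrite bE mulrCA.
rewrite Dn_hyper bE // nmM.
apply: (@le_trans _ _ (B4 * pw n (1 - complex.Re be) * (B1 * B2 * B3 * (B5 * pw n (x + eta - s + (complex.Re be - x + eta) - 1))))); last first.
  have -> : - (s - 2 * eta) = (1 - complex.Re be) + (x + eta - s + (complex.Re be - x + eta) - 1) by ring.
  by rewrite [in leRHS]pwD; move: (pw n (1 - _)) (pw n (_ - 1)) => u v; rewrite le_eqVlt; apply/orP; left; apply/eqP; ring.
apply: ler_pM; rewrite ?nm_ge0 //.
apply: le_trans (nm_sum _ _ _) _.
apply: (@le_trans _ _ (B1 * B2 * B3 * \sum_(l < n.+1) pw l (x + eta - s - 1) * pw (n - l) (complex.Re be - x + eta - 1))); last first.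
  by apply: ler_wpM2l; rewrite ?mulr_ge0.
rewrite mulr_sumr; apply: ler_sum => l _; rewrite (nmM (rfact _ _ * rfact _ _)) (nmM (rfact _ _) (rfact _ _)).
have -> : x + eta - s - 1 = (x + eta - 1) + (- s) by ring.
rewrite pwD.
apply: (@le_trans _ _ (B1 * pw l (x + eta - 1) * (B3 * pw (n - l) (complex.Re be - x + eta - 1)) * (B2 * pw l (- s)))).
  apply: ler_pM; rewrite ?mulr_ge0 ?nm_ge0 //; last exact: (h2 t l Dt).
  by apply: ler_pM; rewrite ?nm_ge0 //; [exact: (h1 t l Dt) | exact: (h3 t (n - l)%N Dt)].
by move: (pw _ _) (pw _ _) (pw _ _) => u v w; rewrite le_eqVlt; apply/orP; left; apply/eqP; ring.
Qed.

End Step.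

(* Replacing [be] by [be + N] only costs the polynomial factor [(be + j)_N], which the class
   absorbs; this removes the condition [Re al < Re be]. *)
Lemma dclass_hyper (al : T -> C) (be : C) (K x eta s : R) c :
  (forall t, D t -> nm (al t) <= K) -> (forall m : nat, be != - m%:R) ->
  (forall t, D t -> x - eta <= complex.Re (al t) <= x + eta) -> s < x + eta ->
  dclass c s -> dclass (fun t j => poch (al t) j / poch be j * c t j) (s - 2 * eta).
Proof.
move=> h1 h2 h3 h4 hc; have [N hN] := archi_nat (x - eta - complex.Re be).
have h2' := npole_addn N h2.
have h5 : 0 < complex.Re (be + N%:R) - x + eta by rewrite ReD Re_nat; move: (N%:R : R) hN => r hN; lra.
pose p : {poly C} := (poch be N)^-1 *: \prod_(i < N) ('X + (be + i%:R)%:P).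
have := dclassM p (dclass_hyper_pos h1 h2' h3 h4 h5 hc); apply: dclass_eq => t j _.
have -> : p.[j%:R] = poch (be + N%:R) j / poch be j.
  have p0 := poch_neq0 N h2; have q0 := poch_neq0 j h2.
  have : poch be N * poch (be + N%:R) j = poch be j * poch (be + j%:R) N by rewrite -!pochD addnC.
  rewrite /p hornerZ horner_prod.
  have -> : \prod_(i < N) ('X + (be + i%:R)%:P).[j%:R] = poch (be + j%:R) N.
    by apply: eq_bigr => i _; rewrite !hornerE /=; ring.
  move: (poch be N) (poch be j) (poch (be + j%:R) N) (poch (be + N%:R) j) p0 q0 => X Y Z W X0 Y0 e.
  have -> : W = Y * Z / X by rewrite -e mulrAC mulfV // mul1r.
  by field; rewrite X0 Y0.
have := poch_neq0 j h2'; have := poch_neq0 j h2.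
by move: (poch (be + _) j) (poch be j) => X Y Y0 X0; field; rewrite X0 Y0.
Qed.

End DifferenceClass.

(** * Orders of the inner terms and of the hypergeometric terms *)

Section TermBounds.
Variable R : realType.
Local Notation C := R[i].
Variables (T : Type) (D : T -> Prop) (m : nat) (a1 a2 : C) (aa bb : T -> nat -> C).
Variables (K eta : R) (Ra Rb : nat -> R).
Hypothesis eta_ge0 : 0 <= eta.
Hypothesis aK : forall t i, (i < m)%N -> D t -> nm (aa t i) <= K.
Hypothesis bK : forall t j, (j < m.+1)%N -> D t -> nm (bb t j) <= K.
Hypothesis Re_aa : forall t i, (i < m)%N -> D t -> Ra i - eta <= complex.Re (aa t i) <= Ra i + eta.
Hypothesis Re_bb : forall t j, (j < m.+1)%N -> D t -> Rb j - eta <= complex.Re (bb t j) <= Rb j + eta.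

(** [eta] is the oscillation allowed in the parameters. Every [upper_shift] varies by [2 * eta], so
    each of the [m] quotients costs [4 * eta], and the three factors of the weight cost [eta] each.
    The use of [mu / 2] instead of [mu] gives the strict inequality that [dclass_hyper] asks for. *)
Lemma iterm_bigO k (be : nat -> C) (mu : R) : (k < m.+1)%N ->
  (forall t i, (i < m)%N -> D t -> lower_shift (bb t) k i = be i) ->
  (forall i, (i < m)%N -> forall n : nat, be i != - n%:R) ->
  0 < mu -> (forall i, (i < m)%N -> mu <= Ra i) ->
  bigO D (fun t n => iterm m a1 a2 (aa t) (bb t) k n) (- 1 - (mu / 2 - (3 + 4 * m%:R) * eta)).
Proof.
move=> km hbe be_np mu0 muRa.
have upK t i : (i < m)%N -> D t -> nm (upper_shift (aa t) (bb t) k i) <= 1 + K + K.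
  move=> im Dt; rewrite /upper_shift; apply: nmD_le (aK im Dt).
  by apply: nmD_le; rewrite ?nm1 // nmN bK.
have dc m' : (m' <= m)%N -> dclass D (fun t j => \prod_(i < m') (poch (upper_shift (aa t) (bb t) k i) j / poch (be i) j))
   (1 - Rb k + mu / 2 - m'%:R * (2 * (2 * eta))).
  elim: m' => [|m' IH] m'm.
    by apply: dclass_eq (dclass_1 D _) => t j _; rewrite big_ord0.
  have {}IH := IH (ltnW m'm).
  have -> : 1 - Rb k + mu / 2 - m'.+1%:R * (2 * (2 * eta)) = 1 - Rb k + mu / 2 - m'%:R * (2 * (2 * eta)) - 2 * (2 * eta).
    by rewrite -natr1; ring.
  have h1 t : D t -> nm (upper_shift (aa t) (bb t) k m') <= 1 + K + K by move=> Dt; apply: upK.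
  have h3 t : D t -> 1 - Rb k + Ra m' - 2 * eta <= complex.Re (upper_shift (aa t) (bb t) k m') <= 1 - Rb k + Ra m' + 2 * eta.
    move=> Dt; have := Re_bb km Dt; have := Re_aa m'm Dt; rewrite /upper_shift !ReD ReN Re_1.
    move: (complex.Re _) (complex.Re _) => u v; lra.
  have h4 : 1 - Rb k + mu / 2 - m'%:R * (2 * (2 * eta)) < 1 - Rb k + Ra m' + 2 * eta.
    have := muRa m' m'm; have : 0 <= m'%:R * eta by rewrite mulr_ge0.
    have -> : m'%:R * (2 * (2 * eta)) = 4 * (m'%:R * eta) by ring.
    move: (m'%:R * eta) (Ra m') eta_ge0 mu0 => u v; lra.
  apply: dclass_eq (dclass_hyper h1 (be_np _ m'm) h3 h4 IH) => t j Dt.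
  by rewrite big_ord_recr /= mulrC.
have {dc} := dc m (leqnn m) 1.
have e0 t n : D t -> Dn (fun j => (1 : {poly C}).[j%:R] * \prod_(i < m) (poch (upper_shift (aa t) (bb t) k i) j / poch (be i) j)) n = Dn (icoef m (aa t) (bb t) k) n.
  move=> Dt; apply: eq_Dn => j; rewrite hornerC mul1r; apply: eq_bigr => i _; by rewrite hbe.
move/(bigO_eq e0) => hD.
have s1 t : D t -> nm (1 - bb t k) <= 1 + K by move=> Dt; apply: nmD_le; rewrite ?nm1 // nmN bK.
have p1 (a : C) : bigO D (fun t n => poch (1 - bb t k + a) n / n`!%:R) (complex.Re a - Rb k + eta).
  apply: (@bigO_poch _ _ _ _ (1 + K + nm a)) => t Dt; first exact: nmD_le (s1 t Dt) _.
  have := Re_bb km Dt; rewrite !ReD ReN Re_1; move: (complex.Re _) (complex.Re _) => u v; lra.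
have p3 : bigO D (fun t n => n`!%:R * rGamma (1 - bb t k + a1 + a2 + n%:R)) (Rb k + eta - complex.Re a1 - complex.Re a2).
  apply: (@bigO_rGamma _ _ _ _ (1 + K + nm a1 + nm a2)) => t Dt.
    by apply: nmD_le => //; apply: nmD_le => //; apply: s1.
  have := Re_bb km Dt; rewrite !ReD ReN Re_1; move: (complex.Re _) (complex.Re _) (complex.Re _) => u v w; lra.
have := bigOM (bigOM (bigOM (p1 a1) (p1 a2)) p3) hD.
have -> : complex.Re a1 - Rb k + eta + (complex.Re a2 - Rb k + eta) + (Rb k + eta - complex.Re a1 - complex.Re a2) - (1 - Rb k + mu / 2 - m%:R * (2 * (2 * eta)))
   = - 1 - (mu / 2 - (3 + 4 * m%:R) * eta) by ring.
apply: bigO_eq => t n _; rewrite /iterm /iweight; have := factC_neq0 R n.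
by move: (poch _ _) (poch _ _) (rGamma _) (Dn _ _) (n`!%:R : C) => x y z w f f0; field.
Qed.

Lemma Lam_bigO : bigO D (fun t s => Lam m a1 a2 (aa t) (bb t) s)
  (- (\sum_(j < m.+1) Rb j - (complex.Re a1 + complex.Re a2) - \sum_(i < m) Ra i) - 1 + (m%:R + m.+1%:R) * eta).
Proof.
have h1 : bigO D (fun t s => \prod_(i < m) (poch (aa t i) s / s`!%:R)) (\sum_(i < m) (Ra i + eta - 1)).
  have h0 (i : 'I_m) : bigO D (fun t s => poch (aa t i) s / s`!%:R) (Ra i + eta - 1).
    apply: (@bigO_poch _ _ _ _ K) => t Dt; first exact: aK.
    by have := Re_aa (ltn_ord i) Dt; move: (complex.Re _) => u; lra.
  exact: (bigO_prod (index_enum 'I_m) h0).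
have h2 : bigO D (fun t s => \prod_(j < m.+1) (s`!%:R * rGamma (bb t j + s%:R))) (\sum_(j < m.+1) (1 - Rb j + eta)).
  have h0 (j : 'I_m.+1) : bigO D (fun t s => s`!%:R * rGamma (bb t j + s%:R)) (1 - Rb j + eta).
    apply: (@bigO_rGamma _ _ _ _ K) => t Dt; first exact: bK.
    by have := Re_bb (ltn_ord j) Dt; move: (complex.Re _) => u; lra.
  exact: (bigO_prod (index_enum 'I_m.+1) h0).
have h3 (a : C) : bigO D (fun t s => poch a s / s`!%:R) (complex.Re a - 1).
  by have [B [B0 hB]] := bigo_poch a; exists B; split=> // t n _; apply: (hB tt).
have := bigOM (bigOM (bigOM (h3 a1) (h3 a2)) h1) h2.
have -> : complex.Re a1 - 1 + (complex.Re a2 - 1) + (\sum_(i < m) (Ra i + eta - 1)) + \sum_(j < m.+1) (1 - Rb j + eta)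
  = - (\sum_(j < m.+1) Rb j - (complex.Re a1 + complex.Re a2) - \sum_(i < m) Ra i) - 1 + (m%:R + m.+1%:R) * eta.
  have e1 : \sum_(i < m) (Ra i + eta - 1) = \sum_(i < m) Ra i + m%:R * (eta - 1).
    rewrite (eq_bigr (fun i : 'I_m => Ra i + (eta - 1))); last by move=> i _; rewrite addrA.
    by rewrite [LHS]big_split /= sumr_const card_ord mulr_natl.
  have e2 : \sum_(j < m.+1) (1 - Rb j + eta) = m.+1%:R * (1 + eta) - \sum_(j < m.+1) Rb j.
    rewrite (eq_bigr (fun i : 'I_m.+1 => (1 + eta) - Rb i)); last by move=> i _; rewrite addrAC.
    by rewrite sumrB sumr_const card_ord mulr_natl.
  rewrite e1 e2 -natr1; clear.
  by move: (\sum_(i < m) Ra i) (\sum_(j < m.+1) Rb j) (m%:R : R) (complex.Re a1) (complex.Re a2) => u v w x y; ring.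
apply: bigO_eq => t s _; rewrite /Lam.
have -> : \prod_(i < m) (poch (aa t i) s / s`!%:R) = (\prod_(i < m) poch (aa t i) s) / s`!%:R ^+ m.
  by rewrite prodf_div prodr_const card_ord.
have -> : \prod_(j < m.+1) (s`!%:R * rGamma (bb t j + s%:R)) = s`!%:R ^+ m * s`!%:R * \prod_(j < m.+1) rGamma (bb t j + s%:R).
  by rewrite [LHS]big_split /= prodr_const card_ord exprSr.
have := factC_neq0 R s; move: (poch a1 _) (poch a2 _) (\prod_(_ < m) _) (\prod_(_ < m.+1) _) (s`!%:R : C) => x y z w f f0.
have := expf_neq0 m f0; move: (f ^+ m) => g g0.
by field; rewrite f0 g0.
Qed.

End TermBounds.

(** * Identity principle *)

Section PolynomialApproximation.
Variable R : realType.
Local Notation C := R[i].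
Implicit Types (f g : C -> C) (z w : C) (p q : {poly C}).

Definition disc z (r : R) := fun t : C => nm (t - z) <= r.

(* Uniform limits of polynomials on a closed disc stand in for holomorphic functions. *)
Definition pappr z (r : R) f := forall e : R, 0 < e ->
  exists p, forall t, disc z r t -> nm (f t - p.[t]) <= e.

Lemma disc_center z r : 0 <= r -> disc z r z.
Proof. by move=> r0; rewrite /disc subrr nm0. Qed.

Lemma poly_bounded z r p : exists M : R, 0 <= M /\ forall t, disc z r t -> nm p.[t] <= M.
Proof.
elim/poly_ind: p => [|p c [M [M0 hM]]]; first by exists 0; split=> // t _; rewrite horner0 nm0.
exists (M * (nm z + `|r|) + nm c); split; first by rewrite addr_ge0 ?mulr_ge0 ?addr_ge0 ?nm_ge0.
move=> t Dt; rewrite !hornerE; apply: nmD_le => //; rewrite nmM; apply: ler_pM; rewrite ?nm_ge0 ?hM //.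
rewrite -[t](subrK z) addrC; apply: nmD_le => //; apply: le_trans Dt _; exact: ler_norm.
Qed.

Section Closure.
Variables (z : C) (r : R).

Lemma pappr_bounded f : pappr z r f -> exists M : R, 0 <= M /\ forall t, disc z r t -> nm (f t) <= M.
Proof.
move=> hf; have [p hp] := hf 1 ltr01; have [M [M0 hM]] := poly_bounded z r p.
exists (1 + M); split=> [|t Dt]; first by rewrite addr_ge0.
by rewrite -[f t](subrK p.[t]); apply: nmD_le; [exact: hp | exact: hM].
Qed.

Lemma pappr_eq f g : (forall t, disc z r t -> f t = g t) -> pappr z r f -> pappr z r g.
Proof. by move=> h hf e e0; have [p hp] := hf e e0; exists p => t Dt; rewrite -h // hp. Qed.

Lemma pappr_poly p : pappr z r (fun t => p.[t]).
Proof. by move=> e e0; exists p => t _; rewrite subrr nm0 ltW. Qed.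

Lemma pappr_cst c : pappr z r (fun=> c).
Proof. by apply: pappr_eq (pappr_poly c%:P) => t _; rewrite hornerC. Qed.

Lemma pappr_affine a c : pappr z r (fun t => a * t + c).
Proof. by apply: pappr_eq (pappr_poly (a *: 'X + c%:P)) => t _; rewrite !hornerE. Qed.

Lemma pappr_lim f : (forall e : R, 0 < e -> exists g, pappr z r g /\ forall t, disc z r t -> nm (f t - g t) <= e) ->
  pappr z r f.
Proof.
move=> h e e0; have e2 : 0 < e / 2 by lra.
have [g [hg fg]] := h _ e2; have [p hp] := hg _ e2; exists p => t Dt.
by apply: le_trans (nm_tri _ (g t) _) _; rewrite [e]splitr lerD ?fg ?hp.
Qed.

Lemma papprD f g : pappr z r f -> pappr z r g -> pappr z r (fun t => f t + g t).
Proof.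
move=> hf hg e e0; have e2 : 0 < e / 2 by lra.
have [p hp] := hf _ e2; have [q hq] := hg _ e2; exists (p + q) => t Dt.
rewrite hornerD opprD addrACA [e]splitr; apply: nmD_le; [exact: hp | exact: hq].
Qed.

Lemma papprM f g : pappr z r f -> pappr z r g -> pappr z r (fun t => f t * g t).
Proof.
move=> hf hg e e0.
have [M [M0 hM]] := pappr_bounded hf; have [N [N0 hN]] := pappr_bounded hg.
have e1 : 0 < e / 2 / (N + 1) by rewrite !divr_gt0 // ltr_wpDl.
have [p hp] := hf _ e1.
have [Mp [Mp0 hMp]] := poly_bounded z r p.
have e2 : 0 < e / 2 / (Mp + 1) by rewrite !divr_gt0 // ltr_wpDl.
have [q hq] := hg _ e2; exists (p * q) => t Dt.
have -> : f t * g t - (p * q).[t] = (f t - p.[t]) * g t + p.[t] * (g t - q.[t]) by rewrite hornerM; ring.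
rewrite [e]splitr; apply: nmD_le; rewrite nmM.
  apply: (@le_trans _ _ (e / 2 / (N + 1) * (N + 1))); last by rewrite divfK // gt_eqF // ltr_wpDl.
  by apply: ler_pM; rewrite ?nm_ge0 ?hp // (le_trans (hN t Dt)) // lerDl.
apply: (@le_trans _ _ ((Mp + 1) * (e / 2 / (Mp + 1)))); last by rewrite mulrC divfK // gt_eqF // ltr_wpDl.
by apply: ler_pM; rewrite ?nm_ge0 ?hq // (le_trans (hMp t Dt)) // lerDl.
Qed.

Lemma papprZ c f : pappr z r f -> pappr z r (fun t => c * f t).
Proof. exact: papprM (pappr_cst c). Qed.

Lemma papprB f g : pappr z r f -> pappr z r g -> pappr z r (fun t => f t - g t).
Proof.
move=> hf hg; apply: pappr_eq (papprD hf (papprZ (-1) hg)) => t _; by rewrite mulN1r.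
Qed.

Lemma pappr_sum (I : Type) (s : seq I) (P : pred I) (f : I -> C -> C) :
  (forall i, pappr z r (f i)) -> pappr z r (fun t => \sum_(i <- s | P i) f i t).
Proof.
move=> h; elim: s => [|i s IH].
  by apply: pappr_eq (pappr_cst 0) => t _; rewrite big_nil.
case Pi : (P i); last by apply: pappr_eq IH => t _; rewrite big_cons Pi.
by apply: pappr_eq (papprD (h i) IH) => t _; rewrite big_cons Pi.
Qed.

Lemma pappr_prod (I : Type) (s : seq I) (P : pred I) (f : I -> C -> C) :
  (forall i, pappr z r (f i)) -> pappr z r (fun t => \prod_(i <- s | P i) f i t).
Proof.
move=> h; elim: s => [|i s IH].
  by apply: pappr_eq (pappr_cst 1) => t _; rewrite big_nil.
case Pi : (P i); last by apply: pappr_eq IH => t _; rewrite big_cons Pi.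
by apply: pappr_eq (papprM (h i) IH) => t _; rewrite big_cons Pi.
Qed.

Lemma papprX f n : pappr z r f -> pappr z r (fun t => f t ^+ n).
Proof.
move=> h; apply: pappr_eq (pappr_prod (index_enum 'I_n) predT (fun=> h)) => t _.
by rewrite prodr_const card_ord.
Qed.

(** Weierstrass' test: the common majorant makes the partial sums converge uniformly on the disc. *)
Lemma pappr_csum (u : C -> nat -> C) (x : R) : x < -1 -> bigO (disc z r) u x ->
  (forall n, pappr z r (fun t => u t n)) -> pappr z r (fun t => csum (u t)).
Proof.
move=> x1 hu hn; have [g [M [hM ug]]] := bigO_bsum x1 hu.
have [r0|r0] := ltP r 0.
  by move=> e _; exists 0 => t Dt; have := le_lt_trans (le_trans (nm_ge0 (t - z)) Dt) r0; rewrite ltxx.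
have g0 n : 0 <= g n by apply: le_trans (ug z n (disc_center z r0)); apply: nm_ge0.
apply: pappr_lim => e e0; have [N hN] := bsum_tail g0 hM e0.
exists (fun t => \sum_(n < N) u t n); split; first exact: pappr_sum.
move=> t Dt; have su : summable (u t) by apply: bigO_summable x1 hu Dt.
have h := tendsB (summable_has_sum su) (tends_cst (\sum_(n < N) u t n)).
apply: tends_le h; exists N => n Nn.
have -> : \sum_(i < n) u t i - \sum_(i < N) u t i = \sum_(i < n | (N <= i)%N) u t i.
  apply/eqP; rewrite subr_eq; apply/eqP.
  rewrite (bigID (fun i : 'I_n => (N <= i)%N)) /=; congr (_ + _).
  rewrite (big_ord_widen _ _ Nn) /=; apply: eq_bigl => i; by rewrite -ltnNge.
apply: le_trans (nm_sum _ _ _) _; apply: ltW; have := hN n; apply: le_lt_trans.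
by apply: ler_sum => i _; apply: ug.
Qed.

Lemma pappr_cexp f : pappr z r f -> pappr z r (fun t => cexp (f t)).
Proof.
move=> hf; have [M [M0 hM]] := pappr_bounded hf.
apply: pappr_lim => e e0.
have [N hN] := null_inv (8 * M ^+ 2 * expR M) e0; have [N' hN'] := archi_nat (2 * M).
pose n := maxn N N'.
exists (fun t => (1 + f t / n.+1%:R) ^+ n.+1); split.
  apply: papprX; apply: papprD; first exact: pappr_cst.
  by apply: pappr_eq (papprZ (n.+1%:R^-1) hf) => t _; rewrite mulrC.
move=> t Dt; have ft := hM t Dt.
apply: (@le_trans _ _ (8 * nm (f t) ^+ 2 * expR (nm (f t)) / n.+1%:R)).
  apply: cexp_power_approx; apply: (@le_trans _ _ (2 * M)); first by rewrite ler_wpM2l.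
  by apply: ltW; apply: lt_le_trans hN' _; rewrite ler_nat leqW // leq_maxr.
apply: le_trans _ (ltW (hN n (leq_maxl _ _))); rewrite ler_wpM2r ?invr_ge0 //.
by apply: ler_pM; rewrite ?mulr_ge0 ?exprn_ge0 ?nm_ge0 ?expR_ge0 ?ler_expR // ler_wpM2l // lerXn2r ?nnegrE ?nm_ge0.
Qed.

Lemma pappr_poch f n : pappr z r f -> pappr z r (fun t => poch (f t) n).
Proof. by move=> hf; apply: pappr_prod => i; apply: papprD hf _; apply: pappr_cst. Qed.

(** Gauss' quotient at a large fixed index equals [rGamma / qgam], and [qgam] is uniformly close to
    [1]. *)
Lemma pappr_rGamma f : pappr z r f -> pappr z r (fun t => rGamma (f t)).
Proof.
move=> hf; have [K [K0 hK]] := pappr_bounded hf.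
have [B [B0 hB]] := rGamma_bound K0; have [C0 [N0 [C00 hN0]]] := qgam_near1 K0.
apply: pappr_lim => e e0.
have e1 : 0 < Num.min (1/2) (e / (2 * B + 1)).
  by rewrite lt_min divr_gt0 //= divr_gt0 // ltr_wpDl // mulr_ge0.
have [N hN] := null_inv C0 e1; pose n := maxn N N0.
exists (fun t => poch (f t) n.+1 * (n`!%:R^-1 * cexp (- (ln n.+1%:R)%:C * f t))); split.
  by apply: papprM; [exact: pappr_poch | apply: papprZ; apply: pappr_cexp; exact: papprZ].
move=> t Dt; have ft := hK t Dt.
have q1 := hN0 n (f t) (leq_maxr _ _) ft.
have := hN n (leq_maxl _ _); rewrite lt_min => /andP[h1 h2].
have q2 : nm (qgam n (f t) - 1) <= 1/2 by apply: le_trans q1 (ltW h1).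
have q3 : nm (qgam n (f t) - 1) <= e / (2 * B + 1) by apply: le_trans q1 (ltW h2).
have q4 : 1/2 <= nm (qgam n (f t)).
  have := nm_subr_ge 1 (1 - qgam n (f t)); rewrite subKr nm1 nmB; lra.
have q0 : qgam n (f t) != 0 by rewrite -nm_gt0; lra.
have -> : poch (f t) n.+1 * (n`!%:R^-1 * cexp (- (ln n.+1%:R)%:C * f t)) = rGamma (f t) / qgam n (f t).
  rewrite (poch_qgam q0) mulNr cexpN -/(npow n (f t)).
  by have := npow_neq0 n (f t); have := factC_neq0 R n; move: (npow _ _) (n`!%:R : C) (qgam _ _) q0 => x y w q0 y0 x0; field; rewrite x0 y0 q0.
have -> : rGamma (f t) - rGamma (f t) / qgam n (f t) = rGamma (f t) * (qgam n (f t) - 1) / qgam n (f t).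
  by move: (rGamma _) (qgam _ _) q0 => x y y0; field.
rewrite nmf_div nmM ler_pdivrMr; last by rewrite nm_gt0.
apply: (@le_trans _ _ (B * (e / (2 * B + 1)))).
  by apply: ler_pM; rewrite ?nm_ge0 ?hB.
apply: (@le_trans _ _ (e * (1/2))); last by rewrite ler_wpM2l // ltW.
rewrite mulrA ler_pdivrMr; last by rewrite ltr_wpDl // mulr_ge0.
by clear - e0 B0; nra.
Qed.

End Closure.

(* Discrete Cauchy formula: average over the N-th roots of unity, with [N] above the degree. *)
Lemma coef_bound (q : {poly C}) (r M : R) : 0 < r -> (forall t, nm t <= r -> nm q.[t] <= M) ->
  forall k, nm q`_k * r ^+ k <= M.
Proof.
move=> r0 hM k.
have M0 : 0 <= M by apply: le_trans (hM 0 _); rewrite ?nm_ge0 // nm0 ltW.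
have [kq|kq] := ltnP k (size q); last by rewrite nth_default // nm0 mul0r.
pose N := size q; have N0 : (0 < N)%N by apply: leq_ltn_trans kq.
have NC : (N%:R : C) != 0 by rewrite pnatr_eq0 -lt0n.
have term (j i : nat) : omega R N ^+ (j * (N - k)) * (q`_i * (r%:C * omega R N ^+ j) ^+ i) = q`_i * r%:C ^+ i * omega R N ^+ (j * (N - k + i)).
  have -> : (r%:C * omega R N ^+ j) ^+ i = r%:C ^+ i * omega R N ^+ (j * i) by rewrite exprMn exprM.
  rewrite mulnDr exprD; move: (omega R N ^+ (j * i)) (omega R N ^+ _) (r%:C ^+ i) (q`_i) => a b c d; ring.
have e : \sum_(j < N) omega R N ^+ (j * (N - k)) * q.[r%:C * omega R N ^+ j] = N%:R * (q`_k * r%:C ^+ k).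
  rewrite (eq_bigr (fun j : 'I_N => \sum_(i < N) q`_i * r%:C ^+ i * omega R N ^+ (j * (N - k + i)))); last first.
    by move=> j _; rewrite horner_coef mulr_sumr; apply: eq_bigr => i _; apply: term.
  rewrite exchange_big /= (bigD1 (Ordinal kq)) //= [X in _ + X]big1 ?addr0.
    rewrite (eq_bigr (fun=> q`_k * r%:C ^+ k)) ?sumr_const ?card_ord ?mulr_natl // => j _.
    by rewrite subnK ?(ltnW kq) // mulnC exprM (prim_expr_order (omega_prim R N0)) expr1n mulr1.
  move=> i ik; rewrite -mulr_sumr omega_sum ?mulr0 //.
  apply: contra ik => /dvdnP[c ec]; apply/eqP/val_inj => /=.
  have : ((N + i) %% N = (c * N + k) %% N)%N by rewrite -ec addnAC subnK // ltnW.
  by rewrite modnDl modnMDl !modn_small ?ltn_ord.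
have NR : (0 : R) < N%:R by rewrite ltr0n.
rewrite -(ler_pM2l NR) -{1}(nm_nat R N) -[r ^+ k]ger0_norm ?exprn_ge0 ?(ltW r0) // -nm_real rmorphXn -!nmM -e.
apply: le_trans (nm_sum _ _ _) _; rewrite -[N in leRHS]card_ord mulr_natl -sumr_const.
apply: ler_sum => j _; rewrite nmM nm_omegaX mul1r; apply: hM.
by rewrite nmM nm_omegaX mulr1 nm_real gtr0_norm.
Qed.

Lemma pappr_shrink z z' r r' f : nm (z' - z) + r' <= r -> pappr z r f -> pappr z' r' f.
Proof.
move=> h hf e e0; have [p hp] := hf e e0; exists p => t Dt; apply: hp.
by apply: le_trans (nm_tri _ z' _) _; apply: le_trans h; rewrite addrC lerD2l.
Qed.

Lemma bsum_half : bsum (fun i => (1 / 2 : R) ^+ i) 2.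
Proof.
move=> n; have -> : \sum_(i < n) (1 / 2 : R) ^+ i = 2 - 2 * (1 / 2) ^+ n.
  elim: n => [|n IH]; first by rewrite big_ord0 expr0; ring.
  by rewrite big_ord_recr /= IH exprS; field.
by rewrite lerBlDr lerDl mulr_ge0 // exprn_ge0.
Qed.

Lemma sum_trunc_le (g : nat -> R) n K : (forall i, 0 <= g i) ->
  \sum_(i < n | ~~ (K <= i)%N) g i <= \sum_(i < K) g i.
Proof.
move=> g0; have [Kn|nK] := leqP K n.
  by rewrite (big_ord_widen n g Kn) le_eqVlt; apply/orP; left; apply/eqP; apply: eq_bigl => i; rewrite ltnNge.
apply: (@le_trans _ _ (\sum_(i < n) g i)).
  by rewrite big_mkcond; apply: ler_sum => i _; case: ifP.
by rewrite -(subnKC (ltnW nK)) big_split_ord lerDl sumr_ge0.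
Qed.

(** A polynomial close to [f] is tiny on the small disc and bounded on the large one. The first fact
    makes any fixed number of low coefficients small; the second leaves a geometric tail at half the
    radius. *)
Lemma pappr_identity z r rho f : 0 < rho -> 0 < r -> pappr z r f ->
  (forall t, disc z rho t -> f t = 0) -> forall t, disc z (r / 2) t -> f t = 0.
Proof.
move=> rho0 r0 hf f0 t Dt; have [M [M0 hM]] := pappr_bounded hf.
pose s := Num.min rho r; have s0 : 0 < s by rewrite lt_min rho0.
apply/eqP; rewrite -nm_eq0 eq_le nm_ge0 andbT; apply/ler_addgt0Pr => e e0; rewrite add0r.
have M1 : 0 < M + 1 by rewrite ltr_wpDl.
have e4 : 0 < e / 4 / (M + 1) by rewrite !divr_gt0.
have [K hK] := bsum_tail (fun i => exprn_ge0 i (divr_ge0 ler01 (ler0n R 2))) bsum_half e4.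
(* The cost of passing from radius [s] to radius [r] in the first [K] coefficients; [d] is chosen
   afterwards to compensate for it. *)
pose A := \sum_(i < K) (r / s) ^+ i.
have A0 : 0 <= A by apply: sumr_ge0 => i _; rewrite exprn_ge0 // divr_ge0 // ltW.
pose d := Num.min 1 (e / 4 / (A + 1)).
have A1 : 0 < A + 1 by rewrite ltr_wpDl.
have d0 : 0 < d by rewrite lt_min ltr01 !divr_gt0.
have [p hp] := hf d d0; pose q := p \Po ('X + z%:P).
have qE h : q.[h] = p.[h + z] by rewrite horner_comp !hornerE.
have disch h x : nm h <= x -> disc z x (h + z) by rewrite /disc addrK.
have q1 h : nm h <= r -> nm q.[h] <= M + 1.
  move=> hr; rewrite qE -[p.[_]](subKr (f (h + z))) addrC [leRHS]addrC.
  apply: nmD_le; last by apply: hM; apply: disch.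
  rewrite nmN; apply: le_trans (hp _ (disch _ _ hr)) _; by rewrite ge_min lexx.
have q2 h : nm h <= s -> nm q.[h] <= d.
  rewrite le_min => /andP[h1 h2]; rewrite qE -[p.[_]](subKr (f (h + z))) f0; last exact: disch.
  by rewrite sub0r nmN -{1}(f0 _ (disch _ _ h1)); apply: hp; apply: disch.
have c1 := coef_bound r0 q1; have c2 := coef_bound s0 q2.
pose h := t - z; have hr : nm h <= r / 2 by [].
have qh : nm q.[h] <= d * A + (M + 1) * (e / 4 / (M + 1)).
  rewrite horner_coef; apply: le_trans (nm_sum _ _ _) _.
  rewrite (bigID (fun i : 'I_(size q) => (K <= i)%N)) /= addrC.
  apply: lerD; last first.
    apply: (@le_trans _ _ ((M + 1) * \sum_(i < size q | (K <= i)%N) (1 / 2) ^+ i)); last first.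
      by rewrite ler_wpM2l ?(ltW M1) // ltW // hK.
    rewrite mulr_sumr; apply: ler_sum => i _; rewrite nmM nmX.
    apply: le_trans _ (ler_wpM2r (exprn_ge0 i (divr_ge0 ler01 (ler0n R 2))) (c1 i)).
    rewrite -mulrA -exprMn ler_wpM2l ?nm_ge0 // lerXn2r ?nnegrE ?nm_ge0 //.
      by rewrite mulr_ge0 ?divr_ge0 // ltW.
    by rewrite mul1r.
  apply: (@le_trans _ _ (\sum_(i < size q | ~~ (K <= i)%N) d * (r / s) ^+ i)).
    apply: ler_sum => i _; rewrite nmM nmX.
    have si : 0 < s ^+ i by rewrite exprn_gt0.
    apply: (@le_trans _ _ (d / s ^+ i * r ^+ i)).
      apply: ler_pM; rewrite ?nm_ge0 ?exprn_ge0 ?nm_ge0 //; first by rewrite ler_pdivlMr.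
      rewrite lerXn2r ?nnegrE ?nm_ge0 ?(ltW r0) // (le_trans hr) // ler_pdivrMr // ler_peMr ?(ltW r0) //.
      by rewrite ler1n.
    by rewrite expr_div_n mulrAC mulrA.
  rewrite -mulr_sumr ler_wpM2l ?(ltW d0) //.
  by apply: sum_trunc_le => i; rewrite exprn_ge0 // divr_ge0 // ltW.
have tE : q.[h] = p.[t] by rewrite qE subrK.
have Dr : disc z r t by apply: le_trans Dt _; rewrite ler_pdivrMr // ler_peMr ?(ltW r0) // ler1n.
rewrite -[f t](subrK p.[t]) -tE.
apply: (@le_trans _ _ (d + (d * A + (M + 1) * (e / 4 / (M + 1))))); first by apply: nmD_le => //; rewrite tE; apply: hp.
have d1 : d * (A + 1) <= e / 4 by rewrite -ler_pdivlMr // ge_min lexx orbT.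
have -> : (M + 1) * (e / 4 / (M + 1)) = e / 4 by rewrite mulrC divfK // gt_eqF.
by clear - d1 e0; lra.
Qed.

(** A connectedness argument on the supremum [x] of the lengths for which [f] vanishes near every
    point of [[1 - x, 1]]. *)
Lemma segment_continuation (f : C -> C) :
  (forall s : R, 0 <= s <= 1 -> exists r : R, 0 < r /\ pappr s%:C r f) ->
  (exists rho : R, 0 < rho /\ forall t, disc 1 rho t -> f t = 0) -> f 0 = 0.
Proof.
move=> hf [rho1 [rho10 f1]].
pose Z (u : R) := exists rho : R, 0 < rho /\ forall t, disc u%:C rho t -> f t = 0.
pose E : set R := [set x : R | 0 <= x <= 1 /\ forall u, 1 - x <= u <= 1 -> Z u]%classic.
have E0 : E 0.
  split=> [|u]; first by rewrite lexx ler01.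
  rewrite subr0 => /andP[h1' h2']; have -> : u = 1.
    by apply: le_anti; rewrite h2' h1'.
  by exists rho1.
have hsup : has_sup E by split; [exists 0 | exists 1 => x [/andP[_]]].
have x0 : 0 <= sup E by apply: ub_le_sup => //; case: hsup.
have x1 : sup E <= 1 by apply: sup_le_ub; [exists 0 | move=> x [/andP[_]]].
set x := sup E in x0 x1.
have s01 : 0 <= 1 - x <= 1 by rewrite subr_ge0 x1 lerBlDr lerDl.
have [r [r0 hr]] := hf _ s01.
(* Some [1 - y] lies within [r / 8] of the critical point. Around it [f] is approximable on radius
   [r / 2], hence vanishes on radius [r / 4]: enough for an advance by [r / 8] with discs of radius
   [r / 8]. *)
have r8 : 0 < r / 8 by rewrite divr_gt0.
have [y [y01 Ey] xy] := sup_adherent r8 hsup; rewrite -/x in xy.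
have yx : y <= x by apply: ub_le_sup; [case: hsup | split].
case/andP: y01 => y0 y1.
have [rho [rho0 hrho]] : Z (1 - y) by apply: Ey; rewrite lexx lerBlDr lerDl.
have h2 : pappr (1 - y)%:C (r / 2) f.
  apply: pappr_shrink hr; rewrite -rcB nm_real; have -> : 1 - y - (1 - x) = x - y by ring.
  by rewrite ger0_norm ?subr_ge0 //; lra.
have r2 : 0 < r / 2 by rewrite divr_gt0.
have h4 := pappr_identity rho0 r2 h2 hrho.
have Zu u : 1 - (y + r / 8) <= u -> u <= 1 -> Z u.
  move=> uy u1; have [uy'|uy'] := leP (1 - y) u; first by apply: Ey; rewrite uy'.
  exists (r / 8); split=> // t Dt; apply: h4; apply: le_trans (nm_tri _ u%:C _) _.
  apply: (@le_trans _ _ (r / 8 + r / 8)); last by lra.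
  by apply: lerD => //; rewrite -rcB nm_real distrC ger0_norm ?subr_ge0 ?(ltW uy') //; lra.
have [y8|y8] := leP 1 (y + r / 8).
  have [rho' [rho'0 h]] : Z 0 by apply: Zu => //; lra.
  by apply: h; rewrite /disc subrr nm0 ltW.
suff : y + r / 8 <= x by move=> h; exfalso; move: h xy; lra.
apply: ub_le_sup; first by case: hsup.
split=> [|u /andP[u0 u1]]; last exact: Zu.
by rewrite addr_ge0 ?(ltW r8) // ltW.
Qed.

End PolynomialApproximation.

(** * Restriction of an analytic function to a complex line *)

Section AnalyticAlongLine.
Variable R : realType.
Local Notation C := R[i].

Definition psum (V : nmodType) m (G : {ffun 'I_m -> nat} -> V) N : V :=
  \sum_(f : {ffun 'I_m -> 'I_N}) G [ffun i => f i : nat].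

Lemma psum_split (V : nmodType) m (G : {ffun 'I_m -> nat} -> V) N N' : (N <= N')%N ->
  psum G N' = psum G N
    + \sum_(f : {ffun 'I_m -> 'I_N'} | ~~ [forall i, (f i < N)%N]) G [ffun i => f i : nat].
Proof.
move=> NN'; rewrite /psum (bigID (fun f : {ffun 'I_m -> 'I_N'} => [forall i, (f i < N)%N])) /=; congr (_ + _).
pose h (f : {ffun 'I_m -> 'I_N}) : {ffun 'I_m -> 'I_N'} := [ffun i => widen_ord NN' (f i)].
have hi : injective h.
  by move=> f g /ffunP e; apply/ffunP => i; have := e i; rewrite !ffunE => /(congr1 val) /= /val_inj.
transitivity (\sum_(f in h @: [set: {ffun 'I_m -> 'I_N}]) G [ffun i => f i : nat]).
  apply: eq_bigl => f; apply/idP/imsetP => [/forallP Pf|[g _ ->]].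
    exists [ffun i => Ordinal (Pf i)] => //; apply/ffunP => i; apply: val_inj.
    by rewrite !ffunE.
  by apply/forallP => i; rewrite ffunE /=.
rewrite big_imset /=; last by move=> f g _ _; apply: hi.
apply: eq_big => [f|f _]; first by rewrite inE.
by congr G; apply/ffunP => i; rewrite !ffunE.
Qed.

Lemma bounded_monotone_tail (A : nat -> R) (M : R) : (forall n n', (n <= n')%N -> A n <= A n') ->
  (forall n, A n <= M) -> forall e : R, 0 < e -> exists N, forall n, (N <= n)%N -> A n - A N <= e.
Proof.
move=> mA hA e e0; pose E : set R := range A.
have hs : has_sup E by split; [exists (A 0%N), 0%N | exists M => _ [n _ <-]].
have [_ [N _ <-] hN] := sup_adherent e0 hs; exists N => n _.
have : A n <= sup E by apply: ub_le_sup; [case: hs | exists n].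
by move: hN; lra.
Qed.

(** The partial sums over cubes of indices are polynomials in [t], and their tails are bounded by
    those of the majorant. The factor [2] in the radius gives the strict inequality required by
    [analytic_at]. *)
Lemma analytic_line m (f : 'rV[C]_m -> C) (z v : 'rV[C]_m) (t0 : C) : analytic_at f z ->
  exists r : R, 0 < r /\ pappr t0 r (fun t => f (z + (t - t0) *: v)).
Proof.
move=> [c [r [M [r0 hM hc]]]].
have rE : r = (complex.Re r)%:C by case: r r0 {hM hc} => x y; rewrite ltcE /= => /andP[/eqP -> _].
move: r0 hM hc; rewrite rE; set x := complex.Re r => x0 hM hc.
have {}x0 : 0 < x by move: x0; rewrite ltcR.
pose A N := psum (fun k : {ffun 'I_m -> nat} => nm (c k) * \prod_(i < m) x ^+ k i) N.
have AE N : mpsum (fun k => `|c k|) (const_mx x%:C) N = (A N)%:C.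
  rewrite /mpsum /A /psum rmorph_sum; apply: eq_bigr => g _ /=.
  rewrite nmE rcM rmorph_prod; congr (_ * _); apply: eq_bigr => i _.
  by rewrite mxE ffunE rmorphXn.
have G0 (g : {ffun 'I_m -> nat}) : 0 <= nm (c g) * \prod_(i < m) x ^+ g i.
  by rewrite mulr_ge0 ?nm_ge0 // prodr_ge0 // => i _; rewrite exprn_ge0 // ltW.
have mA n n' : (n <= n')%N -> A n <= A n'.
  by move=> nn'; rewrite /A (psum_split _ nn') lerDl sumr_ge0.
have AM N : A N <= complex.Re M by have := hM N; rewrite AE lecE => /andP[].
pose V := \sum_(i < m) nm (v 0 i) + 1.
have V0 : 0 < V by rewrite ltr_wpDl // sumr_ge0 // => i _; apply: nm_ge0.
have vV i : nm (v 0 i) <= V.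
  by rewrite /V (bigD1 i) //= -addrA lerDl addr_ge0 // sumr_ge0 // => j _; apply: nm_ge0.
exists (x / (2 * V)); split; first by rewrite divr_gt0 // mulr_gt0.
have hx t : disc t0 (x / (2 * V)) t -> forall i, nm (((t - t0) *: v) 0 i) <= x / 2.
  move=> Dt i; rewrite mxE nmM; apply: (@le_trans _ _ (x / (2 * V) * V)).
    by apply: ler_pM; rewrite ?nm_ge0.
  by rewrite invfM mulrA divfK // gt_eqF.
apply: pappr_lim => e e0; have [N hN] := bounded_monotone_tail mA AM e0.
exists (fun t => mpsum c ((t - t0) *: v) N); split.
  apply: pappr_sum => g; apply: papprZ; apply: pappr_prod => i; apply: papprX.
  apply: pappr_eq (pappr_affine _ _ (v 0 i) (- (t0 * v 0 i))) => t _.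
  by rewrite mxE mulrBl mulrC.
move=> t Dt; have h1 := hx t Dt; set h := (t - t0) *: v in h1 *.
have hh : forall i, `|h 0 i| < x%:C.
  by move=> i; rewrite nmE ltcR; apply: le_lt_trans (h1 i) _; rewrite ltr_pdivrMr // ltr_pMr // ltr1n.
have /tends_cvg ht := hc h hh.
have := tendsB ht (tends_cst (mpsum c h N)); apply: tends_le; exists N => n Nn.
apply: le_trans _ (hN n Nn).
have mE n' : mpsum c h n' = psum (fun k => c k * \prod_(i < m) h 0 i ^+ k i) n'.
  by apply: eq_bigr => g _; congr (_ * _); apply: eq_bigr => i _; rewrite ffunE.
rewrite !mE (psum_split _ Nn) addrAC subrr add0r /A (psum_split _ Nn) addrAC subrr add0r.
apply: le_trans (nm_sum _ _ _) _; apply: ler_sum => g _.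
rewrite nmM ler_wpM2l ?nm_ge0 // nm_prod; apply: ler_prod => i _; rewrite nm_ge0 nmX /=.
by rewrite lerXn2r ?nnegrE ?nm_ge0 ?(ltW x0) // (le_trans (h1 i)) // ler_pdivrMr // ler_peMr ?(ltW x0) // ler1n.
Qed.

End AnalyticAlongLine.

Section Convergence.
Variable R : realType.
Local Notation C := R[i].
Variables (m : nat) (a1 a2 : C) (aa bb : nat -> C).

Lemma positive_lower_bound (n : nat) (f : nat -> R) : (forall i, (i < n)%N -> 0 < f i) ->
  exists mu : R, 0 < mu /\ forall i, (i < n)%N -> mu <= f i.
Proof.
elim: n => [|n IH] h; first by exists 1.
have [|mu [mu0 hmu]] := IH; first by move=> i /ltnW; apply: h.
exists (Num.min mu (f n)); split=> [|i]; first by rewrite lt_min mu0 h.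
by rewrite ltnS leq_eqVlt ge_min => /orP[/eqP ->|/hmu ->]; rewrite ?lexx ?orbT.
Qed.

Lemma nm_common_bound n (f : nat -> C) i : (i < n)%N -> nm (f i) <= \sum_(j < n) nm (f j).
Proof.
by move=> h; rewrite (bigD1 (Ordinal h)) //= lerDl sumr_ge0 // => j _; apply: nm_ge0.
Qed.

Let K : R := \sum_(i < m) nm (aa i) + \sum_(j < m.+1) nm (bb j).

Let aK (t : unit) i : (i < m)%N -> True -> nm (aa i) <= K.
Proof.
move=> im _; apply: le_trans (nm_common_bound aa im) _.
by rewrite lerDl sumr_ge0 // => j _; apply: nm_ge0.
Qed.

Let bK (t : unit) i : (i < m.+1)%N -> True -> nm (bb i) <= K.
Proof.
move=> im _; apply: le_trans (nm_common_bound bb im) _.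
by rewrite lerDr sumr_ge0 // => j _; apply: nm_ge0.
Qed.

Lemma iterm_summable_gen (k : 'I_m.+1) : bsep m bb -> (forall i : 'I_m, 0 < complex.Re (aa i)) ->
  summable (iterm m a1 a2 aa bb k).
Proof.
move=> hb ha; have [|mu [mu0 hmu]] := @positive_lower_bound m (fun i => complex.Re (aa i)).
  by move=> i im; apply: (ha (Ordinal im)).
have := @iterm_bigO R unit (fun=> True) m a1 a2 (fun=> aa) (fun=> bb) K 0 (fun i => complex.Re (aa i))
  (fun j => complex.Re (bb j)) (lexx 0) aK bK.
have e (w : C) : complex.Re w - 0 <= complex.Re w <= complex.Re w + 0 by rewrite subr0 addr0 lexx.
move=> /(_ (fun _ _ _ _ => e _) (fun _ _ _ _ => e _) k (lower_shift bb k) mu (ltn_ord k) (fun _ _ _ _ => erefl)).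
move=> /(_ (fun i im n => lower_shift_npole k (Ordinal im) hb n) mu0 hmu) h.
by apply: (@bigO_summable _ _ _ _ _ tt _ h I); rewrite mulr0 subr0 gtrDl oppr_lt0 divr_gt0.
Qed.

Lemma Lam_summable_gen : 0 < complex.Re (nu_of m a1 a2 aa bb) -> summable (Lam m a1 a2 aa bb).
Proof.
move=> hnu.
have := @Lam_bigO R unit (fun=> True) m a1 a2 (fun=> aa) (fun=> bb) K 0 (fun i => complex.Re (aa i))
  (fun j => complex.Re (bb j)) aK bK.
have e (w : C) : complex.Re w - 0 <= complex.Re w <= complex.Re w + 0 by rewrite subr0 addr0 lexx.
move=> /(_ (fun _ _ _ _ => e _) (fun _ _ _ _ => e _)) h.
apply: (@bigO_summable _ _ _ _ _ tt _ h I).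
move: hnu; rewrite /nu_of !ReD !ReN !ReD !Re_sum mulr0 addr0.
by move: (\sum_(_ < m.+1) _) (\sum_(_ < m) _) => u v w; lra.
Qed.

End Convergence.

(** * Continuation along a line *)

Section NearOne.
Variable R : realType.
Local Notation C := R[i].
Implicit Types (P Q : C -> Prop).

Definition near1 P := exists rho : R, 0 < rho /\ forall t, disc (1 : C) rho t -> P t.

Lemma near1_and P Q : near1 P -> near1 Q -> near1 (fun t => P t /\ Q t).
Proof.
move=> [r [r0 hr]] [s [s0 hs]]; exists (Num.min r s); split; first by rewrite lt_min r0.
by move=> t; rewrite /disc le_min => /andP[h1 h2]; split; [apply: hr | apply: hs].
Qed.

Lemma near1_imp P Q : (forall t, P t -> Q t) -> near1 P -> near1 Q.
Proof. by move=> h [r [r0 hr]]; exists r; split=> // t /hr/h. Qed.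

Lemma near1_all n (P : nat -> C -> Prop) : (forall i : 'I_n, near1 (P i)) -> near1 (fun t => forall i : 'I_n, P i t).
Proof.
elim: n => [|n IH] h; first by exists 1; split=> // t _ [].
have := near1_and (h ord_max) (IH (fun i => h (widen_ord (leqnSn n) i))); apply: near1_imp => t [h1 h2] i.
have [e|ne] := eqVneq (i : nat) n; first by rewrite e.
have lt : (i < n)%N by rewrite ltn_neqAle ne -ltnS ltn_ord.
exact: (h2 (Ordinal lt)).
Qed.

Lemma near1_Re (a c : C) (x : R) : x < complex.Re (a + c) -> near1 (fun t => x < complex.Re (a * t + c)).
Proof.
move=> h; have d0 : 0 < complex.Re (a + c) - x by rewrite subr_gt0.
have a1 : 0 < nm a + 1 by rewrite ltr_wpDl ?nm_ge0.
exists ((complex.Re (a + c) - x) / 2 / (nm a + 1)); split; first by rewrite !divr_gt0.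
move=> t Dt; have : nm (a * (t - 1)) <= (complex.Re (a + c) - x) / 2.
  rewrite nmM; apply: (@le_trans _ _ ((nm a + 1) * ((complex.Re (a + c) - x) / 2 / (nm a + 1)))).
    by apply: ler_pM; rewrite ?nm_ge0 ?lerDl.
  by rewrite mulrC divfK // gt_eqF.
have -> : a * t + c = a * (t - 1) + (a + c) by ring.
move=> /Re_bound; rewrite ler_norml (ReD (a * (t - 1)) (a + c)); move: (complex.Re (a + c)) (complex.Re (a * _)) d0 => u v *; lra.
Qed.

(** A nonzero imaginary part is an open condition that excludes all integers at once; a factor ['i]
    or [- 'i] turns it into a condition on real parts. *)
Lemma near1_nonint (a c : C) : complex.Im (a + c) != 0 ->
  near1 (fun t => forall n : int, a * t + c != n%:~R).
Proof.
have ReiN (w : C) : complex.Re (- 'i * w : C) = complex.Im w by case: w => x y; rewrite /=; ring.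
have Reip (w : C) : complex.Re ('i * w : C) = - complex.Im w by case: w => x y; rewrite /=; ring.
have Imz (n : int) : complex.Im (n%:~R : C) = 0 by rewrite -(rmorph_int (@real_complex R)).
rewrite neq_lt => /orP[h|h].
  have : 0 < complex.Re ('i * a + 'i * c : C) by rewrite -mulrDr Reip oppr_gt0.
  move/near1_Re; apply: near1_imp => t; rewrite -mulrA -mulrDr Reip => h' n; apply: contraTneq h' => ->.
  by rewrite Imz oppr0 ltxx.
have : 0 < complex.Re (- 'i * a + - 'i * c : C) by rewrite -mulrDr ReiN.
move/near1_Re; apply: near1_imp => t; rewrite -mulrA -mulrDr ReiN => h' n; apply: contraTneq h' => ->.
by rewrite Imz ltxx.
Qed.

(** Each of the finitely many conditions excludes at most one [l], so the pigeonhole principle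
    leaves one over. *)
Lemma avoid (I : finType) (P : I -> nat -> Prop) :
  (forall i l l', P i l -> P i l' -> l = l') -> exists l, forall i, ~ P i l.
Proof.
move=> h; apply: contrapT => no.
have ex l : exists i, P i l.
  apply: contrapT => hl; apply: no; exists l => i Pi; apply: hl; by exists i.
have [f hf] := choice ex.
have finj : injective (fun l : 'I_(#|I|.+1) => f l).
  by move=> l l' e; apply: val_inj; apply: h (hf l) _; rewrite e; apply: hf.
by have := leq_card _ finj; rewrite card_ord ltnn.
Qed.

End NearOne.

(** * Choice of a generic line *)

Section GoodLine.
Variable R : realType.
Local Notation C := R[i].
Variables (m : nat) (a1 a2 : C) (aa bb : nat -> C).

(** For real [t] the real parts of the [a_i] do not move, and with them the convergence of the inner
    series. The factor [i.+1] makes the slopes distinct. *)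
Definition aline (th : R) (t : C) i : C := aa i + ('i * (th * i.+1%:R)%:C) * t.
Definition bline (om : C) (t : C) j : C := bb j + om * t.

Definition good_near1 th om := near1 (fun t => [/\
    forall (i : 'I_m) (j : 'I_m.+1), 1 < complex.Re (bline om t j - aline th t i),
    forall i j : 'I_m, i != j -> forall n : int, aline th t i - aline th t j != n%:~R,
    forall (i : 'I_m) (k : 'I_m.+1) (n : int), bline om t k - aline th t i != n%:~R,
    forall i : 'I_m, 0 < complex.Re (aline th t i)
  & forall k : 'I_m.+1, exists M : nat, M%:R < complex.Re (1 + bline om t k - a1 - a2) < M.+1%:R] /\
    0 < complex.Re (nu_of m a1 a2 (aline th t) (bline om t))).

(** The first two clauses keep the segment in the domain of the continuation; the third keeps the
    hypergeometric series convergent along it if it converges at [s = 0]. *)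
Definition avoids_poles th om := forall s : R, 0 <= s <= 1 ->
  [/\ forall (j : 'I_m.+1) (n : nat), bline om s%:C j != - n%:R,
      forall n : nat, nu_of m a1 a2 (aline th s%:C) (bline om s%:C) != - n%:R
    & complex.Re (nu_of m a1 a2 aa bb) <= complex.Re (nu_of m a1 a2 (aline th s%:C) (bline om s%:C))].

Lemma nu_lineE th om t : nu_of m a1 a2 (aline th t) (bline om t) =
  (m.+1%:R * om - \sum_(i < m) 'i * (th * i.+1%:R)%:C) * t + nu_of m a1 a2 aa bb.
Proof.
rewrite /nu_of /aline /bline !big_split /= -!mulr_suml sumr_const card_ord -mulr_natl.
move: (\sum_(_ < _) _) (\sum_(_ < _) _) (\sum_(_ < _) _) => *; ring.
Qed.

(* The imaginary slope [h] of [om] is smaller than every nonzero [`|Im b_j|], and [(m + 1) h]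
   than [`|Im nu|] when this is nonzero: hence [b_j] and [nu] are real on the segment at most at
   [s = 0]. The slopes of the [a_i] and the real part of [om] are chosen outside
   finitely many bad values, for genericity at [t = 1]. *)
Lemma good_line : (forall i : 'I_m, 0 < complex.Re (aa i)) ->
  (forall (j : 'I_m.+1) (n : nat), bb j != - n%:R) -> (forall n : nat, nu_of m a1 a2 aa bb != - n%:R) ->
  exists th om, good_near1 th om /\ avoids_poles th om.
Proof.
move=> ha hb hnu.
pose nz (x : R) := if x == 0 then 1 else `|x|.
have nz0 x : 0 < nz x by rewrite /nz; case: eqVneq => // xn; rewrite normr_gt0.
have [h1 [h10 hh1]] := @positive_lower_bound R m.+1 (fun j => nz (complex.Im (bb j))) (fun j _ => nz0 _).
pose nu0 := nu_of m a1 a2 aa bb.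
pose h := Num.min h1 (nz (complex.Im nu0) / m.+1%:R) / 2.
have m1 : (0 : R) < m.+1%:R by rewrite ltr0n.
have h0 : 0 < h by rewrite divr_gt0 // lt_min h10 divr_gt0.
have hlt1 : h < h1 by rewrite /h ltr_pdivrMr // ; apply: (@le_lt_trans _ _ h1); [rewrite ge_min lexx | rewrite ltr_pMr // ltr1n].
have hlt2 : m.+1%:R * h < nz (complex.Im nu0).
  rewrite mulrC -ltr_pdivlMr //; apply: (@lt_le_trans _ _ (Num.min h1 (nz (complex.Im nu0) / m.+1%:R))); last by rewrite ge_min lexx orbT.
  by rewrite /h ltr_pdivrMr // ltr_pMr ?ltr1n // lt_min h10 divr_gt0.
have inv_inj (l l' : nat) : (l.+1%:R : R)^-1 = l'.+1%:R^-1 -> l = l' by move/invr_inj/eqP; rewrite eqr_nat => /eqP[].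
(* So small that the slopes of the [a_i] add up to less than [m.+1%:R * h]: the imaginary slope of
   [nu] stays positive. *)
pose th0 := h / (2 * m.+1%:R); have th00 : 0 < th0 by rewrite divr_gt0 // mulr_gt0.
pose th_ (l : nat) : R := th0 * l.+1%:R^-1.
have th_inj l l' : th_ l = th_ l' -> l = l' by move/(mulfI (lt0r_neq0 th00)); apply: inv_inj.
(* Coincidences of imaginary parts at [t = 1], between two of the [a_i] or between some [b_k] and
   some [a_i]: these are the obstructions to [near1_nonint]. *)
pose PI (s : ('I_m * 'I_m) + ('I_m.+1 * 'I_m)) (l : nat) := match s with
  | inl (i, j) => i != j /\ complex.Im (aa i) + th_ l * i.+1%:R = complex.Im (aa j) + th_ l * j.+1%:R
  | inr (k, i) => complex.Im (bb k) + h = complex.Im (aa i) + th_ l * i.+1%:R end.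
have [l hl] : exists l, forall s, ~ PI s l.
  apply: avoid => -[[i j]|[k i]] l l' /=.
    move=> [ij e1] [_ e2]; apply: th_inj.
    have d : (i.+1%:R - j.+1%:R : R) != 0 by rewrite subr_eq0 eqr_nat eqSS.
    apply: (mulIf d); move: e1 e2; move: (th_ l) (th_ l') (i.+1%:R : R) (j.+1%:R : R) (complex.Im _) (complex.Im (aa j)) => *; lra.
  move=> e1 e2; apply: th_inj.
  have d : (i.+1%:R : R) != 0 by rewrite pnatr_eq0.
  apply: (mulIf d); move: e1 e2; move: (th_ l * _) (th_ l' * _) (complex.Im _) (complex.Im (aa i)) => *; lra.
pose th := th_ l.
have th0' : 0 < th by rewrite mulr_gt0 // invr_gt0 ltr0n.
have thle : th <= th0 by rewrite ler_piMr ?(ltW th00) // invf_le1 ?ltr0n // ler1n.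
pose B : R := \sum_(j < m.+1) nm (bb j) + \sum_(i < m) nm (aa i) + nm a1 + nm a2 + nm nu0 + 1.
have S0 n (f : nat -> C) : 0 <= \sum_(i < n) nm (f i) by apply: sumr_ge0 => i _; apply: nm_ge0.
have ReB n (f : nat -> C) (i : 'I_n) : `|complex.Re (f i)| <= \sum_(i < n) nm (f i).
  by apply: le_trans (Re_le_nm _) (nm_common_bound f (ltn_ord i)).
(* The offsets lie in [(0, 1/2]], so for a given [k] at most one of them produces a natural number;
   [B + 1] outweighs all real parts involved. *)
pose X_ (l : nat) : R := B + 1 + l.+1%:R^-1 / 2.
have [l' hl'] : exists l', forall k : 'I_m.+1, ~ (exists n : nat, complex.Re (1 + bb k - a1 - a2) + X_ l' = n%:R).
  apply: avoid => k u v [n1 e1] [n2 e2].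
  have e : X_ u - X_ v = n1%:R - n2%:R by rewrite -e1 -e2; ring.
  have bnd (w : nat) : 0 < (w.+1%:R : R)^-1 / 2 <= 1 / 2.
    by rewrite divr_gt0 ?invr_gt0 //= ler_pM2r ?invr_gt0 // invf_le1 // ler1n.
  have lt1 : `|n1%:R - n2%:R : R| < 1.
    by rewrite -e /X_; have := bnd u; have := bnd v; rewrite ltr_norml; move: (u.+1%:R^-1 : R) (v.+1%:R^-1 : R) => *; lra.
  have n12 : n1 = n2.
    by case: (ltngtP n1 n2) => // hn; exfalso; move: hn lt1; rewrite -(ler_nat R) -natr1 ltr_norml;
      move: (n1%:R : R) (n2%:R : R) => x y; lra.
  apply: inv_inj; move: e; rewrite n12 subrr /X_; move: (u.+1%:R^-1 : R) (v.+1%:R^-1 : R) => x y; lra.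
pose X := X_ l'; have XB : B + 1 <= X by rewrite lerDl divr_ge0 // invr_ge0.
pose om : C := X +i* h.
have ImA i : complex.Im (aline th 1 i) = complex.Im (aa i) + th * i.+1%:R.
  by rewrite /aline mulr1 ImD ImiM.
have ReA t i : complex.Re (aline th t i) = complex.Re (aa i) - th * i.+1%:R * complex.Im t.
  by rewrite /aline ReD; congr (_ + _); case: t => x y /=; ring.
have lineA t i : aline th t i = ('i * (th * i.+1%:R)%:C) * t + aa i by rewrite /aline addrC.
have lineB t i : bline om t i = om * t + bb i by rewrite /bline addrC.
exists th, om; split.
  have c1 : near1 (fun t => forall i : 'I_m, forall j : 'I_m.+1, 1 < complex.Re (bline om t j - aline th t i)).
    apply: (@near1_all _ m (fun i t => forall j : 'I_m.+1, 1 < complex.Re (bline om t j - aline th t i))) => i.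
    apply: (@near1_all _ m.+1 (fun j t => 1 < complex.Re (bline om t j - aline th t i))) => j.
    have H := @near1_Re R (om - 'i * (th * i.+1%:R)%:C) (bb j - aa i) 1.
    apply: (near1_imp _ (H _)) => [t /=|].
      by rewrite lineA lineB; congr (_ < complex.Re _); ring.
    rewrite !ReD !ReN ReiM; have := ReB _ bb j; have := ReB _ aa i; rewrite !ler_norml /=.
    move: XB; rewrite /B; move: (S0 m aa) (S0 m.+1 bb) (nm_ge0 a1) (nm_ge0 a2) (nm_ge0 nu0).
    move: (\sum_(_ < m.+1) _) (\sum_(_ < m) _) (nm a1) (nm a2) (nm nu0) (complex.Re (bb j)) (complex.Re (aa i)) => *; lra.
  have c2 : near1 (fun t => forall i j : 'I_m, i != j -> forall n : int, aline th t i - aline th t j != n%:~R).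
    apply: (@near1_all _ m (fun i t => forall j : 'I_m, i != j :> nat -> forall n : int, aline th t i - aline th t j != n%:~R)) => i.
    apply: (@near1_all _ m (fun j t => i != j :> nat -> forall n : int, aline th t i - aline th t j != n%:~R)) => j.
    have [ij|ij] := eqVneq (i : nat) j; first by exists 1.
    have H := @near1_nonint R ('i * (th * i.+1%:R)%:C - 'i * (th * j.+1%:R)%:C) (aa i - aa j).
    apply: (near1_imp _ (H _)) => [t /=|].
      by move=> Ht _ n; have := Ht n; rewrite !lineA; congr (_ != _); ring.
    rewrite addrACA -opprD ImD ImN !ImD !ImiM subr_eq0; apply/eqP => e; apply: (hl (inl (i, j))).
    by split=> //; rewrite addrC e addrC.
  have c3 : near1 (fun t => forall (i : 'I_m) (k : 'I_m.+1) (n : int), bline om t k - aline th t i != n%:~R).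
    apply: (@near1_all _ m (fun i t => forall (k : 'I_m.+1) (n : int), bline om t k - aline th t i != n%:~R)) => i.
    apply: (@near1_all _ m.+1 (fun k t => forall n : int, bline om t k - aline th t i != n%:~R)) => k.
    have H := @near1_nonint R (om - 'i * (th * i.+1%:R)%:C) (bb k - aa i).
    apply: (near1_imp _ (H _)) => [t /=|].
      by move=> Ht n; have := Ht n; rewrite lineA lineB; congr (_ != _); ring.
    rewrite addrACA -opprD ImD ImN !ImD !ImiM subr_eq0; apply/eqP => e; apply: (hl (inr (k, i))).
    by move: e; rewrite /= => e; rewrite addrC e addrC.
  have c4 : near1 (fun t => forall i : 'I_m, 0 < complex.Re (aline th t i)).
    apply: (@near1_all _ m (fun i t => 0 < complex.Re (aline th t i))) => i.
    have H := @near1_Re R ('i * (th * i.+1%:R)%:C) (aa i) 0.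
    apply: (near1_imp _ (H _)) => [t /=|]; first by rewrite lineA.
    by rewrite ReD ReiM add0r.
  have c5 : near1 (fun t => forall k : 'I_m.+1, exists M : nat, M%:R < complex.Re (1 + bline om t k - a1 - a2) < M.+1%:R).
    apply: (@near1_all _ m.+1 (fun k t => exists M : nat, M%:R < complex.Re (1 + bline om t k - a1 - a2) < M.+1%:R)) => k.
    have cpos : 0 <= complex.Re (1 + bb k - a1 - a2) + X.
      rewrite !ReD !ReN Re_1; have := ReB _ bb k; have := Re_le_nm a1; have := Re_le_nm a2; rewrite !ler_norml.
      move: XB; rewrite /B; move: (S0 m aa) (S0 m.+1 bb) (nm_ge0 a1) (nm_ge0 a2) (nm_ge0 nu0).
      move: (\sum_(_ < m.+1) _) (\sum_(_ < m) _) (nm a1) (nm a2) (nm nu0) (complex.Re (bb k)) (complex.Re a1) (complex.Re a2) => *; lra.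
    have [M /andP[M1 M2]] : exists M : nat, M%:R <= complex.Re (1 + bb k - a1 - a2) + X < M.+1%:R.
      by exists (Num.truncn (complex.Re (1 + bb k - a1 - a2) + X)); apply: truncn_itv.
    have M1' : M%:R < complex.Re (1 + bb k - a1 - a2) + X.
      rewrite lt_neqAle M1 andbT; apply/eqP => e; apply: (hl' k); by exists M.
    have n1 := @near1_Re R om (1 + bb k - a1 - a2) M%:R.
    have n2 := @near1_Re R (- om) (- (1 + bb k - a1 - a2)) (- M.+1%:R).
    apply: (near1_imp _ (near1_and (n1 _) (n2 _))) => [t /= [g1 g2]||].
    - exists M; rewrite lineB; apply/andP; split; first by move: g1; congr (_ < complex.Re _); ring.
      by rewrite -ltrN2 -ReN; move: g2; congr (_ < complex.Re _); ring.
    - by rewrite ReD addrC.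
    - by rewrite -opprD ReN ltrN2 ReD addrC.
  have c6 : near1 (fun t => 0 < complex.Re (nu_of m a1 a2 (aline th t) (bline om t))).
    have H := @near1_Re R (m.+1%:R * om - \sum_(i < m) 'i * (th * i.+1%:R)%:C) nu0 0.
    apply: (near1_imp _ (H _)) => [t /=|]; first by rewrite nu_lineE.
    rewrite ReD ReD ReN Re_sum [X in _ - X + _]big1; last by move=> i _; rewrite ReiM.
    rewrite subr0 -rcn cReMr /=; have := Re_le_nm nu0; rewrite ler_norml.
    have : X <= m.+1%:R * X.
      rewrite ler_peMl ?ler1n //; move: XB; rewrite /B; move: (S0 m aa) (S0 m.+1 bb) (nm_ge0 a1) (nm_ge0 a2) (nm_ge0 nu0); lra.
    move: XB; rewrite /B; move: (S0 m aa) (S0 m.+1 bb) (nm_ge0 a1) (nm_ge0 a2) (nm_ge0 nu0).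
    move: (\sum_(_ < m.+1) _) (\sum_(_ < m) _) (nm a1) (nm a2) (nm nu0) (complex.Re nu0) (m.+1%:R * X) => *; lra.
  have := near1_and c1 (near1_and c2 (near1_and c3 (near1_and c4 (near1_and c5 c6)))).
  by apply: near1_imp => t [? [? [? [? []]]]].
move=> s /andP[s0 s1].
have Imn (n : nat) : complex.Im (- n%:R : C) = 0 by rewrite ImN Im_nat oppr0.
have small (x y : R) : 0 < y -> y < nz x -> x + y * s = 0 -> x = 0 /\ s = 0.
  rewrite /nz => y0; case: eqVneq => [-> _|xn yx e].
    by rewrite add0r => /eqP; rewrite mulf_eq0 gt_eqF //= => /eqP.
  exfalso; have : `|x| <= y.
    have -> : x = - (y * s) by apply/eqP; rewrite -addr_eq0 e.
    by rewrite normrN ger0_norm ?mulr_ge0 ?(ltW y0) // ler_piMr // ltW.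
  by rewrite leNgt yx.
split.
- move=> j n; apply/eqP => e; have := congr1 (@complex.Im R) e; rewrite Imn /bline ImD mulrC cImMr /= mulrC => e2.
  have [_ z] := small _ _ h0 (lt_le_trans hlt1 (hh1 j (ltn_ord j))) e2.
  by have := hb j n; rewrite -e z /bline mulr0 addr0 eqxx.
- move=> n; apply/eqP => e; have := congr1 (@complex.Im R) e; rewrite Imn nu_lineE ImD mulrC cImMr addrC -/nu0 mulrC.
  have -> : complex.Im (m.+1%:R * om - \sum_(i < m) 'i * (th * i.+1%:R)%:C) = m.+1%:R * h - \sum_(i < m) th * i.+1%:R.
    by rewrite ImD ImN Im_sum -rcn cImMr (eq_bigr (fun i : 'I_m => th * i.+1%:R)) // => i _; rewrite ImiM.
  set y := _ - _ => e2.
  have St : 0 <= \sum_(i < m) th * i.+1%:R < m.+1%:R * h.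
    apply/andP; split; first by apply: sumr_ge0 => i _; rewrite mulr_ge0 // ltW.
    apply: (@le_lt_trans _ _ (\sum_(i < m) (h / 2))).
      apply: ler_sum => i _; apply: (@le_trans _ _ (th0 * m.+1%:R)).
        by apply: ler_pM; rewrite ?(ltW th0') // ler_nat ltnW // ltnS.
      by rewrite /th0 invfM mulrA divfK // gt_eqF.
    rewrite sumr_const card_ord -(mulr_natl (h / 2) m) -[m.+1%:R]natr1.
    have aux (x w : R) : 0 <= x -> 0 < w -> x * (w / 2) < (x + 1) * w.
      by move=> p q; have := mulr_ge0 p (ltW q); lra.
    by apply: aux; rewrite ?ler0n.
  have y0 : 0 < y by rewrite subr_gt0; case/andP: St.
  have y1 : y < nz (complex.Im nu0) by apply: le_lt_trans hlt2; rewrite lerBlDr lerDl; case/andP: St.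
  have [_ z] := small _ _ y0 y1 e2.
  by have := hnu n; rewrite -e nu_lineE z mulr0 add0r eqxx.
- rewrite nu_lineE (ReD (_ * s%:C) _) lerDr mulrC cReMr mulr_ge0 // ReD ReN Re_sum big1; last by move=> i _; rewrite ReiM.
  rewrite subr0 -rcn cReMr mulr_ge0 //=.
  by apply: le_trans XB; rewrite /B !addr_ge0 ?nm_ge0 ?S0.
Qed.

End GoodLine.

(** * Both sides as functions along the line *)

Section LineIdentity.
Variable R : realType.
Local Notation C := R[i].
Variables (m : nat) (a1 a2 : C) (aa bb : nat -> C) (th : R) (om : C).
Hypothesis m_gt0 : (0 < m)%N.
Hypothesis b_sep : bsep m bb.
Hypothesis Re_a : forall i : 'I_m, 0 < complex.Re (aa i).
Hypothesis good : good_near1 m a1 a2 aa bb th om.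

Let A (t : C) := aline aa th t.
Let B (t : C) := bline bb om t.

Lemma bline_sub t j k : B t j - B t k = bb j - bb k.
Proof. by rewrite /B /bline; ring. Qed.

Lemma bsep_bline t : bsep m (B t).
Proof. by move=> i j ij n; rewrite bline_sub b_sep. Qed.

Lemma lower_shift_bline t k i : lower_shift (B t) k i = lower_shift bb k i.
Proof. by rewrite /lower_shift /B /bline; ring. Qed.

Lemma Re_aline (s : R) i : complex.Re (A s%:C i) = complex.Re (aa i).
Proof. by rewrite /A /aline ReD [_ * s%:C]mulrC cReMr ReiM mulr0 addr0. Qed.

Let L : R := nm om + \sum_(i < m) nm ('i * (th * i.+1%:R)%:C : C) + 1.

Let L_gt0 : 0 < L.
Proof. by rewrite ltr_wpDl // addr_ge0 ?nm_ge0 // sumr_ge0 // => i _; apply: nm_ge0. Qed.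

Lemma line_lipschitz (s : C) (r : R) : 0 <= r -> forall t, disc s r t ->
  (forall i, (i < m)%N -> nm (A t i - A s i) <= L * r) /\ (forall j, nm (B t j - B s j) <= L * r).
Proof.
move=> r0 t Dt; have S0 : 0 <= \sum_(i < m) nm ('i * (th * i.+1%:R)%:C : C) by apply: sumr_ge0 => i _; apply: nm_ge0.
split=> [i im|j].
  have -> : A t i - A s i = 'i * (th * i.+1%:R)%:C * (t - s) by rewrite /A /aline; ring.
  rewrite nmM; apply: ler_pM; rewrite ?nm_ge0 // /L.
  have := nm_common_bound (fun i => 'i * (th * i.+1%:R)%:C : C) im; have := nm_ge0 om.
  move: S0; move: (\sum_(_ < m) _) (nm om) (nm _) => *; lra.
have -> : B t j - B s j = om * (t - s) by rewrite /B /bline; ring.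
rewrite nmM; apply: ler_pM; rewrite ?nm_ge0 // /L.
by move: S0; move: (\sum_(_ < m) _) (nm om) => *; lra.
Qed.

Lemma uniform_line (s : R) (eta : R) : 0 < eta -> exists (r K : R), [/\ 0 < r,
   forall t i, (i < m)%N -> disc s%:C r t -> nm (A t i) <= K,
   forall t j, (j < m.+1)%N -> disc s%:C r t -> nm (B t j) <= K,
   forall t i, (i < m)%N -> disc s%:C r t -> complex.Re (aa i) - eta <= complex.Re (A t i) <= complex.Re (aa i) + eta
 & forall t j, (j < m.+1)%N -> disc s%:C r t -> complex.Re (B s%:C j) - eta <= complex.Re (B t j) <= complex.Re (B s%:C j) + eta].
Proof.
move=> eta0; exists (eta / L), (\sum_(i < m) nm (A s%:C i) + \sum_(j < m.+1) nm (B s%:C j) + eta).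
have r0 : 0 < eta / L by rewrite divr_gt0.
have lip := line_lipschitz (ltW r0).
have e : L * (eta / L) = eta by rewrite mulrC divfK // gt_eqF.
have SA : 0 <= \sum_(i < m) nm (A s%:C i) by apply: sumr_ge0 => i _; apply: nm_ge0.
have SB : 0 <= \sum_(i < m.+1) nm (B s%:C i) by apply: sumr_ge0 => i _; apply: nm_ge0.
split=> // [t i im Dt|t j jm Dt|t i im Dt|t j jm Dt].
- have [h _] := lip _ _ Dt; have := h i im; rewrite e => hi.
  rewrite -[A t i](subrK (A s%:C i)) addrC; apply: nmD_le => //.
  by apply: le_trans (nm_common_bound _ im) _; rewrite lerDl.
- have [_ h] := lip _ _ Dt; have := h j; rewrite e => hj.
  rewrite -[B t j](subrK (B s%:C j)) addrC; apply: nmD_le => //.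
  by apply: le_trans (nm_common_bound _ jm) _; rewrite lerDr.
- have [h _] := lip _ _ Dt; have := h i im; rewrite e => /Re_bound; rewrite ReD ReN Re_aline ler_norml.
  by move: (complex.Re _) (complex.Re _) => *; lra.
- have [_ h] := lip _ _ Dt; have := h j; rewrite e => /Re_bound; rewrite ReD ReN ler_norml.
  by move: (complex.Re (B t j)) (complex.Re _) => *; lra.
Qed.

Section Approximable.
Variables (z : C) (r : R).

Lemma pappr_aline i : pappr z r (fun t => A t i).
Proof. by apply: pappr_eq (pappr_affine z r ('i * (th * i.+1%:R)%:C) (aa i)) => t _; rewrite /A /aline addrC. Qed.

Lemma pappr_bline j : pappr z r (fun t => B t j).
Proof. by apply: pappr_eq (pappr_affine z r om (bb j)) => t _; rewrite /B /bline addrC. Qed.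

Lemma pappr_iterm k n : pappr z r (fun t => iterm m a1 a2 (A t) (B t) k n).
Proof.
have p1 (c : C) : pappr z r (fun t => 1 - B t k + c).
  by apply: papprD (pappr_cst z r c); apply: papprB; [exact: pappr_cst | exact: pappr_bline].
apply: papprM.
  apply: papprM; last exact: pappr_cst.
  apply: papprM; last first.
    by apply: pappr_rGamma; apply: papprD (pappr_cst z r _); apply: papprD (pappr_cst z r _).
  by apply: papprM; apply: pappr_poch.
apply: pappr_sum => j; apply: papprZ; apply: pappr_prod => i.
apply: papprM.
  apply: pappr_poch; apply: papprD (pappr_aline i).
  by apply: papprB; [exact: pappr_cst | exact: pappr_bline].
by apply: pappr_eq (pappr_cst z r (poch (lower_shift bb k i) j)^-1) => t _; rewrite lower_shift_bline.
Qed.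

Lemma pappr_Lam s : pappr z r (fun t => Lam m a1 a2 (A t) (B t) s).
Proof.
apply: papprM.
  apply: papprM (pappr_cst z r _); apply: papprZ; apply: pappr_prod => i.
  exact: pappr_poch (pappr_aline i).
apply: pappr_prod => j; apply: pappr_rGamma; apply: papprD (pappr_cst z r _); exact: pappr_bline.
Qed.

Lemma pappr_rfac k : pappr z r (fun t => rfac m a1 a2 (A t) (B t) k).
Proof.
have pB (c : C) : pappr z r (fun t => rGamma (B t k - c)).
  by apply: pappr_rGamma; apply: papprB; [exact: pappr_bline | exact: pappr_cst].
apply: papprM.
  apply: pappr_eq (pappr_cst z r (\prod_(i < m) rGamma (bb k - bb (bump k i)))^-1) => t _.
  by congr (_^-1); apply: eq_bigr => i _; rewrite bline_sub.
apply: papprM; first exact: papprM.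
by apply: pappr_prod => i; apply: pappr_rGamma; apply: papprB; [exact: pappr_bline | exact: pappr_aline].
Qed.

Lemma pappr_sg f : pappr z r f -> pappr z r (fun t => sg (f t)).
Proof.
move=> hf; apply: papprM; first exact: pappr_rGamma.
by apply: pappr_rGamma; apply: papprB hf; exact: pappr_cst.
Qed.

Lemma pappr_nu : pappr z r (fun t => nu_of m a1 a2 (A t) (B t)).
Proof.
apply: papprB; last by apply: pappr_sum => i; apply: pappr_aline.
by apply: papprB (pappr_cst z r _); apply: pappr_sum => i; apply: pappr_bline.
Qed.

End Approximable.

Lemma pappr_csum_iterm (s : R) : exists r : R, 0 < r /\
  forall k : 'I_m.+1, pappr s%:C r (fun t => csum (iterm m a1 a2 (A t) (B t) k)).
Proof.
have [|mu [mu0 hmu]] := @positive_lower_bound R m (fun i => complex.Re (aa i)).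
  by move=> i im; apply: (Re_a (Ordinal im)).
have N0 : (0 : R) < 3 + 4 * m%:R by rewrite ltr_pwDl // mulr_ge0.
(* This leaves the exponent [- 1 - mu / 4] in [iterm_bigO]. *)
pose eta := mu / 4 / (3 + 4 * m%:R).
have eta0 : 0 < eta by rewrite !divr_gt0.
have [r [K [r0 h1 h2 h3 h4]]] := uniform_line s eta0.
exists r; split=> // k.
have h5 t i : (i < m)%N -> disc s%:C r t -> lower_shift (B t) k i = lower_shift bb k i.
  by move=> _ _; apply: lower_shift_bline.
have h6 i : (i < m)%N -> forall n : nat, lower_shift bb k i != - n%:R.
  by move=> im; apply: (lower_shift_npole k (Ordinal im) b_sep).
have := iterm_bigO a1 a2 (ltW eta0) h1 h2 h3 h4 (ltn_ord k) h5 h6 mu0 hmu.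
move=> hO; apply: pappr_csum hO _; last by move=> n; apply: pappr_iterm.
have -> : (3 + 4 * m%:R) * eta = mu / 4 by rewrite /eta mulrC divfK // gt_eqF.
by lra.
Qed.

Lemma pappr_csum_Lam (s : R) : 0 < complex.Re (nu_of m a1 a2 (A s%:C) (B s%:C)) -> exists r : R, 0 < r /\
  pappr s%:C r (fun t => csum (Lam m a1 a2 (A t) (B t))).
Proof.
move=> hnu; have N0 : (0 : R) < m%:R + m.+1%:R by rewrite ltr_wpDl ?ltr0n.
pose eta := complex.Re (nu_of m a1 a2 (A s%:C) (B s%:C)) / 2 / (m%:R + m.+1%:R).
have eta0 : 0 < eta by rewrite !divr_gt0.
have [r [K [r0 h1 h2 h3 h4]]] := uniform_line s eta0.
exists r; split=> //.
have := Lam_bigO a1 a2 h1 h2 h3 h4.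
move=> hO; apply: pappr_csum hO _; last by move=> n; apply: pappr_Lam.
have -> : (m%:R + m.+1%:R) * eta = complex.Re (nu_of m a1 a2 (A s%:C) (B s%:C)) / 2.
  by rewrite /eta mulrC divfK // gt_eqF.
have -> : \sum_(j < m.+1) complex.Re (B s%:C j) - (complex.Re a1 + complex.Re a2) - \sum_(i < m) complex.Re (aa i)
   = complex.Re (nu_of m a1 a2 (A s%:C) (B s%:C)).
  rewrite /nu_of (ReD (_ - _)) (ReD (\sum_(_ < _) _)) !ReN ReD !Re_sum; congr (_ - _).
  by apply: eq_bigr => i _; rewrite Re_aline.
by move: hnu; move: (complex.Re _) => u; lra.
Qed.

Lemma good_line_identity : near1 (fun t => \prod_(i < m) rGamma (A t i) *
   \sum_(k < m.+1) rfac m a1 a2 (A t) (B t) k * csum (iterm m a1 a2 (A t) (B t) k)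
  = sg (nu_of m a1 a2 (A t) (B t)) * csum (Lam m a1 a2 (A t) (B t))).
Proof.
apply: near1_imp good => t [[g1 g2 g3 g4 g5] g6].
apply: good_region => //; first exact: bsep_bline.
  by move=> k; apply: iterm_summable_gen => //; exact: bsep_bline.
exact: Lam_summable_gen.
Qed.

(** [Phi] stands for the left side: the series itself when it converges at the given parameters,
    otherwise the given continuation times the reciprocal Gamma factors. *)
Lemma line_identity (Phi : C -> C) :
  (forall s : R, 0 <= s <= 1 -> exists r : R, 0 < r /\ pappr s%:C r Phi) ->
  near1 (fun t => Phi t = csum (Lam m a1 a2 (A t) (B t))) ->
  \prod_(i < m) rGamma (aa i) * \sum_(k < m.+1) rfac m a1 a2 aa bb k * csum (iterm m a1 a2 aa bb k)
  = sg (nu_of m a1 a2 aa bb) * Phi 0.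
Proof.
move=> hPhi ePhi.
pose H t := \prod_(i < m) rGamma (A t i) *
   \sum_(k < m.+1) rfac m a1 a2 (A t) (B t) k * csum (iterm m a1 a2 (A t) (B t) k)
   - sg (nu_of m a1 a2 (A t) (B t)) * Phi t.
have H0 : H 0 = 0.
  apply: segment_continuation => [s s01|]; last first.
    have := near1_and good_line_identity ePhi; apply: near1_imp => t [e1 e2].
    by rewrite /H e1 e2 subrr.
  have [r1 [r10 h1]] := pappr_csum_iterm s; have [r2 [r20 h2]] := hPhi s s01.
  exists (Num.min r1 r2); split; first by rewrite lt_min r10.
  have s1 : nm (s%:C - s%:C) + Num.min r1 r2 <= r1 by rewrite subrr nm0 add0r ge_min lexx.
  have s2 : nm (s%:C - s%:C) + Num.min r1 r2 <= r2 by rewrite subrr nm0 add0r ge_min lexx orbT.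
  apply: papprB.
    apply: papprM; first by apply: pappr_prod => i; apply: pappr_rGamma; apply: pappr_aline.
    apply: pappr_sum => k; apply: papprM; first exact: pappr_rfac.
    exact: pappr_shrink s1 (h1 k).
  by apply: papprM; [apply: pappr_sg; exact: pappr_nu | exact: pappr_shrink s2 h2].
have A0 : A 0 = aa by apply/funext => i; rewrite /A /aline mulr0 addr0.
have B0 : B 0 = bb by apply/funext => i; rewrite /B /bline mulr0 addr0.
by move/eqP: H0; rewrite /H A0 B0 subr_eq0 => /eqP.
Qed.

End LineIdentity.

(** * Translation to row vectors *)

Section Coordinates.
Variable R : realType.
Local Notation C := R[i].
Variable m : nat.
Implicit Types (a : 'rV[C]_m.+2) (b : 'rV[C]_m.+1).

(* [acoef a i] is the parameter [a_(i+3)] for [i < m], and junk beyond. *)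
Definition acoef a i : C := a 0 (inord i.+2).
Definition bcoef b j : C := b 0 (inord j).

Lemma bcoefE b (j : 'I_m.+1) : bcoef b j = b 0 j.
Proof. by rewrite /bcoef inord_val. Qed.

Lemma acoefE a (i : 'I_m) : acoef a i = a 0 (lift ord0 (lift ord0 i)).
Proof. by congr (a 0 _); apply: val_inj; rewrite /= inordK // ltnS ltnS. Qed.

Lemma inord1E : inord 1 = lift ord0 ord0 :> 'I_m.+2.
Proof. by apply: val_inj; rewrite /= inordK. Qed.

Lemma big_upper (T : Type) (idx : T) (op : Monoid.law idx) (f : C -> T) a :
  \big[op/idx]_(i < m.+2) f (a 0 i)
  = op (op (f (a 0 ord0)) (f (a 0 (inord 1)))) (\big[op/idx]_(i < m) f (acoef a i)).
Proof.
rewrite !big_ord_recl inord1E Monoid.mulmA; congr (op _ _).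
by apply: eq_bigr => i _; rewrite acoefE.
Qed.

Lemma big_upper_tail (T : Type) (idx : T) (op : Monoid.com_law idx) (f : C -> T) a :
  \big[op/idx]_(i < m.+2 | (1 < i)%N) f (a 0 i) = \big[op/idx]_(i < m) f (acoef a i).
Proof.
rewrite big_mkcond !big_ord_recl /= !Monoid.mul1m.
by apply: eq_bigr => i _; rewrite acoefE.
Qed.

Lemma big_lower (T : Type) (idx : T) (op : Monoid.law idx) (f : C -> T) b :
  \big[op/idx]_(j < m.+1) f (b 0 j) = \big[op/idx]_(j < m.+1) f (bcoef b j).
Proof. by apply: eq_bigr => j _; rewrite bcoefE. Qed.

Lemma nuE a b : nu a b = nu_of m (a 0 ord0) (a 0 (inord 1)) (acoef a) (bcoef b).
Proof.
rewrite /nu /nu_of (big_upper _ idfun) (big_lower _ idfun) /=.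
by move: (\sum_(_ < _) _) (\sum_(_ < _) _) => x y; ring.
Qed.

Lemma lower_okE b : lower_ok b -> forall (j : 'I_m.+1) (n : nat), bcoef b j != - n%:R.
Proof. by move=> h j n; rewrite bcoefE. Qed.

Lemma csum_Lam a b : lower_ok b -> 0 < complex.Re (nu a b) ->
  csum (Lam m (a 0 ord0) (a 0 (inord 1)) (acoef a) (bcoef b)) = \prod_(j < m.+1) rGamma (bcoef b j) * hyp1 a b.
Proof.
move=> hb hnu; set P := \prod_(j < m.+1) rGamma (bcoef b j).
have P0 : P != 0 by apply/prodf_neq0 => j _; apply/rGamma_neq0/lower_okE.
have sL : summable (Lam m (a 0 ord0) (a 0 (inord 1)) (acoef a) (bcoef b)).
  by apply: Lam_summable_gen; rewrite -nuE.
have -> : hyp1 a b = P^-1 * csum (Lam m (a 0 ord0) (a 0 (inord 1)) (acoef a) (bcoef b)).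
  rewrite -csumZ //; apply: eq_csum => s; rewrite expr1n /Lam.
  have -> : \prod_(x <- [seq a 0 i | i <- enum 'I_m.+2]) poch x s = poch (a 0 ord0) s * poch (a 0 (inord 1)) s * \prod_(i < m) poch (acoef a i) s.
    by rewrite big_map big_enum /= (big_upper _ (fun x => poch x s)).
  have -> : \prod_(x <- [seq b 0 j | j <- enum 'I_m.+1]) poch x s = P / \prod_(j < m.+1) rGamma (bcoef b j + s%:R).
    rewrite big_map big_enum /= (big_lower _ (fun x => poch x s)) /P -prodf_div; apply: eq_bigr => j _.
    by apply: rGamma_quotient; apply: npole_addn; apply: lower_okE.
  have : \prod_(j < m.+1) rGamma (bcoef b j + s%:R) != 0.
    by apply/prodf_neq0 => j _; apply: rGamma_neq0; apply: npole_addn; apply: lower_okE.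
  have := factC_neq0 R s; move: (\prod_(_ < m.+1) _) (\prod_(_ < m) _) (poch _ _) (poch _ _) (s`!%:R : C) P P0 => x y z w f P P0 f0 x0.
  by field; rewrite x0 f0 P0.
by rewrite mulrA divff // mul1r.
Qed.

Lemma poch_negn n j : poch (- n%:R : C) j / j`!%:R = (-1) ^+ j * 'C(n, j)%:R.
Proof.
have [jn|nj] := leqP j n; last first.
  rewrite bin_small // mulr0 (_ : poch _ _ = 0) ?mul0r //.
  by rewrite /poch (bigD1 (Ordinal nj)) //= addNr mul0r.
apply: (canLR (mulfK (factC_neq0 R j))); rewrite -mulrA -natrM bin_ffact.
elim: j jn => [|j IH] jn; first by rewrite poch0 ffactn0 mulr1.
rewrite pochS IH; last exact: ltnW.
rewrite ffactnSr natrM natrB; last exact: ltnW.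
by rewrite exprS; move: ((-1) ^+ j) => x; ring.
Qed.

(** The factor [(- n)_j / j!] is a signed binomial coefficient, so the terminating series is an n-th
    difference at [0]. *)
Lemma inner_termE a b (k : 'I_m.+1) n : inner_term a b k n = iterm m (a 0 ord0) (a 0 (inord 1)) (acoef a) (bcoef b) k n.
Proof.
rewrite /inner_term /iterm /iweight bcoefE; congr (_ * _); rewrite /pFq.
set u := (X in csum X).
have uE j : u j = (-1) ^+ j * 'C(n, j)%:R * icoef m (acoef a) (bcoef b) k j.
  have e1 : \prod_(x <- [seq 1 - b 0 k + a 0 i | i : 'I_m.+2 <- enum 'I_m.+2 & (1 < i)%N]) poch x j
     = \prod_(i < m) poch (upper_shift (acoef a) (bcoef b) k i) j.
    rewrite big_map big_filter big_enum_cond /= /upper_shift bcoefE.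
    by rewrite (eq_bigl (fun i : 'I_m.+2 => (1 < i)%N)) // (big_upper_tail _ (fun x => poch (1 - b 0 k + x) j)).
  have e2 : \prod_(x <- [seq 1 - b 0 k + b 0 j | j <- enum 'I_m.+1 & j != k]) poch x j
     = \prod_(i < m) poch (lower_shift (bcoef b) k i) j.
    rewrite big_map big_filter big_enum_cond /= -(prod_bump k (fun i => poch (1 - bcoef b k + bcoef b i) j)).
    by apply: eq_big => // i _; rewrite !bcoefE.
  rewrite /u expr1n big_cons /icoef prodf_div -poch_negn e1 e2.
  move: (poch (- n%:R) j) (\prod_(i < m) poch (upper_shift _ _ _ _) j) ((\prod_(i < m) poch (lower_shift _ _ _) j)^-1) (j`!%:R^-1 : C).
  by move=> x y z w; ring.
have u0 j : (n.+1 <= j)%N -> u j = 0 by move=> nj; rewrite uE bin_small // mulr0 mul0r.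
by rewrite (has_sum_csum (has_sum_finite u0)); apply: eq_bigr => j _; rewrite uE.
Qed.

Lemma rfacE a b (k : 'I_m.+1) :
  (\prod_(j < m.+1 | j != k) Gamma (b 0 k - b 0 j)) * (\prod_(i < m.+2) rGamma (b 0 k - a 0 i))
  = rfac m (a 0 ord0) (a 0 (inord 1)) (acoef a) (bcoef b) k.
Proof.
rewrite (big_upper _ (fun x => rGamma (b 0 k - x))) /= /rfac -bcoefE; congr (_ * _).
rewrite -prodfV -(prod_bump k (fun j => (rGamma (bcoef b k - bcoef b j))^-1)).
by apply: eq_bigr => j _; rewrite /Gamma !bcoefE.
Qed.

Lemma eq_Lam (a1 a2 : C) (aa aa' bb bb' : nat -> C) s : (forall i : 'I_m, aa i = aa' i) -> (forall j : 'I_m.+1, bb j = bb' j) ->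
  Lam m a1 a2 aa bb s = Lam m a1 a2 aa' bb' s :> C.
Proof.
move=> h h'; rewrite /Lam; congr (_ * _ / _ * _); first by apply: eq_bigr => i _; rewrite h.
by apply: eq_bigr => i _; rewrite h'.
Qed.

Lemma eq_nu_of (a1 a2 : C) (aa aa' bb bb' : nat -> C) : (forall i : 'I_m, aa i = aa' i) -> (forall j : 'I_m.+1, bb j = bb' j) ->
  nu_of m a1 a2 aa bb = nu_of m a1 a2 aa' bb' :> C.
Proof.
move=> h h'; rewrite /nu_of; congr (_ - _ - _); apply: eq_bigr => i _; by rewrite ?h ?h'.
Qed.

Section Line.
Variables (a : 'rV[C]_m.+2) (b : 'rV[C]_m.+1) (th : R) (om : C).

(** Row index [i] is position [i - 2] of [acoef], so [i.-1] is the slope factor of [aline] there. *)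
Definition adir : 'rV[C]_m.+2 := \row_i (if (1 < i)%N then 'i * (th * i.-1%:R)%:C else 0).
Definition bdir : 'rV[C]_m.+1 := const_mx om.

Lemma acoef_line t (i : 'I_m) : acoef (a + t *: adir) i = aline (acoef a) th t i.
Proof. by rewrite acoefE !mxE /= -acoefE /aline mulrC. Qed.

Lemma bcoef_line t (j : 'I_m.+1) : bcoef (b + t *: bdir) j = bline (bcoef b) om t j.
Proof. by rewrite bcoefE !mxE -bcoefE /bline mulrC. Qed.

Lemma a1_line t : (a + t *: adir) 0 ord0 = a 0 ord0.
Proof. by rewrite !mxE /= mulr0 addr0. Qed.

Lemma a2_line t : (a + t *: adir) 0 (inord 1) = a 0 (inord 1).
Proof. by rewrite inord1E !mxE /= mulr0 addr0. Qed.

Lemma nu_line t : nu (a + t *: adir) (b + t *: bdir)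
  = nu_of m (a 0 ord0) (a 0 (inord 1)) (aline (acoef a) th t) (bline (bcoef b) om t).
Proof.
rewrite nuE a1_line a2_line; apply: eq_nu_of => i; [exact: acoef_line | exact: bcoef_line].
Qed.

End Line.

Section Main.
Variables (a : 'rV[C]_m.+2) (b : 'rV[C]_m.+1).
Hypothesis m_gt0 : (0 < m)%N.
Hypothesis hb : lower_ok b.
Hypothesis hbb : forall i j : 'I_m.+1, i != j -> forall n : int, b 0 i - b 0 j != n%:~R.
Hypothesis hnu : forall n : int, nu a b != n%:~R.
Hypothesis ha : forall i : 'I_m.+2, (1 < i)%N -> 0 < complex.Re (a 0 i).

Let a1 := a 0 ord0.
Let a2 := a 0 (inord 1).

Let b_sep : bsep m (bcoef b).
Proof. by move=> i j ij n; rewrite !bcoefE hbb. Qed.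

Let Re_a (i : 'I_m) : 0 < complex.Re (acoef a i).
Proof. by rewrite acoefE ha. Qed.

Let rhs := (pi%:C / csin (pi%:C * nu a b)) *
    \sum_(k < m.+1)
      (\prod_(j < m.+1 | j != k) Gamma (b 0 k - b 0 j))
      * (\prod_(i < m.+2) rGamma (b 0 k - a 0 i))
      * csum (inner_term a b k).

Let prefactor := (\prod_(i < m.+2 | (1 < i)%N) Gamma (a 0 i)) / \prod_(j < m.+1) Gamma (b 0 j).

Lemma inner_term_cvg (k : 'I_m.+1) : csum_cvg (inner_term a b k).
Proof.
apply: has_sum_cvg (csum (inner_term a b k)) _; apply: summable_has_sum.
by apply: (eq_summable (fun n => esym (inner_termE a b k n))); apply: iterm_summable_gen.
Qed.

Lemma rhs_from_line (V : C) :
  \prod_(i < m) rGamma (acoef a i) * \sum_(k < m.+1) rfac m a1 a2 (acoef a) (bcoef b) k * csum (iterm m a1 a2 (acoef a) (bcoef b) k)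
  = sg (nu_of m a1 a2 (acoef a) (bcoef b)) * (\prod_(j < m.+1) rGamma (bcoef b j) * V) ->
  prefactor * V = rhs.
Proof.
rewrite /prefactor /rhs -nuE (big_upper_tail _ (@Gamma R)) (big_lower _ (@Gamma R)) /Gamma !prodfV invrK.
have -> : \sum_(k < m.+1) (\prod_(j < m.+1 | j != k) (rGamma (b 0 k - b 0 j))^-1) * (\prod_(i < m.+2) rGamma (b 0 k - a 0 i)) * csum (inner_term a b k)
  = \sum_(k < m.+1) rfac m a1 a2 (acoef a) (bcoef b) k * csum (iterm m a1 a2 (acoef a) (bcoef b) k).
  apply: eq_bigr => k _; rewrite (rfacE a b k); congr (_ * _); apply: eq_csum => n; exact: inner_termE.
have PA0 : \prod_(i < m) rGamma (acoef a i) != 0.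
  by apply/prodf_neq0 => i _; apply/rGamma_neq0/Re_gt0_npole.
have s0 := sg_neq0 hnu; rewrite sgE in s0 *; have p0 := piC_neq0 R.
have c0 : csin (pi%:C * nu a b) != 0 by apply: contraNneq s0 => ->; rewrite mul0r.
move: PA0 c0 p0; move: (pi%:C : C) (\prod_(_ < m) rGamma (acoef a _)) (\prod_(_ < m.+1) _) (\sum_(_ < m.+1) rfac _ _ _ _ _ _ * _) (csin _).
move=> q x y z w x0 w0 q0 e; have -> : z = w / q * (y * V) / x by rewrite -e mulrAC mulfV // mul1r.
by field; rewrite x0 w0 q0.
Qed.

(** Along the segment [Re nu] never falls below its value at the given parameters, so the series
    itself serves as [Phi]. *)
Lemma hyp1_identity : 0 < complex.Re (nu a b) -> prefactor * hyp1 a b = rhs.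
Proof.
move=> Re_nu; apply: rhs_from_line.
have hn (n : nat) : nu_of m a1 a2 (acoef a) (bcoef b) != - n%:R by rewrite -nuE; have := hnu (- n%:Z); rewrite mulrNz.
have [th [om [good av]]] := good_line Re_a (lower_okE hb) hn.
rewrite -(csum_Lam hb Re_nu).
pose Phi t := csum (Lam m a1 a2 (aline (acoef a) th t) (bline (bcoef b) om t)).
have -> : csum (Lam m a1 a2 (acoef a) (bcoef b)) = Phi 0.
  by apply: eq_csum => s; apply: eq_Lam => i; rewrite /aline /bline mulr0 addr0.
apply: (line_identity m_gt0 b_sep Re_a good); last by exists 1; split.
move=> s s01; apply: pappr_csum_Lam; have [_ _ h] := av s s01.
by apply: lt_le_trans h; rewrite -nuE.
Qed.

Lemma continuation_identity (F : 'rV[C]_m.+2 -> 'rV[C]_m.+1 -> C) : hyp1_continuation F -> prefactor * F a b = rhs.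
Proof.
move=> [Fhyp Fan]; apply: rhs_from_line.
have hn (n : nat) : nu_of m a1 a2 (acoef a) (bcoef b) != - n%:R by rewrite -nuE; have := hnu (- n%:Z); rewrite mulrNz.
have [th [om [good av]]] := good_line Re_a (lower_okE hb) hn.
pose Phi t := \prod_(j < m.+1) rGamma (bline (bcoef b) om t j) * F (a + t *: adir th) (b + t *: bdir om).
have -> : \prod_(j < m.+1) rGamma (bcoef b j) * F a b = Phi 0.
  rewrite /Phi !scale0r !addr0; congr (_ * _); apply: eq_bigr => j _; by rewrite /bline mulr0 addr0.
apply: (line_identity m_gt0 b_sep Re_a good).
  move=> s s01; have [h1 h2 _] := av s s01.
  have ok : lower_ok (b + s%:C *: bdir om) by move=> j n; rewrite -bcoefE bcoef_line.
  have nun (n : nat) : nu (a + s%:C *: adir th) (b + s%:C *: bdir om) != - n%:R by rewrite nu_line.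
  have [r [r0 hr]] := analytic_line (row_mx (adir th) (bdir om)) s%:C (Fan _ _ ok nun).
  exists r; split=> //; apply: papprM.
    by apply: pappr_prod => j; apply: pappr_rGamma; apply: pappr_bline.
  apply: pappr_eq hr => t _; rewrite scale_row_mx add_row_mx row_mxKl row_mxKr.
  by congr (F _ _); rewrite -addrA -scalerDl addrCA subrr addr0.
(* Near [t = 1] the real part of each [b_j] exceeds that of [a_3] by more than [1] and is therefore
   positive; as [Re nu > 0] too, [F] is the series there. *)
apply: near1_imp good => t [[g1 _ _ g4 _] g6].
have ok : lower_ok (b + t *: bdir om).
  move=> j n; rewrite -bcoefE bcoef_line; apply: Re_gt0_npole.
  have := g1 (Ordinal m_gt0) j; have := g4 (Ordinal m_gt0); rewrite (ReD _ (- _)) ReN.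
  by move: (complex.Re (aline _ _ _ _)) (complex.Re (bline _ _ _ _)) => x y; lra.
have Rnu : 0 < complex.Re (nu (a + t *: adir th) (b + t *: bdir om)) by rewrite nu_line.
rewrite /Phi Fhyp //; have := csum_Lam ok Rnu; rewrite a1_line a2_line.
rewrite (eq_bigr (fun j : 'I_m.+1 => rGamma (bline (bcoef b) om t j))) => [<-|j _]; last by rewrite bcoef_line.
by apply: eq_csum => s; apply: eq_Lam => i; rewrite ?acoef_line ?bcoef_line.
Qed.

End Main.

End Coordinates.

Theorem theorem3p1 (R : realType) (p : nat)
    (a : 'rV[R[i]]_p.+1) (b : 'rV[R[i]]_p)
    (hp : (2 <= p)%N)
    (hb : forall (j : 'I_p) (m : nat), b 0 j != - m%:R)
    (hbb : forall i j : 'I_p, i != j -> forall m : int, b 0 i - b 0 j != m%:~R)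
    (hnu : forall m : int, nu a b != m%:~R)
    (ha : forall i : 'I_p.+1, (1 < i)%N -> 0 < complex.Re (a 0 i)) :
  let prefactor :=
    (\prod_(i < p.+1 | (1 < i)%N) Gamma (a 0 i)) / \prod_(j < p) Gamma (b 0 j) in
  let rhs :=
    (pi%:C / csin (pi%:C * nu a b)) *
    \sum_(k < p)
      (\prod_(j < p | j != k) Gamma (b 0 k - b 0 j))
      * (\prod_(i < p.+1) rGamma (b 0 k - a 0 i))
      * csum (inner_term a b k) in
  [/\ forall k : 'I_p, csum_cvg (inner_term a b k),
      0 < complex.Re (nu a b) -> prefactor * hyp1 a b = rhs
    & forall F : 'rV[R[i]]_p.+1 -> 'rV[R[i]]_p -> R[i],
        hyp1_continuation F -> prefactor * F a b = rhs].
Proof.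
case: p a b hp hb hbb hnu ha => // m a b m_gt0 hb hbb hnu ha prefactor rhs; split.
- exact: inner_term_cvg.
- exact: hyp1_identity.
- exact: continuation_identity.
Qed.
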